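(* Let $u$ be a minimizer of the functional $J$. Then: (1) The set of vanishing rank-2 flat points of the free boundary has zero measure in $\Omega$. (2) If $D\subset\subset\Omega$ and there exists $\bar c>0$ such that \[ \liminf_{r\to0}\frac{\sup_{B_r(x)}|u|}{r^2}\ge\bar c \] for every $x\in\partial\{u>0\}\cap\overline D$, then $\partial\{u>0\}$ has zero measure, and for any $\delta>0$, the set of free boundary points that are not $\delta$-rank-2 flat has finite $(n-2)$-dimensional Hausdorff measure.
   Context: $\Omega\subset\mathbb R^n$ is a smooth and bounded domain and $u_0\in W^{2,2}(\Omega)$ is a given function. $J[u]:=\int_\Omega\big(|\Delta u|^2+\chi_{\{u>0\}}\big)$, minimized over the admissible class $\mathcal A:=\{u\in W^{2,2}(\Omega)\text{ s.t. }u-u_0\in W^{1,2}_0(\Omega)\}$; a minimizer of $J$ is a $u\in\mathcal A$ with $J[u]\le J[v]$ for all $v\in\mathcal A$. Minimizers belong to $C^{1,\alpha}_{\rm loc}(\Omega)$ for every $\alpha\in(0,1)$. The free boundary of $u$ is $\partial\{u>0\}$. ''Measure'' without further specification means Lebesgue measure. For $A,B\subset\mathbb R^n$, ${\rm HD}(A,B):=\max\{\sup_{a\in A}{\rm dist}(a,B),\ \sup_{b\in B}{\rm dist}(b,A)\}$ is the Hausdorff distance. $P_2$ is the set of all homogeneous polynomials of degree two $p(x)=\sum_{i,j=1}^n a_{ij}x_ix_j$, with $(a_{ij})$ a symmetric $n\times n$ matrix, such that $\|p\|_{L^\infty(B_1)}=1$. For $p\in P_2$ and $x_0\in\mathbb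 R^n$, $S(p,x_0):=\{x\in\mathbb R^n: p(x-x_0)=0\}$. For $r>0$ and $x_0\in\partial\{u>0\}$, \[ h(r,x_0):=\inf_{p\in P_2}{\rm HD}\big(\partial\{u>0\}\cap B_r(x_0),\ S(p,x_0)\cap B_r(x_0)\big). \] Given $\delta>0$ and $r>0$, $\partial\{u>0\}$ is said to be $\delta$-rank-2 flat at level $r$ at $x_0\in\partial\{u>0\}$ if $h(r,x_0)<\delta r$. The claim speaks of points that are ''not $\delta$-rank-2 flat'' without naming a level; the set for which the Hausdorff measure estimate is carried out is the set $\mathcal N_\delta$ of free boundary points $x$ for which there exists $r_x>0$ small enough such that $h(r,x)\ge\delta r$ for every $r<r_x$. For $x_0\in\partial\{u>0\}\cap B_1$, $\partial\{u>0\}$ is said to be vanishing rank-2 flat at $x_0$ if there exist sequences $\delta_k\to0$ and $r_k\to0$ such that $h(r_k,x_0)\le\delta_kr_k$. *)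

(* Defs.v *)
(* MathComp-Analysis. Points of R^n are row vectors 'rV[R]_n. Their library norm
   is the sup norm: it is used only for topological notions, while balls,
   distances and diameters below are Euclidean. *)
From HB Require Import structures.
From mathcomp Require Import all_boot all_order all_algebra.
From mathcomp Require Import all_classical all_reals all_analysis.
From mathcomp Require Import measurable_realfun.

Set Implicit Arguments.
Unset Strict Implicit.
Unset Printing Implicit Defensive.
Import Order.TTheory GRing.Theory Num.Theory.
Import numFieldNormedType.Exports.
Local Open Scope classical_set_scope.
Local Open Scope ring_scope.

Section lebesgue_tuple.
Variable R : realType.
Notation T := (measurableTypeR R).

Section step.
Variables (n : nat) (mu : {sigma_finite_measure set (n.-tuple T) -> \bar R}).

Definition tuple_cons (p : T * n.-tuple T) : n.+1.-tuple T :=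
  [the n.+1.-tuple T of p.1 :: p.2].

Lemma measurable_tuple_cons : measurable_fun setT tuple_cons.
Proof. by apply: measurable_cons. Qed.

Definition tuple_uncons (t : n.+1.-tuple T) : T * n.-tuple T :=
  (tnth t ord0, [tuple of behead t]).

Lemma measurable_tuple_uncons : measurable_fun setT tuple_uncons.
Proof.
apply/measurable_fun_pairP; split.
  exact: measurable_tnth.
exact: measurable_behead.
Qed.

Lemma tuple_consK : cancel tuple_cons tuple_uncons.
Proof.
move=> [x t]; congr pair; exact/val_inj.
Qed.

Definition lebesgue_tuple_step :=
  pushforward (lebesgue_measure \x mu)%E tuple_cons.


HB.instance Definition _ := Measure.copy lebesgue_tuple_step
  (measure_function_pushforward__canonical__measure_function_Measure
     (lebesgue_measure \x mu)%E measurable_tuple_cons).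

Let step_sigma_finite : sigma_finite setT lebesgue_tuple_step.
Proof.
pose m1 : {sigma_finite_measure set T -> \bar R} := lebesgue_measure.
have /sigma_finiteP[F [TF ndF Foo]] := sigma_finiteT m1.
have /sigma_finiteP[G [TG ndG Goo]] := sigma_finiteT mu.
exists (fun k => tuple_uncons @^-1` (F k `*` G k)).
  rewrite -preimage_bigcup [X in _ @^-1` X](_ : _ = setT)//.
  rewrite -subTset => -[x t] _.
  have [i _ Fx] : (\bigcup_i F i) x by rewrite -TF.
  have [j _ Gt] : (\bigcup_i G i) t by rewrite -TG.
  exists (maxn i j) => //; split.
    by move: x Fx; exact/subsetPset/ndF/leq_maxl.
  by move: t Gt; exact/subsetPset/ndG/leq_maxr.
move=> k; have [mF Flty] := Foo k; have [mG Glty] := Goo k; split.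
  rewrite -[X in measurable X]setTI.
  by apply: measurable_tuple_uncons => //; exact: measurableX.
rewrite /lebesgue_tuple_step /pushforward -comp_preimage.
rewrite (_ : _ \o _ = id); last by apply/funext => p /=; rewrite tuple_consK.
by rewrite preimage_id product_measure1E// lte_mul_pinfty// ge0_fin_numE.
Qed.

HB.instance Definition _ := Measure_isSigmaFinite.Build _ _ _
  lebesgue_tuple_step step_sigma_finite.
End step.

(* The n-fold product of the one-dimensional Lebesgue measure. *)
Fixpoint lebesgue_tuple (n : nat) :
    {sigma_finite_measure set (n.-tuple T) -> \bar R} :=
  match n with
  | 0%N => \d_([tuple])
  | k.+1 => lebesgue_tuple_step (lebesgue_tuple k)
  end.

End lebesgue_tuple.

(* Borel sigma-algebra of R^n. *)
HB.instance Definition _ (R : realType) (n : nat) :=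
  Measurable.copy 'rV[R]_n (g_sigma_algebraType (@open 'rV[R]_n)).

Section lebesgue_rV.
Variables (R : realType) (n : nat).
Notation T := (measurableTypeR R).

Definition row_of_tuple (t : n.-tuple T) : 'rV[R]_n := \row_i tnth t i.

Lemma measurable_row_of_tuple : measurable_fun setT row_of_tuple.
Proof.
apply: (measurability (@open 'rV[R]_n) erefl) => _ [U oU <-]; rewrite setTI.
pose I := ('rV[rat]_n * nat)%type.
pose B (p : I) : set 'rV[R]_n := @ball R 'rV[R]_n (map_mx ratr p.1) p.2.+1%:R^-1.
have -> : U = \bigcup_(p in [set p : I | B p `<=` U]) B p.
  apply/seteqP; split => [x Ux|x [p /= BU] /BU//].
  have /nbhs_ballP[e /= e0 xeU] : nbhs x U by exact: open_nbhs_nbhs.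
  have [k ke] : exists k : nat, k.+1%:R^-1 < e / 2.
    have [k _ /(_ k (leqnn k))] := near_infty_natSinv_lt (PosNum (divr_gt0 e0 (ltr0n _ 2))).
    by exists k.
  have k0 : 0 < k.+1%:R^-1 :> R by rewrite invr_gt0.
  have /choice[q qP] : forall i : 'I_n, exists q : rat, `|ratr q - x ord0 i| < k.+1%:R^-1.
    move=> i; have := @rat_in_itvoo R (x ord0 i - k.+1%:R^-1) (x ord0 i + k.+1%:R^-1).
    case; first by rewrite ltrD2l gtrN.
    move=> q; rewrite in_itv/= => /andP[h1 h2]; exists q.
    by rewrite ltr_distl h1 h2.
  have Bx : B (\row_i q i, k) x.
    split => // i j; rewrite !mxE ord1 /ball/=.
    exact: qP.
  exists (\row_i q i, k) => //= y By; apply: xeU.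
  rewrite [e]splitr; apply: (@ball_triangle R 'rV[R]_n (map_mx ratr (\row_i q i))).
    by apply: ball_sym; apply: le_ball Bx; exact: ltW.
  by apply: le_ball By; exact: ltW.
rewrite preimage_bigcup bigcup_mkcond.
apply: countable_bigcupT_measurable => [|[q k]]; first exact: countableP.
case: ifP => // _; rewrite [X in measurable X](_ : _ = \bigcap_(i in [set: 'I_n])
    ((fun t : n.-tuple T => tnth t i) @^-1` @ball R R (ratr (q ord0 i)) k.+1%:R^-1)).
  apply: fin_bigcap_measurable => // i _; rewrite -[X in measurable X]setTI.
  by apply: measurable_tnth => //; exact: measurable_ball.
apply/seteqP; split => [t [_ Bt] i _ /=|t Bt].
  by have := Bt ord0 i; rewrite !mxE.
by split => [|i j]; [rewrite invr_gt0|rewrite ord1 !mxE; exact: (Bt j Logic.I)].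
Qed.

(* Lebesgue measure on the Borel sets of R^n (see [lebesgue_rV_box]); an
   arbitrary set is Lebesgue-null iff it is [lebesgue_rV.-negligible]. *)
Definition lebesgue_rV : set 'rV[R]_n -> \bar R :=
  pushforward (lebesgue_tuple R n) row_of_tuple.

HB.instance Definition _ := Measure.copy lebesgue_rV
  (measure_function_pushforward__canonical__measure_function_Measure
     (lebesgue_tuple R n) measurable_row_of_tuple).
End lebesgue_rV.

Section lebesgue_box.
Variable R : realType.
Notation T := (measurableTypeR R).

Lemma measurable_tuple_box n (A : 'I_n -> set R) :
    (forall i, measurable (A i)) ->
  measurable [set t : n.-tuple T | forall i, A i (tnth t i)].
Proof.
move=> mA; rewrite [X in measurable X](_ : _ = \bigcap_(i in [set: 'I_n])
    ((fun t : n.-tuple T => tnth t i) @^-1` A i)).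
  apply: fin_bigcap_measurable => // i _; rewrite -[X in measurable X]setTI.
  by apply: measurable_tnth => //; exact: mA.
by apply/seteqP; split => [t At i _|t At i]; [exact: At|exact: (At i Logic.I)].
Qed.

Lemma lebesgue_tuple_box n (A : 'I_n -> set R) :
    (forall i, measurable (A i)) ->
  (lebesgue_tuple R n [set t : n.-tuple T | forall i, A i (tnth t i)] =
   \prod_(i < n) lebesgue_measure (A i))%E.
Proof.
elim: n A => [|n IH] A mA.
  rewrite big_ord0 /= diracE mem_set//; by case.
rewrite big_ord_recl /= /lebesgue_tuple_step /pushforward.
rewrite [X in (_ \x _)%E X](_ : _ = A ord0 `*`
    [set t : n.-tuple T | forall i, A (lift ord0 i) (tnth t i)]).
  have mB := measurable_tuple_box (fun i => mA (lift ord0 i)).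
  rewrite product_measure1E//; last exact: mA.
  by rewrite (IH (fun i => A (lift ord0 i)))// => i; exact: mA.
apply/seteqP; split => [[x t] /= At|[x t] /= [Ax At] i].
  split => [|i]; first exact: (At ord0).
  by have := At (lift ord0 i); rewrite /tuple_cons/= tnthS.
case: (unliftP ord0 i) => [j|] ->; last exact: Ax.
by rewrite /tuple_cons/= tnthS; exact: At.
Qed.

Lemma lebesgue_rV_box n (A : 'I_n -> set R) : (forall i, measurable (A i)) ->
  (lebesgue_rV [set x : 'rV[R]_n | forall i, A i (x ord0 i)] =
   \prod_(i < n) lebesgue_measure (A i))%E.
Proof.
move=> mA; rewrite -lebesgue_tuple_box//; congr (lebesgue_tuple _ _ _).
by apply/seteqP; split => t /= At i; have := At i; rewrite mxE.
Qed.
End lebesgue_box.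

Section euclidean.
Variables (R : realType) (n : nat).
Implicit Types (x y : 'rV[R]_n) (A B : set 'rV[R]_n).

Definition enorm x : R := Num.sqrt (\sum_i x ord0 i ^+ 2).

Definition eball x (r : R) : set 'rV[R]_n := [set y | enorm (y - x) < r].

Definition dist x B : \bar R := ereal_inf [set (enorm (x - b))%:E | b in B].


Definition HD A B : \bar R :=
  maxe (ereal_sup [set dist a B | a in A]) (ereal_sup [set dist b A | b in B]).

Definition boundary A : set 'rV[R]_n := closure A `\` interior A.

Definition compactly_contained A B := compact (closure A) /\ closure A `<=` B.

Definition diam A : \bar R :=
  ereal_sup [set (enorm (x - y))%:E | x in A & y in A].

(* Hausdorff measure of integer dimension [s], without the normalizing constant
   omega_s / 2 ^ s. The empty set has weight 0 and a point has weight 0 ^+ s,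
   i.e. 1 for s = 0, so that the 0-dimensional measure counts points. *)
Definition hausdorff_weight (s : nat) A : \bar R :=
  if A == set0 then 0%E else (diam A ^+ s)%E.

Definition hausdorff_pre (s : nat) (e : R) A : \bar R :=
  ereal_inf [set (\sum_(0 <= k <oo) hausdorff_weight s (U k))%E |
    U in [set U : (set 'rV[R]_n)^nat |
      A `<=` \bigcup_k U k /\ forall k, (diam (U k) <= e%:E)%E]].

Definition hausdorff (s : nat) A : \bar R :=
  ereal_sup [set hausdorff_pre s e A | e in [set e : R | 0 < e]].
End euclidean.

Section smooth.
Variable R : realType.

(* Iterated partial derivatives; [s] lists the directions, so it plays the role
   of a multi-index of order [size s]. *)
Definition iter_partial n (s : seq 'I_n) (f : 'rV[R]_n -> R) : 'rV[R]_n -> R :=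
  foldr (fun i g => 'D_(delta_mx ord0 i) g) f s.

Definition smooth n (f : 'rV[R]_n -> R) :=
  forall s : seq 'I_n, continuous (iter_partial s f) /\
    forall i x, derivable (iter_partial s f) x (delta_mx ord0 i).

(* C_c^oo(Omega) *)
Definition test_function n (Omega : set 'rV[R]_n) (phi : 'rV[R]_n -> R) :=
  smooth phi /\ compactly_contained [set x | phi x != 0] Omega.

(* Near each boundary point, up to relabelling and reorienting the coordinate
   axes, Omega is the epigraph of a smooth function of the other n - 1
   coordinates. *)
Definition smooth_boundary n (Omega : set 'rV[R]_n) :=
  forall x0, boundary Omega x0 ->
  exists r : R, 0 < r /\ exists (i : 'I_n) (b : bool) (g : 'rV[R]_(n.-1) -> R),
    smooth g /\
    Omega `&` eball x0 r =
      [set x | g (col' i x) < (-1) ^+ b * x ord0 i] `&` eball x0 r.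

Definition smooth_bounded_domain n (Omega : set 'rV[R]_n) :=
  [/\ Omega !=set0, open Omega, connected Omega, bounded_set Omega &
      smooth_boundary Omega].
End smooth.

Section sobolev.
Variables (R : realType) (n : nat).
Notation leb := (@lebesgue_rV R n).
Variable Omega : set 'rV[R]_n.
Implicit Types (u v w g : 'rV[R]_n -> R) (s : seq 'I_n) (k : nat).

Definition L2 u := u \_ Omega \in Lfun leb 2%:E.

Definition L2norm u : \bar R := ('N[leb]_2%:E [EFin \o (u \_ Omega)])%E.

Definition weak_derivative s u g :=
  forall phi, test_function Omega phi ->
    \int[leb]_(x in Omega) (u x * iter_partial s phi x) =
    (-1) ^+ size s * \int[leb]_(x in Omega) (g x * phi x).

(* The weak derivative in L^2(Omega), unique up to null sets. *)
Definition wderiv s u : 'rV[R]_n -> R :=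
  xget (cst 0) [set g | L2 g /\ weak_derivative s u g].

(* W^{k,2}(Omega). Values of the functions outside of Omega are irrelevant. *)
Definition sobolev k u :=
  L2 u /\ forall s, (size s <= k)%N -> exists g, L2 g /\ weak_derivative s u g.

(* W^{k,2}_0(Omega), the closure of C_c^oo(Omega) in W^{k,2}(Omega) *)
Definition sobolev0 k u :=
  sobolev k u /\ exists phi : nat -> 'rV[R]_n -> R,
    (forall j, test_function Omega (phi j)) /\
    forall s, (size s <= k)%N ->
      L2norm (wderiv s u \- iter_partial s (phi j)) @[j --> \oo] --> 0%E.

Definition positive_set u : set 'rV[R]_n := [set x | Omega x /\ 0 < u x].

Definition laplacian u : 'rV[R]_n -> R :=
  fun x => \sum_(i < n) wderiv [:: i; i] u x.

Definition energy u : \bar R :=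
  (\int[leb]_(x in Omega) (laplacian u x ^+ 2 + \1_(positive_set u) x)%:E)%E.

Definition admissible u0 u := sobolev 2 u /\ sobolev0 1 (u \- u0).

Definition minimizer u0 u :=
  admissible u0 u /\ forall v, admissible u0 v -> (energy u <= energy v)%E.

Definition free_boundary u := boundary (positive_set u).
End sobolev.

Section rank2.
Variables (R : realType) (n : nat).
Notation leb := (@lebesgue_rV R n).
Implicit Types (p : 'rV[R]_n -> R) (E : set 'rV[R]_n) (x : 'rV[R]_n).

Definition quadratic (a : 'M[R]_n) : 'rV[R]_n -> R :=
  fun x => \sum_(i < n) \sum_(j < n) a i j * x ord0 i * x ord0 j.

Definition P2 : set ('rV[R]_n -> R) :=
  [set p | (exists a : 'M[R]_n, a^T = a /\ p = quadratic a) /\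
    ('N[leb]_+oo [EFin \o (p \_ (eball 0%R 1%R))] = 1)%E].

Definition zero_set p x0 : set 'rV[R]_n := [set x | p (x - x0) = 0].

Definition rank2_distance E (r : R) x0 : \bar R :=
  ereal_inf [set HD (E `&` eball x0 r) (zero_set p x0 `&` eball x0 r) |
             p in P2].

Definition vanishing_rank2_flat E x0 :=
  exists delta r : nat -> R,
    [/\ forall k, 0 < r k, delta @ \oo --> 0, r @ \oo --> 0 &
        forall k, (rank2_distance E (r k) x0 <= (delta k * r k)%:E)%E].

(* Points of [E] at which delta-rank-2 flatness fails at every sufficiently
   small level. *)
Definition not_rank2_flat E (delta : R) : set 'rV[R]_n :=
  [set x | E x /\ exists2 rx : R, 0 < rx &
    forall r, 0 < r < rx -> ((delta * r)%:E <= rank2_distance E r x)%E].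
End rank2.

(* Main.v *)
(* The idea. Extend u by 0 to U. Comparing u with u + phi for test functions phi
   shows that - Delta^2 U is a positive measure in Omega whose mass on a ball of
   radius s is O(s^(n-2)). For a suitable kernel, the derivative in s of the
   mollification U_s is given by this measure tested against bumps of radius s,
   hence |U - U_s| = O(s^2).

   Null sets. Both sets are porous. At a vanishing rank-2 flat point the zero set
   of a normalized quadratic form leaves a hole of comparable size at the scales
   r_k. At a nondegenerate point, choose a scale r at which sup |u| is doubling and
   at least c r^2: U_s being Lipschitz at that scale, u does not vanish near a
   maximum point of |u|.

   Hausdorff measure. The points at which s^(2-n) times the mass on B_s does not
   tend to 0 have finite measure, by a Vitali covering. At any other point that is
   nondegenerate and not delta-rank-2 flat, u is at every small scale close to a
   quadratic polynomial. An indefinite one, or a dominant linear part, makes the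
   free boundary flat. Rank one is excluded by minimality: near (g . h)^2, pushing u
   down by d gains the measure of a strip of width sqrt d at a cost of order d; near
   - (g . h)^2, a mean value inequality over ellipsoids flattened in the direction g
   shows that u > 0 on so much of them that it pays to push u below 0. So the form
   is semidefinite of rank at least 2, the free boundary lies close to a plane of
   dimension n - 2, and the failure of flatness yields holes in that plane at all
   scales: iterated covers show that these points have measure zero. *)
Require Import Defs.
From HB Require Import structures.
From mathcomp Require Import all_boot all_order all_algebra.
From mathcomp Require Import all_classical all_reals all_analysis.
From mathcomp Require Import measurable_realfun ess_sup_inf ring lra.

Set Implicit Arguments.
Unset Strict Implicit.
Unset Printing Implicit Defensive.
Import Order.TTheory GRing.Theory Num.Theory.
Import numFieldNormedType.Exports.
Local Open Scope classical_set_scope.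
Local Open Scope ring_scope.

(** The kernel of the mollification is computed, not chosen: for the bump psi = exp(- 2 / (1 -
    |x|^2)), let x eta = - grad Delta psi. Then the s-derivative of s^-n eta(x / s) is s^(3-n) times
    Delta^2 of psi(x / s). The obstacle is the size of the Hessian. Where the mass on B_s is at most
    epsilon s^(n-2), the s-derivative of the third derivatives of U_s is O(epsilon / s^2), which
    integrates to epsilon / s; for the Hessian one gets epsilon / s, hence a possible logarithm,
    neither a limit nor a bound. What survives is one-sided: for |e|^2 <= 2 the quantity tr D^2 U_s
    - D^2 U_s(e, e), corrected by a term of known sign, is nonincreasing in s, so it stays bounded
    below as s tends to 0. On b (g . h)^2 the choice e = sqrt 2 g, on - b (g . h)^2 the choice e =
    0, turns this into an upper bound for b. With e slightly shorter than g it makes U an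
    approximate subsolution of an operator whose balls are the flattened ellipsoids. *)

Lemma open_nbhsW (T : topologicalType) (A : set T) : (forall x, A x -> nbhs x A) -> open A.
Proof. by rewrite openE. Qed.

(** * Boxes and Lebesgue measure on R^n *)

Section lebesgue_boxes0.
Variables (R : realType) (n : nat).
Implicit Type x : 'rV[R]_n.

Lemma coord_norm_le x i : `|x ord0 i| <= `|x|.
Proof. have -> : `|x| = mx_norm x by []; by rewrite mx_normrE (le_bigmax _ (fun ij => `|x ij.1 ij.2|) (ord0, i)). Qed.

Lemma norm_le_coord x (r : R) : 0 <= r -> (forall i, `|x ord0 i| <= r) -> `|x| <= r.
Proof.
move=> r0 h; have -> : `|x| = mx_norm x by [].
rewrite mx_normrE; apply: bigmax_le => // -[i j] _ /=.
by rewrite ord1.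
Qed.
End lebesgue_boxes0.

Section lebesgue_boxes.
Variables (R : realType) (n : nat).
Notation leb := (@lebesgue_rV R n).
Implicit Types (a b x v : 'rV[R]_n).

Definition box a b : set 'rV[R]_n :=
  [set x | forall i, `]a ord0 i, b ord0 i[%classic (x ord0 i)].

Definition boxes : set (set 'rV[R]_n) := [set box p.1 p.2 | p in [set: 'rV[R]_n * 'rV[R]_n]].

Lemma boxP a b x : box a b x <-> forall i, a ord0 i < x ord0 i < b ord0 i.
Proof. by split => h i; have := h i; rewrite /= in_itv. Qed.

Lemma ball_box x (r : R) : 0 < r -> ball x r = box (x - const_mx r) (x + const_mx r).
Proof.
move=> r0; apply/seteqP; split => [y [_ h]|y h].
  by apply/boxP => i; have := h ord0 i; rewrite /ball/= ltr_distlC !mxE.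
split=> // i j; move/boxP : h => /(_ j); rewrite !mxE !ord1 => h.
by rewrite /ball/= ltr_distlC.
Qed.

Lemma open_box a b : open (box a b).
Proof.
rewrite [box a b](_ : _ = \bigcap_(i in [set` enum 'I_n]) ((fun x : 'rV[R]_n => x ord0 i) @^-1` `]a ord0 i, b ord0 i[%classic)).
  rewrite bigcap_seq; apply: big_ind => [|A B oA oB|i _].
  - exact: openT.
  - exact: openI.
  - by apply: open_comp => [x _|]; [exact: coord_continuous|exact: interval_open].
apply/seteqP; split => [x h i _|x h i]; first exact: h.
by apply: h => /=; rewrite mem_enum.
Qed.

Lemma measurable_openrV (U : set 'rV[R]_n) : open U -> measurable U.
Proof. by move=> oU; exact: sub_sigma_algebra. Qed.

Lemma measurable_closedrV (U : set 'rV[R]_n) : closed U -> measurable U.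
Proof.
by move=> cU; rewrite -[U]setCK; apply: measurableC; apply: measurable_openrV; exact: closed_openC.
Qed.

Lemma leb_box a b : (forall i, a ord0 i <= b ord0 i) ->
  leb (box a b) = (\prod_(i < n) (b ord0 i - a ord0 i))%:E.
Proof.
move=> ab; rewrite /box (lebesgue_rV_box (fun i => measurable_itv `]a ord0 i, b ord0 i[)).
rewrite (eq_bigr (fun i => (b ord0 i - a ord0 i)%:E)); last first.
  move=> i _; rewrite lebesgue_measure_itv/= lte_fin.
  by have := ab i; rewrite le_eqVlt => /predU1P[->|->//]; rewrite ltxx subrr.
by rewrite prodEFin.
Qed.

Lemma leb_ball x (r : R) : 0 < r -> leb (ball x r) = ((2 * r) ^+ n)%:E.
Proof.
move=> r0; rewrite ball_box// leb_box; last by move=> i; rewrite !mxE; lra.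
rewrite (eq_bigr (fun=> 2 * r)); last by move=> i _; rewrite !mxE; ring.
by rewrite prodr_const card_ord.
Qed.

Lemma boxI_closed : setI_closed boxes.
Proof.
move=> _ _ [[a b] _ <-] [[c d] _ <-] /=.
exists (\row_i Num.max (a ord0 i) (c ord0 i), \row_i Num.min (b ord0 i) (d ord0 i)) => //=.
apply/seteqP; split => [x /boxP h|x [/boxP h1 /boxP h2]].
  by split; apply/boxP => i; have := h i; rewrite !mxE gt_max lt_min => /andP[/andP[? ?] /andP[? ?]]; apply/andP.
by apply/boxP => i; rewrite !mxE gt_max lt_min; have /andP[-> ->] := h1 i; have /andP[-> ->] := h2 i.
Qed.

(* Every open set is a countable union of rational cubes. *)
Lemma measurable_boxes : @measurable _ 'rV[R]_n = <<s boxes >>.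
Proof.
apply/seteqP; split; last first.
  apply: smallest_sub; first exact: sigma_algebra_measurable.
  by move=> _ [[a b] _ <-]; apply: measurable_openrV; exact: open_box.
apply: smallest_sub; first exact: smallest_sigma_algebra.
move=> U oU.
pose I := ('rV[rat]_n * nat)%type.
pose B (p : I) : set 'rV[R]_n := @ball R 'rV[R]_n (map_mx ratr p.1) p.2.+1%:R^-1.
have -> : U = \bigcup_(p in [set p : I | B p `<=` U]) B p.
  apply/seteqP; split => [x Ux|x [p /= BU] /BU//].
  have /nbhs_ballP[e /= e0 xeU] : nbhs x U by exact: open_nbhs_nbhs.
  have [k ke] : exists k : nat, k.+1%:R^-1 < e / 2.
    have [k _ /(_ k (leqnn k))] := near_infty_natSinv_lt (PosNum (divr_gt0 e0 (ltr0n _ 2))).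
    by exists k.
  have k0 : 0 < k.+1%:R^-1 :> R by rewrite invr_gt0.
  have /choice[q qP] : forall i : 'I_n, exists q : rat, `|ratr q - x ord0 i| < k.+1%:R^-1.
    move=> i; have := @rat_in_itvoo R (x ord0 i - k.+1%:R^-1) (x ord0 i + k.+1%:R^-1).
    case; first by rewrite ltrD2l gtrN.
    move=> q; rewrite in_itv/= => /andP[h1 h2]; exists q.
    by rewrite ltr_distl h1 h2.
  have Bx : B (\row_i q i, k) x.
    split => // i j; rewrite !mxE ord1 /ball/=.
    exact: qP.
  exists (\row_i q i, k) => //= y By; apply: xeU.
  rewrite [e]splitr; apply: (@ball_triangle R 'rV[R]_n (map_mx ratr (\row_i q i))).
    by apply: ball_sym; apply: le_ball Bx; exact: ltW.
  by apply: le_ball By; exact: ltW.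
rewrite bigcup_mkcond.
apply: (@countable_bigcupT_measurable _ (g_sigma_algebraType boxes)) => [|[q k]]; first exact: countableP.
case: ifPn => _; last exact: measurable0.
apply: sub_sigma_algebra; exists (map_mx ratr q - const_mx k.+1%:R^-1, map_mx ratr q + const_mx k.+1%:R^-1) => //=.
by rewrite -ball_box// invr_gt0.
Qed.

Let cube (k : nat) : set 'rV[R]_n := box (const_mx (- k%:R)) (const_mx k%:R).

Let cube_cover : \bigcup_k cube k = setT.
Proof.
rewrite -subTset => x _; have [k _ kx] : exists2 k : nat, True & `|x| < k%:R.
  exists (Num.truncn `|x|).+1 => //; exact: truncnS_gt.
exists k => //; apply/boxP => i; rewrite !mxE -ltr_norml.
apply: le_lt_trans kx; exact: coord_norm_le.
Qed.

Lemma leb_cube k : (leb (cube k) < +oo)%E.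
Proof. by rewrite leb_box ?ltry// => i; rewrite !mxE; have := ler0n R k; lra. Qed.

(** Translation invariance and the dilation formula both reduce to boxes through this, where the
    measure is a product of side lengths. *)
Lemma leb_unique (m : {measure set 'rV[R]_n -> \bar R}) :
  (forall a b, m (box a b) = leb (box a b)) ->
  forall A, measurable A -> m A = leb A.
Proof.
move=> h A mA; apply/esym.
apply: (@measure_unique _ R 'rV[R]_n boxes cube measurable_boxes boxI_closed) => //.
- by move=> k; exists (const_mx (- k%:R), const_mx k%:R).
- by move=> _ [[a b] _ <-] /=; rewrite h.
- exact: leb_cube.
Qed.

Lemma continuous_measurable_rV m (f : 'rV[R]_n -> 'rV[R]_m) : continuous f -> measurable_fun setT f.
Proof.
move=> cf; apply: (measurability (@open 'rV[R]_m) erefl) => _ [U oU <-]; rewrite setTI.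
by apply: measurable_openrV; exact: open_comp.
Qed.

Lemma open_continuous_measurable_rVR (D : set 'rV[R]_n) (f : 'rV[R]_n -> R) :
  open D -> {in D, continuous f} -> measurable_fun D f.
Proof.
move=> oD cf; apply: (@measurability _ _ 'rV[R]_n (measurableTypeR R) _ _ _ (@RGenOpens.measurableE R)).
move=> _ [_ [a [b ->]] <-].
apply: measurable_openrV; apply: open_nbhsW => x [Dx fx].
apply: filterI; first exact: open_nbhs_nbhs.
apply: (cf x); first by rewrite inE.
by apply: open_nbhs_nbhs; split => //; exact: interval_open.
Qed.

Lemma continuous_measurable_rVR (f : 'rV[R]_n -> R) : continuous f -> measurable_fun setT f.
Proof. by move=> cf; apply: open_continuous_measurable_rVR => [|x _]; [exact: openT|exact: cf]. Qed.

Lemma measurable_shift v : measurable_fun setT (fun x : 'rV[R]_n => x + v).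
Proof. by apply: continuous_measurable_rV => x; apply: (@continuousD _ _ _ id (cst v)); [exact: cvg_id|exact: cst_continuous]. Qed.

Lemma leb_shift v A : measurable A -> leb ((fun x => x + v) @^-1` A) = leb A.
Proof.
pose m : {measure set 'rV[R]_n -> \bar R} :=
  measure_function_pushforward__canonical__measure_function_Measure leb (measurable_shift v).
rewrite -/(pushforward leb (fun x : 'rV[R]_n => x + v) A) => mA.
rewrite -[LHS]/(m A); apply: leb_unique => // a b.
rewrite /m /= /pushforward.
have -> : (fun x => x + v) @^-1` box a b = box (a - v) (b - v).
  by apply/seteqP; split => x /boxP h; apply/boxP => i; have := h i; rewrite !mxE ltrBlDr ltrBrDr.
have [ab|/existsNP[i /negP]] := pselect (forall i, a ord0 i <= b ord0 i).
  rewrite !leb_box//; last by move=> i; rewrite !mxE lerD2r.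
  by congr EFin; apply: eq_bigr => i _; rewrite !mxE; ring.
rewrite -ltNge => ba.
suff e0 (c d : 'rV[R]_n) : d ord0 i < c ord0 i -> box c d = set0 by rewrite !e0// !mxE ltrD2r.
by move=> dc; rewrite -subset0 => x /boxP/(_ i)/andP[h1 h2]; have := lt_trans h1 (lt_trans h2 dc); rewrite ltxx.
Qed.
End lebesgue_boxes.

(** * Vitali selection of disjoint balls *)

Section vitali.
Variables (R : realType) (T : normedZmodType R).

(* Zorn on the disjoint families [D] such that every ball meeting [D] meets a
   member of [D] of at least half its radius. *)
Lemma vitali_selection (V : set (T * R)) (rho : R) :
  (forall v, V v -> v.2 <= rho) ->
  (forall v, V v -> 0 < v.2) ->
  exists D : set (T * R), [/\ D `<=` V,
    (forall v w, D v -> D w -> v <> w -> v.2 + w.2 < `|v.1 - w.1|) &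
    (forall v, V v -> exists w, [/\ D w, `|v.1 - w.1| <= v.2 + w.2 & v.2 <= 2 * w.2])].
Proof.
move=> Vrho V0.
pose meet (v w : T * R) := `|v.1 - w.1| <= v.2 + w.2.
have meetC v w : meet v w -> meet w v by rewrite /meet distrC (addrC v.2).
pose P (D : set (T * R)) := [/\ D `<=` V,
    (forall v w, D v -> D w -> v <> w -> ~ meet v w) &
    (forall v, V v -> (exists2 w, D w & meet v w) ->
       exists w, [/\ D w, meet v w & v.2 <= 2 * w.2])].
have [F FP totF|D [[DV disjD mD] maxD]] := @Zorn_bigcup (T * R)%type P.
  split.
  - by move=> v [D /FP[+ _ _]]; exact.
  - move=> v w [D FD Dv] [E FE Ew].
    have [DE|ED] := totF _ _ FD FE.
      by have [_ + _] := FP _ FE; apply => //; exact: DE.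
    by have [_ + _] := FP _ FD; apply => //; exact: ED.
  - move=> v Vv [w [D FD Dw] vw].
    have [_ _ /(_ v Vv)[|z [Dz vz zv]]] := FP _ FD; first by exists w.
    by exists z; split => //; exists D.
exists D; split => // [v w Dv Dw vw|v Vv].
  by rewrite ltNge; apply/negP; exact: disjD.
apply: (mD v Vv); apply: contrapT => nv.
pose S := [set v.2 | v in [set v | V v /\ ~ exists2 w, D w & meet v w]].
have S0 : S v.2 by exists v.
have hS : has_sup S.
  split; first by exists v.2.
  by exists rho => _ [w [Vw _] <-]; exact: Vrho.
have supS_gt0 : 0 < sup S by apply: lt_le_trans (ub_le_sup hS.2 S0); exact: V0.
have [_ [w [Vw nw] <-] hw] := sup_adherent (divr_gt0 supS_gt0 (ltr0n _ 2)) hS.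
have {}hw : sup S < 2 * w.2 by move: hw; lra.
have w0 := V0 _ Vw.
have ww : meet w w by rewrite /meet subrr normr0; lra.
have nDw : ~ D w by move=> Dw; apply: nw; exists w.
apply: (maxD (D `|` [set w])).
  by split; [exact: subsetUl|move=> h; apply: nDw; apply: h; right].
split.
- by move=> z [/DV//|->].
- move=> z z' [Dz|->] [Dz'|->] // zz'; first exact: disjD.
  + by move=> m; apply: nw; exists z => //; exact: meetC.
  + by move=> m; apply: nw; exists z'.
- move=> z Vz [z' Dz' zz'].
  have [hz|hz] := pselect (exists2 w, D w & meet z w).
    by have [y [Dy zy yz]] := mD _ Vz hz; exists y; split => //; left.
  exists w; split; first by right.
    by case: Dz' zz' => [Dz'|->//] zz'; exfalso; apply: hz; exists z'.
  by apply: le_trans (ltW hw); apply: (ub_le_sup hS.2); exists z.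
Qed.
End vitali.

(** * Porous sets are Lebesgue-null *)

Section porosity.
Variables (R : realType) (n : nat).
Notation leb := (@lebesgue_rV R n).
Implicit Types (x y : 'rV[R]_n).

Lemma rV_rat_dense x (e : R) : 0 < e -> exists q : 'rV[rat]_n, `|map_mx ratr q - x| < e.
Proof.
move=> e0.
have /choice[q qP] : forall i : 'I_n, exists q : rat, `|ratr q - x ord0 i| < e / 2.
  move=> i; have := @rat_in_itvoo R (x ord0 i - e / 2) (x ord0 i + e / 2).
  case; first by lra.
  by move=> q; rewrite in_itv/= => /andP[h1 h2]; exists q; rewrite ltr_distl h1 h2.
exists (\row_i q i); apply: (@le_lt_trans _ _ (e / 2)); last by lra.
by apply: norm_le_coord => [|i]; [lra|rewrite !mxE ltW].
Qed.

(** Every ball contains a rational point, and separated balls cannot share one. The numbering later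
    turns families of balls into sequences. *)
Lemma disjoint_balls_countable (D : set ('rV[R]_n * R)) :
  (forall v, D v -> 0 < v.2) ->
  (forall v w, D v -> D w -> v <> w -> v.2 + w.2 < `|v.1 - w.1|) ->
  exists f : 'rV[R]_n * R -> nat, forall v w, D v -> D w -> f v = f w -> v = w.
Proof.
move=> D0 disjD.
have /choice[q qP] : forall v : 'rV[R]_n * R, exists q : 'rV[rat]_n, D v -> `|map_mx ratr q - v.1| < v.2.
  move=> v; have [/D0 v0|nDv] := pselect (D v); last by exists 0.
  by have [q qv] := rV_rat_dense v.1 v0; exists q.
exists (pickle \o q) => v w Dv Dw /= /(pcan_inj pickleK) qq.
apply: contrapT => /(disjD _ _ Dv Dw).
have := qP _ Dv; have := qP _ Dw; rewrite -qq => h1 h2 h3.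
have := ler_distD (map_mx ratr (q v)) v.1 w.1.
by rewrite (distrC v.1 (map_mx _ _)); lra.
Qed.

Lemma closed_normball y (r : R) : closed [set z : 'rV[R]_n | `|z - y| <= r].
Proof.
rewrite (_ : [set _ | _] = (fun z : 'rV[R]_n => `|z - y|) @^-1` [set t | t <= r]) //.
apply: closed_comp => [z _|]; last exact: closed_le.
apply: (@continuous_comp _ _ _ (fun z => z - y) (@Num.norm _ _)).
  by apply: (@continuousB _ _ _ id (cst y)); [exact: cvg_id|exact: cst_continuous].
exact: norm_continuous.
Qed.

Lemma open_normball y (r : R) : open [set z : 'rV[R]_n | `|z - y| < r].
Proof.
rewrite (_ : [set _ | _] = (fun z : 'rV[R]_n => `|z - y|) @^-1` [set t | t < r]) //.
apply: open_comp => [z _|]; last exact: open_lt.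
apply: (@continuous_comp _ _ _ (fun z => z - y) (@Num.norm _ _)).
  by apply: (@continuousB _ _ _ id (cst y)); [exact: cvg_id|exact: cst_continuous].
exact: norm_continuous.
Qed.

Lemma ball_rVE y (r : R) : ball y r = [set z : 'rV[R]_n | `|z - y| < r].
Proof. by rewrite -ball_normE; apply/seteqP; split => z /=; rewrite /ball_/= distrC. Qed.

Lemma leb_normball y (r : R) : 0 < r -> leb [set z : 'rV[R]_n | `|z - y| < r] = ((2 * r) ^+ n)%:E.
Proof. by move=> r0; rewrite -ball_rVE leb_ball. Qed.

(** Outer regularity takes the place of density points. Let m be the infimum of the measures of open
    supersets of E. If m > 0, let U be an open superset of measure close to m. Removing the closed
    holes of disjoint Vitali balls leaves an open superset of E, so the holes have small total
    measure. But the enlarged balls cover E and exceed the holes by a fixed factor, so m would be at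
    most m / 2. *)
Lemma porous_negligible_bounded (E : set 'rV[R]_n) (c M : R) : 0 < c < 1 ->
  (forall x, E x -> `|x| < M) ->
  (forall x, E x -> forall rho : R, 0 < rho -> exists (r : R) y, [/\ 0 < r < rho, `|y - x| <= r &
     forall z, E z -> c * r <= `|z - y|]) ->
  leb.-negligible E.
Proof.
move=> /andP[c0 c1] EM hE.
pose UU := [set leb U | U in [set U : set 'rV[R]_n | open U /\ E `<=` U]].
pose m := ereal_inf UU.
have m0 : (0 <= m)%E by apply: le_ereal_inf_tmp => _ [U _ <-]; exact: measure_ge0.
have mfin : (m < +oo)%E.
  pose M' := Num.max M 1.
  apply: (@le_lt_trans _ _ (leb [set z | `|z - 0| < M'])).
    apply: ereal_inf_lbound; exists [set z | `|z - 0| < M'] => //; split; first exact: open_normball.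
    by move=> x /EM xM /=; rewrite subr0 lt_max xM.
  by rewrite leb_normball ?ltry// lt_max ltr01 orbT.
suff mE : m = 0%E.
  have /choice[U UP] : forall k : nat, exists U : set 'rV[R]_n, [/\ open U, E `<=` U & (leb U < k.+1%:R^-1%:E)%E].
    move=> k; have : (m < k.+1%:R^-1%:E)%E by rewrite mE lte_fin invr_gt0.
    by move=> /ereal_inf_lt[_ [U [oU EU] <-] h]; exists U.
  exists (\bigcap_k U k); split.
  - by apply: bigcapT_measurable => k; apply: measurable_openrV; have [] := UP k.
  - apply/eqP; rewrite eq_le measure_ge0 andbT; apply/lee_addgt0Pr => e e0; rewrite add0e.
    have [k _ /(_ k (leqnn k)) ke] := near_infty_natSinv_lt (PosNum e0).
    have [oU _ Uk] := UP k; apply: le_trans (le_trans (ltW Uk) _); last by rewrite lee_fin ltW.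
    apply: le_measure; rewrite ?inE.
    + by apply: bigcapT_measurable => j; apply: measurable_openrV; have [] := UP j.
    + exact: measurable_openrV.
    + exact: bigcap_inf.
  - by move=> x Ex k _; have [_ + _] := UP k; apply.
apply: contrapT => /eqP mneq; have {mneq} mgt0 : (0 < m)%E by rewrite lt_neqAle eq_sym mneq.
have [t mt] : exists t, m = t%:E by exists (fine m); rewrite fineK// ge0_fin_numE.
have t0 : 0 < t by rewrite -lte_fin -mt.
(* The ratio of the volumes of a sup norm ball of radius 4 v.2 and of a hole of radius c v.2 / 4. *)
pose k1 := (16 / c) ^+ n.
have k10 : 0 < k1 by rewrite exprn_gt0// divr_gt0.
pose kap := t / (2 * k1).
have kap0 : 0 < kap by rewrite divr_gt0// mulr_gt0.
have [U [oU EU Ut]] : exists U : set 'rV[R]_n, [/\ open U, E `<=` U & (leb U < (t + kap)%:E)%E].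
  have : (m < (t + kap)%:E)%E by rewrite mt lte_fin; lra.
  by move=> /ereal_inf_lt[_ [U [oU EU] <-] h]; exists U.
pose V := [set v : 'rV[R]_n * R | [/\ E v.1, 0 < v.2 <= 1, (forall z, `|z - v.1| < v.2 -> U z) &
   exists2 y, `|y - v.1| <= v.2 / 2 & forall z, E z -> c * (v.2 / 2) <= `|z - y|]].
have [D [DV disjD covD]] := @vitali_selection R _ V 1 (fun v '(And4 _ h _ _) => (andP h).2) (fun v '(And4 _ h _ _) => (andP h).1).
have D0 v : D v -> 0 < v.2 by move=> /DV[_ /andP[]].
have [f f_inj] := disjoint_balls_countable D0 disjD.
have /choice[Y YP] : forall v : 'rV[R]_n * R, exists y, D v -> `|y - v.1| <= v.2 / 2 /\ forall z, E z -> c * (v.2 / 2) <= `|z - y|.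
  move=> v; have [/DV[_ _ _ [y h1 h2]]|] := pselect (D v); first by exists y.
  by move=> nDv; exists 0.
pose D' k := [set v | D v /\ f v = k].
(* The factor 4 covers E: the ball of a point x meets a selected ball w of at least half its radius,
   so |x - w.1| <= 3 w.2. As [f] is injective on [D], each union has at most one member. *)
pose F k := \bigcup_(v in D' k) [set z | `|z - v.1| < 4 * v.2].
(* Half of the guaranteed radius, so that E also avoids the closed hole. *)
pose H k := \bigcup_(v in D' k) [set z | `|z - Y v| <= c * v.2 / 4].
have D'P k : (exists2 v, D v & D' k = [set v]) \/ D' k = set0.
  have [->|/set0P[v Dv]] := eqVneq (D' k) set0; first by right.
  left; exists v; first by case: Dv.
  apply/seteqP; split => w /=; last by move=> ->.
  by case: Dv => Dv fv [Dw fw]; apply: f_inj => //; rewrite fv fw.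
have oF k : open (F k) by apply: bigcup_open => v _; exact: open_normball.
have cH k : closed (H k).
  have [[v Dv e]|e] := D'P k; rewrite /H e ?bigcup_set1 ?bigcup_set0; last exact: closed0.
  exact: closed_normball.
have mF k : measurable (F k) by exact: measurable_openrV.
have mH k : measurable (H k) by exact: measurable_closedrV.
have FH k : (leb (F k) <= k1%:E * leb (H k))%E.
  have [[v Dv e]|e] := D'P k; rewrite /F /H e ?bigcup_set1 ?bigcup_set0; last by rewrite !measure0 mule0.
  have v0 := D0 _ Dv.
  rewrite leb_normball; last by lra.
  apply: (@le_trans _ _ (k1%:E * leb [set z | (`|z - Y v| < c * v.2 / 4)%R])%E); last first.
    apply: lee_wpmul2l; first by rewrite lee_fin ltW.
    apply: le_measure; rewrite ?inE; [by apply: measurable_openrV; exact: open_normball| |by move=> z /= /ltW].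
    by apply: measurable_closedrV; exact: closed_normball.
  rewrite leb_normball; last by rewrite divr_gt0// mulr_gt0.
  have c8 : 16 / c * (2 * (c * v.2 / 4)) = 8 * v.2 by field; exact: lt0r_neq0.
  by rewrite -EFinM lee_fin /k1 -exprMn c8 lerXn2r// ?nnegrE; lra.
have HU k : H k `<=` U.
  move=> z [v [Dv _] /= zv]; have [_ _ + _] := DV _ Dv; apply.
  have [yv _] := YP _ Dv; have := D0 _ Dv => v0.
  have := ler_distD (Y v) z v.1.
  have : c * v.2 < v.2 by rewrite gtr_pMl.
  by move: zv yv; lra.
have trivH : trivIset setT H.
  move=> i j _ _ [z [[v [Dv fv] /= zv] [w [Dw fw] /= zw]]].
  apply: contrapT => nij.
  have vw : v <> w by move=> e; apply: nij; rewrite -fv e.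
  have := disjD _ _ Dv Dw vw.
  have [yv _] := YP _ Dv; have [yw _] := YP _ Dw.
  have v0 := D0 _ Dv; have w0 := D0 _ Dw.
  have h1 := ler_distD (Y v) v.1 w.1.
  have h2 := ler_distD z (Y v) w.1.
  have h3 := ler_distD (Y w) z w.1.
  have : c * v.2 < v.2 by rewrite gtr_pMl.
  have : c * w.2 < w.2 by rewrite gtr_pMl.
  rewrite [`|v.1 - Y v|]distrC in h1; rewrite [`|Y v - z|]distrC in h2.
  by move: zv yv zw yw h1 h2 h3; lra.
have EF : E `<=` \bigcup_k F k.
  move=> x Ex.
  have [e /= e0 eU] : exists2 e, 0 < e & forall z, `|z - x| < e -> U z.
    have /nbhs_ballP[e /= e0 eU] : nbhs x U by apply: open_nbhs_nbhs; split => //; exact: EU.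
    by exists e => // z zx; apply: eU; rewrite ball_rVE.
  have [|r [y [/andP[r0 r1] yx hy]]] := hE _ Ex (Num.min (e / 2) (1 / 2)).
    by rewrite lt_min; apply/andP; split; lra.
  move: r1; rewrite lt_min => /andP[re r1].
  have Vx : V (x, 2 * r).
    split => //=; first by apply/andP; split; lra.
      by move=> z zx; apply: eU; lra.
    by exists y; rewrite mulrAC divff// mul1r.
  have [w [Dw xw rw]] := covD _ Vx.
  exists (f w) => //; exists w => //=; have := D0 _ Dw; move: xw rw => /=; lra.
(* [U] without finitely many closed holes is still an open superset of E: its measure is at least t,
   while that of [U] is below t + kap. *)
have sumH K : (\sum_(k < K) leb (H k) <= kap%:E)%E.
  rewrite -measure_semi_additive_ord//=; last 2 first.
    by move=> i j _ _ h; apply: val_inj; exact: trivH h.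
    by apply: bigsetU_measurable => k _; exact: mH.
  set HK := \big[setU/set0]_(k < K) H k.
  have cHK : closed HK by apply: closed_bigsetU => k _; exact: cH.
  have mW : (m <= leb (U `\` HK))%E.
    apply: ereal_inf_lbound; exists (U `\` HK) => //; split.
      by rewrite setDE; apply: openI => //; exact: closed_openC.
    move=> x Ex; split; first exact: EU.
    rewrite /HK -bigcup_mkord => -[k _ [v [Dv _] /= xv]].
    have [_ /(_ _ Ex)] := YP _ Dv; have := D0 _ Dv => v0 h.
    have : 0 < c * v.2 by rewrite mulr_gt0.
    by move: h xv; lra.
  have HKU : HK `<=` U by rewrite /HK -bigcup_mkord => z [k _ /HU].
  have mU := measurable_openrV oU.
  have mHK := measurable_closedrV cHK.
  have : leb U = (leb (U `\` HK) + leb HK)%E.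
    by rewrite (measureDI leb mU mHK) (setIidr HKU).
  move=> Ueq.
  have HKfin : (leb HK < +oo)%E.
    apply: le_lt_trans (lt_trans Ut (ltry _)).
    by apply: le_measure; rewrite ?inE.
  have [h hh] : exists h, leb HK = h%:E.
    by exists (fine (leb HK)); rewrite fineK// ge0_fin_numE// measure_ge0.
  rewrite hh lee_fin.
  have : (t%:E + h%:E < (t + kap)%:E)%E.
    by apply: le_lt_trans Ut; rewrite Ueq hh leeD2r// -mt.
  by rewrite -EFinD lte_fin => ?; lra.
have : (m <= (t / 2)%:E)%E.
  apply: (@le_trans _ _ (leb (\bigcup_k F k))).
    by apply: ereal_inf_lbound; exists (\bigcup_k F k) => //; split => //; exact: bigcup_open.
  apply: (@le_trans _ _ (\sum_(0 <= k <oo) leb (F k))%E).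
    by apply: measure_sigma_subadditive => //; exact: bigcup_measurable.
  apply: lime_le; first exact: is_cvg_nneseries.
  apply: nearW => K; rewrite big_mkord.
  apply: (@le_trans _ _ (\sum_(k < K) k1%:E * leb (H k))%E).
    by apply: lee_sum => k _; exact: FH.
  rewrite -ge0_sume_distrr//.
  apply: (@le_trans _ _ (k1%:E * kap%:E)%E).
    by apply: lee_wpmul2l; [rewrite lee_fin ltW|exact: sumH].
  by rewrite -EFinM lee_fin /kap le_eqVlt; apply/orP; left; apply/eqP; field; exact: lt0r_neq0.
by rewrite mt lee_fin; lra.
Qed.

Lemma porous_negligible (E : set 'rV[R]_n) (c : R) : 0 < c < 1 ->
  (forall x, E x -> forall rho : R, 0 < rho -> exists (r : R) y, [/\ 0 < r < rho, `|y - x| <= r &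
     forall z, E z -> c * r <= `|z - y|]) ->
  leb.-negligible E.
Proof.
move=> c01 hE.
pose EE (k : nat) := E `&` [set x | `|x| < k%:R].
apply: (@negligibleS _ _ _ leb (\bigcup_k EE k)).
  move=> x Ex; exists (Num.truncn `|x|).+1 => //; split => //=; exact: truncnS_gt.
apply: negligible_bigcup => k.
apply: (@porous_negligible_bounded _ c k%:R c01) => [x []//|x [Ex _] rho rho0].
have [r [y [h1 h2 h3]]] := hE _ Ex _ rho0.
by exists r, y; split => // z [Ez _]; exact: h3.
Qed.
End porosity.

(** * Differentiation rules in one variable *)

Section derive1_rules.
Variable R : realType.
Implicit Types (f g : R -> R) (s a b : R).

Lemma is_derive1_eq f s a b : is_derive s 1 f a -> a = b -> is_derive s 1 f b.
Proof. by move=> h <-. Qed.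

Lemma is_derive1_add f g s a b : is_derive s 1 f a -> is_derive s 1 g b ->
  is_derive s 1 (fun t => f t + g t) (a + b).
Proof. exact: is_deriveD. Qed.

Lemma is_derive1_mul f g s a b : is_derive s 1 f a -> is_derive s 1 g b ->
  is_derive s 1 (fun t => f t * g t) (a * g s + f s * b).
Proof.
move=> fa gb; apply: is_derive1_eq (is_deriveM fa gb) _.
by rewrite /GRing.scale/= addrC (mulrC (g s)).
Qed.

Lemma is_derive1_opp f s a : is_derive s 1 f a -> is_derive s 1 (fun t => - f t) (- a).
Proof. exact: is_deriveN. Qed.

Lemma is_derive1_scale f s a c : is_derive s 1 f a -> is_derive s 1 (fun t => c * f t) (c * a).
Proof. exact: is_deriveZ. Qed.

Lemma is_derive1_cst (c s : R) : is_derive s 1 (fun=> c) 0.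
Proof. exact: is_derive_cst. Qed.

Lemma is_derive1_id s : is_derive s 1 (fun t : R => t) 1.
Proof. exact: is_derive_id. Qed.

Lemma is_derive1_exp f n s a : is_derive s 1 f a ->
  is_derive s 1 (fun t => f t ^+ n) (n%:R * f s ^+ n.-1 * a).
Proof.
move=> fa; rewrite (_ : (fun t => f t ^+ n) = f ^+ n); first exact: is_deriveX.
by apply/funext => t; rewrite exprfctE.
Qed.

Lemma is_derive1_inv f s a : f s != 0 -> is_derive s 1 f a ->
  is_derive s 1 (fun t => (f t)^-1) (- a / f s ^+ 2).
Proof.
move=> f0 fa; apply: is_derive1_eq (is_deriveV f0 fa) _.
by rewrite /GRing.scale/= mulNr mulrC mulNr.
Qed.

Lemma is_derive1_compose f g s a b : is_derive (g s) 1 f a -> is_derive s 1 g b ->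
  is_derive s 1 (fun t => f (g t)) (a * b).
Proof. exact: is_derive1_comp. Qed.
End derive1_rules.

(** * A family of smooth cutoffs closed under differentiation *)

Section cutoff.
Variable R : realType.
Implicit Types (k : nat) (s : R).

(* The family is stable under differentiation, see [is_derive_cutoff]. The
   constant 2 makes s |-> cutoff 0 (1 - s) convex on [0, 1]. *)
Definition cutoff k s : R := if 0 < s then s^-1 ^+ k * expR (- (2 / s)) else 0.

Lemma cutoff_le0 k s : s <= 0 -> cutoff k s = 0.
Proof. by rewrite /cutoff leNgt => /negbTE ->. Qed.

Lemma cutoff_ge0 k s : 0 <= cutoff k s.
Proof.
rewrite /cutoff; case: ifPn => // s0.
by rewrite mulr_ge0 ?expR_ge0// exprn_ge0// invr_ge0 ltW.
Qed.

Lemma cutoff_gt0 k s : 0 < s -> 0 < cutoff k s.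
Proof. by move=> s0; rewrite /cutoff s0 mulr_gt0 ?expR_gt0// exprn_gt0// invr_gt0. Qed.

Lemma exprn_le_expR k (y : R) : 0 <= y -> y ^+ k.+1 <= k.+1%:R ^+ k.+1 * expR y.
Proof.
move=> y0; have -> : expR y = expR (y / k.+1%:R) ^+ k.+1.
  by rewrite -expRM_natl mulrC divfK// pnatr_eq0.
rewrite -exprMn lerXn2r// ?nnegrE ?mulr_ge0 ?expR_ge0//.
apply: (@le_trans _ _ (k.+1%:R * (1 + y / k.+1%:R))).
  have -> : k.+1%:R * (1 + y / k.+1%:R) = y + k.+1%:R by field; rewrite addrC natr1 pnatr_eq0.
  by rewrite lerDl ler0n.
by rewrite ler_wpM2l ?ler0n// expR_ge1Dx.
Qed.

(** The exponential beats every power of 1 / s; a bound of order s^2 is what makes the derivative at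
    0 vanish in [is_derive_cutoff]. *)
Lemma cutoff_small k : exists2 C : R, 0 <= C & forall s, cutoff k s <= C * s ^+ 2.
Proof.
exists (k.+2%:R ^+ k.+2 / 2 ^+ k.+2).
  by rewrite divr_ge0// exprn_ge0// ler0n.
move=> s; have [s0|s0] := lerP s 0.
  by rewrite cutoff_le0// mulr_ge0 ?sqr_ge0// divr_ge0 ?exprn_ge0 ?ler0n.
rewrite /cutoff s0 expRN.
have := @exprn_le_expR k.+1 (2 / s) (divr_ge0 (ler0n _ 2) (ltW s0)).
have e0 := expR_gt0 (2 / s).
rewrite exprMn => h.
rewrite ler_pdivrMr// mulrAC.
have -> : s^-1 ^+ k = s^-1 ^+ k.+2 * s ^+ 2.
  by rewrite -addn2 exprD -mulrA -exprMn mulVf ?gt_eqF// expr1n mulr1.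
by rewrite ler_wpM2r ?sqr_ge0// mulrAC ler_pdivlMr ?exprn_gt0// mulrC.
Qed.

Lemma is_derive_cutoff k s :
  is_derive s 1 (cutoff k) (2 * cutoff k.+2 s - k%:R * cutoff k.+1 s).
Proof.
have [s0|s0|->] := ltgtP s 0.
- have -> : 2 * cutoff k.+2 s - k%:R * cutoff k.+1 s = 0.
    by rewrite !cutoff_le0 ?(ltW s0)// !mulr0 subrr.
  apply: (@near_eq_is_derive _ _ _ (cst 0)) .
  have : \forall t \near s, t < 0 by apply: open_nbhs_nbhs; split => //; exact: open_lt.
  by apply: filterS => t t0; rewrite cutoff_le0// ltW.
- have -> : 2 * cutoff k.+2 s - k%:R * cutoff k.+1 s =
    s^-1 ^+ k * (expR (- (2 / s)) * (- (2 * (- s^-2)))) + (k%:R * s^-1 ^+ k.-1 * (- s^-2)) * expR (- (2 / s)).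
    rewrite /cutoff s0; case: k => [|k] /=; rewrite !exprS; field; exact: lt0r_neq0.
  apply: (@near_eq_is_derive _ _ _ (fun s => s^-1 ^+ k * expR (- (2 / s)))) .
    have : \forall t \near s, 0 < t by apply: open_nbhs_nbhs; split => //; exact: open_gt.
    by apply: filterS => t t0; rewrite /cutoff t0.
  have s1 := is_derive1_inv (lt0r_neq0 s0) (is_derive1_id s).
  have s2 := is_derive1_compose (is_derive_expR _) (is_derive1_opp (is_derive1_scale 2 s1)).
  apply: is_derive1_eq (is_derive1_mul (is_derive1_exp k s1) s2) _.
  by rewrite addrC mulN1r.
have -> : 2 * cutoff k.+2 0 - k%:R * cutoff k.+1 0 = 0 by rewrite !cutoff_le0// !mulr0 subrr.
have [C C0 hC] := cutoff_small k.
suff h : h^-1 *: (cutoff k (h *: 1 + 0) - cutoff k 0) @[h --> 0^'] --> (0 : R).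
  by apply: DeriveDef; [apply/cvg_ex; exists 0|apply: cvg_lim].
apply/cvgrPdist_le => e e0.
near=> h.
rewrite sub0r normrN (cutoff_le0 _ (lexx 0)) subr0 addr0 /GRing.scale/= mulr1 normrM normfV.
have h0 : h != 0 by near: h; exact: nbhs_dnbhs_neq.
rewrite ler_pdivrMl ?normr_gt0// ger0_norm ?cutoff_ge0//.
apply: le_trans (hC h) _; rewrite -real_normK ?num_real// expr2 mulrCA ler_wpM2l//.
have : `|h| < e / (C + 1).
  near: h; apply: dnbhs0_lt; rewrite divr_gt0//; lra.
rewrite ltr_pdivlMr; last lra.
by move=> /ltW; apply: le_trans; rewrite mulrC ler_wpM2l//; lra.
Unshelve. all: by end_near.
Qed.

Lemma continuous_cutoff k : continuous (cutoff k).
Proof.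
move=> s; apply: differentiable_continuous; apply/derivable1_diffP.
by have [] := is_derive_cutoff k s.
Qed.
End cutoff.

(** * Test functions as terms with formal derivatives *)

Section terms.
Variables (R : realType) (n : nat).

(* Test functions are represented by terms, a class closed under differentiation,
   so that no smoothness ever has to be proved. *)
Inductive tm : Type :=
| Cst of R
| Var of 'I_n
| Add of tm & tm
| Mul of tm & tm
| Cut of nat & tm.

Fixpoint eval (t : tm) (x : 'rV[R]_n) : R :=
  match t with
  | Cst c => c
  | Var i => x ord0 i
  | Add a b => eval a x + eval b x
  | Mul a b => eval a x * eval b x
  | Cut k a => cutoff k (eval a x)
  end.

Fixpoint der (i : 'I_n) (t : tm) : tm :=
  match t with
  | Cst c => Cst 0
  | Var j => Cst (i == j)%:R
  | Add a b => Add (der i a) (der i b)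
  | Mul a b => Add (Mul (der i a) b) (Mul a (der i b))
  | Cut k a => Mul (Add (Mul (Cst 2) (Cut k.+2 a)) (Mul (Cst (- k%:R)) (Cut k.+1 a))) (der i a)
  end.

Implicit Types (t a b w : tm) (x y z v : 'rV[R]_n).

(** The chain rule along a path serves several times: straight lines give directional derivatives,
    the path s |-> (z - y) / s gives the derivative of a kernel in its scale. *)
Lemma is_derive_path t (g : R -> 'rV[R]_n) (s : R) (g' : 'I_n -> R) :
  (forall i, is_derive s 1 (fun s => g s ord0 i) (g' i)) ->
  is_derive s 1 (fun s => eval t (g s)) (\sum_i g' i * eval (der i t) (g s)).
Proof.
move=> hg; elim: t => [c|j|a iha b ihb|a iha b ihb|k a iha] /=.
- by rewrite big1 => [|i _]; [exact: is_derive_cst|rewrite mulr0].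
- rewrite (bigD1 j)//= eqxx mulr1 big1 ?addr0// => i /negbTE ->; exact: mulr0.
- under eq_bigr do rewrite mulrDr; rewrite big_split/=; exact: is_deriveD.
- under eq_bigr do rewrite mulrDr; rewrite big_split/= addrC.
  apply: is_derive_eq; rewrite /GRing.scale/= !mulr_sumr; congr (_ + _).
    by apply: eq_bigr => i _; rewrite mulrCA.
  by apply: eq_bigr => i _; ring.
- have := @is_derive1_comp R (cutoff k) (fun s => eval a (g s)) s _ _ (is_derive_cutoff k _) iha.
  move=> h; apply: (@is_derive_eq _ _ _ _ _ _ _ _ h).
  by rewrite mulr_sumr; apply: eq_bigr => i _; ring.
Qed.

Lemma is_derive_eval t x v :
  is_derive x v (eval t) (\sum_i v ord0 i * eval (der i t) x).
Proof.
have h : is_derive (0 : R) 1 (fun s => eval t (s *: v + x)) (\sum_i v ord0 i * eval (der i t) (0 *: v + x)).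
  apply: is_derive_path => i.
  rewrite (_ : (fun s : R => _) = (fun s : R => s * v ord0 i + x ord0 i)); last by apply/funext => s; rewrite !mxE.
  apply: is_derive_eq; rewrite /GRing.scale/= ?mulr1 ?addr0 ?mulr0 ?add0r ?mul1r //.
rewrite scale0r add0r in h.
have e : (fun h : R => h^-1 *: (eval t (h *: v + x) - eval t x)) =
   (fun h => h^-1 *: (eval t ((h *: (1 : R) + 0) *: v + x) - eval t (0 *: v + x))).
  by apply/funext => k; rewrite scale0r add0r addr0 /GRing.scale/= mulr1.
case: h => h1 h2; apply: DeriveDef.
  by move: h1; rewrite /derivable/= e.
by move: h2; rewrite /derive/= e.
Qed.

Lemma derive_eval t i : 'D_(delta_mx ord0 i) (eval t) = eval (der i t).
Proof.
apply/funext => x; have [_ ->] := is_derive_eval t x (delta_mx ord0 i).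
rewrite (bigD1 i)//= mxE !eqxx mul1r big1 ?addr0// => j /negbTE ji.
by rewrite mxE ji andbF mul0r.
Qed.

Lemma derive_evalE t i x : 'D_(delta_mx ord0 i) (eval t) x = eval (der i t) x.
Proof. by rewrite -derive_eval. Qed.

Lemma continuous_eval t : continuous (eval t).
Proof.
elim: t => [c|j|a iha b ihb|a iha b ihb|k a iha] x /=.
- exact: cst_continuous.
- exact: coord_continuous.
- by apply: (@continuousD _ _ _ (eval a) (eval b)); [exact: iha|exact: ihb].
- by apply: (@continuousM _ _ (eval a) (eval b)); [exact: iha|exact: ihb].
- by apply: (@continuous_comp _ _ _ (eval a) (cutoff k)); [exact: iha|exact: continuous_cutoff].
Qed.

Lemma iter_partial_eval s t : iter_partial s (eval t) = eval (foldr der t s).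
Proof. by elim: s => //= i s ->; rewrite derive_eval. Qed.

Lemma smooth_eval t : smooth (eval t).
Proof.
move=> s; rewrite iter_partial_eval; split; first exact: continuous_eval.
by move=> i x; have [] := is_derive_eval (foldr der t s) x (delta_mx ord0 i).
Qed.

Lemma measurable_eval t : measurable_fun setT (eval t).
Proof. by apply: continuous_measurable_rVR; exact: continuous_eval. Qed.

Lemma der_eq i t t' : eval t = eval t' -> eval (der i t) = eval (der i t').
Proof. by move=> e; rewrite -!derive_eval e. Qed.

Lemma derC i j t : eval (der i (der j t)) = eval (der j (der i t)).
Proof.
apply/funext => x; elim: t => [c|k|a iha b ihb|a iha b ihb|k a iha] //=.
- by rewrite iha ihb.
- rewrite iha ihb; ring.
- rewrite iha; ring.
Qed.

Definition tsum (F : 'I_n -> tm) : tm := foldr (fun i acc => Add (F i) acc) (Cst 0) (enum 'I_n).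

Lemma eval_tsum F x : eval (tsum F) x = \sum_i eval (F i) x.
Proof.
rewrite /tsum -big_enum/=; elim: (enum 'I_n) => [|i s ih] /=; first by rewrite big_nil.
by rewrite big_cons ih.
Qed.

Lemma der_tsum i F x : eval (der i (tsum F)) x = \sum_j eval (der i (F j)) x.
Proof.
rewrite /tsum -big_enum/=; elim: (enum 'I_n) => [|j s ih] /=; first by rewrite big_nil.
by rewrite big_cons ih.
Qed.

Definition lap t := tsum (fun i => der i (der i t)).

Lemma eval_lap t x : eval (lap t) x = \sum_i eval (der i (der i t)) x.
Proof. exact: eval_tsum. Qed.

Lemma lap_eq t t' : eval t = eval t' -> eval (lap t) = eval (lap t').
Proof.
move=> e; apply/funext => x; rewrite !eval_lap; apply: eq_bigr => i _.
by rewrite (der_eq i (der_eq i e)).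
Qed.

Lemma der_lap i t : eval (der i (lap t)) = eval (lap (der i t)).
Proof.
apply/funext => x; rewrite der_tsum eval_lap; apply: eq_bigr => j _.
by rewrite derC (der_eq j (derC i j t)).
Qed.

Definition vanish (K : set 'rV[R]_n) t := forall x, ~ K x -> eval t x = 0.

Lemma vanish_der K t i : closed K -> vanish K t -> vanish K (der i t).
Proof.
move=> cK tK x Kx; rewrite -derive_eval.
have : \forall y \near x, (0 : R) = eval t y.
  have : nbhs x (~` K) by apply: open_nbhs_nbhs; split => //; exact: closed_openC.
  by apply: filterS => y /tK.
by move=> /near_eq_is_derive/(_ (is_derive_cst _ _ (delta_mx ord0 i)))[_ ->].
Qed.

Lemma vanish_tsum K F : (forall i, vanish K (F i)) -> vanish K (tsum F).
Proof. by move=> h x Kx; rewrite eval_tsum big1// => i _; exact: h. Qed.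

Lemma vanish_lap K t : closed K -> vanish K t -> vanish K (lap t).
Proof. by move=> cK h; apply: vanish_tsum => i; apply: (vanish_der i cK); exact: (vanish_der i cK). Qed.

Lemma vanishS K K' t : K `<=` K' -> vanish K t -> vanish K' t.
Proof. by move=> KK h x nx; apply: h => /KK. Qed.

Lemma vanish_mull K a b : vanish K a -> vanish K (Mul a b).
Proof. by move=> h x /h /= ->; rewrite mul0r. Qed.

Lemma vanish_mulr K a b : vanish K b -> vanish K (Mul a b).
Proof. by move=> h x /h /= ->; rewrite mulr0. Qed.

Lemma vanish_add K a b : vanish K a -> vanish K b -> vanish K (Add a b).
Proof. by move=> h h' x kx; rewrite /= h// h'// addr0. Qed.

Fixpoint rescale y (s : R) t : tm :=
  match t with
  | Cst c => Cst c
  | Var i => Mul (Cst s^-1) (Add (Var i) (Cst (- y ord0 i)))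
  | Add a b => Add (rescale y s a) (rescale y s b)
  | Mul a b => Mul (rescale y s a) (rescale y s b)
  | Cut k a => Cut k (rescale y s a)
  end.

Lemma eval_rescale y s t x : eval (rescale y s t) x = eval t (s^-1 *: (x - y)).
Proof.
elim: t => [c|j|a iha b ihb|a iha b ihb|k a iha] //=.
- by rewrite !mxE.
- by rewrite iha ihb.
- by rewrite iha ihb.
- by rewrite iha.
Qed.

Lemma der_rescale i y s t x : eval (der i (rescale y s t)) x = s^-1 * eval (der i t) (s^-1 *: (x - y)).
Proof.
elim: t => [c|j|a iha b ihb|a iha b ihb|k a iha] /=.
- by rewrite mulr0.
- by rewrite mul0r add0r addr0.
- by rewrite iha ihb mulrDr.
- by rewrite iha ihb !eval_rescale; ring.
- by rewrite iha !eval_rescale; ring.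
Qed.

Lemma lap_rescale y s t x : eval (lap (rescale y s t)) x = s^-1 ^+ 2 * eval (lap t) (s^-1 *: (x - y)).
Proof.
rewrite !eval_lap mulr_sumr; apply: eq_bigr => i _.
have e : eval (der i (rescale y s t)) = eval (Mul (Cst s^-1) (rescale y s (der i t))).
  by apply/funext => z; rewrite der_rescale /= eval_rescale.
by rewrite (der_eq i e) /= der_rescale mul0r add0r mulrA expr2.
Qed.

Definition sqn x : R := \sum_i x ord0 i ^+ 2.

Definition tsqn : tm := tsum (fun i => Mul (Var i) (Var i)).

Lemma eval_tsqn x : eval tsqn x = sqn x.
Proof. by rewrite eval_tsum. Qed.

Definition tball : tm := Add (Cst 1) (Mul (Cst (-1)) tsqn).

Lemma eval_tball x : eval tball x = 1 - sqn x.
Proof. by rewrite /= eval_tsqn mulN1r. Qed.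

Lemma sqn_ge0 x : 0 <= sqn x.
Proof. by apply: sumr_ge0 => i _; exact: sqr_ge0. Qed.

Lemma coord_le_sqn x i : x ord0 i ^+ 2 <= sqn x.
Proof. by rewrite /sqn (bigD1 i)//= lerDl; apply: sumr_ge0 => j _; exact: sqr_ge0. Qed.

Lemma norm_le_sqn x : `|x| ^+ 2 <= sqn x.
Proof.
rewrite -(sqr_sqrtr (sqn_ge0 x)) lerXn2r// ?nnegrE ?sqrtr_ge0//.
apply: norm_le_coord => [|i]; first exact: sqrtr_ge0.
by rewrite -sqrtr_sqr ler_wsqrtr// coord_le_sqn.
Qed.

Lemma sqn_le_norm x : sqn x <= n%:R * `|x| ^+ 2.
Proof.
apply: (@le_trans _ _ (\sum_(i < n) `|x| ^+ 2)).
  by apply: ler_sum => i _; rewrite -real_normK ?num_real// lerXn2r// ?nnegrE// coord_norm_le.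
by rewrite sumr_const card_ord mulr_natl.
Qed.

Lemma sqnZ (c : R) x : sqn (c *: x) = c ^+ 2 * sqn x.
Proof. by rewrite /sqn mulr_sumr; apply: eq_bigr => i _; rewrite mxE exprMn. Qed.

Lemma enormE x : enorm x = Num.sqrt (sqn x). Proof. by []. Qed.

Lemma continuous_sqn : continuous sqn.
Proof. by rewrite (_ : sqn = eval tsqn); [exact: continuous_eval|apply/funext => x; rewrite eval_tsqn]. Qed.

(** With squares the ball is a sublevel set of a polynomial. Membership in terms of [enorm] requires
    a nonnegative radius, see [cballP]. *)
Definition cball y (r : R) : set 'rV[R]_n := [set z | sqn (z - y) <= r ^+ 2].

Lemma closed_cball y r : closed (cball y r).
Proof.
rewrite /cball (_ : [set _ | _] = (fun z => sqn (z - y)) @^-1` [set t | t <= r ^+ 2])//.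
apply: closed_comp => [z _|]; last exact: closed_le.
apply: (@continuous_comp _ _ _ (fun z => z - y) sqn); last exact: continuous_sqn.
by apply: (@continuousB _ _ _ id (cst y)); [exact: cvg_id|exact: cst_continuous].
Qed.

Lemma cball_norm y r z : 0 <= r -> cball y r z -> `|z - y| <= r.
Proof.
move=> r0 h; rewrite -(@ler_pXn2r _ 2)// ?nnegrE//.
by apply: le_trans (norm_le_sqn _) h.
Qed.

Lemma compact_normball y (r : R) : compact [set x : 'rV[R]_n | `|x - y| <= r].
Proof.
apply: bounded_closed_compact; last exact: closed_normball.
exists (r + `|y|); split; first exact: num_real.
move=> M M1 x /= xy; apply: le_trans (ltW M1).
by rewrite -[x](subrK y) (le_trans (ler_normD _ _))// lerD2r.
Qed.

Lemma compact_cball y r : compact (cball y r).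
Proof.
apply: (subclosed_compact (@closed_cball y r) (@compact_normball y `|r|)) => z h /=.
by apply: cball_norm => //; rewrite /cball/= real_normK ?num_real.
Qed.

Definition off K (F : 'rV[R]_n -> R) := forall x, ~ K x -> F x = 0.

Lemma bounded_off K F : compact K -> continuous F -> off K F -> exists2 C : R, 0 < C & forall x, `|F x| <= C.
Proof.
move=> cK cF hF.
have ct : {within K, continuous F} by apply: continuous_subspaceT => x; exact: cF.
have [M [_ hM]] := compact_bounded (continuous_compact ct cK).
exists (`|M| + 1) => [|x]; first by rewrite ltr_wpDl.
have [Kx|/hF ->] := pselect (K x); last by rewrite normr0 addr_ge0.
apply: (hM (`|M| + 1)); first by rewrite (le_lt_trans (ler_norm _))// ltrDl.
by exists x.
Qed.

Lemma bounded_vanish K t : compact K -> vanish K t -> exists2 C : R, 0 < C & forall x, `|eval t x| <= C.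
Proof. by move=> cK ht; apply: (bounded_off cK) => //; exact: continuous_eval. Qed.

Lemma off_derive K F v : closed K -> off K F -> off K ('D_v F).
Proof.
move=> cK KF x Kx.
have : \forall y \near x, (0 : R) = F y.
  have : nbhs x (~` K) by apply: open_nbhs_nbhs; split => //; exact: closed_openC.
  by apply: filterS => y /KF.
by move=> /near_eq_is_derive/(_ (is_derive_cst _ _ v))[_ ->].
Qed.

Lemma cts_mul (F G : 'rV[R]_n -> R) : continuous F -> continuous G -> continuous (fun x => F x * G x).
Proof. by move=> cF cG x; apply: (@continuousM _ _ F G); [exact: cF|exact: cG]. Qed.

Lemma cts_add (F G : 'rV[R]_n -> R) : continuous F -> continuous G -> continuous (fun x => F x + G x).
Proof. by move=> cF cG x; apply: (@continuousD _ _ _ F G); [exact: cF|exact: cG]. Qed.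

(** Regularity in one direction, in a form shared by terms, by smooth test functions and by
    convolutions as functions of their centre: integration by parts is applied to all three. *)
Definition C1dir i (F : 'rV[R]_n -> R) := [/\ continuous F,
  (forall x, derivable F x (delta_mx ord0 i)) & continuous ('D_(delta_mx ord0 i) F)].

Lemma C1dir_eval i t : C1dir i (eval t).
Proof.
split; first exact: continuous_eval.
  by move=> x; have [] := is_derive_eval t x (delta_mx ord0 i).
by rewrite derive_eval; exact: continuous_eval.
Qed.

Lemma C1dir_smooth i s F : smooth F -> C1dir i (iter_partial s F).
Proof. by move=> sF; have [h1 h2] := sF s; split => //; have [] := sF (i :: s). Qed.

Lemma C1dirM i F G : C1dir i F -> C1dir i G -> C1dir i (fun x => F x * G x) /\
  'D_(delta_mx ord0 i) (fun x => F x * G x) =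
  fun x => F x * 'D_(delta_mx ord0 i) G x + 'D_(delta_mx ord0 i) F x * G x.
Proof.
move=> [cF dF cdF] [cG dG cdG].
have D x : is_derive x (delta_mx ord0 i) (fun x => F x * G x)
    (F x * 'D_(delta_mx ord0 i) G x + 'D_(delta_mx ord0 i) F x * G x).
  have -> : (fun x => F x * G x) = F * G by apply/funext => y; rewrite mulrfctE.
  apply: is_derive_eq (is_deriveM (DeriveDef (dF x) erefl) (DeriveDef (dG x) erefl)) _.
  by rewrite /GRing.scale/= [G x * _]mulrC.
have E : 'D_(delta_mx ord0 i) (fun x => F x * G x) =
  fun x => F x * 'D_(delta_mx ord0 i) G x + 'D_(delta_mx ord0 i) F x * G x.
  by apply/funext => x; have [_ ->] := D x.
split; last exact: E.
split; first exact: cts_mul.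
  by move=> x; have [] := D x.
by rewrite E; apply: cts_add; apply: cts_mul.
Qed.

Lemma is_derive_line (F : 'rV[R]_n -> R) x v (r : R) : derivable F (x + r *: v) v ->
  is_derive r 1 (fun s : R => F (x + s *: v)) ('D_v F (x + r *: v)).
Proof.
move=> dF.
have e : (fun h : R => h^-1 *: (F (h *: v + (x + r *: v)) - F (x + r *: v))) =
   (fun h => h^-1 *: (F (x + (h *: (1 : R) + r) *: v) - F (x + r *: v))).
  by apply/funext => k; rewrite scaler1 scalerDl [in LHS]addrCA.
apply: DeriveDef.
  by move: dF; rewrite /derivable/= e.
by rewrite /derive/= e.
Qed.
End terms.

(** * Integration over R^n and integration by parts *)

Section integrals.
Variables (R : realType) (n : nat).
Notation leb := (@lebesgue_rV R n).
Implicit Types (f g : 'rV[R]_n -> R) (x v : 'rV[R]_n) (t : tm R n) (K : set 'rV[R]_n).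

Definition intg f := leb.-integrable setT (EFin \o f).
Definition Int f : R := \int[leb]_x f x.

Lemma intg_measurable f : intg f -> measurable_fun setT f.
Proof. by move=> /integrableP[/measurable_EFinP]. Qed.

Lemma intg_le f g : measurable_fun setT f -> (forall x, `|f x| <= g x) -> intg g -> intg f.
Proof.
move=> mf fg; apply: le_integrable => //; first exact/measurable_EFinP.
by move=> x _ /=; rewrite lee_fin (le_trans (fg x))// ler_norm.
Qed.

Lemma intgD f g : intg f -> intg g -> intg (fun x => f x + g x).
Proof. by move=> hf hg; have := integrableD measurableT hf hg. Qed.

Lemma intgZ c f : intg f -> intg (fun x => c * f x).
Proof. by move=> hf; have := integrableZl measurableT c hf. Qed.

Lemma intgN f : intg f -> intg (fun x => - f x).
Proof. by move=> hf; have := integrableN hf. Qed.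

Lemma intgB f g : intg f -> intg g -> intg (fun x => f x - g x).
Proof. by move=> hf hg; apply: intgD => //; exact: intgN. Qed.

Lemma intg_abs f : intg f -> intg (fun x => `|f x|).
Proof. exact: integrable_norm. Qed.

Lemma intgM f g C : intg f -> measurable_fun setT g -> (forall x, `|g x| <= C) ->
  intg (fun x => f x * g x).
Proof.
move=> hf mg gC; apply: (@intg_le _ (fun x => C * `|f x|)).
- by apply: measurable_funM => //; exact: intg_measurable.
- by move=> x; rewrite normrM mulrC ler_wpM2r.
- by apply: intgZ; exact: intg_abs.
Qed.

Lemma intg_sum (I : Type) (s : seq I) (F : I -> 'rV[R]_n -> R) :
  (forall i, intg (F i)) -> intg (fun x => \sum_(i <- s) F i x).
Proof.
move=> h; elim: s => [|i s ih].
  rewrite (_ : (fun x => _) = cst 0); last by apply/funext => x; rewrite big_nil.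
  exact: integrable0.
rewrite (_ : (fun x => _) = (fun x => F i x + \sum_(j <- s) F j x)); last first.
  by apply/funext => x; rewrite big_cons.
exact: intgD.
Qed.

Lemma IntD f g : intg f -> intg g -> Int (fun x => f x + g x) = Int f + Int g.
Proof. by move=> hf hg; rewrite /Int RintegralD. Qed.

Lemma IntB f g : intg f -> intg g -> Int (fun x => f x - g x) = Int f - Int g.
Proof. by move=> hf hg; rewrite /Int RintegralB. Qed.

Lemma IntZ c f : intg f -> Int (fun x => c * f x) = c * Int f.
Proof. by move=> hf; rewrite /Int RintegralZl. Qed.

Lemma Int0 : Int (fun=> 0) = 0.
Proof. by rewrite /Int/Rintegral integral0. Qed.

Lemma Int_sum (I : Type) (s : seq I) (F : I -> 'rV[R]_n -> R) :
  (forall i, intg (F i)) -> Int (fun x => \sum_(i <- s) F i x) = \sum_(i <- s) Int (F i).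
Proof.
move=> h; elim: s => [|i s ih].
  rewrite big_nil -[RHS]Int0; congr Int; apply/funext => x; exact: big_nil.
rewrite big_cons -ih -IntD//; last exact: intg_sum.
by congr Int; apply/funext => x; rewrite big_cons.
Qed.

Lemma Int_le f g : intg f -> intg g -> (forall x, f x <= g x) -> Int f <= Int g.
Proof. by move=> hf hg fg; apply: le_Rintegral => // x _; exact: fg. Qed.

Lemma Int_ge0 f : (forall x, 0 <= f x) -> 0 <= Int f.
Proof. by move=> f0; apply: Rintegral_ge0 => x _; exact: f0. Qed.

Lemma Int_abs f : intg f -> `|Int f| <= Int (fun x => `|f x|).
Proof. by move=> hf; apply: le_normr_Rintegral. Qed.

Lemma leb_compact K : compact K -> (leb K < +oo)%E.
Proof.
move=> cK; have [M [_ hM]] := compact_bounded cK.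
have M0 : 0 < `|M| + 1 + 1 by rewrite addr_gt0// ltr_wpDl.
apply: (@le_lt_trans _ _ (leb [set z | `|z - 0| < `|M| + 1 + 1])); last first.
  by rewrite leb_normball// ltry.
apply: le_measure; rewrite ?inE.
- by apply: measurable_closedrV; apply: compact_closed => //; exact: norm_hausdorff.
- by apply: measurable_openrV; exact: open_normball.
- move=> z Kz /=; rewrite subr0; apply: (@le_lt_trans _ _ (`|M| + 1)); last by rewrite ltrDl.
  by apply: hM => //; rewrite (le_lt_trans (ler_norm _))// ltrDl.
Qed.

Lemma compact_measurable K : compact K -> measurable K.
Proof. by move=> cK; apply: measurable_closedrV; apply: compact_closed => //; exact: norm_hausdorff. Qed.

Lemma intg_indic K : measurable K -> (leb K < +oo)%E -> intg (\1_K : 'rV[R]_n -> R).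
Proof.
move=> mK Kf; apply/integrableP; split; first exact/measurable_EFinP.
rewrite (eq_integral (fun x => (\1_K x)%:E)); last first.
  by move=> x _ /=; rewrite ger0_norm// indicE ler0n.
by rewrite integral_indic// setIT.
Qed.

Lemma Int_indic K : measurable K -> Int (\1_K) = fine (leb K).
Proof. by move=> mK; rewrite /Int /Rintegral integral_indic// setIT. Qed.

Lemma Int_bound f K C : measurable K -> (leb K < +oo)%E -> measurable_fun setT f ->
  (forall x, `|f x| <= C * \1_K x) -> intg f /\ `|Int f| <= C * fine (leb K).
Proof.
move=> mK Kf mf fC; have h := intgZ C (intg_indic mK Kf).
have hf := intg_le mf fC h; split => //.
rewrite -Int_indic// -IntZ; last exact: intg_indic.
by apply: le_trans (Int_abs hf) _; apply: Int_le => //; exact: intg_abs.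
Qed.

Lemma intg_vanish K t : compact K -> vanish K t -> intg (eval t).
Proof.
move=> cK Kt; have [C C0 hC] := bounded_vanish cK Kt.
have [] // := @Int_bound (eval t) K C (compact_measurable cK) (leb_compact cK) (measurable_eval t).
move=> x; rewrite indicE; have [Kx|Kx] := pselect (K x).
  by rewrite mem_set// mulr1.
by rewrite memNset// mulr0 (Kt _ Kx) normr0.
Qed.

Lemma is_derive_Int f (g dg : R -> 'rV[R]_n -> R) (a b s C : R) : a < s < b -> intg f ->
  (forall r, a < r < b -> measurable_fun setT (g r)) ->
  (forall r x, a < r < b -> `|g r x| <= C) ->
  (forall r x, a < r < b -> is_derive r 1 (g^~ x) (dg r x)) ->
  (forall r x, a < r < b -> `|dg r x| <= C) ->
  is_derive s 1 (fun r => Int (fun x => f x * g r x)) (Int (fun x => f x * dg s x)).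
Proof.
move=> asb hf mg gC hg dgC.
have inI r : `]a, b[%classic r -> a < r < b by rewrite /= in_itv.
have dE r x : a < r < b -> partial1of2 (fun r x => f x * g r x) r x = f x * dg r x.
  move=> arb; rewrite partial1of2E.
  by have [_ ->] := is_derive1_scale (f x) (hg r x arb).
have C0 : 0 <= C by apply: le_trans (gC s 0 asb).
pose H := @cvg_differentiation_under_integral R _ _ leb (fun r x => f x * g r x) setT measurableT s a b.
have {}H := H _ _ _ (fun x => C * `|f x|).
have E : Int (fun x => f x * dg s x) = \int[leb]_x partial1of2 (fun r x => f x * g r x) s x.
  by congr Int; apply/funext => x; rewrite dE.
have cv : h^-1 *: (Int (fun x => f x * g (h *: 1 + s) x) - Int (fun x => f x * g s x)) @[h --> 0^'] -->
    Int (fun x => f x * dg s x).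
  rewrite E; under eq_fun do rewrite scaler1.
  apply: H.
  - by rewrite /= in_itv.
  - by move=> r /inI arb; apply: (@intgM _ _ C) => // [|x]; [exact: mg|exact: gC].
  - move=> r x /inI arb _; by have [] := is_derive1_scale (f x) (hg r x arb).
  - by move=> x; rewrite mulr_ge0.
  - by apply: intgZ; exact: intg_abs.
  - by move=> r x /inI arb _; rewrite dE// normrM mulrC ler_wpM2r// dgC.
apply: DeriveDef; last exact: cvg_lim cv.
by apply/cvg_ex; eexists; exact: cv.
Qed.

Lemma Int_shift f v : intg f -> Int (fun x => f (x + v)) = Int f.
Proof.
move=> hf; congr fine.
have mv : measurable_fun setT (fun x : 'rV[R]_n => x + v) by exact: measurable_shift.
pose m : {measure set 'rV[R]_n -> \bar R} :=
  measure_function_pushforward__canonical__measure_function_Measure leb mv.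
have e A : measurable A -> A `<=` setT -> m A = leb A.
  by move=> mA _; rewrite /m/= /pushforward leb_shift.
have -> : (\int[leb]_x (f x)%:E = \int[m]_x (f x)%:E)%E.
  by apply: eq_measure_integral => A mA At; rewrite e.
have hfm : leb.-integrable setT (EFin \o (fun x => f (x + v))).
  apply/integrableP; split.
    by apply/measurable_EFinP; apply: (measurableT_comp (intg_measurable hf)).
  have := @ge0_integral_pushforward _ _ _ _ _ _ mv leb setT (fun x => `|(f x)%:E|%E).
  rewrite preimage_setT => <-//.
  - rewrite (_ : integral _ _ _ = \int[m]_x `|(f x)%:E|)%E//.
    by rewrite (eq_measure_integral leb) => [|A mA At]; [have /integrableP[] := hf|rewrite e].
  - by apply: measurableT_comp => //; apply/measurable_EFinP; exact: intg_measurable.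
have := @integral_pushforward _ _ _ _ _ _ mv leb setT (EFin \o f).
rewrite preimage_setT => -> //.
by apply/measurable_EFinP; exact: intg_measurable.
Qed.

Lemma intg_off K F : compact K -> continuous F -> off K F -> intg F.
Proof.
move=> cK cF KF; have [C C0 hC] := bounded_off cK cF KF.
have [] // := @Int_bound F K C (compact_measurable cK) (leb_compact cK) (continuous_measurable_rVR cF).
move=> x; rewrite indicE; have [Kx|Kx] := pselect (K x).
  by rewrite mem_set// mulr1.
by rewrite memNset// mulr0 (KF _ Kx) normr0.
Qed.

(** A consequence of translation invariance alone: the integral of F(x + s e) does not depend on s,
    and its derivative at s = 0 is the integral in question. *)
Lemma Int_derive K F i : compact K -> C1dir i F -> off K F -> Int ('D_(delta_mx ord0 i) F) = 0.
Proof.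
move=> cK [cF dF cdF] KF; have [M [_ hM]] := compact_bounded cK.
set dF' := 'D_(delta_mx ord0 i) F.
have [C1 _ hC1] := bounded_off cK cF KF.
have clK : closed K by apply: compact_closed => //; exact: norm_hausdorff.
have KdF : off K dF' by exact: off_derive.
have [C2 _ hC2] := bounded_off cK cdF KdF.
(* Large enough for the indicator of [Q] to be 1 on the support of every translate with |s| < 1.
   This indicator is the integrable factor that [is_derive_Int] asks for. *)
pose N : R := `|M| + 2; pose Q : set 'rV[R]_n := [set x | `|x - 0| <= N].
have cQ : compact Q by exact: compact_normball.
pose e : 'rV[R]_n := delta_mx ord0 i.
pose g (s : R) x := F (x + s *: e).
pose dg (s : R) x := dF' (x + s *: e).
have he : `|e| <= 1.
  apply: norm_le_coord => // j; rewrite mxE eqxx/=; case: eqP => _; rewrite ?normr1 ?normr0//.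
have hQ (G : 'rV[R]_n -> R) (s : R) x : off K G -> -1 < s < 1 -> \1_Q x * G (x + s *: e) = G (x + s *: e).
  move=> KG s1; rewrite indicE; have [Qx|Qx] := pselect (Q x); first by rewrite mem_set// mul1r.
  rewrite memNset// mul0r KG// => Kx; apply: Qx; rewrite /Q/= subr0.
  have := hM (`|M| + 1) _ _ Kx; rewrite (le_lt_trans (ler_norm _)) ?ltrDl// => /(_ isT) h.
  rewrite -[x](addrK (s *: e)); apply: le_trans (ler_normB _ _) _.
  have : `|s *: e| <= 1.
    by rewrite normrZ -[leRHS]mulr1 ler_pM// ltW// ltr_norml.
  by move: h => /=; rewrite /N; lra.
have s0 : ((-1 : R) < 0) && ((0 : R) < 1) by rewrite ltrN10 ltr01.
have H : is_derive (0 : R) 1 (fun r => Int (fun x => \1_Q x * g r x)) (Int (fun x => \1_Q x * dg 0 x)).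
  apply: (@is_derive_Int _ g dg (-1) 1 0 (Num.max C1 C2)) => //.
  - by apply: intg_indic; [exact: compact_measurable|exact: leb_compact].
  - move=> r _; apply: (measurableT_comp (continuous_measurable_rVR cF)); exact: measurable_shift.
  - by move=> r x _; rewrite le_max hC1.
  - by move=> r x _; exact: is_derive_line.
  - by move=> r x _; rewrite le_max hC2 orbT.
have c0 : is_derive (0 : R) 1 (fun r => Int (fun x => \1_Q x * g r x)) 0.
  apply: (@near_eq_is_derive _ _ _ (cst (Int F))).
  have : \forall r \near (0 : R), -1 < r < 1.
    apply: filterS (nbhsx_ballx (0 : R) _ ltr01) => r; rewrite /ball/= sub0r normrN ltr_norml //.
  apply: filterS => r r1; rewrite /= -(@Int_shift _ (r *: e)); last exact: intg_off KF.
  by congr Int; apply/funext => x; rewrite /g hQ.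
have := H; case => _ h1; case: c0 => _; rewrite h1 => <-.
congr Int; apply/funext => x; rewrite /dg hQ//.
by rewrite scale0r addr0.
Qed.

Lemma Int_by_parts K F G i : compact K -> C1dir i F -> C1dir i G -> off K F \/ off K G ->
  Int (fun x => F x * 'D_(delta_mx ord0 i) G x) = - Int (fun x => 'D_(delta_mx ord0 i) F x * G x).
Proof.
move=> cK CF CG KFG; have clK : closed K by apply: compact_closed => //; exact: norm_hausdorff.
have [cF _ cdF] := CF; have [cG _ cdG] := CG.
have v1 : off K (fun x => F x * 'D_(delta_mx ord0 i) G x).
  move=> x Kx; case: KFG => h; first by rewrite h ?mul0r.
  by rewrite (off_derive _ clK h)// mulr0.
have v2 : off K (fun x => 'D_(delta_mx ord0 i) F x * G x).
  move=> x Kx; case: KFG => h; last by rewrite h ?mulr0.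
  by rewrite (off_derive _ clK h)// mul0r.
have i1 : intg (fun x => F x * 'D_(delta_mx ord0 i) G x).
  by apply: (intg_off cK _ v1); exact: cts_mul.
have i2 : intg (fun x => 'D_(delta_mx ord0 i) F x * G x).
  by apply: (intg_off cK _ v2); exact: cts_mul.
apply/eqP; rewrite -addr_eq0 -IntD//; apply/eqP.
have [C E] := C1dirM CF CG; rewrite -E (Int_derive cK C)// => x Kx.
by case: KFG => h; rewrite h ?mul0r ?mulr0.
Qed.
End integrals.

(** * The fundamental lemma of the calculus of variations *)

Section fundamental_lemma.
Variables (R : realType) (n : nat).
Notation leb := (@lebesgue_rV R n).
Implicit Types (f g : 'rV[R]_n -> R) (x v : 'rV[R]_n) (t : tm R n) (K : set 'rV[R]_n).

Lemma Int_dominated (f_ : nat -> 'rV[R]_n -> R) f g :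
  (forall k, measurable_fun setT (f_ k)) -> intg g -> (forall k x, `|f_ k x| <= g x) ->
  (forall x, f_ ^~ x @ \oo --> f x) -> Int (f_ k) @[k --> \oo] --> Int f.
Proof.
move=> mf ig fg ff.
have cE x : (f_ k x)%:E @[k --> \oo] --> (f x)%:E.
  by apply: cvg_EFin; [exact: nearW|exact: ff].
have mfE k : measurable_fun setT (EFin \o f_ k) by apply/measurable_EFinP.
have mlim : measurable_fun setT (EFin \o f).
  apply: (@emeasurable_fun_cvg _ _ _ _ (fun k => EFin \o f_ k)) => // x _; exact: cE.
have H := @dominated_convergence _ _ _ leb setT measurableT (fun k => EFin \o f_ k) (EFin \o f) (EFin \o g).
have [|||||_ _ C] := H => //.
- by apply: aeW => x _; exact: cE.
- by apply: aeW => x k _; rewrite /= lee_fin.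
apply: fine_cvg; rewrite fineK//.
have intf : intg f.
  apply: (intg_le _ _ ig); first exact/measurable_EFinP.
  move=> x; have h : `|f_ k x| @[k --> \oo] --> `|f x| by apply: cvg_norm; exact: ff.
  rewrite -(cvg_lim _ h)//.
  by apply: limr_le; [apply/cvg_ex; exists (`|f x|)|exact: nearW].
exact: integrable_fin_num intf.
Qed.

(** Terms with values in [0, 1] that converge to the indicator of the open box: exp(- 2 / (k.+1 s))
    tends to 1 for s > 0, and the cutoff is 0 for s <= 0. *)
Definition box_term (a b : 'rV[R]_n) (k : nat) : tm R n :=
  foldr (fun i acc => Mul (Mul (Cut 0 (Mul (Cst n k.+1%:R) (Add (Var R i) (Cst n (- a ord0 i)))))
                              (Cut 0 (Mul (Cst n k.+1%:R) (Add (Cst n (b ord0 i)) (Mul (Cst n (-1)) (Var R i))))))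
                         acc) (Cst n 1) (enum 'I_n).

Lemma eval_box_term a b k x : eval (box_term a b k) x =
  \prod_i (cutoff 0 (k.+1%:R * (x ord0 i - a ord0 i)) * cutoff 0 (k.+1%:R * (b ord0 i - x ord0 i))).
Proof.
rewrite /box_term -big_enum/=; elim: (enum 'I_n) => [|i s ih] /=; first by rewrite big_nil.
by rewrite big_cons ih mulN1r.
Qed.

Lemma cutoff0_le1 (s : R) : cutoff 0 s <= 1.
Proof.
rewrite /cutoff; case: ifPn => // s0; rewrite expr0 mul1r -[leRHS]expR0 ler_expR oppr_le0.
by rewrite divr_ge0// ltW.
Qed.

Lemma cutoff0_cvg (s : R) : 0 < s -> cutoff 0 (k.+1%:R * s) @[k --> \oo] --> (1 : R).
Proof.
move=> s0; rewrite (_ : (fun k => _) = (fun k : nat => expR (- (2 / s) * k.+1%:R^-1))); last first.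
  apply/funext => k; rewrite /cutoff mulr_gt0// expr0 mul1r; congr expR.
  by rewrite mulNr -mulrA [s^-1 * _]mulrC -invfM.
have h : - (2 / s) * k.+1%:R^-1 @[k --> \oo] --> - (2 / s) * 0.
  by apply: cvgMr; exact: cvg_harmonic.
suff : expR (- (2 / s) * k.+1%:R^-1) @[k --> \oo] --> expR (- (2 / s) * 0) by rewrite mulr0 expR0.
exact: (cvg_comp _ _ h (@continuous_expR R _)).
Qed.

Lemma cvg_prod_seq (I : Type) (s : seq I) (F : I -> nat -> R) (L : I -> R) :
  (forall i, F i k @[k --> \oo] --> L i) ->
  \prod_(i <- s) F i k @[k --> \oo] --> \prod_(i <- s) L i.
Proof.
move=> h; elim: s => [|i s ih].
  by rewrite big_nil; under eq_fun do rewrite big_nil; exact: cvg_cst.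
by rewrite big_cons; under eq_fun do rewrite big_cons; exact: cvgM.
Qed.

Lemma box_term_cvg a b x : eval (box_term a b k) x @[k --> \oo] --> (\1_(box a b) x : R).
Proof.
under eq_fun do rewrite eval_box_term.
rewrite indicE; have [bx|bx] := pselect (box a b x).
  rewrite mem_set// (_ : true%:R = \prod_(i < n) (1 * 1) :> R); last first.
    by rewrite big1 // => i _; rewrite mulr1.
  move/boxP : bx => bx.
  apply: cvg_prod_seq => i; have /andP[h1 h2] := bx i.
  by apply: cvgM; apply: cutoff0_cvg; rewrite subr_gt0.
rewrite memNset//.
have /existsNP[i /negP] : ~ forall i, a ord0 i < x ord0 i < b ord0 i by move/boxP.
rewrite negb_and -!leNgt => h.
rewrite (_ : (fun k : nat => _) = cst 0); first exact: cvg_cst.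
apply/funext => k; rewrite (bigD1 i)//=.
case/orP: h => h; rewrite [X in X * _](_ : _ = 0) ?mul0r//.
  by rewrite cutoff_le0 ?mul0r// mulr_ge0_le0// subr_le0.
by rewrite mulrC cutoff_le0 ?mul0r// mulr_ge0_le0// subr_le0.
Qed.

Lemma box_term_bnd a b k x : 0 <= eval (box_term a b k) x <= 1.
Proof.
rewrite eval_box_term; apply/andP; split.
  by apply: prodr_ge0 => i _; rewrite mulr_ge0// cutoff_ge0.
apply: prodr_ile1 => i _; apply/andP; split; first by rewrite mulr_ge0// cutoff_ge0.
by rewrite -[leRHS]mulr1 ler_pM// ?cutoff_ge0 ?cutoff0_le1.
Qed.

Definition cbox (a b : 'rV[R]_n) : set 'rV[R]_n := [set x | forall i, a ord0 i <= x ord0 i <= b ord0 i].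

Lemma vanish_box_term a b k : vanish (cbox a b) (box_term a b k).
Proof.
move=> x /existsNP[i /negP]; rewrite negb_and -!ltNge => h.
rewrite eval_box_term (bigD1 i)//=.
case/orP: h => h; rewrite [X in X * _](_ : _ = 0) ?mul0r//.
  by rewrite cutoff_le0 ?mul0r// mulr_ge0_le0// subr_le0 ltW.
by rewrite mulrC cutoff_le0 ?mul0r// mulr_ge0_le0// subr_le0 ltW.
Qed.

Lemma closed_cbox a b : closed (cbox a b).
Proof.
rewrite [cbox a b](_ : _ = \bigcap_(i in [set: 'I_n]) ((fun x : 'rV[R]_n => x ord0 i) @^-1` [set t | a ord0 i <= t <= b ord0 i])); last first.
  by apply/seteqP; split => [x h i _|x h i]; [exact: h|exact: (h i)].
apply: closed_bigI => i _; apply: closed_comp => [x _|]; first exact: coord_continuous.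
rewrite (_ : [set t | _] = [set t | a ord0 i <= t] `&` [set t | t <= b ord0 i]); last first.
  by apply/seteqP; split => [t /andP[]|t [h1 h2]] //=; apply/andP.
by apply: closedI; [exact: closed_ge|exact: closed_le].
Qed.

Lemma compact_cbox a b : compact (cbox a b).
Proof.
apply: (subclosed_compact (@closed_cbox a b) (@compact_normball _ _ 0 (`|a| + `|b|))) => x h /=.
rewrite subr0; apply: norm_le_coord => [|i]; first exact: addr_ge0.
have /andP[h1 h2] := h i; have := coord_norm_le a i; have := coord_norm_le b i.
rewrite !ler_norml => /andP[b1 b2] /andP[a1 a2].
by apply/andP; split; lra.
Qed.

Variable Omega : set 'rV[R]_n.

Lemma Int_box_eq0 G a b : intg G -> cbox a b `<=` Omega ->
  (forall t K, compact K -> K `<=` Omega -> vanish K t -> Int (fun x => G x * eval t x) = 0) ->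
  Int (fun x => G x * \1_(box a b) x) = 0.
Proof.
move=> iG abO hG.
have : Int (fun x => G x * eval (box_term a b k) x) @[k --> \oo] --> Int (fun x => G x * \1_(box a b) x).
  apply: (@Int_dominated _ _ (fun x => `|G x|)).
  - by move=> k; apply: measurable_funM; [exact: intg_measurable|exact: measurable_eval].
  - exact: intg_abs.
  - move=> k x; have /andP[h0 h1] := box_term_bnd a b k x.
    by rewrite normrM -[leRHS]mulr1 ler_pM// ger0_norm.
  - by move=> x; apply: cvgMr; exact: box_term_cvg.
rewrite [X in X @ _ --> _](_ : _ = cst 0); last first.
  by apply/funext => k; apply: (hG _ (cbox a b)); [exact: compact_cbox|by []|exact: vanish_box_term].
by move=> /(cvg_lim (@norm_hausdorff _ _)) <-; rewrite lim_cst.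
Qed.

(** As G has no sign, integrating it over A does not define a measure in A. The sets on which the
    integral vanishes still form a lambda-system, and it contains the boxes. *)
Lemma Int_setI_eq0 G (Q : set 'rV[R]_n) : intg G -> measurable Q ->
  (forall a b, Int (fun x => G x * \1_(Q `&` box a b) x) = 0) ->
  forall A, measurable A -> Int (fun x => G x * \1_(Q `&` A) x) = 0.
Proof.
move=> iG mQ hG.
have iGA A : measurable A -> intg (fun x => G x * \1_(Q `&` A) x).
  move=> mA; apply: (@intgM _ _ _ _ 1) => //; first by apply: measurable_indic; exact: measurableI.
  by move=> x; rewrite indicE ger0_norm ?ler0n// lern1; case: (_ \in _).
have lim0 (F : nat -> set 'rV[R]_n) : (forall k, measurable (F k)) ->
    (forall i j, (i <= j)%N -> F i `<=` F j) ->
    (forall k, Int (fun x => G x * \1_(Q `&` F k) x) = 0) ->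
    Int (fun x => G x * \1_(Q `&` \bigcup_k F k) x) = 0.
  move=> mF ndF h.
  have : Int (fun x => G x * \1_(Q `&` F k) x) @[k --> \oo] --> Int (fun x => G x * \1_(Q `&` \bigcup_k F k) x).
    apply: (@Int_dominated _ _ (fun x => `|G x|)).
    - by move=> k; apply: intg_measurable; exact: iGA.
    - exact: intg_abs.
    - move=> k x; rewrite normrM ler_piMr// indicE ger0_norm ?ler0n// lern1; by case: (_ \in _).
    - move=> x; apply: cvgMr.
      have [[Qx [k _ Fkx]]|nx] := pselect ((Q `&` \bigcup_k F k) x).
        apply: (@cvg_near_cst _ _ _ _ _ _).
        exists k => // j /= kj; rewrite !indicE !mem_set//; first by split => //; exists k.
        by split => //; exact: (ndF k).
      apply: (@cvg_near_cst _ _ _ _ _ _); apply: nearW => k.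
      by rewrite !indicE !memNset// => -[Qx Fx]; apply: nx; split => //; exists k.
  under eq_fun do rewrite h.
  by move=> /(cvg_lim (@norm_hausdorff _ _)) <-; rewrite lim_cst.
pose H := [set A : set 'rV[R]_n | measurable A /\ Int (fun x => G x * \1_(Q `&` A) x) = 0].
move=> A mA; suff : H A by case.
move: mA; rewrite measurable_boxes => mA.
apply: (@lambda_system_subset _ (@boxes R n) (@boxI_closed R n) setT H) => //; last first.
  move=> _ [[a b] _ <-] /=; split; first by apply: measurable_openrV; exact: open_box.
  exact: hG.
split => //.
- pose cube (k : nat) : set 'rV[R]_n := box (const_mx (- k%:R)) (const_mx k%:R).
  have cu : \bigcup_k cube k = setT.
    rewrite -subTset => x _; exists (Num.truncn `|x|).+1 => //; apply/boxP => i; rewrite !mxE -ltr_norml.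
    by apply: (le_lt_trans (coord_norm_le _ _)); exact: truncnS_gt.
  split; first exact: measurableT.
  rewrite -cu; apply: lim0.
  + by move=> k; apply: measurable_openrV; exact: open_box.
  + move=> i j ij x /boxP h; apply/boxP => l; have := h l; rewrite !mxE => /andP[h1 h2].
    have ij' : i%:R <= j%:R :> R by rewrite ler_nat.
    by apply/andP; split; lra.
  + by move=> k; exact: hG.
- move=> A' B BA [mA' hA'] [mB hB]; split; first exact: measurableD.
  rewrite -(subrr 0) -{1}hA' -hB -IntB; [|exact: iGA|exact: iGA].
  congr Int; apply/funext => x; rewrite -mulrBr; congr (_ * _).
  rewrite !indicE setDE !in_setI in_setC; case: (_ \in Q) => /=; last by rewrite subrr.
  have [xB|xB] := boolP (x \in B); last by rewrite andbT subr0.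
  by rewrite andbF mem_set ?subrr//; apply: BA; rewrite -inE.
- move=> F ndF hF; split; first by apply: bigcupT_measurable => k; case: (hF k).
  apply: lim0 => [k|i j ij|k]; [by case: (hF k)| |by case: (hF k)].
  by have := ndF i j ij; rewrite -subsetEset.
Qed.

(** Omega is the union of countably many rational cubes whose closures it contains. On each of them
    the integral of G over every measurable subset vanishes, hence G does almost everywhere. *)
Lemma ae_zero_test G : open Omega -> intg G ->
  (forall t K, compact K -> K `<=` Omega -> vanish K t -> Int (fun x => G x * eval t x) = 0) ->
  {ae leb, forall x, Omega x -> G x = 0}.
Proof.
move=> oO iG hG.
pose I := ('rV[rat]_n * nat)%type.
pose e (p : I) : R := p.2.+1%:R^-1.
pose lo (p : I) : 'rV[R]_n := map_mx ratr p.1 - const_mx (e p).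
pose hi (p : I) : 'rV[R]_n := map_mx ratr p.1 + const_mx (e p).
pose good (p : I) := cbox (lo p) (hi p) `<=` Omega.
have bad p : good p -> leb.-negligible [set x | box (lo p) (hi p) x /\ G x != 0].
  move=> gp; set Q := box (lo p) (hi p).
  have mQ : measurable Q by apply: measurable_openrV; exact: open_box.
  have H := @Int_setI_eq0 G Q iG mQ.
  have : ae_eq leb Q (EFin \o G) (cst 0%E).
    apply: integral_ae_eq => //.
      by apply: (integrableS measurableT) => //.
    move=> E EQ mE; rewrite integral_cst// mul0e.
    have <- : (Int (fun x => G x * \1_(Q `&` E) x))%:E = (\int[leb]_(x in E) (EFin \o G) x)%E.
      rewrite /Int /Rintegral fineK; last first.
        apply: integrable_fin_num => //.
        apply: (@intgM _ _ _ _ 1) => //; first by apply: measurable_indic; exact: measurableI.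
        by move=> x; rewrite indicE ger0_norm ?ler0n// lern1; case: (_ \in _).
      rewrite [in RHS]integral_mkcond; apply: eq_integral => x _.
      rewrite patchE indicE (setIidr EQ); case: (x \in E) => /=; by rewrite ?mulr1 ?mulr0.
    rewrite H// => a b.
    have [_ [[c d] _ <-] e'] : exists2 B, boxes B & B = Q `&` box a b.
      by exists (Q `&` box a b) => //; apply: boxI_closed; [exists (lo p, hi p)|exists (a, b)].
    rewrite -e' /=.
    have [cd|/existsNP[i /negP]] := pselect (forall i, c ord0 i < d ord0 i); last first.
      rewrite -leNgt => dc; rewrite [X in Int X](_ : _ = fun=> 0) ?Int0//; apply/funext => x.
      rewrite indicE memNset ?mulr0// => /boxP/(_ i)/andP[h1 h2].
      by have := lt_trans h1 h2; rewrite ltNge dc.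
    apply: Int_box_eq0 => //; apply: subset_trans gp => x hx i.
    have sub y : box c d y -> Q y by rewrite e' => -[].
    rewrite leNgt leNgt; apply/andP; split; apply/negP => hi'.
    (* If x lay below [lo] in the coordinate i, the open box would contain this point, whose i-th
       coordinate is at most that of [lo], although the box is part of [Q]. *)
    - pose y : 'rV[R]_n := \row_j (if j == i then Num.min ((lo p) ord0 i) ((c ord0 i + d ord0 i) / 2)  else (c ord0 j + d ord0 j) / 2).
      have /sub/boxP/(_ i) : box c d y.
        apply/boxP => j; rewrite !mxE; have := cd j; case: eqP => [->|_] cdj; last by apply/andP; split; lra.
        have := hx i => /andP[h1 h2].
        by rewrite lt_min gt_min; apply/andP; split; [apply/andP; split; [by have := le_lt_trans h1 hi'; rewrite !mxE|lra]|apply/orP; right; lra].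
      by rewrite !mxE eqxx lt_min ltxx.
    - pose y : 'rV[R]_n := \row_j (if j == i then Num.max ((hi p) ord0 i) ((c ord0 i + d ord0 i) / 2)  else (c ord0 j + d ord0 j) / 2).
      have /sub/boxP/(_ i) : box c d y.
        apply/boxP => j; rewrite !mxE; have := cd j; case: eqP => [->|_] cdj; last by apply/andP; split; lra.
        have := hx i => /andP[h1 h2].
        by rewrite lt_max gt_max; apply/andP; split; [apply/orP; right; lra|apply/andP; split; [by have := lt_le_trans hi' h2; rewrite !mxE|lra]].
      by rewrite !mxE eqxx gt_max ltxx andbF.
  apply: negligibleS => x /= [Qx Gx] /(_ Qx)/= [] /eqP; exact/negP.
have cov : [set x | ~ (Omega x -> G x = 0)] `<=` \bigcup_(p in good) [set x | box (lo p) (hi p) x /\ G x != 0].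
  move=> x /not_implyP[Ox /eqP Gx].
  have /nbhs_ballP[r /= r0 rO] : nbhs x Omega by exact: open_nbhs_nbhs.
  have [k _ /(_ k (leqnn k))/= kr] := near_infty_natSinv_lt (PosNum (divr_gt0 r0 (ltr0n _ 3))).
  have k0 : 0 < k.+1%:R^-1 :> R by rewrite invr_gt0.
  have [q qx] := rV_rat_dense x k0.
  have hq i : `|ratr (q ord0 i) - x ord0 i| < k.+1%:R^-1.
    by have := coord_norm_le (map_mx ratr q - x) i; rewrite !mxE => h; apply: le_lt_trans h qx.
  exists (q, k) => /=.
    move=> y hy; apply: rO; rewrite ball_rVE/=; apply: (@le_lt_trans _ _ (2 * k.+1%:R^-1)); last first.
      by move: kr => /=; move: (_^-1) => z; lra.
    apply: norm_le_coord => [|i]; first by rewrite mulr_ge0// ltW.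
    have := hy i; have := hq i; rewrite !mxE /e/= ltr_norml ler_norml; move: (_^-1) => z /andP[? ?] /andP[? ?].
    by apply/andP; split; lra.
  split => //; apply/boxP => i; have := hq i; rewrite !mxE /e/= ltr_norml; move: (_^-1) => z /andP[? ?].
  by apply/andP; split; lra.
apply: (negligibleS cov).
rewrite (_ : \bigcup_(p in good) _ = \bigcup_k \bigcup_(p in [set p | good p /\ pickle p = k]) [set x | box (lo p) (hi p) x /\ G x != 0]); last first.
  apply/seteqP; split => [x [p gp h]|x [k _ [p [gp _] h]]]; last by exists p.
  by exists (pickle p) => //; exists p.
apply: negligible_bigcup => k.
have [[p [gp pk]]|np] := pselect (exists p, good p /\ pickle p = k); last first.
  rewrite (_ : \bigcup_(p in _) _ = set0); first exact: negligible_set0.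
  by rewrite -subset0 => x [p hp _]; apply: np; exists p.
apply: negligibleS (bad p gp) => x [p' [_ p'k]].
by move: pk; rewrite -p'k => /(pcan_inj pickleK) ->.
Qed.
End fundamental_lemma.

(** * Sobolev functions and the first variation *)

Section variation.
Variables (R : realType) (n : nat).
Notation leb := (@lebesgue_rV R n).
Implicit Types (f g u : 'rV[R]_n -> R) (x v : 'rV[R]_n) (t : tm R n) (K : set 'rV[R]_n) (s : seq 'I_n).

Definition sqi f := measurable_fun setT f /\ intg (fun x => f x ^+ 2).

Lemma Lfun2P f : f \in Lfun leb 2%:E <-> sqi f.
Proof.
split => [lf|[mf lf]].
  split; last exact: Lfun2_integrable_sqr.
  by move: lf; rewrite inE => /andP[]; rewrite inE.
rewrite inE; apply/andP; split; rewrite inE//=.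
rewrite /finite_norm unlock poweR_lty//.
move/integrableP : lf => [_]; apply: le_lt_trans.
rewrite le_eqVlt; apply/orP; left; apply/eqP; apply: eq_integral => x _ /=.
by rewrite powR_mulrn// normrX.
Qed.

Lemma sqi_mul f g : sqi f -> sqi g -> intg (fun x => f x * g x).
Proof.
move=> [mf lf] [mg lg]; apply: (@intg_le _ _ _ (fun x => f x ^+ 2 + g x ^+ 2)).
- exact: measurable_funM.
- move=> x; rewrite normrM -(@real_normK _ (f x)) ?num_real// -(@real_normK _ (g x)) ?num_real//.
  have := sqr_ge0 (`|f x| - `|g x|); have := sqr_ge0 (`|f x|); have := sqr_ge0 (`|g x|).
  by rewrite !expr2; nra.
- exact: intgD.
Qed.

Lemma sqiD f g : sqi f -> sqi g -> sqi (fun x => f x + g x).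
Proof.
move=> hf hg; have := sqi_mul hf hg; move: hf hg => [mf lf] [mg lg] lfg.
split; first exact: measurable_funD.
rewrite (_ : (fun x => _) = (fun x => f x ^+ 2 + g x ^+ 2 + 2 * (f x * g x))); last first.
  by apply/funext => x; ring.
by apply: intgD; [exact: intgD|exact: intgZ].
Qed.

Lemma sqi_sum (I : Type) (r : seq I) (F : I -> 'rV[R]_n -> R) :
  (forall i, sqi (F i)) -> sqi (fun x => \sum_(i <- r) F i x).
Proof.
move=> h; elim: r => [|i r ih].
  rewrite (_ : (fun x => _) = cst 0); last by apply/funext => x; rewrite big_nil.
  split; first exact: measurable_cst.
  rewrite (_ : (fun x => _) = cst 0); last by apply/funext => x; rewrite expr0n.
  exact: integrable0.
rewrite (_ : (fun x => _) = (fun x => F i x + \sum_(j <- r) F j x)); last first.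
  by apply/funext => x; rewrite big_cons.
exact: sqiD.
Qed.

Lemma sqi_vanish K t : compact K -> vanish K t -> sqi (eval t).
Proof.
move=> cK Kt; split; first exact: measurable_eval.
apply: (intg_vanish (t := Mul t t) cK).
by apply: vanish_mull.
Qed.

Lemma Int_ae f g : measurable_fun setT f -> measurable_fun setT g ->
  {ae leb, forall x, f x = g x} -> Int f = Int g.
Proof.
move=> mf mg h; congr fine; apply: ae_eq_integral => //; [exact/measurable_EFinP|exact/measurable_EFinP|].
by apply: filterS h => x e _; rewrite e.
Qed.

Lemma Lnorm2_ae f g : measurable_fun setT f -> measurable_fun setT g ->
  {ae leb, forall x, f x = g x} -> ('N[leb]_2%:E [EFin \o f] = 'N[leb]_2%:E [EFin \o g])%E.
Proof.
move=> mf mg h; rewrite unlock.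
have m f' : measurable_fun setT f' -> measurable_fun setT (fun x => (`|(EFin \o f') x| `^ 2)%E).
  move=> mf'; apply/measurable_EFinP; apply: (measurableT_comp (measurable_powR _)) => //.
  exact: measurableT_comp.
suff -> : (\int[leb]_x `|(EFin \o f) x| `^ 2 = \int[leb]_x `|(EFin \o g) x| `^ 2)%E by [].
apply: ge0_ae_eq_integral; [exact: measurableT|exact: m|exact: m|..].
- by move=> x _; exact: poweR_ge0.
- by move=> x _; exact: poweR_ge0.
by apply: filterS h => x e _ /=; rewrite e.
Qed.

Variable Omega : set 'rV[R]_n.
Hypotheses (oO : open Omega) (bO : bounded_set Omega).

Let mO : measurable Omega. Proof. exact: measurable_openrV. Qed.

Let leb_Omega : (leb Omega < +oo)%E.
Proof.
have [M [_ hM]] := bO.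
apply: (@le_lt_trans _ _ (leb [set z | `|z - 0| < `|M| + 1 + 1])); last first.
  by rewrite leb_normball ?ltry// addr_gt0// ltr_wpDl.
apply: le_measure; rewrite ?inE//.
  by apply: measurable_openrV; exact: open_normball.
move=> z Kz /=; rewrite subr0; apply: (@le_lt_trans _ _ (`|M| + 1)); last by rewrite ltrDl.
by apply: hM => //; rewrite (le_lt_trans (ler_norm _))// ltrDl.
Qed.

Lemma restrE f : f \_ Omega = fun x => f x * \1_Omega x.
Proof. by apply/funext => x; rewrite patchE indicE; case: ifP => _; rewrite ?mulr1 ?mulr0. Qed.

Lemma Rint_restr f : \int[leb]_(x in Omega) f x = Int (f \_ Omega).
Proof. exact: Rintegral_mkcond. Qed.

Lemma sqi_intg f : sqi (f \_ Omega) -> intg (f \_ Omega).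
Proof.
move=> [mf lf]; apply: (@intg_le _ _ _ (fun x => \1_Omega x + (f \_ Omega) x ^+ 2)) => //.
- move=> x; rewrite restrE indicE; case: (x \in Omega) => /=; last first.
    by rewrite mulr0 normr0 expr0n addr0.
  rewrite mulr1 -(@real_normK _ (f x)) ?num_real//.
  by have := sqr_ge0 (`|f x| - 1); have := normr_ge0 (f x); rewrite !expr2; nra.
- by apply: intgD => //; exact: intg_indic.
Qed.

Lemma test_supp phi : test_function Omega phi ->
  exists K, [/\ compact K, K `<=` Omega, off K phi & smooth phi].
Proof.
move=> [sp [cK KO]]; exists (closure [set x | phi x != 0]); split => //.
move=> x nx; apply/eqP; apply: contra_notT nx => px; exact: subset_closure.
Qed.

Lemma term_test t K : compact K -> K `<=` Omega -> vanish K t -> test_function Omega (eval t).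
Proof.
move=> cK KO Kt; split; first exact: smooth_eval.
have clK : closed K by apply: compact_closed => //; exact: norm_hausdorff.
have sub : closure [set x | eval t x != 0] `<=` K.
  rewrite (closure_id K).1//; apply: closure_subset => x /= px.
  by apply: contrapT => /Kt e; rewrite e eqxx in px.
split; last exact: subset_trans sub KO.
by apply: subclosed_compact cK sub; exact: closed_closure.
Qed.

Lemma continuous_smooth s (phi : 'rV[R]_n -> R) : smooth phi -> continuous (iter_partial s phi).
Proof. by move=> /(_ s)[]. Qed.

Lemma off_iter K s phi : closed K -> off K phi -> off K (iter_partial s phi).
Proof. by move=> cK h; elim: s => //= i s ih; exact: off_derive. Qed.

Lemma restr_mul f g : (fun x => f x * g x) \_ Omega = fun x => (f \_ Omega) x * g x.
Proof. by apply/funext => x; rewrite !restrE mulrAC. Qed.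

Lemma weak_derivativeE s u g : weak_derivative Omega s u g <->
  forall phi, test_function Omega phi ->
   Int (fun x => (u \_ Omega) x * iter_partial s phi x) = (-1) ^+ size s * Int (fun x => (g \_ Omega) x * phi x).
Proof.
by split => h phi tp; have := h phi tp; rewrite !Rint_restr !restr_mul.
Qed.

Lemma intg_test (f phi : 'rV[R]_n -> R) s : intg f -> test_function Omega phi -> intg (fun x => f x * iter_partial s phi x).
Proof.
move=> hf /test_supp[K [cK KO Kp sp]].
have clK : closed K by apply: compact_closed => //; exact: norm_hausdorff.
have [C C0 hC] := bounded_off cK (@continuous_smooth s _ sp) (off_iter s clK Kp).
apply: (intgM hf _ hC); apply: continuous_measurable_rVR; exact: continuous_smooth.
Qed.

Lemma weak_derivative_unique s u g1 g2 : L2 Omega g1 -> L2 Omega g2 ->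
  weak_derivative Omega s u g1 -> weak_derivative Omega s u g2 ->
  {ae leb, forall x, Omega x -> g1 x = g2 x}.
Proof.
move=> /Lfun2P/sqi_intg l1 /Lfun2P/sqi_intg l2 /weak_derivativeE w1 /weak_derivativeE w2.
have := @ae_zero_test R n Omega (fun x => (g1 \_ Omega) x - (g2 \_ Omega) x) oO (intgB l1 l2).
move=> H; have {}H := H _.
have /H : forall t K, compact K -> K `<=` Omega -> vanish K t ->
    Int (fun x => ((g1 \_ Omega) x - (g2 \_ Omega) x) * eval t x) = 0.
  move=> t K cK KO Kt; have tt := term_test cK KO Kt.
  have := w1 _ tt; have s0 : (-1) ^+ size s != 0 :> R by rewrite signr_eq0.
  rewrite (w2 _ tt) => /(mulfI s0) e.
  rewrite (_ : (fun x => _) = (fun x => (g1 \_ Omega) x * eval t x - (g2 \_ Omega) x * eval t x)); last first.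
    by apply/funext => x; rewrite mulrBl.
  rewrite IntB; [by rewrite e subrr|exact: (@intg_test _ _ [::])|exact: (@intg_test _ _ [::])].
apply: filterS => x h Ox; have := h Ox; rewrite !restrE indicE mem_set// !mulr1.
by move=> /eqP; rewrite subr_eq0 => /eqP.
Qed.

Lemma eval_foldr_der t s i : eval (foldr (@der R n) (der i t) s) = eval (der i (foldr (@der R n) t s)).
Proof.
elim: s => //= j s ih; rewrite derC; exact: der_eq.
Qed.

(** The weak derivatives of a term are its formal ones. The test function is smooth but not a term,
    so the integration by parts pairs the two kinds of functions. *)
Lemma term_weak_derivative t s phi : test_function Omega phi ->
  Int (fun x => eval t x * iter_partial s phi x) =
  (-1) ^+ size s * Int (fun x => eval (foldr (@der R n) t s) x * phi x).
Proof.
move=> /test_supp[K [cK KO Kp sp]].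
have clK : closed K by apply: compact_closed => //; exact: norm_hausdorff.
elim: s t => [|i s ih] t /=; first by rewrite mul1r.
rewrite (@Int_by_parts R n K (eval t) (iter_partial s phi) i cK); first last.
- by right; exact: off_iter.
- exact: C1dir_smooth.
- exact: C1dir_eval.
rewrite (_ : (fun x => 'D_(delta_mx ord0 i) (eval t) x * _) = (fun x => eval (der i t) x * iter_partial s phi x)); last first.
  by apply/funext => x; rewrite derive_evalE.
by rewrite ih exprS mulN1r mulNr eval_foldr_der.
Qed.

Lemma weak_derivative_add s u g t K : L2 Omega u -> L2 Omega g -> compact K -> K `<=` Omega -> vanish K t ->
  weak_derivative Omega s u g ->
  weak_derivative Omega s (fun x => u x + eval t x) (fun x => g x + eval (foldr (@der R n) t s) x).
Proof.
move=> /Lfun2P/sqi_intg lu /Lfun2P/sqi_intg lg cK KO Kt /weak_derivativeE w.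
have clK : closed K by apply: compact_closed => //; exact: norm_hausdorff.
have Ks : vanish K (foldr (@der R n) t s).
  by elim: s {w} => //= i s ih; exact: vanish_der.
have R1 f t' : vanish K t' -> (fun x => f x + eval t' x) \_ Omega = fun x => (f \_ Omega) x + eval t' x.
  move=> Kt'; apply/funext => x; rewrite !restrE indicE.
  have [Ox|Ox] := pselect (Omega x); first by rewrite mem_set// !mulr1.
  by rewrite memNset// (Kt' x) ?mulr0 ?addr0// => /KO.
apply/weak_derivativeE => phi tp; rewrite !R1//.
have D f g' h : (fun x => (f x + g' x) * h x) = (fun x : 'rV[R]_n => f x * h x + g' x * h x) :> (_ -> R).
  by apply/funext => x; rewrite mulrDl.
rewrite !D !IntD; first last.
- by apply: (@intg_test _ _ s) => //; exact: intg_vanish Kt.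
- exact: intg_test.
- by apply: (@intg_test _ _ [::]) => //; exact: intg_vanish Ks.
- exact: (@intg_test _ _ [::]).
by rewrite w// term_weak_derivative// mulrDr.
Qed.

Lemma wderivP s u : (exists g, L2 Omega g /\ weak_derivative Omega s u g) ->
  L2 Omega (wderiv Omega s u) /\ weak_derivative Omega s u (wderiv Omega s u).
Proof. by move=> h; exact: (xgetPex (cst 0) h). Qed.

Lemma L2_add_term u t K : compact K -> K `<=` Omega -> vanish K t -> L2 Omega u -> L2 Omega (fun x => u x + eval t x).
Proof.
move=> cK KO Kt /Lfun2P lu; apply/Lfun2P.
have -> : (fun x => u x + eval t x) \_ Omega = fun x => (u \_ Omega) x + eval t x.
  apply/funext => x; rewrite !restrE indicE.
  have [Ox|Ox] := pselect (Omega x); first by rewrite mem_set// !mulr1.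
  by rewrite memNset// (Kt x) ?mulr0 ?addr0// => /KO.
by apply: sqiD => //; exact: sqi_vanish Kt.
Qed.

Lemma vanish_foldr K t s : closed K -> vanish K t -> vanish K (foldr (@der R n) t s).
Proof. by move=> cK Kt; elim: s => //= i s ih; exact: vanish_der. Qed.

Lemma sobolev_add k u t K : compact K -> K `<=` Omega -> vanish K t ->
  sobolev Omega k u -> sobolev Omega k (fun x => u x + eval t x).
Proof.
move=> cK KO Kt [lu hu]; split; first exact: L2_add_term Kt lu.
have clK : closed K by apply: compact_closed => //; exact: norm_hausdorff.
move=> s sk; have [g [lg wg]] := hu s sk.
exists (fun x => g x + eval (foldr (@der R n) t s) x); split; last exact: weak_derivative_add Kt _.
by apply: (L2_add_term cK KO _ lg); exact: vanish_foldr.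
Qed.

Lemma wderiv_add k u t K s : compact K -> K `<=` Omega -> vanish K t ->
  sobolev Omega k u -> (size s <= k)%N ->
  {ae leb, forall x, Omega x -> wderiv Omega s (fun x => u x + eval t x) x =
    wderiv Omega s u x + eval (foldr (@der R n) t s) x}.
Proof.
move=> cK KO Kt su sk; have [l1 w1] := wderivP ((sobolev_add cK KO Kt su).2 s sk).
have [l2 w2] := wderivP (su.2 s sk).
have clK : closed K by apply: compact_closed => //; exact: norm_hausdorff.
apply: (weak_derivative_unique l1 _ w1 (weak_derivative_add su.1 l2 cK KO Kt w2)).
by apply: (L2_add_term cK KO _ l2); exact: vanish_foldr.
Qed.

Lemma iter_partial_add s phi t : smooth phi ->
  iter_partial s (fun x => phi x + eval t x) = fun x => iter_partial s phi x + eval (foldr (@der R n) t s) x.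
Proof.
move=> sp; elim: s => //= i s ih; rewrite ih; apply/funext => x.
have [_ dp] := sp s.
have D := @is_deriveD _ _ _ (iter_partial s phi) (eval (foldr (@der R n) t s)) x (delta_mx ord0 i) _ _
  (DeriveDef (dp i x) erefl) (is_derive_eval _ x _).
have [_] := D; rewrite [X in 'D_ _ X _ = _](_ : _ = fun x => iter_partial s phi x + eval (foldr (@der R n) t s) x)//.
move=> ->; congr (_ + _).
have [_ <-] := is_derive_eval (foldr (@der R n) t s) x (delta_mx ord0 i).
by rewrite derive_evalE.
Qed.

Lemma test_add phi t K : compact K -> K `<=` Omega -> vanish K t -> test_function Omega phi ->
  test_function Omega (fun x => phi x + eval t x).
Proof.
move=> cK KO Kt tp; have [sp [cp pO]] := tp; split.
  move=> s; rewrite iter_partial_add//; split.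
    by apply: cts_add; [exact: continuous_smooth|exact: continuous_eval].
  move=> i x; have [_ dp] := sp s.
  have [] := @is_deriveD _ _ _ (iter_partial s phi) (eval (foldr (@der R n) t s)) x (delta_mx ord0 i) _ _
    (DeriveDef (dp i x) erefl) (is_derive_eval _ x _).
  by [].
have clK : closed K by apply: compact_closed => //; exact: norm_hausdorff.
have sub : closure [set x | phi x + eval t x != 0] `<=` closure [set x | phi x != 0] `|` K.
  have cl : closed (closure [set x | phi x != 0] `|` K) by apply: closedU => //; exact: closed_closure.
  rewrite [X in _ `<=` X](closure_id _).1//; apply: closure_subset => x /= px.
  have [p0|p0] := eqVneq (phi x) 0; last by left; exact: subset_closure.
  by right; apply: contrapT => /Kt e; rewrite p0 e addr0 eqxx in px.
split; last by apply: subset_trans sub _ => x [/pO|/KO].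
apply: subclosed_compact sub; first exact: closed_closure.
exact: compactU.
Qed.

Lemma measurable_L2 f : L2 Omega f -> measurable_fun setT (f \_ Omega).
Proof. by move=> /Lfun2P[]. Qed.

Lemma measurable_restr_cont f : continuous f -> measurable_fun setT (f \_ Omega).
Proof.
move=> cf; rewrite restrE; apply: measurable_funM; first exact: continuous_measurable_rVR.
exact: measurable_indic.
Qed.

(** Adding the term to each approximating test function leaves all the L^2 errors unchanged. *)
Lemma sobolev0_add k w t K : compact K -> K `<=` Omega -> vanish K t ->
  sobolev0 Omega k w -> sobolev0 Omega k (fun x => w x + eval t x).
Proof.
move=> cK KO Kt [sw [phi [tphi hphi]]]; split; first exact: sobolev_add Kt sw.
exists (fun j x => phi j x + eval t x); split; first by move=> j; exact: test_add Kt (tphi j).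
move=> s sk; have := hphi s sk; apply: cvg_trans; apply: near_eq_cvg; apply: nearW => j.
have [l1 _] := wderivP ((sobolev_add cK KO Kt sw).2 s sk).
have [l2 _] := wderivP (sw.2 s sk).
have cp := @continuous_smooth s _ (tphi j).1.
have rB f g : (f \- g) \_ Omega = (fun x => (f \_ Omega) x - (g \_ Omega) x).
  by apply/funext => x; rewrite !restrE /= mulrBl.
apply: Lnorm2_ae.
- rewrite rB; apply: measurable_funB; first exact: measurable_L2.
  exact: measurable_restr_cont.
- rewrite rB; apply: measurable_funB; first exact: measurable_L2.
  by rewrite iter_partial_add; [|exact: (tphi j).1]; apply: measurable_restr_cont; apply: cts_add => //; exact: continuous_eval.
have := wderiv_add cK KO Kt sw sk; apply: filterS => x h.
rewrite !restrE indicE /=; have [Ox|Ox] := pselect (Omega x); last by rewrite memNset// !mulr0.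
rewrite mem_set// !mulr1 iter_partial_add; last exact: (tphi j).1.
by rewrite h// opprD addrACA subrr addr0.
Qed.

Lemma admissible_add u0 u t K : compact K -> K `<=` Omega -> vanish K t ->
  admissible Omega u0 u -> admissible Omega u0 (fun x => u x + eval t x).
Proof.
move=> cK KO Kt [su s0]; split; first exact: sobolev_add Kt su.
rewrite (_ : _ \- u0 = fun x => (u \- u0) x + eval t x); first exact: sobolev0_add Kt s0.
by apply/funext => x /=; rewrite addrAC.
Qed.

Lemma laplacian_L2 u : sobolev Omega 2 u -> sqi (laplacian Omega u \_ Omega).
Proof.
move=> su.
rewrite (_ : _ \_ _ = fun x => \sum_(i <- index_enum 'I_n) (wderiv Omega [:: i; i] u \_ Omega) x); last first.
  by apply/funext => x; rewrite restrE /laplacian mulr_suml; apply: eq_bigr => i _; rewrite restrE.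
apply: sqi_sum => i; apply/Lfun2P; have [] // := wderivP (su.2 [:: i; i] _).
Qed.

Lemma positive_setE u : Defs.positive_set Omega u = [set x | 0 < (u \_ Omega) x].
Proof.
apply/seteqP; split => [x [Ox ux] /=|x /=].
  by rewrite restrE indicE mem_set// mulr1.
rewrite restrE indicE; have [Ox|Ox] := pselect (Omega x); first by rewrite mem_set// mulr1.
by rewrite memNset// mulr0 ltxx.
Qed.

Lemma measurable_positive_set u : L2 Omega u -> measurable (Defs.positive_set Omega u).
Proof.
move=> /measurable_L2 mu; rewrite positive_setE -[X in measurable X]setTI.
rewrite (_ : [set x | _] = (u \_ Omega) @^-1` `]0, +oo[%classic); last first.
  by apply/seteqP; split => x /=; rewrite in_itv/= andbT.
by apply: mu => //; exact: measurable_itv.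
Qed.

Lemma leb_positive_set u : L2 Omega u -> (leb (Defs.positive_set Omega u) < +oo)%E.
Proof.
move=> lu; apply: le_lt_trans leb_Omega; apply: le_measure; rewrite ?inE//.
  exact: measurable_positive_set.
by move=> x [].
Qed.

Lemma energyE u : sobolev Omega 2 u ->
  energy Omega u = (Int (fun x => (laplacian Omega u \_ Omega) x ^+ 2) + fine (leb (Defs.positive_set Omega u)))%:E.
Proof.
move=> su; have [ml il] := laplacian_L2 su.
have mp := measurable_positive_set su.1.
have ip := intg_indic mp (leb_positive_set su.1).
rewrite -(Int_indic mp) -IntD// /energy.
rewrite /Int /Rintegral fineK; last by apply: integrable_fin_num => //; exact: intgD.
rewrite [LHS]integral_mkcond; apply: eq_integral => x _.
rewrite !patchE; case: ifPn => Ox //.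
rewrite indicE memNset; first by rewrite addr0 expr0n.
by move=> [/mem_set Ox' _]; rewrite Ox' in Ox.
Qed.

Lemma laplacian_add u t K : compact K -> K `<=` Omega -> vanish K t -> sobolev Omega 2 u ->
  {ae leb, forall x, Omega x -> laplacian Omega (fun x => u x + eval t x) x =
     laplacian Omega u x + eval (lap t) x}.
Proof.
move=> cK KO Kt su.
have H i : {ae leb, forall x, Omega x -> wderiv Omega [:: i; i] (fun x => u x + eval t x) x =
     wderiv Omega [:: i; i] u x + eval (der i (der i t)) x}.
  exact: (@wderiv_add 2 u t K [:: i; i]).
have : {ae leb, forall x, forall i, Omega x -> wderiv Omega [:: i; i] (fun x => u x + eval t x) x =
     wderiv Omega [:: i; i] u x + eval (der i (der i t)) x}.
  exact: filter_forall H.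
apply: filterS => x h Ox; rewrite /laplacian eval_lap -big_split/=.
by apply: eq_bigr => i _; exact: h.
Qed.

(* First variation of the energy along compactly supported perturbations. *)
Lemma minimizer_ineq u0 u t K : minimizer Omega u0 u -> compact K -> K `<=` Omega -> vanish K t ->
  0 <= 2 * Int (fun x => (u \_ Omega) x * eval (lap (lap t)) x) + Int (fun x => eval (lap t) x ^+ 2) +
       (fine (leb (Defs.positive_set Omega (fun x => u x + eval t x))) - fine (leb (Defs.positive_set Omega u))).
Proof.
move=> [au mu] cK KO Kt; have := mu _ (admissible_add cK KO Kt au).
have [su _] := au; have sv := sobolev_add cK KO Kt su.
have clK : closed K by apply: compact_closed => //; exact: norm_hausdorff.
rewrite !energyE// lee_fin.
have Kl := vanish_lap clK Kt; have Kll := vanish_lap clK Kl.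
set L := laplacian Omega u \_ Omega.
have sL : sqi L := laplacian_L2 su.
have sl := sqi_vanish cK Kl.
have -> : Int (fun x => (laplacian Omega (fun x => u x + eval t x) \_ Omega) x ^+ 2) =
    Int (fun x => (L x + eval (lap t) x) ^+ 2).
  apply: Int_ae.
  - by apply: measurable_funX; exact: (laplacian_L2 sv).1.
  - apply: measurable_funX; apply: measurable_funD; [exact: sL.1|exact: sl.1].
  have := laplacian_add cK KO Kt su; apply: filterS => x h.
  congr (_ ^+ 2); rewrite /L !restrE indicE; have [Ox|Ox] := pselect (Omega x).
    by rewrite mem_set// !mulr1 h.
  by rewrite memNset// !mulr0 add0r Kl// => /KO.
have -> : Int (fun x => (L x + eval (lap t) x) ^+ 2) =
    Int (fun x => L x ^+ 2) + 2 * Int (fun x => L x * eval (lap t) x) + Int (fun x => eval (lap t) x ^+ 2).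
  have i1 := sqi_mul sL sl; have [_ i2] := sL; have [_ i3] := sl.
  rewrite -IntZ// -IntD//; last exact: intgZ.
  rewrite -IntD//; last by apply: intgD => //; exact: intgZ.
  by congr Int; apply/funext => x; ring.
(* The Laplacian of u in the cross term is moved onto the perturbation. From here on u enters only
   through its values. *)
have -> : Int (fun x => L x * eval (lap t) x) = Int (fun x => (u \_ Omega) x * eval (lap (lap t)) x).
  have iu : intg (u \_ Omega) by apply: sqi_intg; apply/Lfun2P; exact: su.1.
  have tl := term_test cK KO Kl.
  have w i : L2 Omega (wderiv Omega [:: i; i] u) /\ weak_derivative Omega [:: i; i] u (wderiv Omega [:: i; i] u).
    by apply: wderivP; exact: su.2.
  have iw i : intg (fun x => (wderiv Omega [:: i; i] u \_ Omega) x * eval (lap t) x).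
    apply: (@intg_test _ _ [::]) => //; apply: sqi_intg; apply/Lfun2P; exact: (w i).1.
  have id i : intg (fun x => (u \_ Omega) x * eval (der i (der i (lap t))) x).
    by have := intg_test [:: i; i] iu tl; rewrite iter_partial_eval.
  transitivity (\sum_i Int (fun x => (wderiv Omega [:: i; i] u \_ Omega) x * eval (lap t) x)).
    rewrite -Int_sum//; congr Int; apply/funext => x.
    by rewrite /L restrE /laplacian !mulr_suml; apply: eq_bigr => i _; rewrite restrE.
  transitivity (\sum_i Int (fun x => (u \_ Omega) x * eval (der i (der i (lap t))) x)).
    apply: eq_bigr => i _; have [_ /weak_derivativeE/(_ _ tl)] := w i.
    by rewrite iter_partial_eval /= sqrrN expr1n mul1r => ->.
  rewrite -Int_sum//; congr Int; apply/funext => x.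
  by rewrite eval_lap mulr_sumr.
lra.
Qed.
End variation.

(** * Dilations *)

Section scaling.
Variables (R : realType) (n : nat).
Notation leb := (@lebesgue_rV R n).
Implicit Types (f U : 'rV[R]_n -> R) (x y v : 'rV[R]_n) (t : tm R n) (s r : R).

Lemma measurable_dilate s : measurable_fun setT (fun x : 'rV[R]_n => s *: x).
Proof.
by apply: continuous_measurable_rV => x; apply: scaler_continuous.
Qed.

Lemma leb_dilate s A : 0 < s -> measurable A ->
  leb ((fun x => s *: x) @^-1` A) = ((s ^- n)%:E * leb A)%E.
Proof.
move=> s0 mA; have sn : 0 < s ^+ n by exact: exprn_gt0.
pose m : {measure set 'rV[R]_n -> \bar R} :=
  mscale (NngNum (ltW sn)) (measure_function_pushforward__canonical__measure_function_Measure leb (measurable_dilate s)).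
have mE B : m B = ((s ^+ n)%:E * leb ((fun x => s *: x) @^-1` B))%E by [].
have := @leb_unique R n m _ A mA; rewrite mE => <-.
  by rewrite muleA -EFinM mulVf ?gt_eqF// mul1e.
move=> a b; rewrite mE.
have -> : (fun x => s *: x) @^-1` box a b = box (s^-1 *: a) (s^-1 *: b).
  apply/seteqP; split => x /boxP h; apply/boxP => i; have := h i; rewrite !mxE.
    by rewrite ltr_pdivrMl// ltr_pdivlMl.
  by rewrite ltr_pdivrMl// ltr_pdivlMl.
have [ab|/existsNP[i /negP]] := pselect (forall i, a ord0 i <= b ord0 i).
  rewrite !leb_box//; last by move=> i; rewrite !mxE ler_pM2l// invr_gt0.
  rewrite -EFinM; congr EFin; under eq_bigr do rewrite !mxE -mulrBr.
  by rewrite big_split/= prodr_const card_ord exprVn mulrA mulfV ?gt_eqF// mul1r.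
rewrite -ltNge => ba.
have e0 (a' b' : 'rV[R]_n) : b' ord0 i < a' ord0 i -> box a' b' = set0.
  move=> ba'; apply/seteqP; split => // x /boxP/(_ i) /andP[h1 h2].
  by have := lt_trans h1 h2; rewrite ltNge (ltW ba').
by rewrite !e0 ?measure0 ?mule0// !mxE ltr_pM2l// invr_gt0.
Qed.

Lemma Int_dilate f s : 0 < s -> intg f -> Int (fun x => f (s *: x)) = s ^- n * Int f.
Proof.
move=> s0 hf.
have sn : 0 < s ^- n by rewrite invr_gt0 exprn_gt0.
have mv := measurable_dilate s.
pose p : {measure set 'rV[R]_n -> \bar R} :=
  measure_function_pushforward__canonical__measure_function_Measure leb mv.
pose m : {measure set 'rV[R]_n -> \bar R} := mscale (NngNum (ltW sn)) leb.
have e A : measurable A -> A `<=` setT -> p A = m A.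
  by move=> mA _; rewrite /p /m /= /pushforward leb_dilate.
have mE := intg_measurable hf.
have ip g : measurable_fun setT g -> (forall x, 0 <= g x)%E ->
    (\int[p]_x g x = (s ^- n)%:E * \int[leb]_x g x)%E.
  move=> mg g0; rewrite (eq_measure_integral m) => [|A mA At]; last exact: e.
  by rewrite ge0_integral_mscale.
have im : p.-integrable setT (EFin \o f).
  apply/integrableP; split; first exact/measurable_EFinP.
  rewrite ip//; last by apply: measurableT_comp => //; exact/measurable_EFinP.
  by apply: lte_mul_pinfty; rewrite ?lee_fin ?ltW//; have /integrableP[] := hf.
rewrite /Int /Rintegral -[X in X * _]/(fine (s ^- n)%:E) -fineM//; last first.
  by apply: integrable_fin_num.
congr fine; transitivity (\int[p]_x (f x)%:E)%E; last first.
  rewrite (integralE p) (integralE leb) (ip (funepos _))//; first rewrite (ip (funeneg _))//.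
  - apply/esym/muleBr => //; apply: (fin_num_adde_defr _ (integrable_pos_fin_num measurableT hf)).
  - by apply: measurable_funeneg; exact/measurable_EFinP.
  - by apply: measurable_funepos; exact/measurable_EFinP.
have := @integral_pushforward _ _ _ _ _ _ mv leb setT (EFin \o f).
rewrite preimage_setT => -> //.
  exact/measurable_EFinP.
have := @ge0_integral_pushforward _ _ _ _ _ _ mv leb setT (fun x => `|(f x)%:E|%E).
rewrite preimage_setT => H; apply/integrableP; split.
  by apply/measurable_EFinP; apply: (measurableT_comp mE).
rewrite -H//; first by have /integrableP[] := im.
by apply: measurableT_comp => //; exact/measurable_EFinP.
Qed.
End scaling.

(** * Mean value and Taylor estimates *)

Section mean_value.
Variable R : realType.
Implicit Types (f df : R -> R) (a b C : R).

Lemma mvt_eq f df a b : a < b -> (forall s, a <= s <= b -> is_derive s 1 f (df s)) ->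
  exists2 c, a < c < b & f b - f a = df c * (b - a).
Proof.
move=> ab hf; have [] := @MVT R f df a b ab.
- by move=> x; rewrite in_itv/= => /andP[/ltW h1 /ltW h2]; apply: hf; rewrite h1.
- apply: derivable_within_continuous => x; rewrite in_itv/= => xab.
  by have [] := hf x xab.
by move=> c; rewrite in_itv/= => h e; exists c.
Qed.

Lemma mvt_abs f df a b C : a <= b -> (forall s, a <= s <= b -> is_derive s 1 f (df s)) ->
  (forall s, a <= s <= b -> `|df s| <= C) -> `|f b - f a| <= C * (b - a).
Proof.
rewrite le_eqVlt => /predU1P[-> _ _|ab hf hC]; first by rewrite !subrr normr0 mulr0.
have [c /andP[h1 h2] ->] := mvt_eq ab hf.
have ba : 0 <= b - a by rewrite subr_ge0 ltW.
by rewrite normrM (ger0_norm ba); apply: ler_wpM2r => //; apply: hC; rewrite !ltW.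
Qed.

Lemma mvt_ge f df a b C : a <= b -> (forall s, a <= s <= b -> is_derive s 1 f (df s)) ->
  (forall s, a <= s <= b -> C <= df s) -> C * (b - a) <= f b - f a.
Proof.
rewrite le_eqVlt => /predU1P[-> _ _|ab hf hC]; first by rewrite !subrr mulr0.
have [c /andP[h1 h2] ->] := mvt_eq ab hf.
by apply: ler_wpM2r; [rewrite subr_ge0 ltW|apply: hC; rewrite !ltW].
Qed.

Lemma mvt_le f df a b C : a <= b -> (forall s, a <= s <= b -> is_derive s 1 f (df s)) ->
  (forall s, a <= s <= b -> df s <= C) -> f b - f a <= C * (b - a).
Proof.
rewrite le_eqVlt => /predU1P[-> _ _|ab hf hC]; first by rewrite !subrr mulr0.
have [c /andP[h1 h2] ->] := mvt_eq ab hf.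
by apply: ler_wpM2r; [rewrite subr_ge0 ltW|apply: hC; rewrite !ltW].
Qed.

Lemma taylor2 (f f1 f2 f3 : R -> R) C :
  (forall s : R, 0 <= s <= 1 -> is_derive s 1 f (f1 s)) ->
  (forall s : R, 0 <= s <= 1 -> is_derive s 1 f1 (f2 s)) ->
  (forall s : R, 0 <= s <= 1 -> is_derive s 1 f2 (f3 s)) ->
  (forall s : R, 0 <= s <= 1 -> `|f3 s| <= C) ->
  `|f 1 - f 0 - f1 0 - f2 0 / 2| <= C.
Proof.
move=> h1 h2 h3 hC.
have C0 : 0 <= C by apply: le_trans (hC 0 _); rewrite ?lexx ?ler01.
have b2 s : 0 <= s <= 1 -> `|f2 s - f2 0| <= C.
  move=> /andP[s0 s1]; apply: (@le_trans _ _ (C * (s - 0))); last by rewrite subr0 ler_piMr.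
  apply: (mvt_abs s0) => t /andP[t0 ts]; [apply: h3|apply: hC]; rewrite t0 (le_trans ts)//.
have b1 s : 0 <= s <= 1 -> `|f1 s - f1 0 - s * f2 0| <= C.
  move=> /andP[s0 s1].
  have := @mvt_abs (fun t => f1 t - t * f2 0) (fun t => f2 t - f2 0) 0 s C s0.
  rewrite mul0r !subr0 => H.
  apply: (@le_trans _ _ (C * s)); last by rewrite ler_piMr.
  rewrite addrAC; apply: H => t /andP[t0 ts]; last by apply: b2; rewrite t0 (le_trans ts).
  apply: is_derive1_add; first by apply: h2; rewrite t0 (le_trans ts).
  by apply: is_derive1_opp; apply: is_derive1_eq (is_derive1_mul (is_derive1_id t) (is_derive1_cst (f2 0) t)) _; rewrite mul1r mulr0 addr0.
have := @mvt_abs (fun t => f t - t * f1 0 - t ^+ 2 * (f2 0 / 2)) (fun t => f1 t - f1 0 - t * f2 0) 0 1 C ler01.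
rewrite !mul0r !mul1r expr1n expr0n/= mul1r mul0r !subr0 mulr1 => H.
have -> : f 1 - f 0 - f1 0 - f2 0 / 2 = f 1 - f1 0 - f2 0 / 2 - f 0 by ring.
apply: H => t t01; last exact: b1.
apply: is_derive1_add; first apply: is_derive1_add; first exact: h1.
  by apply: is_derive1_opp; apply: is_derive1_eq (is_derive1_mul (is_derive1_id t) (is_derive1_cst (f1 0) t)) _; rewrite mul1r mulr0 addr0.
apply: is_derive1_opp; apply: is_derive1_eq (is_derive1_mul (is_derive1_exp 2 (is_derive1_id t)) (is_derive1_cst (f2 0 / 2) t)) _.
by rewrite /= expr1; field.
Qed.
End mean_value.

(** * Mollification kernels and their scale derivative *)

Section kernels.
Variables (R : realType) (n : nat).
Notation leb := (@lebesgue_rV R n).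
Implicit Types (f U V : 'rV[R]_n -> R) (x y v : 'rV[R]_n) (t phi : tm R n) (s r : R).

Notation unitball := (cball (0 : 'rV[R]_n) 1).

Lemma leb_cball_le y r : 0 < r -> (fine (leb (cball y r)) <= (4 * r) ^+ n).
Proof.
move=> r0; have r20 : 0 < 2 * r by rewrite mulr_gt0.
have cc := @compact_cball R n y r.
have -> : (4 * r) ^+ n = fine (leb [set z | `|z - y| < 2 * r]).
  by rewrite leb_normball//= mulrA -natrM.
apply: fine_le.
- by rewrite ge0_fin_numE//; exact: leb_compact.
- by rewrite leb_normball.
apply: le_measure; rewrite ?inE; [exact: compact_measurable|apply: measurable_openrV; exact: open_normball|].
move=> z /(cball_norm (ltW r0)) h /=; apply: le_lt_trans h _; lra.
Qed.

Lemma sqn_sub_scale y s z : 0 < s -> sqn (s^-1 *: (z - y)) = sqn (z - y) / s ^+ 2.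
Proof. by move=> s0; rewrite sqnZ exprVn mulrC. Qed.

Lemma in_unitball y s z : 0 < s -> unitball (s^-1 *: (z - y)) <-> cball y s z.
Proof.
by move=> s0; rewrite /cball/= subr0 sqn_sub_scale// expr1n ler_pdivrMr ?exprn_gt0// mul1r.
Qed.

Lemma vanish_rescale y s t : 0 < s -> vanish unitball t -> vanish (cball y s) (rescale y s t).
Proof. by move=> s0 h z nz; rewrite eval_rescale h//; rewrite in_unitball. Qed.

(** Not normalised: the mollification of U is - s ^- n * convol U eta y s / c0, as the integral of
    [eta] is - c0. *)
Definition convol U t y s : R := Int (fun z => U z * eval t (s^-1 *: (z - y))).

Lemma measurable_convol t y s : measurable_fun setT (fun z : 'rV[R]_n => eval t (s^-1 *: (z - y))).
Proof.
rewrite (_ : (fun z => _) = eval (rescale y s t)); first exact: measurable_eval.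
by apply/funext => z; rewrite eval_rescale.
Qed.

Lemma intg_convol U t y s : intg U -> vanish unitball t -> intg (fun z => U z * eval t (s^-1 *: (z - y))).
Proof.
move=> iU vt; have [C C0 hC] := bounded_vanish (@compact_cball _ _ _ _) vt.
by apply: (intgM iU (measurable_convol t y s)) => x; exact: hC.
Qed.

Lemma convol_add U t t' y s : intg U -> vanish unitball t -> vanish unitball t' ->
  convol U (Add t t') y s = convol U t y s + convol U t' y s.
Proof.
move=> iU h h'; rewrite /convol -IntD; [|exact: intg_convol|exact: intg_convol].
by congr Int; apply/funext => z /=; rewrite mulrDr.
Qed.

Lemma convol_scale U t c y s : intg U -> vanish unitball t ->
  convol U (Mul (Cst n c) t) y s = c * convol U t y s.
Proof.
move=> iU h; rewrite /convol -IntZ; last exact: intg_convol.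
by congr Int; apply/funext => z /=; rewrite mulrCA.
Qed.

Lemma convol_eq U t t' y s : eval t = eval t' -> convol U t y s = convol U t' y s.
Proof. by rewrite /convol => ->. Qed.

Lemma convol_tsum U (F : 'I_n -> tm R n) y s : intg U -> (forall i, vanish unitball (F i)) ->
  convol U (tsum F) y s = \sum_i convol U (F i) y s.
Proof.
move=> iU h; rewrite /convol -Int_sum; last by move=> i; exact: intg_convol.
by congr Int; apply/funext => z /=; rewrite eval_tsum mulr_sumr.
Qed.

Lemma convol_bound t : vanish unitball t -> exists2 A : R, 0 < A &
  forall U y s (e : R), 0 < s -> intg U -> 0 <= e -> (forall z, cball y s z -> `|U z| <= e) ->
    `|convol U t y s| <= A * e * s ^+ n.
Proof.
move=> vt; have [C C0 hC] := bounded_vanish (@compact_cball _ _ _ _) vt.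
exists (C * 4 ^+ n) => [|U y s e s0 iU e0 hU]; first by rewrite mulr_gt0// exprn_gt0.
have cc := @compact_cball R n y s.
have := @Int_bound _ _ (fun z => U z * eval t (s^-1 *: (z - y))) (cball y s) (e * C)
  (compact_measurable cc) (leb_compact cc).
case.
- by apply: measurable_funM; [exact: intg_measurable|exact: measurable_convol].
- move=> z; rewrite indicE; have [cz|cz] := pselect (cball y s z).
    by rewrite mem_set// mulr1 normrM ler_pM// hU.
  by rewrite memNset// mulr0 vt ?mulr0 ?normr0// in_unitball.
move=> _ h; apply: le_trans h _; have := leb_cball_le y s0.
rewrite exprMn => h; rewrite (_ : C * 4 ^+ n * e * s ^+ n = e * C * (4 ^+ n * s ^+ n)); last by ring.
by rewrite ler_wpM2l// mulr_ge0// ltW.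
Qed.

Lemma Int_kernel t y s : 0 < s -> vanish unitball t ->
  Int (fun z => eval t (s^-1 *: (z - y))) = s ^+ n * Int (eval t).
Proof.
move=> s0 vt; have it := intg_vanish (@compact_cball _ _ _ _) vt.
have is' : intg (fun z => eval t (s^-1 *: z)).
  have := intg_vanish (@compact_cball _ _ _ _) (vanish_rescale (y := 0) s0 vt).
  rewrite (_ : eval (rescale 0 s t) = (fun z => eval t (s^-1 *: z)))//.
  by apply/funext => z; rewrite eval_rescale subr0.
rewrite -[LHS](@Int_shift _ _ _ y).
  under eq_fun do rewrite addrK.
  by rewrite Int_dilate ?invr_gt0// exprVn invrK.
have := intg_vanish (@compact_cball _ _ _ _) (vanish_rescale (y := y) s0 vt).
rewrite (_ : eval (rescale y s t) = (fun z => eval t (s^-1 *: (z - y))))//.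
by apply/funext => z; rewrite eval_rescale.
Qed.

(** [convol_bound] is applied to U minus c times the indicator of the ball, which a kernel supported
    there does not distinguish from U - c. *)
Lemma convol_near U t : vanish unitball t -> exists2 A : R, 0 < A &
  forall y s (e c : R), 0 < s -> intg U -> 0 <= e -> (forall z, cball y s z -> `|U z - c| <= e) ->
    `|s ^- n * convol U t y s - c * Int (eval t)| <= A * e.
Proof.
move=> vt; have [A A0 hA] := convol_bound vt; exists A => // y s e c s0 iU e0 h.
have cc := @compact_cball R n y s.
pose V z := U z - c * \1_(cball y s) z.
have iV : intg V.
  by apply: intgB => //; apply: intgZ; apply: intg_indic; [exact: compact_measurable|exact: leb_compact].
have := hA V y s e s0 iV e0 _; have sn : 0 < s ^+ n by rewrite exprn_gt0.
have -> : convol V t y s = convol U t y s - c * (s ^+ n * Int (eval t)).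
  rewrite -(Int_kernel y s0 vt) /convol -IntZ; last first.
    have := intg_vanish (@compact_cball _ _ _ _) (vanish_rescale (y := y) s0 vt).
    rewrite (_ : eval (rescale y s t) = (fun z => eval t (s^-1 *: (z - y))))//.
    by apply/funext => z; rewrite eval_rescale.
  rewrite -IntB; [|exact: intg_convol|]; last first.
    apply: intgZ; have := intg_vanish (@compact_cball _ _ _ _) (vanish_rescale (y := y) s0 vt).
    rewrite (_ : eval (rescale y s t) = (fun z => eval t (s^-1 *: (z - y))))//.
    by apply/funext => z; rewrite eval_rescale.
  congr Int; apply/funext => z; rewrite /V indicE; have [cz|cz] := pselect (cball y s z).
    by rewrite mem_set// mulr1 mulrBl.
  by rewrite vt ?in_unitball// !mulr0 subr0.
have -> : s ^- n * convol U t y s - c * Int (eval t) = s ^- n * (convol U t y s - c * (s ^+ n * Int (eval t))).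
  by field; rewrite gt_eqF.
have sn0 : 0 <= s ^- n by rewrite invr_ge0 ltW.
move=> H; rewrite normrM (ger0_norm sn0) ler_pdivrMl// [leRHS]mulrC; apply: H.
by move=> z cz; rewrite /V indicE mem_set// mulr1; exact: h.
Qed.

(** The Euler operator x . grad, which appears when z |-> t((z - y) / s) is differentiated in s. *)
Definition eul t : tm R n := tsum (fun i => Mul (Var R i) (der i t)).

Definition ddir v t : tm R n := tsum (fun i => Mul (Cst n (v ord0 i)) (der i t)).

Lemma eval_eul t x : eval (eul t) x = \sum_i x ord0 i * eval (der i t) x.
Proof. exact: eval_tsum. Qed.

Lemma eval_ddir v t x : eval (ddir v t) x = \sum_i v ord0 i * eval (der i t) x.
Proof. exact: eval_tsum. Qed.

Lemma vanish_eul K t : closed K -> vanish K t -> vanish K (eul t).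
Proof. by move=> cK h; apply: vanish_tsum => i; apply: vanish_mulr; exact: vanish_der. Qed.

Lemma vanish_ddir K v t : closed K -> vanish K t -> vanish K (ddir v t).
Proof. by move=> cK h; apply: vanish_tsum => i; apply: vanish_mulr; exact: vanish_der. Qed.

Lemma is_derive_convol_scale U t y s : 0 < s -> intg U -> vanish unitball t ->
  is_derive s 1 (fun r => convol U t y r) (- s^-1 * convol U (eul t) y s).
Proof.
move=> s0 iU vt; have ve : vanish unitball (eul t) by apply: vanish_eul vt; exact: closed_cball.
have [C1 C10 h1] := bounded_vanish (@compact_cball _ _ _ _) vt.
have [C2 C20 h2] := bounded_vanish (@compact_cball _ _ _ _) ve.
have := @is_derive_Int _ _ U (fun r z => eval t (r^-1 *: (z - y)))
  (fun r z => - r^-1 * eval (eul t) (r^-1 *: (z - y))) (s / 2) (2 * s) s (Num.max C1 (2 / s * C2)).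
rewrite (_ : Int (fun x => U x * (- s^-1 * eval (eul t) (s^-1 *: (x - y)))) = - s^-1 * convol U (eul t) y s); last first.
  rewrite /convol -IntZ; last exact: intg_convol.
  by congr Int; apply/funext => z; rewrite mulrCA.
apply=> //.
- by apply/andP; split; lra.
- by move=> r _; exact: measurable_convol.
- by move=> r x _; rewrite le_max h1.
- move=> r x /andP[r1 _]; have r0 : r != 0 by rewrite gt_eqF//; lra.
  apply: is_derive1_eq; first apply: (@is_derive_path _ _ t (fun r => r^-1 *: (x - y)) r
    (fun i => - 1 / r ^+ 2 * (x - y) ord0 i)) => i.
    rewrite (_ : (fun _ => _) = (fun s : R => s^-1 * (x - y) ord0 i)); last by apply/funext => q; rewrite !mxE.
    apply: is_derive1_eq (is_derive1_mul (is_derive1_inv r0 (is_derive1_id r)) (is_derive1_cst _ _)) _.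
    by rewrite mulr0 addr0.
  rewrite eval_eul mulr_sumr; apply: eq_bigr => i _; rewrite !mxE; field; exact: r0.
- move=> r x /andP[r1 _]; have r0 : 0 < r by lra.
  rewrite le_max normrM normrN; apply/orP; right; apply: ler_pM => //.
  rewrite gtr0_norm ?invr_gt0// -[leRHS]invrK lef_pV2 ?posrE ?invr_gt0 ?divr_gt0// invf_div; lra.
Qed.

Lemma is_derive_convol_dir U t y v s r : 0 < s -> intg U -> vanish unitball t ->
  is_derive r 1 (fun r => convol U t (y + r *: v) s) (- s^-1 * convol U (ddir v t) (y + r *: v) s).
Proof.
move=> s0 iU vt; have ve : vanish unitball (ddir v t) by apply: vanish_ddir vt; exact: closed_cball.
have [C1 C10 h1] := bounded_vanish (@compact_cball _ _ _ _) vt.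
have [C2 C20 h2] := bounded_vanish (@compact_cball _ _ _ _) ve.
have := @is_derive_Int _ _ U (fun r z => eval t (s^-1 *: (z - (y + r *: v))))
  (fun r z => - s^-1 * eval (ddir v t) (s^-1 *: (z - (y + r *: v)))) (r - 1) (r + 1) r (Num.max C1 (s^-1 * C2)).
rewrite (_ : Int (fun x => U x * (- s^-1 * eval (ddir v t) (s^-1 *: (x - (y + r *: v))))) = - s^-1 * convol U (ddir v t) (y + r *: v) s); last first.
  rewrite /convol -IntZ; last exact: intg_convol.
  by congr Int; apply/funext => z; rewrite mulrCA.
apply=> //.
- by apply/andP; split; lra.
- by move=> q _; exact: measurable_convol.
- by move=> q x _; rewrite le_max h1.
- move=> q x _.
  apply: is_derive1_eq; first apply: (@is_derive_path _ _ t (fun q => s^-1 *: (x - (y + q *: v))) q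
    (fun i => - s^-1 * v ord0 i)) => i.
    rewrite (_ : (fun _ => _) = (fun p : R => s^-1 * (x - y) ord0 i + p * (- s^-1 * v ord0 i))); last first.
      by apply/funext => p; rewrite !mxE; ring.
    apply: is_derive1_eq (is_derive1_add (is_derive1_cst _ _) (is_derive1_mul (is_derive1_id q) (is_derive1_cst _ _))) _.
    by rewrite mulr0 addr0 mul1r add0r.
  by rewrite eval_ddir mulr_sumr; apply: eq_bigr => i _; rewrite mulrA.
- move=> q x _; rewrite le_max normrM normrN (gtr0_norm (_ : 0 < s^-1)) ?invr_gt0//.
  by apply/orP; right; rewrite ler_pM2l ?invr_gt0.
Qed.

(* [eta] is the kernel of the mollification, see [kernel_pair]. *)
Definition F2 : tm R n := Mul (Cst n 4) (Add (Cut 4 (tball R n)) (Mul (Cst n (-1)) (Cut 3 (tball R n)))).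
Definition F3 : tm R n := Add (Mul (Cst n 8) (Cut 6 (tball R n)))
  (Add (Mul (Cst n (- 24)) (Cut 5 (tball R n))) (Mul (Cst n 12) (Cut 4 (tball R n)))).
Definition psi : tm R n := Cut 0 (tball R n).
Definition eta : tm R n := Add (Mul (Cst n (- (4 * n%:R + 8))) F2) (Mul (Cst n 8) (Mul (tsqn R n) F3)).

Lemma der_tball i x : eval (der i (tball R n)) x = - 2 * x ord0 i.
Proof.
rewrite /= der_tsum (bigD1 i)//= eqxx mulr1n big1 ?addr0; first by ring.
by move=> j /negbTE; rewrite eq_sym => ->; rewrite mulr0n; ring.
Qed.

Lemma der_Cut k i x : eval (der i (Cut k (tball R n))) x =
  - 2 * x ord0 i * (2 * cutoff k.+2 (1 - sqn x) - k%:R * cutoff k.+1 (1 - sqn x)).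
Proof. rewrite -[LHS]/((2 * cutoff k.+2 (eval (tball R n) x) + - k%:R * cutoff k.+1 (eval (tball R n) x)) * eval (der i (tball R n)) x).
by rewrite der_tball eval_tball; ring. Qed.

Lemma eval_Cut k x : eval (Cut k (tball R n)) x = cutoff k (1 - sqn x).
Proof. by rewrite /= eval_tsqn mulN1r. Qed.

Lemma der_sqn i x : eval (der i (tsqn R n)) x = 2 * x ord0 i.
Proof.
rewrite der_tsum (bigD1 i)//= eqxx mulr1n big1 ?addr0; first by ring.
by move=> j /negbTE; rewrite eq_sym => ->; rewrite mulr0n; ring.
Qed.

Lemma eval_F2 x : eval F2 x = 4 * (cutoff 4 (1 - sqn x) - cutoff 3 (1 - sqn x)).
Proof. by rewrite /= eval_tsqn !mulN1r. Qed.

Lemma eval_F3 x : eval F3 x = 8 * cutoff 6 (1 - sqn x) - 24 * cutoff 5 (1 - sqn x) + 12 * cutoff 4 (1 - sqn x).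
Proof. by rewrite /= eval_tsqn !mulN1r; ring. Qed.

Lemma der_F2 i x : eval (der i F2) x = - 2 * x ord0 i * eval F3 x.
Proof.
have -> : eval (der i F2) x = 4 * (eval (der i (Cut 4 (tball R n))) x - eval (der i (Cut 3 (tball R n))) x).
  by rewrite /F2 /=; ring.
by rewrite !der_Cut eval_F3; ring.
Qed.

Lemma eval_eta x : eval eta x = - (4 * n%:R + 8) * eval F2 x + 8 * (sqn x * eval F3 x).
Proof. by rewrite -eval_tsqn. Qed.

Lemma eval_lap_psi x : eval (lap psi) x = 4 * sqn x * eval F2 x - 4 * n%:R * cutoff 2 (1 - sqn x).
Proof.
rewrite eval_lap.
pose d i : tm R n := Mul (Mul (Cst n (- 4)) (Var R i)) (Cut 2 (tball R n)).
have e i : eval (der i psi) = eval (d i).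
  apply/funext => z; rewrite /psi der_Cut /d -[RHS]/(-4 * z ord0 i * eval (Cut 2 (tball R n)) z) eval_Cut; ring.
rewrite (eq_bigr (fun i => 4 * x ord0 i ^+ 2 * eval F2 x - 4 * cutoff 2 (1 - sqn x))); last first.
  move=> i _; rewrite (der_eq i (e i)) /d.
  rewrite -[LHS]/((0 * x ord0 i + -4 * (i == i)%:R) * eval (Cut 2 (tball R n)) x + -4 * x ord0 i * eval (der i (Cut 2 (tball R n))) x).
  by rewrite eqxx mulr1n eval_Cut der_Cut eval_F2; ring.
rewrite sumrB -mulr_suml -mulr_sumr -/(sqn x) sumr_const card_ord -mulr_natl; ring.
Qed.

(** The origin of [eta]. Writing psi = f(|x|^2), [F2] is f'' and [F3] is - f'''. Then grad Delta psi
    = x ((4 n + 8) f'' + 8 |x|^2 f'''), and [eta] is minus this factor. *)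
Lemma der_lap_psi i x : eval (der i (lap psi)) x = - (x ord0 i * eval eta x).
Proof.
pose l : tm R n := Add (Mul (Mul (Cst n 4) (tsqn R n)) F2) (Mul (Cst n (- (4 * n%:R))) (Cut 2 (tball R n))).
have e : eval (lap psi) = eval l.
  apply/funext => z; rewrite eval_lap_psi /l.
  rewrite -[RHS]/(4 * eval (tsqn R n) z * eval F2 z + - (4 * n%:R) * eval (Cut 2 (tball R n)) z).
  by rewrite eval_tsqn eval_Cut; ring.
rewrite (der_eq i e) /l.
rewrite -[LHS]/((0 * eval (tsqn R n) x + 4 * eval (der i (tsqn R n)) x) * eval F2 x +
   4 * eval (tsqn R n) x * eval (der i F2) x +
   (0 * eval (Cut 2 (tball R n)) x + - (4 * n%:R) * eval (der i (Cut 2 (tball R n))) x)).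
rewrite der_Cut der_sqn der_F2 eval_tsqn eval_eta eval_F2; ring.
Qed.

Lemma lap_lap_psi x : eval (lap (lap psi)) x = - (n%:R * eval eta x + eval (eul eta) x).
Proof.
rewrite eval_lap eval_eul.
have e i : eval (der i (lap psi)) = eval (Mul (Cst n (-1)) (Mul (Var R i) eta)).
  by apply/funext => z; rewrite der_lap_psi /=; ring.
rewrite (eq_bigr (fun i => - eval eta x - x ord0 i * eval (der i eta) x)); last first.
  move=> i _; rewrite (der_eq i (e i)).
  rewrite -[LHS]/(0 * (x ord0 i * eval eta x) + -1 * ((i == i)%:R * eval eta x + x ord0 i * eval (der i eta) x)).
  by rewrite eqxx mulr1n; ring.
rewrite sumrB sumr_const card_ord -mulr_natl; ring.
Qed.

Lemma vanish_Cut k : vanish unitball (Cut k (tball R n)).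
Proof.
move=> x nx; rewrite eval_Cut cutoff_le0//.
by move: nx; rewrite /cball/= subr0 expr1n => /negP; rewrite -ltNge subr_le0 => /ltW.
Qed.

Lemma vanish_psi : vanish unitball psi. Proof. exact: vanish_Cut. Qed.

Lemma vanish_F2 : vanish unitball F2.
Proof.
move=> x hx; rewrite eval_F2 -!eval_Cut !vanish_Cut// subrr mulr0 //.
Qed.

Lemma vanish_F3 : vanish unitball F3.
Proof. by move=> x hx; rewrite eval_F3 -!eval_Cut !vanish_Cut//; ring. Qed.

Lemma vanish_eta : vanish unitball eta.
Proof. by move=> x hx; rewrite eval_eta vanish_F2// vanish_F3//; ring. Qed.


Lemma cutoffS k s : cutoff k s = s * cutoff k.+1 s.
Proof.
rewrite /cutoff; case: ifPn => s0; last by rewrite mulr0.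
by rewrite exprS !mulrA mulfV ?gt_eqF// mul1r.
Qed.

(** This is the convexity of the radial profile of [psi] in |x|^2, for which the constant 2 in
    [cutoff] is chosen. It gives the signs of [c0] and of [mono_pot]. *)
Lemma F2_ge0 x : 0 <= eval F2 x.
Proof.
rewrite eval_F2 (cutoffS 3) mulr_ge0//.
rewrite -[X in X - _]mul1r -mulrBl opprB addrCA subrr addr0.
by rewrite mulr_ge0 ?sqn_ge0 ?cutoff_ge0.
Qed.

Lemma Int_gt0 f x : intg f -> continuous f -> (forall z, 0 <= f z) -> 0 < f x -> 0 < Int f.
Proof.
move=> fi cf f0 fx; have fx2 : 0 < f x / 2 by rewrite divr_gt0.
have /cvgrPdist_lt/(_ _ fx2) := cf x; move=> /nbhs_ballP[e /= e0 he].
have mB : measurable (ball x e : set 'rV[R]_n) by apply: measurable_openrV; exact: ball_open.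
have fB : (leb (ball x e) < +oo)%E by rewrite leb_ball// ltry.
have := @Int_le _ _ (fun z => f x / 2 * \1_(ball x e) z) f (intgZ _ (intg_indic mB fB)) fi.
rewrite IntZ; last exact: intg_indic.
rewrite Int_indic// leb_ball//= => H; apply: lt_le_trans (H _).
  by rewrite mulr_gt0// exprn_gt0// mulr_gt0.
move=> z; rewrite indicE; have [bz|bz] := pselect (ball x e z).
  rewrite mem_set// mulr1; have := he z bz; rewrite /= ltr_distlC => /andP[h _].
  by apply: ltW; apply: le_lt_trans h; lra.
by rewrite memNset// mulr0.
Qed.

Lemma Int_der t i K : compact K -> vanish K t -> Int (eval (der i t)) = 0.
Proof.
move=> cK Kt; rewrite -derive_eval; apply: (Int_derive cK) => //; exact: C1dir_eval.
Qed.

Definition c0 : R := 8 * Int (eval F2).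

Lemma c0_gt0 : (0 < n)%N -> 0 < c0.
Proof.
move=> n0; rewrite mulr_gt0//.
(* [F2] vanishes at the origin, so positivity is tested at a point with |z|^2 = 1 / 4. *)
pose z : 'rV[R]_n := \row_j (if j == Ordinal n0 then 1 / 2 else 0).
apply: (@Int_gt0 _ z) => //.
- exact: intg_vanish (@compact_cball _ _ _ _) vanish_F2.
- exact: continuous_eval.
- by move=> x; exact: F2_ge0.
have sz : sqn z = 1 / 4.
  rewrite /sqn (bigD1 (Ordinal n0))//= big1; last by move=> i /negbTE h; rewrite mxE h expr0n.
  by rewrite mxE eqxx addr0; field.
rewrite eval_F2 sz (cutoffS 3) mulr_gt0//.
have -> : cutoff 4 (1 - 1 / 4) - (1 - 1 / 4) * cutoff 4 (1 - 1 / 4) = 1 / 4 * cutoff 4 (1 - 1 / 4) :> R by ring.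
by rewrite mulr_gt0// cutoff_gt0//; lra.
Qed.

(** The divergence n F2 - 2 |x|^2 F3 of x F2 has integral 0, which expresses the integral of |x|^2
    F3 through that of F2. *)
Lemma Int_eta : Int (eval eta) = - c0.
Proof.
have cc := @compact_cball R n 0 1.
pose g i : tm R n := Mul (Var R i) F2.
have vg i : vanish unitball (g i) by apply: vanish_mulr; exact: vanish_F2.
have cl := @closed_cball R n 0 1.
have E : eval (tsum (fun i => der i (g i))) = fun x => n%:R * eval F2 x - 2 * (sqn x * eval F3 x).
  apply/funext => x; rewrite eval_tsum.
  rewrite (eq_bigr (fun i => eval F2 x - 2 * x ord0 i ^+ 2 * eval F3 x)); last first.
    move=> i _; rewrite -[LHS]/((i == i)%:R * eval F2 x + x ord0 i * eval (der i F2) x).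
    by rewrite eqxx mulr1n der_F2; ring.
  rewrite sumrB; congr (_ - _); first by rewrite sumr_const card_ord mulr_natl.
  by rewrite -mulr_suml -mulr_sumr -mulrA.
have I0 : Int (fun x => n%:R * eval F2 x - 2 * (sqn x * eval F3 x)) = 0.
  rewrite -E (_ : eval _ = fun x => \sum_i eval (der i (g i)) x); last by apply/funext => x; rewrite eval_tsum.
  rewrite Int_sum; first by rewrite big1// => i _; exact: Int_der cc (vg i).
  by move=> i; apply: (intg_vanish cc); exact: vanish_der.
have i2 : intg (eval F2) by apply: (intg_vanish cc); exact: vanish_F2.
have i3 : intg (fun x => sqn x * eval F3 x).
  have -> : (fun x => sqn x * eval F3 x) = eval (Mul (tsqn R n) F3) by apply/funext => x; rewrite -eval_tsqn.
  by apply: (intg_vanish cc); apply: vanish_mulr; exact: vanish_F3.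
rewrite IntB in I0; [|exact: intgZ|exact: intgZ].
rewrite (IntZ _ i2) (IntZ _ i3) in I0.
have -> : eval eta = fun x => - (4 * n%:R + 8) * eval F2 x + 8 * (sqn x * eval F3 x).
  by apply/funext => x; rewrite eval_eta.
rewrite IntD; [|exact: intgZ|exact: intgZ].
rewrite (IntZ _ i2) (IntZ _ i3) /c0; lra.
Qed.

(* [nconvol] with kernel [t] has s-derivative given by the bilaplacian of [phi], see [is_derive_kernel]. *)
Definition kernel_pair (N : nat) t phi :=
  forall x, N%:R * eval t x + eval (eul t) x = - eval (lap (lap phi)) x.

Lemma kernel_pair_eta : kernel_pair n eta psi.
Proof. by move=> x; rewrite lap_lap_psi opprK. Qed.

Lemma eul_der i t x : eval (eul (der i t)) x = eval (der i (eul t)) x - eval (der i t) x.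
Proof.
have E : \sum_j (i == j)%:R * eval (der j t) x = eval (der i t) x.
  rewrite (bigD1 i)//= eqxx mul1r big1 ?addr0// => j /negbTE.
  by rewrite eq_sym => ->; rewrite mul0r.
rewrite eval_eul der_tsum /= big_split/= E addrAC subrr add0r.
by apply: eq_bigr => j _; rewrite derC.
Qed.

Lemma lapD t t' x : eval (lap (Add t t')) x = eval (lap t) x + eval (lap t') x.
Proof. by rewrite !eval_lap -big_split. Qed.

Lemma lapZ c t x : eval (lap (Mul (Cst n c) t)) x = c * eval (lap t) x.
Proof. by rewrite !eval_lap mulr_sumr; apply: eq_bigr => i _ /=; ring. Qed.

Lemma lap2D t t' x : eval (lap (lap (Add t t'))) x = eval (lap (lap t)) x + eval (lap (lap t')) x.
Proof.
rewrite -lapD; congr (_ x); apply: lap_eq; apply/funext => z; exact: lapD.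
Qed.

Lemma lap2Z c t x : eval (lap (lap (Mul (Cst n c) t))) x = c * eval (lap (lap t)) x.
Proof.
rewrite -lapZ; congr (_ x); apply: lap_eq; apply/funext => z; exact: lapZ.
Qed.

(** A partial derivative commutes with the Euler operator up to itself, which raises N by one. So
    the derivatives of the mollification in y are governed by the same mechanism, with derivatives
    of [psi] as potentials. *)
Lemma kernel_pair_der N t phi i : kernel_pair N t phi -> kernel_pair N.+1 (der i t) (der i phi).
Proof.
move=> h x.
have -> : eval (lap (lap (der i phi))) x = eval (der i (lap (lap phi))) x.
  rewrite der_lap; congr (_ x); apply: lap_eq; by rewrite der_lap.
have e : eval (Add (Mul (Cst n N%:R) t) (eul t)) = eval (Mul (Cst n (-1)) (lap (lap phi))).
  by apply/funext => z; rewrite /= -/(eval (eul t) z) h; ring.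
have : N%:R * eval (der i t) x + eval (der i (eul t)) x = - eval (der i (lap (lap phi))) x.
  by have := congr1 (@^~ x) (der_eq i e); rewrite /= !mul0r !add0r mulN1r.
by move=> <-; rewrite eul_der -natr1; ring.
Qed.

Lemma kernel_pair_add N t phi t' phi' : kernel_pair N t phi -> kernel_pair N t' phi' ->
  kernel_pair N (Add t t') (Add phi phi').
Proof.
move=> h h' x; rewrite lap2D opprD -h -h' !eval_eul /=.
under [X in _ + X = _]eq_bigr do rewrite mulrDr.
rewrite big_split/=; ring.
Qed.

Lemma kernel_pair_scale N t phi c : kernel_pair N t phi ->
  kernel_pair N (Mul (Cst n c) t) (Mul (Cst n c) phi).
Proof.
move=> h x; rewrite lap2Z -mulrN -h !eval_eul /= mulrDr mulr_sumr; congr (_ + _); first by ring.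
by apply: eq_bigr => i _; ring.
Qed.

Lemma kernel_pair_tsum N (t phi : 'I_n -> tm R n) : (forall i, kernel_pair N (t i) (phi i)) ->
  kernel_pair N (tsum t) (tsum phi).
Proof.
move=> h; rewrite /tsum; elim: (enum 'I_n) => [|i r ih] /=.
  move=> x; rewrite eval_eul /= mulr0 add0r big1 => [|i _]; last by rewrite mulr0.
  have -> : eval (lap (lap (Cst n 0))) = eval (lap (lap (Mul (Cst n 0) (Cst n (0 : R))))).
    by do 2 apply: lap_eq; apply/funext => z /=; rewrite mulr0.
  by rewrite lap2Z mul0r oppr0.
exact: kernel_pair_add.
Qed.

Lemma kernel_pair_ddir N t phi v : kernel_pair N t phi -> kernel_pair N.+1 (ddir v t) (ddir v phi).
Proof.
by move=> h; apply: kernel_pair_tsum => i; apply: kernel_pair_scale; exact: kernel_pair_der.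
Qed.

(** The pairing of the distribution Delta^2 U with t. *)
Definition bilap U t : R := Int (fun z => U z * eval (lap (lap t)) z).

Lemma bilap_rescale U y s t : bilap U (rescale y s t) = Int (fun z => U z * (s ^- 4 * eval (lap (lap t)) (s^-1 *: (z - y)))).
Proof.
congr Int; apply/funext => z; congr (_ * _).
have e : eval (lap (rescale y s t)) = eval (Mul (Cst n (s^-1 ^+ 2)) (rescale y s (lap t))).
  by apply/funext => x; rewrite lap_rescale /= eval_rescale.
by rewrite (lap_eq e) lapZ lap_rescale mulrA -exprD exprVn.
Qed.

(** The s-derivative of s ^- N t((z - y) / s) is - s ^- N.+1 (N t + x . grad t) at (z - y) / s. The
    kernel pair turns this into Delta^2 phi, and rescaling [phi] accounts for a factor s ^- 4. *)
Lemma is_derive_kernel U N t phi y s : 0 < s -> intg U -> vanish unitball t -> vanish unitball phi ->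
  kernel_pair N t phi ->
  is_derive s 1 (fun r => r ^- N * convol U t y r) (s ^+ 3 / s ^+ N * bilap U (rescale y s phi)).
Proof.
move=> s0 iU vt vp h; have cl := @closed_cball R n 0 1.
have ve : vanish unitball (eul t) by exact: vanish_eul.
have v2 : vanish unitball (lap (lap phi)) by apply: vanish_lap => //; exact: vanish_lap.
have sN : s ^+ N != 0 by rewrite gt_eqF// exprn_gt0.
have s1 : s != 0 by rewrite gt_eqF.
have D1 := @is_derive1_inv _ (fun r => r ^+ N) s _ sN (is_derive1_exp N (is_derive1_id s)).
apply: is_derive1_eq (is_derive1_mul D1 (is_derive_convol_scale y s0 iU vt)) _.
have -> : bilap U (rescale y s phi) = s ^- 4 * convol U (lap (lap phi)) y s.
  by rewrite bilap_rescale /convol -IntZ; [congr Int; apply/funext => z; ring|exact: intg_convol].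
have -> : convol U (lap (lap phi)) y s = - (N%:R * convol U t y s + convol U (eul t) y s).
  rewrite -(convol_scale _ _ _ iU vt) -(convol_add _ _ iU) //; last exact: vanish_mulr.
  rewrite -mulN1r -convol_scale//; last by apply: vanish_add => //; exact: vanish_mulr.
  apply: convol_eq; apply/funext => x; rewrite /= -/(eval (eul t) x) h; ring.
have -> : N%:R * s ^+ N.-1 * 1 = N%:R * s ^+ N / s.
  by case: (N) => [|k]; rewrite ?mul0r// exprS/= mulr1 mulrAC -mulrA mulKf.
by field; rewrite sN s1.
Qed.
End kernels.

(** * Inner product, Euclidean norm and balls *)

Section euclid.
Variables (R : realType) (n : nat).
Implicit Types (x y z : 'rV[R]_n) (r s : R).

Definition dot x y : R := \sum_i x ord0 i * y ord0 i.

Lemma dot_sqn x : dot x x = sqn x. Proof. by apply: eq_bigr => i _; rewrite expr2. Qed.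

Lemma dotC x y : dot x y = dot y x. Proof. by apply: eq_bigr => i _; rewrite mulrC. Qed.

Lemma dotDl x y z : dot (x + y) z = dot x z + dot y z.
Proof. by rewrite -big_split; apply: eq_bigr => i _; rewrite mxE mulrDl. Qed.

Lemma dotDr x y z : dot z (x + y) = dot z x + dot z y.
Proof. by rewrite dotC dotDl !(dotC z). Qed.

Lemma dotZl (c : R) x z : dot (c *: x) z = c * dot x z.
Proof. by rewrite mulr_sumr; apply: eq_bigr => i _; rewrite mxE mulrA. Qed.

Lemma dotZr (c : R) x z : dot z (c *: x) = c * dot z x.
Proof. by rewrite dotC dotZl dotC. Qed.

Lemma dotNl x z : dot (- x) z = - dot x z.
Proof. by rewrite -scaleN1r dotZl mulN1r. Qed.

Lemma dotNr x z : dot z (- x) = - dot z x.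
Proof. by rewrite dotC dotNl dotC. Qed.

Lemma sqnD x y : sqn (x + y) = sqn x + 2 * dot x y + sqn y.
Proof. rewrite -!dot_sqn dotDl !dotDr (dotC y x); ring. Qed.

Lemma sqn0_eq0 x : sqn x = 0 -> x = 0.
Proof.
move=> h; apply/rowP => i; rewrite mxE; have := coord_le_sqn x i.
by rewrite h => h'; apply/eqP; rewrite -sqrf_eq0 eq_le h' sqr_ge0.
Qed.

Lemma cauchy_schwarz x y : dot x y ^+ 2 <= sqn x * sqn y.
Proof.
have [y0|y0] := eqVneq (sqn y) 0.
  rewrite y0 mulr0 (sqn0_eq0 y0) (_ : dot x 0 = 0) ?expr0n//.
  by rewrite -(scale0r 0) dotZr mul0r.
have yp : 0 < sqn y by rewrite lt_def y0 sqn_ge0.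
have := sqn_ge0 (sqn y *: x - dot x y *: y).
rewrite sqnD -scaleNr !sqnZ dotZl dotZr => h.
rewrite -subr_ge0 -(pmulr_rge0 _ yp); apply: le_trans h _.
by rewrite le_eqVlt; apply/orP; left; apply/eqP; ring.
Qed.

Lemma enorm_ge0 x : 0 <= enorm x. Proof. exact: sqrtr_ge0. Qed.

Lemma sqr_enorm x : enorm x ^+ 2 = sqn x.
Proof. by rewrite enormE sqr_sqrtr// sqn_ge0. Qed.

Lemma enorm_le x r : 0 <= r -> (enorm x <= r) = (sqn x <= r ^+ 2).
Proof. by move=> r0; rewrite -sqr_enorm ler_pXn2r// nnegrE ?enorm_ge0. Qed.

Lemma enorm_lt x r : 0 <= r -> (enorm x < r) = (sqn x < r ^+ 2).
Proof. by move=> r0; rewrite -sqr_enorm ltr_pXn2r// nnegrE ?enorm_ge0. Qed.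

Lemma dot_le x y : `|dot x y| <= enorm x * enorm y.
Proof.
rewrite -(@ler_pXn2r _ 2)// ?nnegrE ?mulr_ge0 ?enorm_ge0//.
by rewrite exprMn !sqr_enorm real_normK ?num_real// cauchy_schwarz.
Qed.

Lemma enormD x y : enorm (x + y) <= enorm x + enorm y.
Proof.
rewrite enorm_le ?addr_ge0 ?enorm_ge0// sqnD sqrrD !sqr_enorm.
have := dot_le x y; rewrite ler_norml => /andP[_]; rewrite -mulr_natl; lra.
Qed.

Lemma enormZ r x : enorm (r *: x) = `|r| * enorm x.
Proof. by rewrite enormE sqnZ sqrtrM ?sqr_ge0// sqrtr_sqr. Qed.

Lemma enormN x : enorm (- x) = enorm x.
Proof. by rewrite -scaleN1r enormZ normrN1 mul1r. Qed.

Lemma enormB x y : enorm (x - y) = enorm (y - x).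
Proof. by rewrite -enormN opprB. Qed.

Lemma enorm0 : enorm (0 : 'rV[R]_n) = 0.
Proof. by rewrite -(scale0r 0) enormZ normr0 mul0r. Qed.

Lemma enorm_eq0 x : enorm x = 0 -> x = 0.
Proof. by move=> h; apply: sqn0_eq0; rewrite -sqr_enorm h expr0n. Qed.

Lemma enorm_tri x y z : enorm (x - z) <= enorm (x - y) + enorm (y - z).
Proof. by rewrite -[x - z](subrKA y) enormD. Qed.

Lemma coord_le_enorm x i : `|x ord0 i| <= enorm x.
Proof.
rewrite -(@ler_pXn2r _ 2)// ?nnegrE ?enorm_ge0// sqr_enorm real_normK ?num_real//.
exact: coord_le_sqn.
Qed.

Lemma norm_le_enorm x : `|x| <= enorm x.
Proof. by apply: norm_le_coord => [|i]; [exact: enorm_ge0|exact: coord_le_enorm]. Qed.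

Lemma enorm_le_norm x : enorm x <= n%:R * `|x|.
Proof.
rewrite enorm_le ?mulr_ge0// exprMn; apply: le_trans (sqn_le_norm x) _.
by rewrite ler_wpM2r ?sqr_ge0// -natrX ler_nat; case: (n) => // k; rewrite -{1}[k.+1]expn1 leq_pexp2l.
Qed.

Lemma cballP y r z : 0 <= r -> cball y r z <-> enorm (z - y) <= r.
Proof. by move=> r0; rewrite enorm_le. Qed.

Lemma cball_sub y r x s : 0 <= r -> 0 <= s -> enorm (y - x) + r <= s -> cball y r `<=` cball x s.
Proof.
move=> r0 s0 h z /(cballP _ _ r0) zy; apply/cballP => //.
by apply: le_trans (enorm_tri z y x) _; apply: le_trans h; rewrite addrC lerD2l.
Qed.

Lemma cball_mono y r s : 0 <= r -> r <= s -> cball y r `<=` cball y s.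
Proof. by move=> r0 rs; apply: cball_sub => //; [exact: le_trans rs|rewrite subrr enorm0 add0r]. Qed.

Lemma cball_self y r : cball y r y.
Proof. by rewrite /cball/= subrr /sqn big1 ?sqr_ge0// => i _; rewrite mxE expr0n. Qed.

Lemma open_eball y r : open (eball y r).
Proof.
rewrite (_ : eball y r = [set z | 0 < r /\ sqn (z - y) < r ^+ 2]); last first.
  apply/seteqP; split => z; rewrite /eball/=.
    by move=> h; have r0 := le_lt_trans (enorm_ge0 _) h; rewrite -enorm_lt// ltW.
  by move=> [r0]; rewrite -enorm_lt// ltW.
have [r0|r0] := ltP 0 r; last first.
  rewrite (_ : [set _ | _] = set0); first exact: open0.
  by apply/seteqP; split => // z [].
rewrite (_ : [set _ | _] = (fun z => sqn (z - y)) @^-1` [set t | t < r ^+ 2]); last first.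
  by apply/seteqP; split => z //= [].
apply: open_comp => [z _|]; last exact: open_lt.
apply: (@continuous_comp _ _ _ (fun z => z - y) (@sqn R n)); last exact: continuous_sqn.
by apply: (@continuousB _ _ _ id (cst y)); [exact: cvg_id|exact: cst_continuous].
Qed.
End euclid.

(** For derivative bounds that vary along the interval, such as E / r^2 in [third_order]. *)
Lemma mvt_dom (R : realType) (f df g dg : R -> R) (a b : R) : a <= b ->
  (forall s : R, a <= s <= b -> is_derive s 1 f (df s)) ->
  (forall s : R, a <= s <= b -> is_derive s 1 g (dg s)) ->
  (forall s : R, a <= s <= b -> `|df s| <= dg s) -> `|f b - f a| <= g b - g a.
Proof.
move=> ab hf hg h.
have h1 := @mvt_ge _ (fun s => g s - f s) (fun s => dg s - df s) a b 0 ab.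
have h2 := @mvt_ge _ (fun s => g s + f s) (fun s => dg s + df s) a b 0 ab.
have /h1 : forall s : R, a <= s <= b -> is_derive s 1 (fun s => g s - f s) (dg s - df s).
  by move=> s hs; apply: is_derive1_add; [exact: hg|apply: is_derive1_opp; exact: hf].
have /h2 : forall s : R, a <= s <= b -> is_derive s 1 (fun s => g s + f s) (dg s + df s).
  by move=> s hs; apply: is_derive1_add; [exact: hg|exact: hf].
move=> H2 H1; rewrite ler_norml.
have /H2 : forall s : R, a <= s <= b -> 0 <= dg s + df s.
  by move=> s /h; rewrite ler_norml => /andP[k _]; lra.
have /H1 : forall s : R, a <= s <= b -> 0 <= dg s - df s.
  by move=> s /h; rewrite ler_norml => /andP[_ k]; lra.
by rewrite mul0r; lra.
Qed.

(** * The consequences of minimality *)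

Section minimizer_facts.
Variables (R : realType) (n : nat).
Notation leb := (@lebesgue_rV R n).
Variables (Omega : set 'rV[R]_n) (U : 'rV[R]_n -> R).
Implicit Types (x y v : 'rV[R]_n) (t phi : tm R n) (s r : R) (K G : set 'rV[R]_n).

(* What the minimality of [u] gives on [U = u \_ Omega] for perturbations that
   decrease, resp. arbitrarily change, [u]. *)
Definition local_min :=
  [/\ open Omega, intg U, (forall x, Omega x -> {for x, continuous U}),
   (forall t K G, compact K -> K `<=` Omega -> vanish K t -> (forall x, eval t x <= 0) ->
     measurable G -> (forall x, G x -> 0 < U x /\ U x + eval t x <= 0) ->
     fine (leb G) <= 2 * bilap U t + Int (fun x => eval (lap t) x ^+ 2)) &
   (forall t K, compact K -> K `<=` Omega -> vanish K t ->
     0 <= 2 * bilap U t + Int (fun x => eval (lap t) x ^+ 2) + fine (leb K))].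
End minimizer_facts.

Lemma fineD_le (R : realType) (a b c : \bar R) :
  (a + b <= c)%E -> (0 <= a)%E -> (0 <= b)%E -> (c < +oo)%E ->
  fine a + fine b <= fine c.
Proof.
by move: a b c => [a||] [b||] [c||]//=; rewrite -EFinD lee_fin.
Qed.

Lemma fine_leD (R : realType) (a b c : \bar R) : (c <= a + b)%E -> (0 <= c)%E -> (0 <= a < +oo)%E -> (0 <= b < +oo)%E ->
  fine c <= fine a + fine b.
Proof.
move=> h c0 /andP[a0 ay] /andP[b0 byy].
have fa : a \is a fin_num by rewrite ge0_fin_numE.
have fb : b \is a fin_num by rewrite ge0_fin_numE.
have fab : (a + b)%E \is a fin_num by rewrite fin_numD fa fb.
have fc : c \is a fin_num.
  by rewrite ge0_fin_numE// (le_lt_trans h)// -ge0_fin_numE ?adde_ge0.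
by rewrite -fineD//; exact: fine_le.
Qed.

Lemma near_continuous (T V : topologicalType) (f g : T -> V) (x : T) :
  (\forall z \near x, f z = g z) -> {for x, continuous f} -> {for x, continuous g}.
Proof.
move=> e c; have fx := nbhs_singleton e; rewrite /prop_for /continuous_at -fx.
by apply: cvg_trans c; exact: near_eq_cvg.
Qed.

(** A perturbation with t <= 0 can only shrink the positivity set, and the set loses all of G. An
    arbitrary perturbation enlarges it at most by K. *)
Lemma minimizer_local_min (R : realType) n (Omega : set 'rV[R]_n) u0 u : open Omega -> bounded_set Omega ->
  minimizer Omega u0 u -> {in Omega, continuous u} -> local_min Omega (u \_ Omega).
Proof.
move=> oO bO mu cu; have [[[lu _] _] _] := mu.
have mO := measurable_openrV oO.
split => //.
- by apply: (sqi_intg oO bO); apply/Lfun2P.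
- move=> x Ox; have : {for x, continuous u} by apply: cu; rewrite inE.
  apply: near_continuous; apply: filterS (open_nbhs_nbhs (conj oO Ox)) => z Oz.
  by rewrite patchE mem_set.
- move=> t K G cK KO Kt t0 mG hG; have := minimizer_ineq oO bO mu cK KO Kt.
  set P := Defs.positive_set Omega u; set P' := Defs.positive_set _ _.
  have lu' := L2_add_term cK KO Kt lu.
  have mP : measurable P := measurable_positive_set lu.
  have mP' : measurable P' := measurable_positive_set lu'.
  have fP := leb_positive_set oO bO lu; have fP' := leb_positive_set oO bO lu'.
  have GP : G `<=` P.
    move=> x /hG[]; rewrite patchE; case: ifPn => [|_]; last by rewrite ltxx.
    by rewrite inE.
  have fG : (lebesgue_rV G < +oo)%E.
    by apply: le_lt_trans fP; apply: le_measure => //; rewrite inE.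
  have sub : G `|` P' `<=` P.
    move=> x [/GP//|[Ox ux]]; split => //; apply: lt_le_trans ux _.
    by rewrite gerDl.
  have dis : [disjoint G & P'].
    apply/disj_setPS => x [/hG[_]]; rewrite patchE => + [Ox]; rewrite mem_set// => h1 h2.
    by have := lt_le_trans h2 h1; rewrite ltxx.
  have : fine (lebesgue_rV G) + fine (lebesgue_rV P') <= fine (lebesgue_rV P).
    apply: fineD_le => //; rewrite -measureU//; last exact/disj_set2P.
    by apply: le_measure; rewrite ?inE//; exact: measurableU.
  rewrite /bilap; lra.
move=> t K cK KO Kt; have := minimizer_ineq oO bO mu cK KO Kt.
set P := Defs.positive_set Omega u; set P' := Defs.positive_set _ _.
have lu' := L2_add_term cK KO Kt lu.
have mP : measurable P := measurable_positive_set lu.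
have mP' : measurable P' := measurable_positive_set lu'.
have fP := leb_positive_set oO bO lu; have fP' := leb_positive_set oO bO lu'.
have mK := compact_measurable cK; have fK := leb_compact cK.
have sub : P' `<=` P `|` K.
  move=> x [Ox ux]; have [Kx|Kx] := pselect (K x); first by right.
  by left; split => //; move: ux; rewrite Kt// addr0.
have : fine (lebesgue_rV P') <= fine (lebesgue_rV P) + fine (lebesgue_rV K).
  apply: fine_leD; rewrite ?measure_ge0//.
  apply: (@le_trans _ _ (lebesgue_rV (P `|` K))); last exact: measureU2.
  by apply: le_measure; rewrite ?inE//; exact: measurableU.
rewrite /bilap; lra.
Qed.

(** * The measure - Delta^2 U and its density *)

Section local_theory.
Variables (R : realType) (n : nat).
Variables (Omega : set 'rV[R]_n) (U : 'rV[R]_n -> R).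
Hypothesis hU : local_min Omega U.
Implicit Types (x y v : 'rV[R]_n) (t phi : tm R n) (s r C S kappa rho epsilon : R) (K G : set 'rV[R]_n).
Notation unitball := (cball (0 : 'rV[R]_n) 1).

Let iU : intg U. Proof. by case: hU. Qed.

Lemma closed_compact K : compact K -> closed K.
Proof. by move=> cK; apply: compact_closed => //; exact: norm_hausdorff. Qed.

Lemma intg_lap2 t K : compact K -> vanish K t -> intg (fun z => U z * eval (lap (lap t)) z).
Proof.
move=> cK vt; have cl := closed_compact cK.
have v2 : vanish K (lap (lap t)) by apply: vanish_lap => //; exact: vanish_lap.
have [C C0 hC] := bounded_vanish cK v2.
by apply: (intgM iU (measurable_eval _)) => x; exact: hC.
Qed.

Lemma bilap_add t t' K : compact K -> vanish K t -> vanish K t' -> bilap U (Add t t') = bilap U t + bilap U t'.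
Proof.
move=> cK h h'; rewrite /bilap -IntD; [|exact: intg_lap2 cK h|exact: intg_lap2 cK h'].
by congr Int; apply/funext => z; rewrite lap2D mulrDr.
Qed.

Lemma bilap_scale c t K : compact K -> vanish K t -> bilap U (Mul (Cst n c) t) = c * bilap U t.
Proof.
move=> cK h; rewrite /bilap -IntZ; last exact: intg_lap2 cK h.
by congr Int; apply/funext => z; rewrite lap2Z mulrCA.
Qed.

Lemma bilap_eq t t' : eval t = eval t' -> bilap U t = bilap U t'.
Proof. by move=> e; rewrite /bilap (lap_eq (lap_eq e)). Qed.

(** Pushing U down by c t does not increase the measure term, so 0 <= - 2 c bilap U t + c^2 I for
    all c >= 0; a small c gives the sign. *)
Lemma bilap_le0 t K : compact K -> K `<=` Omega -> vanish K t -> (forall x, 0 <= eval t x) -> bilap U t <= 0.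
Proof.
move=> cK KO vt t0; case: hU => _ _ _ PD _; rewrite leNgt; apply/negP => Tp.
pose I := Int (fun x => eval (lap t) x ^+ 2).
have I0 : 0 <= I by apply: Int_ge0 => x; exact: sqr_ge0.
pose c := bilap U t / (I + 1).
have c0 : 0 < c by rewrite divr_gt0// ltr_wpDl.
have := PD (Mul (Cst n (- c)) t) K set0 cK KO (vanish_mulr _ vt).
rewrite measure0 (bilap_scale _ cK vt).
have -> : Int (fun x => eval (lap (Mul (Cst n (- c)) t)) x ^+ 2) = c ^+ 2 * I.
  rewrite /I -IntZ.
    by congr Int; apply/funext => x; rewrite lapZ; ring.
  have cl := closed_compact cK.
  have vl : vanish K (lap t) by exact: vanish_lap.
  by apply: (intg_vanish (t := Mul (lap t) (lap t)) cK); exact: vanish_mull.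
move=> /(_ _ measurable0)/= H.
have {}H : 0 <= 2 * (- c * bilap U t) + c ^+ 2 * I.
  by apply: H => // x; rewrite mulNr oppr_le0 mulr_ge0// ltW.
have e : c * (I + 1) = bilap U t by rewrite /c divfK// gt_eqF// ltr_wpDl.
have : 0 < c * (bilap U t) by rewrite mulr_gt0.
by move: H; rewrite -e; nra.
Qed.

Lemma bilap_mono t t' K : compact K -> K `<=` Omega -> vanish K t -> vanish K t' ->
  (forall x, eval t x <= eval t' x) -> bilap U t' <= bilap U t.
Proof.
move=> cK KO vt vt' h.
have v1 : vanish K (Mul (Cst n (-1)) t) by exact: vanish_mulr.
have := @bilap_le0 (Add t' (Mul (Cst n (-1)) t)) K cK KO (vanish_add vt' v1).
rewrite (bilap_add cK vt' v1) (bilap_scale _ cK vt) mulN1r subr_le0; apply => x /=.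
by rewrite mulN1r subr_ge0.
Qed.

(* The mass of - Delta^2 U near the ball of radius s about x, up to constants. *)
Definition dens x s : R := - bilap U (rescale x s (psi R n)).

Lemma psi_ge0 x : 0 <= eval (psi R n) x.
Proof. by rewrite /psi eval_Cut cutoff_ge0. Qed.

Lemma cutoff0_homo (a b : R) : a <= b -> cutoff 0 a <= cutoff 0 b.
Proof.
move=> ab; have [a0|a0] := leP a 0; first by rewrite cutoff_le0// cutoff_ge0.
have b0 := lt_le_trans a0 ab.
rewrite /cutoff a0 b0 !expr0 !mul1r ler_expR lerN2 ler_pM2l// lef_pV2//.
Qed.

(** The minimum of [psi] on the ball of radius 1 / 2, where 1 - |x|^2 >= 3 / 4. *)
Definition psi0 : R := cutoff 0 (3 / 4).

Lemma psi0_gt0 : 0 < psi0. Proof. by rewrite cutoff_gt0// divr_gt0. Qed.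

Lemma psi_ge y s z : 0 < s -> cball y (s / 2) z -> psi0 <= eval (psi R n) (s^-1 *: (z - y)).
Proof.
move=> s0 h; rewrite /psi eval_Cut; apply: cutoff0_homo; rewrite sqn_sub_scale//.
move: h; rewrite /cball/= => h.
have : sqn (z - y) / s ^+ 2 <= (s / 2) ^+ 2 / s ^+ 2 by rewrite ler_pM2r// invr_gt0 exprn_gt0.
rewrite (_ : (s / 2) ^+ 2 / s ^+ 2 = 1 / 4); first by lra.
by field; rewrite gt_eqF.
Qed.

Lemma psi_le1 x : eval (psi R n) x <= 1.
Proof. by rewrite /psi eval_Cut cutoff0_le1. Qed.

Lemma dens_ge0 x s : 0 < s -> cball x s `<=` Omega -> 0 <= dens x s.
Proof.
move=> s0 sO; rewrite oppr_ge0; apply: (bilap_le0 (@compact_cball _ _ x s) sO).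
  by apply: vanish_rescale => //; exact: vanish_psi.
by move=> z; rewrite eval_rescale psi_ge0.
Qed.

Lemma Int_lap_rescale : exists2 C : R, 0 < C & forall y s, 0 < s ->
  Int (fun x => eval (lap (rescale y s (psi R n))) x ^+ 2) <= C * s ^+ n / s ^+ 4.
Proof.
have cl := @closed_cball R n 0 1.
have vl : vanish unitball (lap (psi R n)) by apply: vanish_lap => //; exact: vanish_psi.
have [A A0 hA] := convol_bound vl.
have [C C0 hC] := bounded_vanish (@compact_cball _ _ _ _) vl.
exists (C ^+ 2 * 4 ^+ n) => [|y s s0]; first by rewrite mulr_gt0// exprn_gt0.
have cc := @compact_cball R n y s.
have s4 : 0 <= s ^- 4 by rewrite invr_ge0 exprn_ge0// ltW.
have := @Int_bound _ _ (fun x => eval (lap (rescale y s (psi R n))) x ^+ 2) (cball y s) (C ^+ 2 / s ^+ 4)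
  (compact_measurable cc) (leb_compact cc).
case.
- by apply: measurable_funX; exact: measurable_eval.
- move=> z; rewrite indicE; have [cz|cz] := pselect (cball y s z).
    rewrite mem_set// mulr1 lap_rescale ger0_norm ?sqr_ge0// exprMn -exprM -exprVn mulrC.
    by rewrite ler_wpM2r ?exprVn// -real_normK ?num_real// lerXn2r// nnegrE ltW.
  by rewrite memNset// mulr0 lap_rescale vl ?in_unitball// mulr0 expr0n normr0.
move=> _ /(le_trans (ler_norm _)) h; apply: le_trans h _.
have := leb_cball_le y s0; rewrite exprMn => h.
rewrite (_ : C ^+ 2 * 4 ^+ n * s ^+ n / s ^+ 4 = C ^+ 2 / s ^+ 4 * (4 ^+ n * s ^+ n)); last by ring.
by apply: ler_wpM2l => //; rewrite mulr_ge0// sqr_ge0.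
Qed.

(** The competitor adds a bump of height s^2. Its bending energy s^4 s^(n-4) and the measure of its
    support are both of order s^n, and the linear term carries the factor s^2. *)
Lemma dens_le : exists2 C : R, 0 < C & forall x s, 0 < s -> cball x s `<=` Omega ->
  dens x s <= C * s ^+ n / s ^+ 2.
Proof.
case: hU => _ _ _ _ PU; have [C C0 hC] := Int_lap_rescale.
exists (C + 4 ^+ n) => [|x s s0 sO]; first by rewrite addr_gt0// exprn_gt0.
have cc := @compact_cball R n x s.
have vp : vanish (cball x s) (rescale x s (psi R n)) by apply: vanish_rescale => //; exact: vanish_psi.
have := PU (Mul (Cst n (s ^+ 2)) (rescale x s (psi R n))) (cball x s) cc sO (vanish_mulr _ vp).
rewrite (bilap_scale _ cc vp).
have -> : Int (fun z => eval (lap (Mul (Cst n (s ^+ 2)) (rescale x s (psi R n)))) z ^+ 2) =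
    s ^+ 4 * Int (fun z => eval (lap (rescale x s (psi R n))) z ^+ 2).
  rewrite -IntZ; first by congr Int; apply/funext => z; rewrite lapZ exprMn -exprM.
  have vl := vanish_lap (closed_compact cc) vp.
  by apply: (intg_vanish (t := Mul (lap _) (lap _)) cc); exact: vanish_mull.
have := hC x s s0; have := leb_cball_le x s0; rewrite exprMn.
have s4 : 0 < s ^+ 4 by rewrite exprn_gt0. have s2 : 0 < s ^+ 2 by rewrite exprn_gt0.
rewrite ler_pdivlMr// ler_pdivlMr// /dens.
set I := Int _; set L := fine _; set t := bilap _ _; have sn : 0 < s ^+ n by rewrite exprn_gt0.
move=> h1 h2 h3.
have p1 : 0 <= C * s ^+ n by rewrite mulr_ge0// ltW.
have p2 : 0 <= 4 ^+ n * s ^+ n by rewrite mulr_ge0// ?exprn_ge0// ltW.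
by lra.
Qed.

(** As - Delta^2 U is positive, a kernel without sign is controlled through its absolute value,
    which lies below C / psi0 times a bump at the larger scale S. *)
Lemma dominated_dens (C : R) t x S y s : 0 < C -> vanish unitball t -> (forall z, `|eval t z| <= C) ->
  0 < s -> 0 < S -> cball x S `<=` Omega -> cball y s `<=` cball x (S / 2) ->
  `|bilap U (rescale y s t)| <= C / psi0 * dens x S.
Proof.
move=> C0 vt hC s0 S0 SO sS; have cc := @compact_cball R n x S.
have vp : vanish (cball x S) (rescale x S (psi R n)) by apply: vanish_rescale => //; exact: vanish_psi.
have SS : cball x (S / 2) `<=` cball x S.
  by apply: cball_mono; [rewrite divr_ge0// ltW|lra].
have vt' : vanish (cball x S) (rescale y s t).
  by apply: vanishS (vanish_rescale s0 vt); exact: subset_trans SS.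
have p0 := psi0_gt0; have Cp : 0 < C / psi0 by rewrite divr_gt0.
have B z : `|eval t (s^-1 *: (z - y))| <= C / psi0 * eval (psi R n) (S^-1 *: (z - x)).
  have [zs|zs] := pselect (cball y s z); last first.
    by rewrite vt ?in_unitball// normr0 mulr_ge0 ?psi_ge0// ltW.
  apply: le_trans (hC _) _; rewrite -[leLHS](divfK (lt0r_neq0 p0)); apply: ler_wpM2l; first exact: ltW.
  by apply: psi_ge => //; exact: sS.
rewrite ler_norml; apply/andP; split.
- rewrite /dens mulrN opprK -(bilap_scale _ cc vp); apply: (bilap_mono cc SO) => //; first exact: vanish_mulr.
  by move=> z; rewrite /= !eval_rescale (le_trans (ler_norm _)).
- rewrite /dens mulrN -mulNr -(bilap_scale _ cc vp); apply: (bilap_mono cc SO) => //; first exact: vanish_mulr.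
  move=> z; have := B z; rewrite ler_norml => /andP[h1 _].
  rewrite -[leLHS]/(- (C / psi0) * eval (rescale x S (psi R n)) z) !eval_rescale mulNr; exact: h1.
Qed.

Definition nconvol N t y s : R := s ^- N * convol U t y s.

Lemma is_derive_nconvol N t phi y s : 0 < s -> vanish unitball t -> vanish unitball phi -> kernel_pair N t phi ->
  is_derive s 1 (nconvol N t y) (s ^+ 3 / s ^+ N * bilap U (rescale y s phi)).
Proof. by move=> s0 vt vp h; exact: is_derive_kernel. Qed.

Lemma powB (k N : nat) s : 0 < s -> s ^+ k / s ^+ (k + N) = s ^- N.
Proof. by move=> s0; rewrite exprD invfM mulrA mulfV ?mul1r// gt_eqF// exprn_gt0. Qed.

(** The scale derivative of [nconvol] is s^(3-n) times the mass, hence at most C s. It is integrated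
    down to scale 0, where continuity of U identifies the limit - c0 U y. *)
Lemma mollify_close : (0 < n)%N -> exists2 C : R, 0 < C & forall y s, 0 < s -> cball y s `<=` Omega ->
  `|U y + nconvol n (eta R n) y s / c0 R n| <= C * s ^+ 2.
Proof.
move=> n0; have c00 := @c0_gt0 R n n0; have [C C0 hC] := dens_le.
exists (C / c0 R n) => [|y s s0 sO]; first by rewrite divr_gt0.
have [oO _ cU _ _] := hU.
have [A A0 hA] := @convol_near R n U _ (@vanish_eta R n).
have Oy : Omega y by apply: sO; exact: cball_self.
(* The error e is that of a tiny scale q at which U is within e of U y on the ball; between q and s
   the bound on the derivative is used. *)
suff H : forall e : R, 0 < e -> `|nconvol n (eta R n) y s + c0 R n * U y| <= C * s ^+ 2 + A * e.
  have : `|nconvol n (eta R n) y s + c0 R n * U y| <= C * s ^+ 2.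
    by apply/ler_addgt0Pr => e e0; have := H (e / A) (divr_gt0 e0 A0); rewrite [A * _]mulrCA mulfV ?mulr1// gt_eqF.
  have -> : nconvol n (eta R n) y s + c0 R n * U y = c0 R n * (U y + nconvol n (eta R n) y s / c0 R n).
    by rewrite mulrDr mulrCA mulfV ?mulr1 ?gt_eqF// addrC.
  by rewrite normrM gtr0_norm// -ler_pdivlMl// mulrA [_^-1 * C]mulrC.
move=> e e0; have /cvgrPdist_le/(_ _ e0)/nbhs_ballP[d /= d0 hd] := cU y Oy.
pose q := Num.min s (d / 2); have q0 : 0 < q by rewrite lt_min s0 divr_gt0.
have qs : q <= s by rewrite ge_min lexx.
have h1 : `|nconvol n (eta R n) y q + c0 R n * U y| <= A * e.
  have -> : c0 R n * U y = - (U y * Int (eval (eta R n))) by rewrite Int_eta; ring.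
  apply: hA => //; first exact: ltW.
  move=> z zq; rewrite distrC; apply: hd; rewrite ball_rVE /=.
  apply: le_lt_trans (cball_norm (ltW q0) zq) _.
  by rewrite gt_min; apply/orP; right; lra.
have h2 : `|nconvol n (eta R n) y s - nconvol n (eta R n) y q| <= C * s * (s - q).
  apply: (@mvt_abs _ _ _ _ _ _ qs) => r /andP[qr rs].
    by apply: is_derive_nconvol; [exact: lt_le_trans qr|exact: vanish_eta|exact: vanish_psi|exact: kernel_pair_eta].
  have r0 := lt_le_trans q0 qr.
  have rO : cball y r `<=` Omega.
    by apply: subset_trans sO; apply: cball_mono => //; exact: ltW.
  have D0 := dens_ge0 r0 rO; have D1 := hC y r r0 rO.
  rewrite normrM -[X in _ * X]normrN -/(dens y r) (ger0_norm D0) ger0_norm; last first.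
    by rewrite divr_ge0// exprn_ge0// ltW.
  apply: (@le_trans _ _ (r ^+ 3 / r ^+ n * (C * r ^+ n / r ^+ 2))).
    by apply: ler_wpM2l => //; rewrite divr_ge0// exprn_ge0// ltW.
  have -> : r ^+ 3 / r ^+ n * (C * r ^+ n / r ^+ 2) = C * r.
    by field; rewrite !gt_eqF// exprn_gt0.
  by rewrite ler_wpM2l// ltW.
rewrite -[nconvol n _ y s](subrK (nconvol n (eta R n) y q)) -addrA.
apply: le_trans (ler_normD _ _) _; apply: lerD => //.
by apply: le_trans h2 _; rewrite expr2 mulrA ler_wpM2l ?gerBl ?ltW// mulr_gt0.
Qed.

Lemma convol_crude (C : R) t y s : vanish unitball t -> (forall z, `|eval t z| <= C) -> `|convol U t y s| <= C * Int (fun z => `|U z|).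
Proof.
move=> vt hC; rewrite -IntZ; last exact: intg_abs.
have h := intg_convol y s iU vt.
apply: le_trans (Int_abs h) _; apply: Int_le; [exact: intg_abs|by apply: intgZ; exact: intg_abs|].
by move=> z; rewrite normrM mulrC ler_wpM2r.
Qed.

Lemma der_ddir i v t : eval (der i (ddir v t)) = eval (ddir v (der i t)).
Proof.
apply/funext => x; rewrite der_tsum eval_ddir; apply: eq_bigr => j _ /=.
by rewrite mul0r add0r derC.
Qed.

Lemma ddir_eq v t t' : eval t = eval t' -> eval (ddir v t) = eval (ddir v t').
Proof. by move=> e; apply/funext => x; rewrite !eval_ddir; apply: eq_bigr => i _; rewrite (der_eq i e). Qed.

Lemma der_iter i v k t : eval (der i (iter k (ddir v) t)) = eval (iter k (ddir v) (der i t)).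
Proof. by elim: k => //= k ih; rewrite der_ddir; exact: ddir_eq. Qed.

Lemma vanish_iter v k t : vanish unitball t -> vanish unitball (iter k (ddir v) t).
Proof. by move=> vt; elim: k => //= k ih; apply: vanish_ddir => //; exact: closed_cball. Qed.

Lemma iter_ddir_bound k t : vanish unitball t -> exists2 C : R, 0 < C &
  forall v z, `|eval (iter k (ddir v) t) z| <= C * enorm v ^+ k.
Proof.
elim: k t => [|k ih] t vt.
  have [C C0 hC] := bounded_vanish (@compact_cball _ _ _ _) vt; exists C => // v z.
  by rewrite expr0 mulr1.
have cl := @closed_cball R n 0 1.
have H i : exists C : R, 0 < C /\ forall v z, `|eval (iter k (ddir v) (der i t)) z| <= C * enorm v ^+ k.
  by have [C C0 hC] := ih (der i t) (vanish_der i cl vt); exists C.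
have [C hC] := choice H; exists (1 + \sum_i C i) => [|v z].
  by rewrite ltr_pwDl// sumr_ge0// => i _; have [/ltW] := hC i.
rewrite /= eval_ddir; apply: le_trans (ler_norm_sum _ _ _) _.
apply: (@le_trans _ _ (\sum_i C i * enorm v ^+ k.+1)); last first.
  by rewrite -mulr_suml ler_wpM2r ?lerDr// exprn_ge0// enorm_ge0.
apply: ler_sum => i _; rewrite normrM der_iter exprS mulrCA.
by apply: ler_pM => //; [exact: coord_le_enorm|have [_] := hC i; exact].
Qed.

Lemma kernel_pair_iter N k v t phi : kernel_pair N t phi ->
  kernel_pair (k + N) (iter k (ddir v) t) (iter k (ddir v) phi).
Proof. by move=> h; elim: k => //= k ih; rewrite addSn; exact: kernel_pair_ddir. Qed.

(* Derivatives in y of the mollification at scale s, where x is a point of small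
   density and |y - x| <= s / kappa. *)
Lemma dens_near (C kappa rho epsilon : R) t x y s : 0 < C -> vanish unitball t -> (forall z, `|eval t z| <= C) ->
  0 < kappa <= 1 -> 0 < s -> 4 * s <= kappa * rho -> cball x rho `<=` Omega -> enorm (y - x) <= s / kappa ->
  0 <= epsilon -> (forall S, 0 < S <= rho -> dens x S <= epsilon * S ^+ n / S ^+ 2) ->
  `|bilap U (rescale y s t)| <= C / psi0 * epsilon * (4 / kappa) ^+ n * s ^+ n / s ^+ 2.
Proof.
move=> C0 vt hC /andP[k0 k1] s0 skr rO yx e0 he.
pose S := 4 * s / kappa.
have S0 : 0 < S by rewrite divr_gt0// mulr_gt0.
have Sr : S <= rho by rewrite ler_pdivrMr// [rho * _]mulrC.
have SO : cball x S `<=` Omega.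
  by apply: subset_trans rO; apply: cball_mono; first exact: ltW.
have sk : s <= s / kappa by rewrite ler_pdivlMr// ler_piMr// ltW.
have h := @dominated_dens C t x S y s C0 vt hC s0 S0 SO _.
apply: le_trans (h _) _.
  apply: cball_sub; [exact: ltW|by rewrite divr_ge0// ltW|].
  apply: le_trans (lerD yx sk) _; rewrite /S; lra.
have Cp : 0 <= C / psi0 by rewrite divr_ge0// ltW// psi0_gt0.
rewrite -!mulrA; apply: ler_wpM2l; first exact: ltW.
apply: ler_wpM2l; first by rewrite invr_ge0 ltW// psi0_gt0.
have := he S; rewrite S0 Sr => /(_ isT) hS; apply: le_trans hS _.
have -> : S ^+ n = (4 / kappa) ^+ n * s ^+ n by rewrite -exprMn; congr (_ ^+ _); rewrite /S; ring.
rewrite !mulrA; apply: ler_wpM2l.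
  by rewrite !mulr_ge0 ?exprn_ge0// ?divr_ge0// ltW.
rewrite lef_pV2 ?posrE ?exprn_gt0//; apply: lerXn2r; [exact: ltW|exact: ltW|].
apply: le_trans sk _; rewrite /S; have := divr_gt0 s0 k0; lra.
Qed.

(** At this order the scale derivative is O(epsilon / r^2), so its integral from s to a fixed scale
    is O(epsilon / s) and not a logarithm. The factor m carries the dependence of the kernels on a
    direction, as in |h|^3. *)
Lemma third_order C1 C2 kappa : 0 < C1 -> 0 < C2 -> 0 < kappa <= 1 -> exists2 B2 : R, 0 < B2 &
  forall rho, 0 < rho -> exists2 B1 : R, 0 < B1 &
  forall t phi (m : R) x y s epsilon, kernel_pair (3 + n) t phi -> vanish unitball t -> vanish unitball phi ->
   0 <= m -> (forall z, `|eval t z| <= C1 * m) -> (forall z, `|eval phi z| <= C2 * m) ->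
   0 <= epsilon -> 0 < s -> 4 * s <= kappa * rho -> cball x rho `<=` Omega -> enorm (y - x) <= s / kappa ->
  (forall S, 0 < S <= rho -> dens x S <= epsilon * S ^+ n / S ^+ 2) ->
  `|nconvol (3 + n) t y s| <= m * (B2 * epsilon / s + B1).
Proof.
move=> C10 C20 k01; have /andP[k0 k1] := k01.
have IU : 0 <= Int (fun z => `|U z|) by exact: Int_ge0.
pose B2 := C2 / psi0 * (4 / kappa) ^+ n.
have B20 : 0 < B2 by rewrite mulr_gt0 ?divr_gt0 ?exprn_gt0 ?divr_gt0 ?psi0_gt0.
exists B2 => // rho r0.
(* The largest scale at which [dens_near] applies. There only the L^1 norm of U is used, so B1
   depends on rho while B2 does not. *)
pose s1 := kappa * rho / 4; have s10 : 0 < s1 by rewrite divr_gt0// mulr_gt0.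
pose B1 := s1 ^- (3 + n) * (C1 * Int (fun z => `|U z|)).
have B10 : 0 <= B1 by rewrite mulr_ge0 ?invr_ge0 ?exprn_ge0 ?(ltW s10)// mulr_ge0// ltW.
exists (B1 + 1); first by rewrite ltr_wpDl.
move=> t phi m x y s e kp vt vp m0 h1 h2 e0 s0 skr rO yx he.
have [mz|mnz] := eqVneq m 0.
  have -> : nconvol (3 + n) t y s = 0.
    rewrite /nconvol /convol (_ : (fun z => _) = fun=> 0) ?Int0 ?mulr0//.
    apply/funext => z; have := h1 (s^-1 *: (z - y)); rewrite mz mulr0 => h.
    by rewrite (_ : eval _ _ = 0) ?mulr0//; apply/eqP; rewrite -normr_le0.
  by rewrite normr0 mz mul0r.
have mp : 0 < m by rewrite lt_def mnz.
have ss1 : s <= s1 by rewrite /s1; lra.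
pose E := B2 * e * m.
have E0 : 0 <= E by apply: mulr_ge0 => //; apply: mulr_ge0 => //; exact: ltW.
have Hd : `|nconvol (3 + n) t y s1 - nconvol (3 + n) t y s| <= - E / s1 - - E / s.
  apply: (@mvt_dom _ _ (fun r => r ^+ 3 / r ^+ (3 + n) * bilap U (rescale y r phi))
     (fun r => - E / r) (fun r => E / r ^+ 2) _ _ ss1).
  - by move=> r /andP[sr _]; apply: is_derive_nconvol => //; exact: lt_le_trans sr.
  - move=> r /andP[sr _]; have r_neq : r != 0 by rewrite gt_eqF// (lt_le_trans s0).
    apply: is_derive1_eq (is_derive1_scale (- E) (is_derive1_inv r_neq (is_derive1_id r))) _.
    by rewrite mulN1r mulrNN.
  move=> r /andP[sr rs1]; have rp := lt_le_trans s0 sr.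
  rewrite normrM powB// ger0_norm; last by rewrite invr_ge0 exprn_ge0// ltW.
  have := @dens_near (C2 * m) kappa rho e phi x y r (mulr_gt0 C20 mp) vp h2 k01 rp.
  move=> H; have {}H : `|bilap U (rescale y r phi)| <= C2 * m / psi0 * e * (4 / kappa) ^+ n * r ^+ n / r ^+ 2.
    apply: H => //; first by move: rs1; rewrite /s1; lra.
    by apply: le_trans yx _; rewrite ler_pM2r// invr_gt0.
  apply: le_trans (_ : r ^- n * (C2 * m / psi0 * e * (4 / kappa) ^+ n * r ^+ n / r ^+ 2) <= _).
    by apply: ler_wpM2l => //; rewrite invr_ge0 exprn_ge0// ltW.
  rewrite le_eqVlt; apply/orP; left; apply/eqP; rewrite /E /B2.
  by field; rewrite !gt_eqF ?exprn_gt0 ?psi0_gt0.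
have H1 : `|nconvol (3 + n) t y s1| <= B1 * m.
  rewrite normrM ger0_norm; last by rewrite invr_ge0 exprn_ge0// ltW.
  rewrite /B1 -[leRHS]mulrA ler_wpM2l ?invr_ge0 ?exprn_ge0 ?(ltW s10)//.
  by rewrite mulrAC; exact: (convol_crude y s1 vt h1).
have {}Hd : `|nconvol (3 + n) t y s| <= B1 * m + E / s.
  set a := nconvol _ _ _ _ in Hd H1 *; set b := nconvol _ _ _ _ in Hd *.
  have -> : b = a - (a - b) by ring.
  apply: le_trans (ler_normB _ _) _; apply: lerD => //.
  by apply: le_trans Hd _; rewrite !mulNr opprK gerDr oppr_le0 divr_ge0// ltW.
apply: le_trans Hd _; rewrite mulrDr addrC; apply: lerD.
  by rewrite le_eqVlt; apply/orP; left; apply/eqP; rewrite /E; ring.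
by rewrite mulrC; apply: ler_wpM2l => //; rewrite lerDl.
Qed.
End local_theory.

Ltac pos := repeat first [assumption | exact: psi0_gt0 | exact: c0_gt0 | rewrite invr_gt0
 | apply: exprn_gt0 | apply: mulr_gt0 | by []].

(** * The kernel behind the monotonicity in the scale *)

Section kernel_identities.
Variables (R : realType) (n : nat).
Implicit Types (x e : 'rV[R]_n) (t phi : tm R n).

Lemma lap_eul t x : eval (lap (eul t)) x = eval (eul (lap t)) x + 2 * eval (lap t) x.
Proof.
have e i : eval (der i (eul t)) = eval (Add (eul (der i t)) (der i t)).
  by apply/funext => z; rewrite /= -/(eval (eul (der i t)) z) eul_der subrK.
rewrite eval_lap.
rewrite (eq_bigr (fun i => eval (eul (der i (der i t))) x + 2 * eval (der i (der i t)) x)); last first.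
  move=> i _; rewrite (der_eq i (e i)).
  rewrite -[LHS]/(eval (der i (eul (der i t))) x + eval (der i (der i t)) x).
  by rewrite eul_der; ring.
rewrite big_split/= -mulr_sumr -eval_lap; congr (_ + _).
rewrite eval_eul; under eq_bigr do rewrite eval_eul.
by rewrite exchange_big/=; apply: eq_bigr => j _; rewrite der_tsum mulr_sumr.
Qed.

Lemma lap2_eul t x : eval (lap (lap (eul t))) x = eval (eul (lap (lap t))) x + 4 * eval (lap (lap t)) x.
Proof.
have e : eval (lap (eul t)) = eval (Add (eul (lap t)) (Mul (Cst n 2) (lap t))).
  by apply/funext => z; rewrite lap_eul.
by rewrite (lap_eq e) lapD lapZ lap_eul; ring.
Qed.

(** Delta^2 commutes with the Euler operator up to 4 Delta^2. Thus Delta^2 of a bump may be added to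
    a kernel: its scale derivative is again a pairing of Delta^2 U with a bump. *)
Lemma kernel_pair_lap2 N (c : R) t : N%:R + c = 4 ->
  kernel_pair N (lap (lap t)) (Add (Mul (Cst n c) t) (Mul (Cst n (-1)) (eul t))).
Proof.
move=> Nc x; rewrite lap2D !lap2Z lap2_eul.
have -> : N%:R = 4 - c by rewrite -Nc; ring.
ring.
Qed.

(* For |e|^2 <= 2 the operator tr D^2 - D^2(e, e), corrected by a term with a
   sign, is nonincreasing in the scale along [mono_kernel]. *)
Definition tdd e t : tm R n := Add (lap t) (Mul (Cst n (-1)) (ddir e (ddir e t))).
Definition mono_kernel e : tm R n :=
  Add (Mul (Cst n (-1)) (tdd e (eta R n))) (Mul (Cst n 4) (lap (lap (Cut 2 (tball R n))))).
Definition mono_pot e : tm R n :=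
  Add (Mul (Cst n (-1)) (tdd e (psi R n)))
   (Mul (Cst n 4) (Add (Mul (Cst n (2 - n%:R)) (Cut 2 (tball R n))) (Mul (Cst n (-1)) (eul (Cut 2 (tball R n)))))).

Lemma kernel_pair_tdd N e t phi : kernel_pair N t phi -> kernel_pair (2 + N) (tdd e t) (tdd e phi).
Proof.
move=> h; apply: kernel_pair_add; first by apply: kernel_pair_tsum => i; apply: kernel_pair_der; exact: kernel_pair_der.
by apply: kernel_pair_scale; apply: kernel_pair_ddir; exact: kernel_pair_ddir.
Qed.

Lemma kernel_pair_mono e : kernel_pair (2 + n) (mono_kernel e) (mono_pot e).
Proof.
apply: kernel_pair_add; apply: kernel_pair_scale.
  by apply: kernel_pair_tdd; exact: kernel_pair_eta.
by apply: kernel_pair_lap2; rewrite natrD; ring.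
Qed.

Lemma der_Cut2 i x : eval (der i (Cut 2 (tball R n))) x = - (x ord0 i * eval (F2 R n) x).
Proof. by rewrite der_Cut eval_F2; ring. Qed.

Lemma eval_ddir2_psi e x : eval (ddir e (ddir e (psi R n))) x =
  - 4 * sqn e * eval (Cut 2 (tball R n)) x + 4 * dot e x ^+ 2 * eval (F2 R n) x.
Proof.
pose d : tm R n := Mul (Mul (Cst n (- 4)) (tsum (fun i => Mul (Cst n (e ord0 i)) (Var R i)))) (Cut 2 (tball R n)).
have ed z : eval (tsum (fun i => Mul (Cst n (e ord0 i)) (Var R i))) z = dot e z by rewrite eval_tsum.
have E : eval (ddir e (psi R n)) = eval d.
  apply/funext => z; rewrite eval_ddir -[RHS]/(-4 * eval (tsum (fun i => Mul (Cst n (e ord0 i)) (Var R i))) z * eval (Cut 2 (tball R n)) z).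
  rewrite ed /dot mulr_sumr mulr_suml; apply: eq_bigr => i _.
  by rewrite /psi der_Cut eval_Cut; ring.
rewrite (ddir_eq e E) eval_ddir.
rewrite (eq_bigr (fun i => e ord0 i ^+ 2 * (- 4 * eval (Cut 2 (tball R n)) x) + (e ord0 i * x ord0 i) * (4 * dot e x * eval (F2 R n) x))); last first.
  move=> i _; rewrite -[eval (der i d) x]/((0 * eval (tsum (fun i => Mul (Cst n (e ord0 i)) (Var R i))) x + -4 * eval (der i (tsum (fun i => Mul (Cst n (e ord0 i)) (Var R i)))) x) * eval (Cut 2 (tball R n)) x + -4 * eval (tsum (fun i => Mul (Cst n (e ord0 i)) (Var R i))) x * eval (der i (Cut 2 (tball R n))) x).
  have -> : eval (der i (tsum (fun i => Mul (Cst n (e ord0 i)) (Var R i)))) x = e ord0 i.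
    rewrite der_tsum (bigD1 i)//= eqxx mulr1n big1 ?addr0; first by ring.
    by move=> j /negbTE; rewrite eq_sym => ->; rewrite mulr0n; ring.
  by rewrite ed der_Cut2; ring.
rewrite big_split/= -!mulr_suml -/(sqn e) -/(dot e x); ring.
Qed.

(** The correction is made to cancel the terms n and |x|^2 F2 of Delta psi. What remains is (8 - 4
    |e|^2) times a cutoff plus 4 (e . x)^2 F2, whence the condition on e. *)
Lemma mono_pot_ge0 e x : sqn e <= 2 -> 0 <= eval (mono_pot e) x.
Proof.
move=> e2.
have -> : eval (mono_pot e) x = (8 - 4 * sqn e) * eval (Cut 2 (tball R n)) x + 4 * dot e x ^+ 2 * eval (F2 R n) x.
  rewrite -[LHS]/(-1 * (eval (lap (psi R n)) x + -1 * eval (ddir e (ddir e (psi R n))) x) +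
   4 * ((2 - n%:R) * eval (Cut 2 (tball R n)) x + -1 * eval (eul (Cut 2 (tball R n))) x)).
  rewrite eval_lap_psi eval_ddir2_psi eval_eul -eval_Cut.
  have -> : \sum_i x ord0 i * eval (der i (Cut 2 (tball R n))) x = - sqn x * eval (F2 R n) x.
    rewrite mulNr /sqn mulr_suml -sumrN; apply: eq_bigr => i _; rewrite der_Cut2; ring.
  ring.
apply: addr_ge0; apply: mulr_ge0; rewrite ?F2_ge0//; first by lra.
  by rewrite eval_Cut cutoff_ge0.
by rewrite mulr_ge0// sqr_ge0.
Qed.

Lemma vanish_tdd K e t : closed K -> vanish K t -> vanish K (tdd e t).
Proof.
move=> cK vt; apply: vanish_add; first exact: vanish_lap.
by apply: vanish_mulr; apply: vanish_ddir => //; exact: vanish_ddir.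
Qed.

Lemma vanish_mono_kernel e : vanish (cball 0 1) (mono_kernel e).
Proof.
have cl := @closed_cball R n 0 1.
apply: vanish_add; apply: vanish_mulr; first by apply: vanish_tdd => //; exact: vanish_eta.
by apply: vanish_lap => //; apply: vanish_lap => //; exact: vanish_Cut.
Qed.

Lemma vanish_mono_pot e : vanish (cball 0 1) (mono_pot e).
Proof.
have cl := @closed_cball R n 0 1; have v2 := @vanish_Cut R n 2.
apply: vanish_add; apply: vanish_mulr; first by apply: vanish_tdd => //; exact: vanish_psi.
by apply: vanish_add; apply: vanish_mulr => //; exact: vanish_eul.
Qed.
End kernel_identities.

Opaque eta psi.

(** * Quadratic approximation at points of small density *)

Section approximation.
Variables (R : realType) (n : nat).
Variables (Omega : set 'rV[R]_n) (U : 'rV[R]_n -> R).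
Hypotheses (n_gt0 : (0 < n)%N) (hU : local_min Omega U).
Implicit Types (x y v h e : 'rV[R]_n) (t phi : tm R n) (s r C S kappa rho epsilon : R) (K G : set 'rV[R]_n).
Notation unitball := (cball (0 : 'rV[R]_n) 1).

Let iU : intg U. Proof. by case: hU. Qed.
Let c0p : 0 < c0 R n. Proof. exact: c0_gt0. Qed.

(* Gradient and half the Hessian of the mollification of [U] at scale [s]. *)
Definition mgrad x s : 'rV[R]_n := \row_i (nconvol U (1 + n) (der i (eta R n)) x s / c0 R n).
Definition mhess x s : 'M[R]_n :=
  \matrix_(i, j) (- nconvol U (2 + n) (der i (der j (eta R n))) x s / (2 * c0 R n)).

Definition small_density x rho epsilon :=
  [/\ 0 < rho, cball x rho `<=` Omega, 0 <= epsilon &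
   forall S, 0 < S <= rho -> dens U x S <= epsilon * S ^+ n / S ^+ 2].

Lemma nconvol_ddir N v t y s : vanish unitball t ->
  nconvol U N (ddir v t) y s = \sum_i v ord0 i * nconvol U N (der i t) y s.
Proof.
move=> vt; rewrite /nconvol /ddir convol_tsum//; last first.
  by move=> i; apply: vanish_mulr; apply: vanish_der => //; exact: closed_cball.
rewrite mulr_sumr; apply: eq_bigr => i _; rewrite convol_scale//; last first.
  by apply: vanish_der => //; exact: closed_cball.
by rewrite mulrCA.
Qed.

Lemma nconvol_eq N t t' y s : eval t = eval t' -> nconvol U N t y s = nconvol U N t' y s.
Proof. by move=> e; rewrite /nconvol (convol_eq _ _ _ e). Qed.

Lemma nconvol_add N t t' y s : vanish unitball t -> vanish unitball t' ->
  nconvol U N (Add t t') y s = nconvol U N t y s + nconvol U N t' y s.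
Proof. by move=> v v'; rewrite /nconvol convol_add// mulrDr. Qed.

Lemma nconvol_scale N (c : R) t y s : vanish unitball t -> nconvol U N (Mul (Cst n c) t) y s = c * nconvol U N t y s.
Proof. by move=> v; rewrite /nconvol convol_scale// mulrCA. Qed.

Lemma nconvol_ddir2 N v t y s : vanish unitball t ->
  nconvol U N (ddir v (ddir v t)) y s = \sum_i \sum_j v ord0 i * v ord0 j * nconvol U N (der i (der j t)) y s.
Proof.
move=> vt; have cl := @closed_cball R n 0 1.
rewrite nconvol_ddir; last exact: vanish_ddir.
apply: eq_bigr => i _; rewrite (nconvol_eq _ _ _ (der_ddir i v t)) nconvol_ddir; last exact: vanish_der.
rewrite mulr_sumr; apply: eq_bigr => j _; rewrite mulrA; congr (_ * _).
by apply: nconvol_eq; apply/funext => z; rewrite derC.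
Qed.

Lemma mhess_sym x s : (mhess x s)^T = mhess x s.
Proof.
have e i j : eval (der i (der j (eta R n))) = eval (der j (der i (eta R n))) by apply/funext => z; rewrite derC.
by apply/matrixP => i j; rewrite !mxE (nconvol_eq _ _ _ (e i j)).
Qed.

Lemma is_derive_nconvol_line N t v y s r : 0 < s -> vanish unitball t ->
  is_derive r 1 (fun r : R => nconvol U N t (y + r *: v) s) (- nconvol U (1 + N) (ddir v t) (y + r *: v) s).
Proof.
move=> s0 vt; have h := is_derive1_scale (s ^- N) (@is_derive_convol_dir R n U t y v s r s0 iU vt).
apply: is_derive1_eq h _; rewrite /nconvol exprS; field.
by rewrite !gt_eqF ?exprn_gt0.
Qed.

(** Taylor expansion of the mollification at scale kappa r; U x = 0 disposes of the constant term.
    Mollifying costs kappa^2 r^2, and the remainder is r^3 times the bound epsilon / (kappa r) + B1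
    on third derivatives. Only C1 is independent of kappa. *)
Lemma quad_approx : exists2 C1 : R, 0 < C1 &
  forall kappa, 0 < kappa <= 1 -> exists2 B2 : R, 0 < B2 & forall rho, 0 < rho -> exists2 B1 : R, 0 < B1 &
  forall x r h epsilon, small_density x rho epsilon -> U x = 0 -> 0 < r -> 4 * r <= rho -> enorm h <= r ->
  `|U (x + h) - (dot (mgrad x (kappa * r)) h + quadratic (mhess x (kappa * r)) h)| <=
    (C1 * kappa ^+ 2 + B2 * epsilon + B1 * r) * r ^+ 2.
Proof.
have [Ce Ce0 he] := mollify_close hU n_gt0.
exists (2 * Ce) => [|kappa k01]; first by rewrite mulr_gt0.
have /andP[k0 k1] := k01.
have [A1 A10 a1] := iter_ddir_bound 3 (@vanish_eta R n).
have [A2 A20 a2] := iter_ddir_bound 3 (@vanish_psi R n).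
have [B0 B00 hB0] := third_order hU A10 A20 k01.
exists (B0 / kappa / c0 R n) => [|rho rho0]; first by rewrite !divr_gt0.
have [B B_gt hB'] := hB0 rho rho0.
exists (B / c0 R n) => [|x r h e [_ rO e0 hd] Ux r0 r4 hr]; first by rewrite !divr_gt0.
have hB y (s : R) := hB' _ _ (enorm h ^+ 3) x y s e (kernel_pair_iter 3 h (@kernel_pair_eta R n))
  (vanish_iter h 3 (@vanish_eta R n)) (vanish_iter h 3 (@vanish_psi R n)) (exprn_ge0 3 (enorm_ge0 h)) (a1 h) (a2 h) e0.
set s := kappa * r; have s0 : 0 < s by rewrite mulr_gt0.
have sr : s <= r by rewrite ler_piMl// ltW.
have cl := @closed_cball R n 0 1; have ve := @vanish_eta R n.
pose F k (q : R) := nconvol U (k + n) (iter k (ddir h) (eta R n)) (x + q *: h) s.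
have dF k (q : R) : is_derive q 1 (F k) (- F k.+1 q).
  by apply: is_derive_nconvol_line => //; exact: vanish_iter.
have bd3 q : 0 <= q <= 1 -> `|F 3 q| <= r ^+ 2 * (B0 / kappa * e + B * r).
  move=> /andP[q0 q1]; have yx : enorm (x + q *: h - x) <= r.
    by rewrite addrC addKr enormZ ger0_norm// (le_trans _ hr)// ler_piMl ?enorm_ge0.
  apply: le_trans (hB (x + q *: h) s s0 _ rO _ hd) _.
  - by rewrite /s mulrCA ler_pM2l.
  - by rewrite /s mulrC mulKf// gt_eqF.
  apply: (@le_trans _ _ (r ^+ 3 * (B0 * e / s + B))).
    apply: ler_wpM2r; last by rewrite lerXn2r// nnegrE ?enorm_ge0// ltW.
    by rewrite addr_ge0 ?(ltW B_gt)// divr_ge0 ?mulr_ge0// ltW.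
  by rewrite le_eqVlt; apply/orP; left; apply/eqP; rewrite /s; field; rewrite !gt_eqF.
have := @taylor2 R (F 0) (fun q => - F 1 q) (F 2) (fun q => - F 3 q) _ (fun q _ => dF 0 q) _ (fun q _ => dF 2 q) _.
move=> /(_ (r ^+ 2 * (B0 / kappa * e + B * r))) H.
have {}H : `|F 0 1 - F 0 0 - - F 1 0 - F 2 0 / 2| <= r ^+ 2 * (B0 / kappa * e + B * r).
  apply: H => p p01; last by rewrite normrN; exact: bd3.
  by rewrite -[F 2 p]opprK; apply: is_derive1_opp.
have G1 : `|U (x + h) + F 0 1 / c0 R n| <= Ce * s ^+ 2.
  rewrite /F scale1r; apply: he => //; apply: subset_trans rO; apply: cball_sub; rewrite ?(ltW s0) ?(ltW rho0)//.
  by rewrite [x + h]addrC addrK; lra.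
have G0 : `|F 0 0 / c0 R n| <= Ce * s ^+ 2.
  have := he x s s0; rewrite Ux add0r /F scale0r addr0; apply.
  by apply: subset_trans rO; apply: cball_mono; [exact: ltW|lra].
have E1 : dot (mgrad x s) h = F 1 0 / c0 R n.
  rewrite /F scale0r addr0 /= nconvol_ddir// mulr_suml; apply: eq_bigr => i _; rewrite !mxE; ring.
have E2 : quadratic (mhess x s) h = - (F 2 0 / 2) / c0 R n.
  rewrite /F scale0r addr0 /= nconvol_ddir2// mulNr mulr_suml mulr_suml -sumrN; apply: eq_bigr => i _.
  rewrite mulr_suml mulr_suml -sumrN; apply: eq_bigr => j _.
  by rewrite !mxE; field; rewrite gt_eqF.
rewrite E1 E2.
have alg (a b c d f g : R) : g != 0 ->
    a - (d / g + - (f / 2) / g) = a + b / g - c / g - (b - c - - d - f / 2) / g by move=> g0; field.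
rewrite (alg _ (F 0 1) (F 0 0) _ _ _ (lt0r_neq0 c0p)).
apply: le_trans (ler_normB _ _) _; apply: le_trans (lerD (ler_normB _ _) (lexx _)) _.
have ci : 0 <= (c0 R n)^-1 by rewrite invr_ge0 ltW.
apply: (@le_trans _ _ (Ce * s ^+ 2 + Ce * s ^+ 2 + r ^+ 2 * (B0 / kappa * e + B * r) / c0 R n)).
  apply: lerD; first exact: lerD.
  by rewrite normrM (ger0_norm ci); apply: ler_wpM2r.
rewrite /s; move: (c0 R n)^-1 kappa^-1 => c k; rewrite le_eqVlt; apply/orP; left; apply/eqP; ring.
Qed.

(** The bound epsilon / s on third derivatives is used over a distance r = s / kappa, so the
    variation is of order epsilon at every scale. *)
Lemma mhess_near kappa : 0 < kappa <= 1 -> exists2 B2 : R, 0 < B2 & forall rho, 0 < rho -> exists2 B1 : R, 0 < B1 &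
  forall x y r i j epsilon, small_density x rho epsilon -> 0 < r -> 4 * r <= rho -> enorm (y - x) <= r ->
  `|mhess y (kappa * r) i j - mhess x (kappa * r) i j| <= B2 * epsilon + B1 * r.
Proof.
move=> k01; have /andP[k0 k1] := k01; have cl := @closed_cball R n 0 1.
have vd t i : vanish unitball t -> vanish unitball (der i t) by exact: vanish_der.
have ve2 i j := vd _ i (vd _ j (@vanish_eta R n)); have vp2 i j := vd _ i (vd _ j (@vanish_psi R n)).
have H1 (p : 'I_n * 'I_n) : exists C : R, 0 < C /\ (forall v z, `|eval (iter 1 (ddir v) (der p.1 (der p.2 (eta R n)))) z| <= C * enorm v ^+ 1) /\
   (forall v z, `|eval (iter 1 (ddir v) (der p.1 (der p.2 (psi R n)))) z| <= C * enorm v ^+ 1).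
  have [C C_0 hC] := iter_ddir_bound 1 (ve2 p.1 p.2); have [C' C'_0 hC'] := iter_ddir_bound 1 (vp2 p.1 p.2).
  exists (C + C'); split; first exact: addr_gt0.
  split=> v z; [apply: le_trans (hC v z) _|apply: le_trans (hC' v z) _]; apply: ler_wpM2r; rewrite ?exprn_ge0 ?enorm_ge0//.
    by rewrite lerDl ltW.
  by rewrite lerDr ltW.
have [D hD] := choice H1.
pose C := 1 + \sum_p D p.
have Cp : 0 < C by rewrite ltr_pwDl// sumr_ge0// => p _; have [/ltW] := hD p.
have DC p : D p <= C.
  rewrite /C (bigD1 p)//= addrCA lerDl addr_ge0// sumr_ge0// => q _; by have [/ltW] := hD q.
have [B2 B20 hB] := third_order hU Cp Cp k01.
exists (B2 / kappa / (2 * c0 R n)) => [|rho rho0]; first by pos.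
have [B1 B10 hB1] := hB rho rho0.
exists (B1 / (2 * c0 R n)) => [|x y r i j e [_ rO e0 hd] r0 r4 yx]; first by pos.
set s := kappa * r; have s0 : 0 < s by rewrite mulr_gt0.
set v := y - x.
have [_ [hDe hDp]] := hD (i, j).
have bd (q : R) : 0 <= q <= 1 -> `|- nconvol U (3 + n) (ddir v (der i (der j (eta R n)))) (x + q *: v) s| <= r * (B2 * e / s + B1).
  move=> /andP[q0 q1]; rewrite normrN.
  apply: le_trans (hB1 (ddir v (der i (der j (eta R n)))) (ddir v (der i (der j (psi R n)))) (enorm v) x (x + q *: v) s e _ _ _ (enorm_ge0 v) _ _ e0 s0 _ rO _ hd) _.
  - by apply: kernel_pair_ddir; apply: kernel_pair_der; apply: kernel_pair_der; exact: kernel_pair_eta.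
  - by apply: vanish_ddir => //; exact: ve2.
  - by apply: vanish_ddir => //; exact: vp2.
  - by move=> z; apply: le_trans (hDe v z) _; rewrite expr1; apply: ler_wpM2r; [exact: enorm_ge0|exact: DC].
  - by move=> z; apply: le_trans (hDp v z) _; rewrite expr1; apply: ler_wpM2r; [exact: enorm_ge0|exact: DC].
  - by rewrite /s mulrCA ler_pM2l.
  - rewrite [x + _]addrC addrK enormZ ger0_norm//.
    have -> : s / kappa = r by rewrite /s mulrC mulKf ?gt_eqF.
    by apply: le_trans yx; rewrite ler_piMl ?enorm_ge0.
  - apply: ler_wpM2r => //; rewrite addr_ge0 ?(ltW B10)// divr_ge0 ?mulr_ge0// ltW//.
pose g (q : R) := nconvol U (2 + n) (der i (der j (eta R n))) (x + q *: v) s.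
pose dg (q : R) := - nconvol U (3 + n) (ddir v (der i (der j (eta R n)))) (x + q *: v) s.
have dgE (q : R) : is_derive q 1 g (dg q).
  exact: (is_derive_nconvol_line (2 + n) v x q s0 (ve2 i j)).
have := @mvt_abs R g dg 0 1 (r * (B2 * e / s + B1)) ler01 (fun q _ => dgE q) bd.
rewrite /g.
have yv : x + v = y by rewrite /v addrC subrK.
rewrite scale0r addr0 scale1r yv subr0 mulr1 => H.
have p2 : 0 <= (2 * c0 R n)^-1 by rewrite invr_ge0 mulr_ge0// ltW.
have E (a b : R) : `|- a - - b| = `|a - b| by rewrite opprK addrC distrC.
rewrite !mxE -mulrBl normrM (ger0_norm p2) E.
apply: le_trans (ler_wpM2r p2 H) _.
move: (2 * c0 R n)^-1 => q; rewrite le_eqVlt; apply/orP; left; apply/eqP; rewrite /s; field.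
by rewrite !gt_eqF.
Qed.

(** The powers r^3 / r^(1+n) and r^n / r^2 cancel: the gradient moves in the scale at a speed of
    order epsilon, and its total variation below s is O(epsilon s). *)
Lemma mgrad_evol : exists2 C : R, 0 < C & forall x rho epsilon s s' i, small_density x rho epsilon ->
  0 < s' <= s -> 4 * s <= rho -> `|mgrad x s ord0 i - mgrad x s' ord0 i| <= C * epsilon * s.
Proof.
have cl := @closed_cball R n 0 1.
have [C0 C00 hC0] := iter_ddir_bound 1 (@vanish_psi R n).
exists (C0 / psi0 R * 4 ^+ n / c0 R n) => [|x rho e s s' i [rho0 rO e0 hd] /andP[s'0 ss] s4].
  by pos.
pose v : 'rV[R]_n := delta_mx ord0 i.
have Ei : eval (der i (psi R n)) = eval (ddir v (psi R n)).
  apply/funext => z; rewrite eval_ddir (bigD1 i)//= mxE !eqxx mul1r big1 ?addr0// => j /negbTE ji.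
  by rewrite mxE ji andbF mul0r.
have nv : enorm v = 1.
  rewrite enormE (_ : sqn v = 1) ?sqrtr1// /sqn (bigD1 i)//= mxE !eqxx expr1n big1 ?addr0// => j /negbTE ji.
  by rewrite mxE ji andbF expr0n.
have hC z : `|eval (der i (psi R n)) z| <= C0.
  by have := hC0 v z; rewrite /= -Ei nv expr1 mulr1.
have vd t : vanish unitball t -> vanish unitball (der i t) by exact: vanish_der.
rewrite !mxE -mulrBl normrM (ger0_norm (_ : 0 <= (c0 R n)^-1)) ?invr_ge0 ?(ltW c0p)//.
rewrite [leRHS](_ : _ = C0 / psi0 R * 4 ^+ n * e * s / c0 R n); last by ring.
apply: ler_wpM2r; first by rewrite invr_ge0 ltW.
apply: (@le_trans _ _ (C0 / psi0 R * 4 ^+ n * e * (s - s'))); last first.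
  apply: ler_wpM2l; last by rewrite gerBl ltW.
  by rewrite !mulr_ge0 ?exprn_ge0 ?invr_ge0 ?(ltW C00) ?(ltW (psi0_gt0 R)).
apply: (@mvt_abs _ _ (fun r => r ^+ 3 / r ^+ (1 + n) * bilap U (rescale x r (der i (psi R n)))) _ _ _ ss).
  move=> r /andP[sr _]; apply: (is_derive_nconvol hU); [exact: lt_le_trans sr|apply: vd; exact: vanish_eta|apply: vd; exact: vanish_psi|].
  by apply: kernel_pair_der; exact: kernel_pair_eta.
move=> r /andP[sr rs]; have r0 := lt_le_trans s'0 sr.
have H := @dens_near R n Omega U hU C0 1 rho e (der i (psi R n)) x x r C00 (vd _ (@vanish_psi R n)) hC _ r0 _ rO _ e0 hd.
have {}H : `|bilap U (rescale x r (der i (psi R n)))| <= C0 / psi0 R * e * (4 / 1) ^+ n * r ^+ n / r ^+ 2.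
  apply: H; rewrite ?ltr01 ?lexx//; first by rewrite mul1r; lra.
  by rewrite subrr enorm0 divr_ge0// ltW.
rewrite divr1 in H; rewrite normrM ger0_norm; last by rewrite divr_ge0// exprn_ge0// ltW.
apply: le_trans (ler_wpM2l _ H) _; first by rewrite divr_ge0// exprn_ge0// ltW.
rewrite le_eqVlt; apply/orP; left; apply/eqP; rewrite exprD; field.
by rewrite !gt_eqF ?exprn_gt0 ?psi0_gt0.
Qed.

(** Integrating epsilon / r would give a logarithm of s / s'; the cruder ratio suffices for
    [grad_small]. *)
Lemma mhess_evol : exists2 C : R, 0 < C & forall x rho epsilon s s' i j, small_density x rho epsilon ->
  0 < s' <= s -> 4 * s <= rho -> `|mhess x s i j - mhess x s' i j| <= C * epsilon * (s / s').
Proof.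
have cl := @closed_cball R n 0 1.
have vd t i : vanish unitball t -> vanish unitball (der i t) by exact: vanish_der.
have vp2 i j := vd _ i (vd _ j (@vanish_psi R n)).
have ve2 i j := vd _ i (vd _ j (@vanish_eta R n)).
have H0 (p : 'I_n * 'I_n) : exists C : R, 0 < C /\ forall z, `|eval (der p.1 (der p.2 (psi R n))) z| <= C.
  by have [C C_gt hC] := bounded_vanish (@compact_cball _ _ _ _) (vp2 p.1 p.2); exists C.
have [D hD] := choice H0.
pose C0 := 1 + \sum_p D p.
have C00 : 0 < C0 by rewrite ltr_pwDl// sumr_ge0// => p _; have [/ltW] := hD p.
have hC i j z : `|eval (der i (der j (psi R n))) z| <= C0.
  have [_ /(_ z) h] := hD (i, j); apply: le_trans h _.
  rewrite /C0 (bigD1 (i, j))//= addrCA lerDl addr_ge0// sumr_ge0// => p _; by have [/ltW] := hD p.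
exists (C0 / psi0 R * 4 ^+ n / (2 * c0 R n)) => [|x rho e s s' i j [rho0 rO e0 hd] /andP[s'0 ss] s4].
  by pos.
have p2 : 0 <= (2 * c0 R n)^-1 by rewrite invr_ge0 mulr_ge0// ltW.
have E (a b : R) : `|- a - - b| = `|a - b| by rewrite opprK addrC distrC.
rewrite !mxE -mulrBl normrM (ger0_norm p2) E.
rewrite [leRHS](_ : _ = C0 / psi0 R * 4 ^+ n * e * (s / s') / (2 * c0 R n)); last by ring.
apply: ler_wpM2r => //.
have Kp : 0 <= C0 / psi0 R * 4 ^+ n * e.
  by rewrite !mulr_ge0 ?exprn_ge0 ?invr_ge0 ?(ltW C00) ?(ltW (psi0_gt0 R)).
apply: (@le_trans _ _ (C0 / psi0 R * 4 ^+ n * e / s' * (s - s'))); last first.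
  rewrite -mulrA; apply: ler_wpM2l => //.
  by rewrite mulrC; apply: ler_wpM2r; [rewrite invr_ge0 ltW|rewrite gerBl ltW].
apply: (@mvt_abs _ _ (fun r => r ^+ 3 / r ^+ (2 + n) * bilap U (rescale x r (der i (der j (psi R n))))) _ _ _ ss).
  move=> r /andP[sr _]; apply: (is_derive_nconvol hU); [exact: lt_le_trans sr|exact: ve2|exact: vp2|].
  by apply: kernel_pair_der; apply: kernel_pair_der; exact: kernel_pair_eta.
move=> r /andP[sr rs]; have r0 := lt_le_trans s'0 sr.
have H := @dens_near R n Omega U hU C0 1 rho e (der i (der j (psi R n))) x x r C00 (vp2 i j) (hC i j) _ r0 _ rO _ e0 hd.
have {}H : `|bilap U (rescale x r (der i (der j (psi R n))))| <= C0 / psi0 R * e * (4 / 1) ^+ n * r ^+ n / r ^+ 2.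
  apply: H; rewrite ?ltr01 ?lexx//; first by rewrite mul1r; lra.
  by rewrite subrr enorm0 divr_ge0// ltW.
rewrite divr1 in H; rewrite normrM ger0_norm; last by rewrite divr_ge0// exprn_ge0// ltW.
apply: le_trans (ler_wpM2l _ H) _; first by rewrite divr_ge0// exprn_ge0// ltW.
rewrite (_ : r ^+ 3 / r ^+ (2 + n) * _ = C0 / psi0 R * 4 ^+ n * e / r); last first.
  by rewrite exprD; field; rewrite !gt_eqF ?exprn_gt0 ?psi0_gt0.
by apply: ler_wpM2l => //; rewrite lef_pV2.
Qed.

Lemma nconvol_tdd e x s : nconvol U (2 + n) (tdd e (eta R n)) x s =
  - (2 * c0 R n) * (\tr (mhess x s) - quadratic (mhess x s) e).
Proof.
have cl := @closed_cball R n 0 1; have ve := @vanish_eta R n.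
have v2 : vanish unitball (ddir e (ddir e (eta R n))) by apply: vanish_ddir => //; exact: vanish_ddir.
have cn : c0 R n != 0 by rewrite gt_eqF.
rewrite nconvol_add; [|exact: vanish_lap|exact: vanish_mulr].
rewrite nconvol_scale// nconvol_ddir2// mulN1r mulrBr; congr (_ + _).
  rewrite /nconvol convol_tsum//; last by move=> i; apply: vanish_der => //; exact: vanish_der.
  rewrite /mxtrace !mulr_sumr; apply: eq_bigr => i _; rewrite mxE -/(nconvol _ _ _ _ _); by field.
rewrite /quadratic mulr_sumr -sumrN -sumrN; apply: eq_bigr => i _.
rewrite mulr_sumr -!sumrN; apply: eq_bigr => j _; rewrite !mxE; by field.
Qed.

(** Along [mono_kernel] the scale derivative pairs Delta^2 U with the nonnegative [mono_pot], so it
    is nonpositive. The correction has a sign at scale s' and is controlled by the density at scale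
    s. This one-sided estimate stands in for a bound on the Hessian. *)
Lemma mhess_mono : exists2 C : R, 0 < C & forall e x s s', sqn e <= 2 -> 0 < s' <= s -> cball x (2 * s) `<=` Omega ->
  \tr (mhess x s) - quadratic (mhess x s) e - C * (s ^+ 2 / s ^+ n * dens U x (2 * s)) <=
  \tr (mhess x s') - quadratic (mhess x s') e.
Proof.
have cl := @closed_cball R n 0 1.
have v2 := @vanish_Cut R n 2.
have [A A0 hA] := bounded_vanish (@compact_cball _ _ _ _) v2.
exists (4 * (A / psi0 R) / (2 * c0 R n)) => [|e x s s' e2 /andP[s'0 ss] sO].
  by pos.
have s0 := lt_le_trans s'0 ss.
have vl2 : vanish unitball (lap (lap (Cut 2 (tball R n)))) by apply: vanish_lap => //; exact: vanish_lap.
have vtd : vanish unitball (tdd e (eta R n)) by apply: vanish_tdd => //; exact: vanish_eta.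
pose G r := 2 * c0 R n * (\tr (mhess x r) - quadratic (mhess x r) e).
have ME r : 0 < r -> nconvol U (2 + n) (mono_kernel e) x r = G r + 4 * (r ^+ 2 / r ^+ n * bilap U (rescale x r (Cut 2 (tball R n)))).
  move=> r0; rewrite nconvol_add; [|exact: vanish_mulr|exact: vanish_mulr].
  rewrite !nconvol_scale// nconvol_tdd mulN1r mulNr opprK; congr (_ + _ * _).
  rewrite bilap_rescale /nconvol /convol -!IntZ; last first.
  - rewrite (_ : (fun z => _) = (fun z => r ^- 4 * (U z * eval (lap (lap (Cut 2 (tball R n)))) (r^-1 *: (z - x))))).
      by apply: intgZ; exact: intg_convol.
    by apply/funext => z; rewrite mulrCA.
  - exact: intg_convol.
  congr Int; apply/funext => z.
  have -> : r ^- (2 + n) = r ^+ 2 / r ^+ n * r ^- 4 by rewrite exprD; field; rewrite !gt_eqF ?exprn_gt0.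
  by move: (eval _ _) (U z) => a b; ring.
have Tle r : 0 < r -> r <= s -> bilap U (rescale x r (Cut 2 (tball R n))) <= 0.
  move=> r0 rs; apply: (bilap_le0 hU (@compact_cball _ _ x r)).
  - by apply: subset_trans sO; apply: cball_mono; [exact: ltW|lra].
  - exact: vanish_rescale.
  - by move=> z; rewrite eval_rescale eval_Cut cutoff_ge0.
have mono : nconvol U (2 + n) (mono_kernel e) x s - nconvol U (2 + n) (mono_kernel e) x s' <= 0 * (s - s').
  apply: (@mvt_le _ _ (fun r => r ^+ 3 / r ^+ (2 + n) * bilap U (rescale x r (mono_pot e))) _ _ _ ss) => r /andP[sr rs].
    apply: (is_derive_nconvol hU); [exact: lt_le_trans sr|exact: vanish_mono_kernel|exact: vanish_mono_pot|exact: kernel_pair_mono].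
  have r0 := lt_le_trans s'0 sr.
  apply: mulr_ge0_le0; first by rewrite divr_ge0// exprn_ge0// ltW.
  apply: (bilap_le0 hU (@compact_cball _ _ x r)).
  - by apply: subset_trans sO; apply: cball_mono; [exact: ltW|lra].
  - by apply: vanish_rescale => //; exact: vanish_mono_pot.
  - by move=> z; rewrite eval_rescale mono_pot_ge0.
rewrite mul0r !ME// subr_le0 in mono.
have s2 : 0 < 2 * s by rewrite mulr_gt0.
have D := @dominated_dens R n Omega U hU A (Cut 2 (tball R n)) x (2 * s) x s A0 v2 hA s0 s2 sO.
have {}D : `|bilap U (rescale x s (Cut 2 (tball R n)))| <= A / psi0 R * dens U x (2 * s).
  by apply: D; rewrite mulrC mulKf//; apply: subset_refl.
have q0 : 0 <= s ^+ 2 / s ^+ n by rewrite divr_ge0// exprn_ge0// ltW.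
have D' : - (s ^+ 2 / s ^+ n * bilap U (rescale x s (Cut 2 (tball R n)))) <= s ^+ 2 / s ^+ n * (A / psi0 R * dens U x (2 * s)).
  by rewrite -mulrN; apply: ler_wpM2l => //; move: D; rewrite ler_norml => /andP[h _]; rewrite lerNl.
have D'' : s' ^+ 2 / s' ^+ n * bilap U (rescale x s' (Cut 2 (tball R n))) <= 0.
  by apply: mulr_ge0_le0; [rewrite divr_ge0// exprn_ge0// ltW|exact: Tle].
have c2 : 0 < 2 * c0 R n by rewrite mulr_gt0.
have key : G s - 4 * (s ^+ 2 / s ^+ n * (A / psi0 R * dens U x (2 * s))) <= G s'.
  move: mono D' D''; move: (G s) (G s') (_ * bilap U (rescale x s _)) (_ * bilap U (rescale x s' _)).
  by move: (_ * (A / _ * _)) => a b c d q; lra.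
rewrite -(ler_pM2l c2) [leLHS]mulrBr; apply: le_trans key; rewrite lerD2l lerN2.
move: (dens _ _ _) (s ^+ 2 / s ^+ n) (A / _) => a b c.
rewrite (_ : 2 * c0 R n * _ = (2 * c0 R n / (2 * c0 R n)) * (4 * (b * (c * a)))); last by ring.
by rewrite divff ?mul1r ?gt_eqF.
Qed.
End approximation.

(** * Quadratic forms *)

Section quadratic_forms.
Variables (R : realType) (n : nat).
Implicit Types (x y z h : 'rV[R]_n) (a b : 'M[R]_n) (c r : R).

Definition bil a x y : R := \sum_(i < n) \sum_(j < n) a i j * x ord0 i * y ord0 j.

Lemma bil_quadratic a x : bil a x x = quadratic a x. Proof. by []. Qed.

Lemma bilC a x y : a^T = a -> bil a x y = bil a y x.
Proof.
move=> aT; rewrite /bil exchange_big/=; apply: eq_bigr => i _; apply: eq_bigr => j _.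
by rewrite -{1}aT mxE mulrAC.
Qed.

Lemma bilDl a x y z : bil a (x + y) z = bil a x z + bil a y z.
Proof.
rewrite -big_split; apply: eq_bigr => i _; rewrite -big_split; apply: eq_bigr => j _.
by rewrite !mxE /=; ring.
Qed.

Lemma bilZl a c x z : bil a (c *: x) z = c * bil a x z.
Proof.
rewrite mulr_sumr; apply: eq_bigr => i _; rewrite mulr_sumr; apply: eq_bigr => j _.
by rewrite !mxE; ring.
Qed.

Lemma bilDr a x y z : bil a z (x + y) = bil a z x + bil a z y.
Proof.
rewrite -big_split; apply: eq_bigr => i _; rewrite -big_split; apply: eq_bigr => j _.
by rewrite !mxE /=; ring.
Qed.

Lemma bilZr a c x z : bil a z (c *: x) = c * bil a z x.
Proof.
rewrite mulr_sumr; apply: eq_bigr => i _; rewrite mulr_sumr; apply: eq_bigr => j _.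
by rewrite !mxE; ring.
Qed.

Lemma quadraticD a x y : a^T = a -> quadratic a (x + y) = quadratic a x + 2 * bil a x y + quadratic a y.
Proof. by move=> aT; rewrite -!bil_quadratic !bilDl !bilDr (bilC y x aT); ring. Qed.

Lemma quadraticZ a c x : quadratic a (c *: x) = c ^+ 2 * quadratic a x.
Proof. by rewrite -!bil_quadratic bilZl bilZr; ring. Qed.

Lemma quadratic0 a : quadratic a 0 = 0.
Proof. by rewrite -(scale0r 0) quadraticZ expr0n mul0r. Qed.

(** Polarisation gives the bound M (|x|^2 + |y|^2) / 2; rescaling x and y to a common norm, which
    preserves the left-hand side, improves it to M |x| |y|. *)
Lemma bil_bound a M x y : a^T = a -> 0 <= M -> (forall z, `|quadratic a z| <= M * sqn z) ->
  `|bil a x y| <= M * (enorm x * enorm y).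
Proof.
move=> aT M0 hM.
have H x' y' : `|bil a x' y'| <= M / 2 * (sqn x' + sqn y').
  have E : 4 * bil a x' y' = quadratic a (x' + y') - quadratic a (x' - y').
    by rewrite -(scaleN1r y') !quadraticD// bilZr quadraticZ; ring.
  have E2 : sqn (x' + y') + sqn (x' - y') = 2 * (sqn x' + sqn y').
    by rewrite !sqnD -(scaleN1r y') dotZr sqnZ; ring.
  have h4 : `|4 * bil a x' y'| <= M * (2 * (sqn x' + sqn y')).
    rewrite E -E2 mulrDr; apply: le_trans (ler_normB _ _) _; exact: lerD.
  by rewrite normrM ger0_norm// in h4; lra.
have [x0|x0] := eqVneq (enorm x) 0.
  by rewrite (enorm_eq0 x0) -(scale0r 0) bilZl mul0r normr0 mulr_ge0// mulr_ge0// enorm_ge0.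
have [y0|y0] := eqVneq (enorm y) 0.
  by rewrite (enorm_eq0 y0) -(scale0r 0) bilZr mul0r normr0 mulr_ge0// mulr_ge0// enorm_ge0.
have xp : 0 < enorm x by rewrite lt_def x0 enorm_ge0.
have yp : 0 < enorm y by rewrite lt_def y0 enorm_ge0.
have := H (Num.sqrt (enorm y / enorm x) *: x) (Num.sqrt (enorm x / enorm y) *: y).
rewrite bilZl bilZr !sqnZ !sqr_sqrtr ?divr_ge0 ?enorm_ge0// mulrA -sqrtrM ?divr_ge0 ?enorm_ge0//.
have -> : enorm y / enorm x * (enorm x / enorm y) = 1 by field; rewrite x0 y0.
rewrite sqrtr1 mul1r -!sqr_enorm.
by rewrite [leRHS](_ : _ = M * (enorm x * enorm y))//; field; rewrite x0 y0.
Qed.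

Lemma quadratic_lip a M x y : a^T = a -> 0 <= M -> (forall z, `|quadratic a z| <= M * sqn z) ->
  `|quadratic a x - quadratic a y| <= M * (enorm (x - y) * enorm (x + y)).
Proof.
move=> aT M0 hM; have <- : bil a (x - y) (x + y) = quadratic a x - quadratic a y.
  by rewrite -(scaleN1r y) bilDl !bilDr !bilZl (bilC y x aT) !bil_quadratic; ring.
exact: bil_bound.
Qed.

Lemma continuous_quadratic a : continuous (quadratic a).
Proof.
pose t : tm R n := tsum (fun i => tsum (fun j => Mul (Mul (Cst n (a i j)) (Var R i)) (Var R j))).
rewrite (_ : quadratic a = eval t); first exact: continuous_eval.
by apply/funext => x; rewrite eval_tsum; apply: eq_bigr => i _; rewrite eval_tsum.
Qed.

Lemma quadratic_max a : exists2 z, enorm z <= 1 & forall x, `|quadratic a x| <= `|quadratic a z| * sqn x.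
Proof.
have c1 : {within cball (0 : 'rV[R]_n) 1, continuous (fun x => `|quadratic a x|)}.
  apply: continuous_subspaceT => x; apply: (@continuous_comp _ _ _ (quadratic a) (@Num.norm R R)).
    exact: continuous_quadratic.
  exact: norm_continuous.
have ne : cball (0 : 'rV[R]_n) 1 !=set0 by exists 0; exact: cball_self.
have [z z1 hz] := compact_EVT_max ne (@compact_cball R n 0 1) c1.
rewrite inE in z1; have /cballP := z1 => /(_ ler01); rewrite subr0 => z1'.
exists z => // x; have [x0|x0] := eqVneq (enorm x) 0.
  by rewrite (enorm_eq0 x0) quadratic0 normr0 mulr_ge0// sqn_ge0.
have xp : 0 < enorm x by rewrite lt_def x0 enorm_ge0.
have := hz ((enorm x)^-1 *: x); rewrite inE => h.
have {}h : `|quadratic a ((enorm x)^-1 *: x)| <= `|quadratic a z|.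
  by apply: h; apply/cballP => //; rewrite subr0 enormZ gtr0_norm ?invr_gt0// mulVf.
rewrite quadraticZ normrM ger0_norm ?sqr_ge0// exprVn ler_pdivrMl ?exprn_gt0// in h.
by rewrite -sqr_enorm mulrC.
Qed.

(** Let M be the maximum of |a| on the unit ball, attained at z. Within r / 4 of (3 r / 4) z the
    form differs by at most M (r / 4) (7 r / 4) = 7 M r^2 / 16 from its value there, which is 9 M
    r^2 / 16 in absolute value. *)
Lemma P2_hole p x0 r : P2 p -> 0 < r -> exists2 y, enorm (y - x0) <= 3 / 4 * r &
  forall z, enorm (z - y) < r / 4 -> p (z - x0) <> 0.
Proof.
move=> [[a [aT ->]] hN] r0.
have [z z1 hz] := quadratic_max a.
have M0 : 0 < `|quadratic a z|.
  rewrite normr_gt0; apply/eqP => e.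
  have q0 x : quadratic a x = 0 by apply/eqP; rewrite -normr_le0; have := hz x; rewrite e normr0 mul0r.
  move: hN; rewrite (_ : EFin \o _ = cst 0%E) ?Lnorm0//; first by move=> [] /eqP; rewrite eq_sym oner_eq0.
  by apply/funext => x /=; rewrite patchE; case: ifP => // _; rewrite q0.
exists (x0 + (3 / 4 * r) *: z).
  have q0 : 0 <= 3 / 4 * r by rewrite mulr_ge0// ltW.
  by rewrite addrC addKr enormZ ger0_norm// ler_piMr.
move=> w hw qw.
pose d := w - (x0 + (3 / 4 * r) *: z).
have wE : w - x0 = (3 / 4 * r) *: z + d by apply/rowP => i; rewrite !mxE; ring.
have := quadratic_lip (w - x0) ((3 / 4 * r) *: z) aT (ltW M0) hz.
rewrite qw sub0r normrN quadraticZ normrM ger0_norm ?sqr_ge0//.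
have nd : enorm d < r / 4 by [].
have n1 : enorm (w - x0 - (3 / 4 * r) *: z) <= r / 4 by rewrite wE addrC addKr ltW.
have nz : enorm ((3 / 4 * r) *: z) <= 3 / 4 * r.
  by rewrite enormZ ger0_norm ?ler_piMr// mulr_ge0// ltW.
have n2 : enorm (w - x0 + (3 / 4 * r) *: z) <= 7 / 4 * r.
  rewrite wE; apply: le_trans (enormD _ _) _; apply: le_trans (lerD (enormD _ _) (lexx _)) _; lra.
have n3 : enorm (w - x0 - (3 / 4 * r) *: z) * enorm (w - x0 + (3 / 4 * r) *: z) <= r / 4 * (7 / 4 * r).
  by apply: ler_pM => //; exact: enorm_ge0.
move=> h; have := le_trans h (ler_wpM2l (ltW M0) n3).
rewrite mulrC ler_pM2l//; have := exprn_gt0 2 r0; rewrite exprMn expr2; nra.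
Qed.
End quadratic_forms.

(** * Porosity in the Euclidean norm and vanishing flat points *)

Section porosity.
Variables (R : realType) (n : nat).
Notation leb := (@lebesgue_rV R n).
Implicit Types (x y z : 'rV[R]_n) (r c : R) (E F : set 'rV[R]_n).

Lemma euclid_porous_negligible E c : 0 < c ->
  (forall x, E x -> forall rho : R, 0 < rho -> exists r y, [/\ 0 < r < rho, enorm (y - x) <= r &
     forall z, E z -> c * r <= enorm (z - y)]) ->
  leb.-negligible E.
Proof.
move=> c0 h; pose c' := c / (n.+1%:R * (1 + c)).
have n1 : 1 <= n.+1%:R :> R by rewrite ler1n.
have d0 : 0 < n.+1%:R * (1 + c) by rewrite mulr_gt0// addr_gt0.
have c'1 : 0 < c' < 1.
  apply/andP; split; first by rewrite divr_gt0.
  rewrite ltr_pdivrMr// mul1r; apply: (@lt_le_trans _ _ (1 + c)); first by rewrite ltrDr.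
  by rewrite ler_peMl// addr_ge0// ltW.
apply: (porous_negligible c'1) => x Ex rho rho0.
have [r [y [/andP[r0 rr] yx hz]]] := h x Ex rho rho0.
exists r, y; split; [by rewrite r0|exact: le_trans (norm_le_enorm _) yx|].
move=> z Ez; have := le_trans (hz z Ez) (enorm_le_norm _) => h1.
have : c' * r <= c * r / n.+1%:R.
  rewrite /c' [leRHS]mulrAC; apply: ler_wpM2r; first exact: ltW.
  apply: ler_wpM2l; first exact: ltW.
  by rewrite lef_pV2 ?posrE// ler_peMr// lerDl ltW.
move/le_trans; apply; rewrite ler_pdivrMr// [leRHS]mulrC; apply: le_trans h1 _.
by rewrite ler_wpM2r// ler_nat.
Qed.

Lemma HD_lt E F r a : (HD E F < r%:E)%E -> E a -> exists2 b, F b & enorm (a - b) < r.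
Proof.
rewrite /HD gt_max => /andP[h _] Ea.
have : (dist a F < r%:E)%E by apply: le_lt_trans h; apply: ereal_sup_ubound; exists a.
by move=> /ereal_inf_lt[_ [b Fb <-]]; rewrite lte_fin => hb; exists b.
Qed.

(** The polynomial has no zero in a ball of radius r / 4, and F stays within r / 8 of the zero set,
    so the ball of half that radius contains no point of F. *)
Lemma vanishing_flat_negligible F E : (forall x, E x -> F x /\ vanishing_rank2_flat F x) -> leb.-negligible E.
Proof.
move=> EF; have c8 : 0 < 8^-1 :> R by [].
apply: (euclid_porous_negligible c8) => x /[dup] Ex /EF[Fx [delta [r [r0 d0 rl hk]]]] rho rho0.
have [k [dk rk]] : exists k, delta k < 8^-1 /\ r k < rho.
  have A : \forall k \near \oo, delta k < 8^-1 by apply: (cvgr_lt _ d0).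
  have B : \forall k \near \oo, r k < rho by apply: (cvgr_lt _ rl).
  near \oo => k; exists k; split; near: k; [exact: A|exact: B].
have rk0 := r0 k.
have : (rank2_distance F (r k) x < (r k / 8)%:E)%E.
  by apply: le_lt_trans (hk k) _; rewrite lte_fin mulrC ltr_pM2l.
move=> /ereal_inf_lt[_ [p Pp <-]] hHD.
have [y yx hy] := P2_hole x Pp rk0.
exists (r k), y; split; [by rewrite rk0|apply: le_trans yx _; lra|].
move=> z /EF[Fz _]; rewrite leNgt; apply/negP => zy.
have Bz : eball x (r k) z.
  rewrite /eball /=; apply: le_lt_trans (enorm_tri z y x) _; lra.
have [s [ps _] zs] := HD_lt hHD (conj Fz Bz).
apply: (hy s) ps; apply: le_lt_trans (enorm_tri s z y) _.
by rewrite enormB; lra.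
Unshelve. all: by end_near.
Qed.
End porosity.

(** * Nondegenerate free boundary points *)

Section free_boundary.
Variables (R : realType) (n : nat).
Notation leb := (@lebesgue_rV R n).
Variables (Omega : set 'rV[R]_n) (U : 'rV[R]_n -> R).
Hypotheses (n_gt0 : (0 < n)%N) (hU : local_min Omega U).
Implicit Types (x y z v h e : 'rV[R]_n) (t phi : tm R n) (s r c C M S kappa rho epsilon : R) (K G : set 'rV[R]_n).
Let fb := boundary [set x | 0 < U x].

Let iU : intg U. Proof. by case: hU. Qed.
Let c0p : 0 < c0 R n. Proof. exact: c0_gt0. Qed.

Lemma near_pos (f : 'rV[R]_n -> R) x : {for x, continuous f} -> 0 < f x -> \forall z \near x, 0 < f z.
Proof.
by move=> c f0; have := c _ (open_nbhs_nbhs (conj (@open_gt R 0) f0)).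
Qed.

Lemma fb_zero x : fb x -> Omega x -> U x = 0.
Proof.
move=> [cl nint] Ox; have [_ _ cU _ _] := hU; have cx := cU x Ox.
have [u0|u0|//] := ltgtP (U x) 0.
  have cN : {for x, continuous (fun z => - U z)} by apply: continuousN.
  have /cl[z [/= z1 z2]] := near_pos cN (ltac:(by rewrite oppr_gt0) : 0 < - U x).
  by move: z1 z2; rewrite oppr_gt0 => /lt_trans h /h; rewrite ltxx.
by exfalso; apply: nint; exact: near_pos.
Qed.

Lemma fb_pos x : fb x -> forall r : R, 0 < r -> exists2 z, enorm (z - x) < r & 0 < U z.
Proof.
move=> [cl _] r r0; have : nbhs x (eball x r).
  by apply: open_nbhs_nbhs; split; [exact: open_eball|rewrite /eball/= subrr enorm0].
by move=> /cl[z [/= z1 z2]]; exists z.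
Qed.

Lemma nconvol_lip : exists2 A : R, 0 < A & forall y y' s r M, 0 < s -> 0 <= M -> enorm (y' - y) <= r ->
  (forall z, cball y (r + s) z -> `|U z| <= M) ->
  `|nconvol U n (eta R n) y' s - nconvol U n (eta R n) y s| <= A * M / s * enorm (y' - y).
Proof.
have cl := @closed_cball R n 0 1; have ve := @vanish_eta R n.
have H0 i : exists C : R, 0 < C /\ forall U y s (e : R), 0 < s -> intg U -> 0 <= e -> (forall z, cball y s z -> `|U z| <= e) ->
    `|convol U (der i (eta R n)) y s| <= C * e * s ^+ n.
  by have [C C0 hC] := convol_bound (vanish_der i cl ve); exists C.
have [D hD] := choice H0.
exists (1 + \sum_i D i) => [|y y' s r M s0 M0 yr hM].
  by rewrite ltr_pwDl// sumr_ge0// => i _; have [/ltW] := hD i.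
set v := y' - y; have r0 : 0 <= r := le_trans (enorm_ge0 _) yr.
have hX i q : 0 <= q <= 1 -> `|nconvol U (1 + n) (der i (eta R n)) (y + q *: v) s| <= D i * (M / s).
  move=> /andP[q0 q1]; have [Di hDi] := hD i.
  have h := hDi U (y + q *: v) s M s0 iU M0 _.
  rewrite /nconvol normrM ger0_norm ?invr_ge0 ?exprn_ge0 ?(ltW s0)//.
  rewrite ler_pdivrMl ?exprn_gt0//; apply: le_trans (h _) _; last first.
    rewrite le_eqVlt; apply/orP; left; apply/eqP; rewrite exprD; field; by rewrite gt_eqF.
  move=> z zs; apply: hM; move: z zs; apply: cball_sub; rewrite ?addr_ge0 ?(ltW s0)//.
  by rewrite lerD2r addrC addKr enormZ ger0_norm// (le_trans _ yr)// ler_piMl ?enorm_ge0.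
have F (q : R) : is_derive q 1 (fun q : R => nconvol U n (eta R n) (y + q *: v) s) (- nconvol U (1 + n) (ddir v (eta R n)) (y + q *: v) s).
  exact: (is_derive_nconvol_line hU).
have := @mvt_abs R _ _ 0 1 ((1 + \sum_i D i) * M / s * enorm v) ler01 (fun q _ => F q).
have yv : y + v = y' by rewrite /v addrC subrK.
rewrite scale0r addr0 scale1r subr0 mulr1 yv; apply => q q01.
rewrite normrN (nconvol_ddir hU)//; apply: le_trans (ler_norm_sum _ _ _) _.
apply: (@le_trans _ _ (\sum_i D i * (M / s) * enorm v)).
  apply: ler_sum => i _; rewrite normrM mulrC; apply: ler_pM => //; [exact: hX|exact: coord_le_enorm].
rewrite -!mulr_suml -mulrA -!(mulrA (_ + _)); apply: ler_wpM2r; last by rewrite lerDr.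
by rewrite mulr_ge0 ?divr_ge0 ?enorm_ge0 ?(ltW s0).
Qed.

Definition nondegenerate c x := exists2 r1 : R, 0 < r1 & forall r, 0 < r < r1 ->
  exists2 y, enorm (y - x) < r & c * r ^+ 2 < `|U y|.

Lemma cball_max x r : 0 <= r -> cball x r `<=` Omega ->
  exists2 z, cball x r z & forall w, cball x r w -> `|U w| <= `|U z|.
Proof.
move=> r0 rO; have [oO _ cU _ _] := hU.
have c1 : {within cball x r, continuous (fun x => `|U x|)}.
  apply: continuous_in_subspaceT => w /[!inE] /rO Ow.
  by apply: (@continuous_comp _ _ _ U (@Num.norm R R)); [exact: cU|exact: norm_continuous].
have ne : cball x r !=set0 by exists x; exact: cball_self.
have [z z1 hz] := compact_EVT_max ne (@compact_cball R n x r) c1.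
by exists z => [|w ww]; [rewrite inE in z1|apply: hz; rewrite inE].
Qed.

(** If the maximum of |U| fell by more than the factor 8 at each halving of the radius, it would be
    O(8^-k) at radius r0 / 2^k, eventually below the lower bound c r0^2 / 4^k. *)
Lemma doubling_scale c x rho : 0 < c -> 0 < rho -> cball x rho `<=` Omega -> nondegenerate c x ->
  exists r M, [/\ 0 < r, 2 * r <= rho, c * r ^+ 2 <= M, (exists2 z, cball x r z & `|U z| = M) &
    forall w, cball x (2 * r) w -> `|U w| <= 8 * M].
Proof.
move=> c0 rho0 rO [r1 r10 hr1].
pose r0 := Num.min rho (r1 / 2) / 2.
have r00 : 0 < r0 by rewrite divr_gt0// lt_min rho0 divr_gt0.
have r0r : 2 * r0 <= rho by rewrite /r0 mulrC divfK// ge_min lexx.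
have r0r1 : r0 < r1.
  have : Num.min rho (r1 / 2) <= r1 / 2 by rewrite ge_min lexx orbT.
  by rewrite /r0; lra.
pose q k := r0 / 2 ^+ k.
have q0 k : 0 < q k by rewrite divr_gt0// exprn_gt0.
have qr k : q k <= r0 by rewrite ler_pdivrMr ?exprn_gt0// ler_peMr ?(ltW r00)// exprn_ege1// ler1n.
have sub k : cball x (2 * q k) `<=` Omega.
  apply: subset_trans rO; apply: cball_mono; first by rewrite mulr_ge0// ltW.
  by apply: le_trans r0r; rewrite ler_pM2l.
have sub1 k : cball x (q k) `<=` Omega.
  apply: subset_trans (sub k); apply: cball_mono; first exact: ltW.
  by have := q0 k; lra.
have H k : exists z, cball x (q k) z /\ forall w, cball x (q k) w -> `|U w| <= `|U z|.
  by have [z h1 h2] := cball_max (ltW (q0 k)) (sub1 k); exists z.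
have [m hm] := choice H.
have mc k : c * q k ^+ 2 < `|U (m k)|.
  have [|y yq hy] := hr1 (q k); first by rewrite q0 (le_lt_trans (qr k)).
  apply: lt_le_trans hy _; have [_] := hm k; apply; apply/cballP; first exact: ltW.
  exact: ltW.
have qS k : q k = 2 * q k.+1 by rewrite /q exprS; field; rewrite gt_eqF// exprn_gt0.
suff [k hk] : exists k, `|U (m k)| <= 8 * `|U (m k.+1)|.
  have [h1 h2] := hm k; have [h3 h4] := hm k.+1.
  exists (q k.+1), `|U (m k.+1)|; split => //.
  - by apply: le_trans r0r; rewrite ler_pM2l.
  - by apply: ltW; exact: mc.
  - by exists (m k.+1).
  - by move=> w; rewrite -qS => /h2/le_trans; apply.
apply: contrapT => /forallNP hn.
have dec k : `|U (m k)| * 8 ^+ k <= `|U (m 0%N)|.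
  elim: k => [|k ih]; first by rewrite mulr1.
  apply: le_trans ih; rewrite exprS mulrA ler_wpM2r ?exprn_ge0//.
  by have /negP := hn k; rewrite -ltNge mulrC => /ltW.
have bd k : c * r0 ^+ 2 * 2 ^+ k <= `|U (m 0%N)|.
  apply: le_trans (dec k); have := ltW (mc k); rewrite /q expr_div_n -exprM => h.
  have -> : c * r0 ^+ 2 * 2 ^+ k = c * (r0 ^+ 2 / 2 ^+ (k * 2)) * 8 ^+ k.
    have -> : 8 ^+ k = 2 ^+ k * 2 ^+ (k * 2) :> R.
      by rewrite mulnC exprM -exprMn; congr (_ ^+ _); rewrite expr2; ring.
    by field; rewrite gt_eqF// exprn_gt0.
  by rewrite ler_wpM2r// exprn_ge0.
have cp : 0 < c * r0 ^+ 2 by rewrite mulr_gt0// exprn_gt0.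
have [k hk] : exists k : nat, `|U (m 0%N)| / (c * r0 ^+ 2) < k%:R.
  exists (Num.truncn (`|U (m 0%N)| / (c * r0 ^+ 2))).+1; exact: truncnS_gt.
have := bd k; rewrite -ler_pdivlMl// mulrC => h.
have : k%:R < 2 ^+ k :> R by rewrite -natrX ltr_nat ltn_expl.
by move=> h3; have := lt_trans hk h3; rewrite ltNge h.
Qed.

(** Let |U z| = M be maximal at a doubling scale r. Within c2 r of z the mollification varies by at
    most M / 4 and differs from U by at most M / 16, which leaves no room for a zero of U. *)
Lemma nondegenerate_negligible c E : 0 < c ->
  (forall x, E x -> [/\ fb x, Omega x & nondegenerate c x]) -> leb.-negligible E.
Proof.
have absurd_bd (m : R) : 0 < m -> m <= m / 16 + m / 16 + m / 4 -> False by lra.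
move=> c00 hE; have [Ce Ce0 hCe] := mollify_close hU n_gt0; have [A A0 hA] := nconvol_lip.
have [oO _ cU _ _] := hU.
(* Makes the mollification error Ce s^2 at most c r^2 / 16, hence at most M / 16. *)
pose kappa := Num.min 1 (c / (16 * Ce)) / 2.
have k0 : 0 < kappa by rewrite divr_gt0// lt_min ltr01/= divr_gt0// mulr_gt0.
have k1 : kappa <= 1 / 2 by rewrite ler_pM2r// ge_min lexx.
have kc : Ce * kappa ^+ 2 <= c / 16.
  have : kappa <= c / (16 * Ce) / 2 by rewrite ler_pM2r// ge_min lexx orbT.
  rewrite invfM mulrA => h; have : Ce * kappa <= c / 16 / 2.
    by rewrite -ler_pdivlMl//; apply: le_trans h _; rewrite le_eqVlt; apply/orP; left; apply/eqP; field; rewrite gt_eqF.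
  move=> h'; apply: (@le_trans _ _ (c / 16 / 2 * kappa)); last by nra.
  by rewrite expr2 mulrA; apply: ler_wpM2r => //; exact: ltW.
pose c2 := Num.min (1 / 4) (kappa * c0 R n / (32 * A)).
have c20 : 0 < c2 by rewrite lt_min; apply/andP; split; pos.
have c24 : c2 <= 1 / 4 by rewrite ge_min lexx.
apply: (euclid_porous_negligible c20) => x /hE[fx Ox nx] rho rho0.
have : nbhs x Omega by exact: open_nbhs_nbhs.
move=> /nbhs_ballP[d /= d0 hd].
pose rho' := Num.min rho (d / 2).
have rho'0 : 0 < rho' by rewrite lt_min rho0 divr_gt0.
have rO : cball x rho' `<=` Omega.
  move=> z /(cball_norm (ltW rho'0)) h; apply: hd; rewrite ball_rVE /= .
  apply: le_lt_trans h _; rewrite gt_min; apply/orP; right; lra.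
have [r [M [r0 r2 cM [z zr zM] hM]]] := doubling_scale c00 rho'0 rO nx.
have rr : rho' <= rho by rewrite ge_min lexx.
have /cballP := zr => /(_ (ltW r0)) zr'.
exists r, z; split => //; first by rewrite r0; lra.
move=> w /hE[fw Ow _]; rewrite leNgt; apply/negP => wz.
have Uw := fb_zero fw Ow.
set s := kappa * r; have s0 : 0 < s by rewrite mulr_gt0.
have sr : s <= r / 2 by rewrite /s; nra.
have M0 : 0 < M by apply: lt_le_trans cM; rewrite mulr_gt0// exprn_gt0.
have c2r : c2 * r <= r / 4 by nra.
have b1 : cball z s `<=` cball x (2 * r).
  by apply: cball_sub; [exact: ltW|by rewrite mulr_ge0// ltW|lra].
have b2 : cball w s `<=` cball x (2 * r).
  apply: cball_sub; [exact: ltW|by rewrite mulr_ge0// ltW|].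
  by have := enorm_tri w z x; lra.
have O2 : cball x (2 * r) `<=` Omega by apply: subset_trans rO; apply: cball_mono; rewrite ?mulr_ge0// ltW.
have b3 : cball z (c2 * r + s) `<=` cball x (2 * r).
  apply: cball_sub; [by rewrite addr_ge0 ?ltW// mulr_gt0|by rewrite mulr_ge0// ltW|lra].
have h5 : Ce * s ^+ 2 <= M / 16.
  rewrite /s exprMn mulrA; apply: le_trans (ler_wpM2r (sqr_ge0 r) kc) _; lra.
have h1 := hCe z s s0 (subset_trans b1 O2).
have h2 := hCe w s s0 (subset_trans b2 O2).
have M8 : 0 <= 8 * M by rewrite mulr_ge0// ltW.
have h3 := hA z w s (c2 * r) (8 * M) s0 M8 (ltW wz) _.
have {}h3 : `|nconvol U n (eta R n) w s - nconvol U n (eta R n) z s| <= A * (8 * M) / s * enorm (w - z).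
  by apply: h3 => y /b3; exact: hM.
have h4 : A * (8 * M) / s * enorm (w - z) / c0 R n <= M / 4.
  rewrite ler_pdivrMr//.
  apply: (@le_trans _ _ (A * (8 * M) / s * (c2 * r))).
    apply: ler_wpM2l; last exact: ltW.
    by apply: divr_ge0; [apply: mulr_ge0 => //; exact: ltW|exact: ltW].
  have : c2 * (32 * A) <= kappa * c0 R n by rewrite -ler_pdivlMr ?mulr_gt0// ge_min lexx orbT.
  have -> : A * (8 * M) / s * (c2 * r) = M / 4 * (c2 * (32 * A) / kappa) by rewrite /s; field; rewrite !gt_eqF.
  move=> h; rewrite ler_pM2l ?divr_gt0// ler_pdivrMr// [leRHS]mulrC //.
have alg (a p q g : R) : a = (a + p * g) - (0 + q * g) + (q - p) * g by ring.
have EU : U z = (U z + nconvol U n (eta R n) z s / c0 R n) - (U w + nconvol U n (eta R n) w s / c0 R n) +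
   (nconvol U n (eta R n) w s - nconvol U n (eta R n) z s) / c0 R n.
  by rewrite Uw; exact: alg.
have : M <= M / 16 + M / 16 + M / 4.
  rewrite -{1}zM EU; apply: le_trans (ler_normD _ _) _; apply: lerD.
    by apply: le_trans (ler_normB _ _) _; apply: lerD; [exact: le_trans h1 h5|exact: le_trans h2 h5].
  apply: le_trans h4; rewrite normrM [X in _ * X]ger0_norm ?invr_ge0 ?(ltW c0p)//.
  by apply: ler_wpM2r => //; rewrite invr_ge0 ltW.
exact: absurd_bd M0.
Qed.
End free_boundary.

(** * Flatness of the free boundary from a model function *)

Section flatness.
Variables (R : realType) (n : nat).
Notation leb := (@lebesgue_rV R n).
Implicit Types (x y z v h e w : 'rV[R]_n) (a : 'M[R]_n) (s r c M rho kappa delta : R) (E F : set 'rV[R]_n).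

Lemma leb_ball_gt0 x r : 0 < r -> (0 < leb (ball x r))%E.
Proof. by move=> r0; rewrite leb_ball// lte_fin exprn_gt0// mulr_gt0. Qed.

Lemma leb_setT_gt0 : (0 < leb setT)%E.
Proof.
apply: lt_le_trans (@leb_ball_gt0 0 1 ltr01) _; apply: le_measure; rewrite ?inE//.
by apply: measurable_openrV; exact: ball_open.
Qed.

Lemma quadratic_scale c a x : quadratic (c *: a) x = c * quadratic a x.
Proof.
rewrite /quadratic mulr_sumr; apply: eq_bigr => i _; rewrite mulr_sumr; apply: eq_bigr => j _.
by rewrite mxE !mulrA.
Qed.

(** The scalar is the inverse of the essential supremum of |a| on the unit ball, which is finite by
    compactness and positive because, by homogeneity and continuity, a is nonzero on an open part of
    that ball. *)
Lemma P2_scale a z : a^T = a -> quadratic a z != 0 -> exists2 c, c != 0 & P2 (quadratic (c *: a)).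
Proof.
move=> aT az.
pose f := (abse \o (EFin \o (quadratic a \_ (eball 0 1)))) : 'rV[R]_n -> \bar R.
have fE x : f x = `|(quadratic a \_ (eball 0 1)) x|%:E by [].
have [z0 z01 hz0] := quadratic_max a.
have f0 x : (0 <= f x)%E by rewrite fE lee_fin.
have fM x : (f x <= `|quadratic a z0|%:E)%E.
  rewrite fE lee_fin patchE; case: ifPn => [|_]; last by rewrite normr0.
  rewrite inE /eball /= subr0 => /ltW; rewrite enorm_le// expr1n => x1.
  by apply: le_trans (hz0 x) _; rewrite ler_piMr.
have E1 : (ess_sup leb f <= `|quadratic a z0|%:E)%E by apply/ess_supP; apply: nearW.
have E0 : (0 < ess_sup leb f)%E.
  rewrite ltNge; apply/negP => /ess_supP ae0.
  pose d := (2 * (1 + enorm z))^-1.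
  have z10 : 0 < 1 + enorm z by rewrite ltr_pwDl// enorm_ge0.
  have d0 : 0 < d by rewrite invr_gt0 mulr_gt0.
  have bz : eball 0 1 (d *: z).
    rewrite /eball /= subr0 enormZ gtr0_norm// /d invfM -mulrA mulrC.
    rewrite -ltr_pdivlMr ?invr_gt0// invrK mul1r ltr_pdivrMl//.
    by have := enorm_ge0 z; lra.
  have pz : 0 < `|quadratic a (d *: z)|.
    by rewrite normr_gt0 quadraticZ mulf_neq0// sqrf_eq0 gt_eqF.
  have cq : {for d *: z, continuous (fun x => `|quadratic a x|)}.
    apply: (@continuous_comp _ _ _ (quadratic a) (@Num.norm R R)); last exact: norm_continuous.
    exact: continuous_quadratic.
  have N1 := near_pos cq pz.
  have N2 : nbhs (d *: z) (eball 0 1) by apply: open_nbhs_nbhs; split => //; exact: open_eball.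
  have : nbhs (d *: z) [set x | 0 < `|quadratic a x| /\ eball 0 1 x] by exact: filterI N1 N2.
  move=> /nbhs_ballP[r /= r0 hr].
  move: ae0 => [B [mB B0 sB]].
  have : (leb (ball (d *: z) r) <= leb B)%E.
    apply: le_measure; rewrite ?inE//; first by apply: measurable_openrV; exact: ball_open.
    move=> x /hr[px bx]; apply: sB => /=; rewrite fE patchE mem_set// lee_fin.
    by apply/negP; rewrite -ltNge.
  by rewrite B0 leNgt leb_ball_gt0.
have Ef : ess_sup leb f \is a fin_num by rewrite ge0_fin_numE ?(ltW E0)// (le_lt_trans E1)// ltry.
pose e := fine (ess_sup leb f); have e0 : 0 < e by rewrite fine_gt0// E0 (le_lt_trans E1)// ltry.
exists e^-1; first by rewrite invr_neq0// gt_eqF.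
split; first by exists (e^-1 *: a); split=> //; rewrite linearZ/= aT.
rewrite unlock leb_setT_gt0.
rewrite (_ : _ \o _ = cst e^-1%:E \* f)%E; last first.
  apply/funext => x; rewrite /= -EFinM !patchE; case: ifP => _; last by rewrite !normr0 mulr0.
  by rewrite quadratic_scale normrM gtr0_norm// invr_gt0.
by rewrite ess_sup_pZl ?invr_gt0// -(fineK Ef) -EFinM -/e mulVf// gt_eqF.
Qed.

Lemma HD_le E F r : (forall p, E p -> exists2 q, F q & enorm (p - q) <= r) ->
  (forall q, F q -> exists2 p, E p & enorm (q - p) <= r) -> (HD E F <= r%:E)%E.
Proof.
move=> h1 h2; rewrite /HD ge_max; apply/andP; split; apply: ge_ereal_sup => _ [x hx <-].
  by have [b Fb ab] := h1 x hx; apply: (@le_trans _ _ (enorm (x - b))%:E); [apply: ereal_inf_lbound; exists b|rewrite lee_fin].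
by have [b Fb ab] := h2 x hx; apply: (@le_trans _ _ (enorm (x - b))%:E); [apply: ereal_inf_lbound; exists b|rewrite lee_fin].
Qed.

(* The zero set of [a] only matters up to a scalar, so the normalisation in P2 is harmless. *)
Lemma rank2_distance_le F x r s a z : a^T = a -> quadratic a z != 0 ->
  (HD (F `&` eball x r) ([set y | quadratic a (y - x) = 0%R] `&` eball x r) <= s%:E)%E ->
  (rank2_distance F r x <= s%:E)%E.
Proof.
move=> aT az h; have [c c0 Pc] := P2_scale aT az.
apply: le_trans h; apply: ereal_inf_lbound; exists (quadratic (c *: a)) => //.
congr (HD _ (_ `&` _)); apply/seteqP; split => y; rewrite /zero_set /= quadratic_scale.
  by move/eqP; rewrite mulf_eq0 (negbTE c0) => /eqP.
by move=> ->; rewrite mulr0.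
Qed.

Lemma enorm_segment (p q h : 'rV[R]_n) s t : 0 <= t <= 1 -> enorm (p - h) <= s -> enorm (q - h) <= s ->
  enorm (p + t *: (q - p) - h) <= s.
Proof.
move=> /andP[t0 t1] hp hq.
have -> : p + t *: (q - p) - h = (1 - t) *: (p - h) + t *: (q - h).
  by apply/rowP => i; rewrite !mxE; ring.
apply: le_trans (enormD _ _) _; rewrite !enormZ !ger0_norm ?subr_ge0//.
have -> : s = (1 - t) * s + t * s by ring.
by apply: lerD; apply: ler_wpM2l => //; rewrite subr_ge0.
Qed.

Lemma segment_continuous (p v : 'rV[R]_n) : continuous (fun t : R => p + t *: v).
Proof.
move=> t; apply: (@continuousD _ _ _ (cst p) (fun t : R => t *: v)); first exact: cst_continuous.
by apply: (@continuousZr_tmp _ _ _ id v); exact: cvg_id.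
Qed.

(** The infimum T of the parameters with U <= 0: by continuity U <= 0 at T, while U > 0 just
    before. *)
Lemma segment_boundary (U : 'rV[R]_n -> R) (p q : 'rV[R]_n) :
  (forall t : R, 0 <= t <= 1 -> {for p + t *: (q - p), continuous U}) -> 0 < U p -> U q <= 0 ->
  exists2 t : R, 0 <= t <= 1 & boundary [set x | 0 < U x] (p + t *: (q - p)).
Proof.
move=> cU Up Uq; pose g (t : R) := p + t *: (q - p).
pose A := [set t : R | 0 <= t <= 1 /\ U (g t) <= 0].
have A1 : A 1 by rewrite /A/= ler01 lexx /g scale1r addrC subrK.
have lbA : lbound A 0 by move=> t [/andP[]].
have hlA : has_lbound A by exists 0.
pose T := inf A; have T0 : 0 <= T by apply: lb_le_inf => //; exists 1.
have T1 : T <= 1 by apply: ge_inf.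
have T01 : 0 <= T <= 1 by rewrite T0.
have cg : {for T, continuous (U \o g)}.
  by apply: continuous_comp; [exact: segment_continuous|exact: cU].
have UT : U (g T) <= 0.
  rewrite leNgt; apply/negP => UT.
  have := cg _ (open_nbhs_nbhs (conj (@open_gt R 0) UT)).
  move=> /nbhs_ballP[d /= d0 hd].
  have [t At tT] := inf_adherent d0 (conj (ex_intro _ 1 A1) hlA).
  have Tt : T <= t by apply: ge_inf.
  have := hd t; rewrite /ball/= => H.
  have : 0 < U (g t).
    by apply: H; rewrite distrC ger0_norm ?subr_ge0// ltrBlDl.
  by rewrite ltNge At.2.
have Tp : 0 < T.
  rewrite lt_def T0 andbT; apply/eqP => e; move: UT; rewrite e /g scale0r addr0.
  by rewrite leNgt Up.
exists T => //; split; last first.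
  by move=> /interior_subset /=; rewrite ltNge UT.
move=> B nB; have := @segment_continuous p (q - p) T B nB.
move=> /nbhs_ballP[d /= d0 hd].
pose t := Num.max 0 (T - d / 2).
have tT : t < T by rewrite gt_max Tp/=; lra.
have t0 : 0 <= t by rewrite le_max lexx.
exists (g t); split; last first.
  apply: hd; rewrite /ball/= ger0_norm ?subr_ge0 ?(ltW tT)//.
  have : T - d / 2 <= t by rewrite le_max lexx orbT.
  lra.
rewrite /= ltNge; apply/negP => Ut.
have At : A t by split => //; rewrite t0 (le_trans (ltW tT)).
by have := ge_inf hlA At; rewrite leNgt tT.
Qed.

Lemma segment_zero (f : 'rV[R]_n -> R) (p q : 'rV[R]_n) : continuous f -> 0 <= f p -> f q <= 0 ->
  exists2 t : R, 0 <= t <= 1 & f (p + t *: (q - p)) = 0.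
Proof.
move=> cf fp fq; have [||t] := @IVT R (fun t => f (p + t *: (q - p))) 0 1 0 ler01.
- apply: continuous_subspaceT => t; apply: (@continuous_comp _ _ _ (fun t : R => p + t *: (q - p)) f).
    exact: segment_continuous.
  exact: cf.
- rewrite scale0r addr0 scale1r addrC [q - p + _]addrC.
  by rewrite addrC subrK ge_min fq orbT le_max fp.
by rewrite in_itv/= => t01 ft; exists t.
Qed.

(* A model f that moves by more than the approximation error within distance
   delta r / 8 of every point forces the free boundary to follow its zero set. *)
Lemma flat_model (U f : 'rV[R]_n -> R) a x r delta kappa z0 : 0 < r -> 0 < delta < 1 -> a^T = a -> quadratic a z0 != 0 ->
  (forall z, quadratic a z = 0 <-> f z = 0) -> continuous f ->
  (forall h, enorm h <= r -> {for x + h, continuous U}) ->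
  (forall h, enorm h <= r -> `|U (x + h) - f h| < kappa) ->
  (forall h, exists p q : 'rV[R]_n, [/\ enorm (p - h) <= delta * r / 8, enorm (q - h) <= delta * r / 8,
     f h + kappa <= f p & f q <= f h - kappa]) ->
  (rank2_distance (boundary [set y | (0 < U y)%R]) r x < (delta * r)%:E)%E.
Proof.
move=> r0 /andP[d0 d1] aT az fa cf cU fU mv; set s := delta * r / 8.
have dr0 : 0 < delta * r by rewrite mulr_gt0.
have s0 : 0 < s by rewrite divr_gt0.
have sr2 : s + (r - 2 * s) < r by lra.
have s3 : 2 * s + s <= 3 * s by lra.
have s3' : s + s <= 3 * s by lra.
have k0 : 0 < kappa by apply: le_lt_trans (fU 0 _) => //; rewrite enorm0 ltW.
have fb0 h : enorm h <= r -> boundary [set x | 0 < U x] (x + h) -> U (x + h) = 0.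
  move=> hr [cl ni]; have c := cU h hr; have [u0|u0|//] := ltgtP (U (x + h)) 0.
    have cN : {for x + h, continuous (fun z => - U z)} by apply: continuousN.
    have /cl[z [/= z1 z2]] := near_pos cN (ltac:(by rewrite oppr_gt0) : 0 < - U (x + h)).
    by move: z1 z2; rewrite oppr_gt0 => /lt_trans q /q; rewrite ltxx.
  by exfalso; apply: ni; exact: near_pos.
have fZ c z : f z = 0 -> f (c *: z) = 0.
  by move=> /fa qz; apply/fa; rewrite quadraticZ qz mulr0.
apply: (@le_lt_trans _ _ (3 * s)%:E); last by rewrite lte_fin /s; lra.
apply: (rank2_distance_le aT az); apply: HD_le => [w [Fw]|w [/fa fw]]; rewrite /eball /= => wr.
  have E : w = x + (w - x) by rewrite addrC subrK.
  have Uw := fb0 (w - x) (ltW wr); rewrite -E in Uw; have {}Uw := Uw Fw.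
  have := fU (w - x) (ltW wr); rewrite -E Uw sub0r normrN ltr_norml => /andP[f1 f2].
  have [p [q [hp hq fp fq]]] := mv (w - x).
  have [z zw fz] : exists2 z, enorm (z - (w - x)) <= s & f z = 0.
    have hh : enorm (w - x - (w - x)) <= s by rewrite subrr enorm0 ltW.
    have [fpos|fneg] := leP 0 (f (w - x)).
      have [|t t01 ft] := segment_zero cf fpos (_ : f q <= 0); first by apply: le_trans fq _; lra.
      by exists (w - x + t *: (q - (w - x))) => //; exact: enorm_segment.
    have [|t t01 ft] := segment_zero cf (_ : 0 <= f p) (ltW fneg); first by apply: le_trans fp; lra.
    by exists (p + t *: (w - x - p)) => //; exact: enorm_segment.
  (* The zero z of the model may lie just outside the ball. Its zero set is a cone, so a contraction
     brings z inside at the further cost s. *)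
  pose c := r / (r + s); have rs : 0 < r + s by rewrite addr_gt0.
  have c0 : 0 < c by rewrite divr_gt0.
  have zr : enorm z < r + s.
    rewrite -[z](subrK (w - x)); apply: le_lt_trans (enormD _ _) _; lra.
  exists (x + c *: z).
    split; first by rewrite /= [x + _]addrC addrK; apply/fa; exact: fZ.
    rewrite /eball /= [x + _]addrC addrK enormZ gtr0_norm// /c mulrAC ltr_pdivrMr//.
    by rewrite ltr_pM2l.
  have -> : w - (x + c *: z) = - (z - (w - x)) + (1 - c) *: z by apply/rowP => i; rewrite !mxE; ring.
  apply: le_trans (enormD _ _) _; rewrite enormN enormZ.
  have c1 : 1 - c = s / (r + s) by rewrite /c; field; rewrite gt_eqF.
  have : `|1 - c| * enorm z <= s.
    rewrite c1 gtr0_norm ?divr_gt0// mulrAC ler_pdivrMr//.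
    by apply: ler_wpM2l; [exact: ltW|exact: ltW].
  move=> E2; exact: le_trans (lerD zw E2) s3'.
(* Conversely the zero of the model is pulled inwards by 2 s, which keeps the segment from p to q
   inside the ball. *)
pose c := 1 - delta / 4; pose h := c *: (w - x).
have c0 : 0 < c by rewrite /c; lra.
have hr : enorm h <= r - 2 * s.
  rewrite enormZ gtr0_norm//; apply: (@le_trans _ _ (c * r)); first by rewrite ler_pM2l// ltW.
  by rewrite /c /s; lra.
have fh : f h = 0 by exact: fZ.
have [p [q [hp hq fp fq]]] := mv h.
have tri z : enorm (z - h) <= s -> enorm z <= r.
  move=> zh; rewrite -[z](subrK h); apply: le_trans (enormD _ _) _; lra.
have Up : 0 < U (x + p).
  have := fU p (tri _ hp); rewrite ltr_norml => /andP[h1 _]; rewrite fh in fp; lra.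
have Uq : U (x + q) <= 0.
  have := fU q (tri _ hq); rewrite ltr_norml => /andP[_ h1]; rewrite fh in fq; lra.
have seg (t : R) : x + p + t *: (x + q - (x + p)) = x + (p + t *: (q - p)).
  by apply/rowP => i; rewrite !mxE; ring.
have [|t t01] := segment_boundary _ Up Uq.
  move=> t t01; rewrite seg; apply: cU; apply: tri; exact: enorm_segment.
rewrite seg => bt; exists (x + (p + t *: (q - p))).
  split => //; rewrite /eball /= [x + _]addrC addrK.
  have zh := enorm_segment t01 hp hq.
  rewrite -[X in enorm X](subrK h); apply: le_lt_trans (enormD _ _) _.
  exact: le_lt_trans (lerD zh hr) sr2.
have := enorm_segment t01 hp hq; set z := p + _ => zh.
have -> : w - (x + z) = (1 - c) *: (w - x) - (z - h) by apply/rowP => i; rewrite !mxE /c; ring.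
apply: le_trans (enormD _ _) _; rewrite enormN enormZ.
have : `|1 - c| * enorm (w - x) <= 2 * s.
  rewrite /c opprB addrCA subrr addr0 gtr0_norm ?divr_gt0//.
  apply: (@le_trans _ _ (delta / 4 * r)); first by apply: ler_wpM2l; [exact: ltW (divr_gt0 _ _)|exact: ltW].
  by rewrite /s; lra.
move=> E2; exact: le_trans (lerD E2 zh) s3.
Qed.
End flatness.

(** * Small gradients and one-sided Hessian bounds *)

Section blowup.
Variables (R : realType) (n : nat).
Variables (Omega : set 'rV[R]_n) (U : 'rV[R]_n -> R).
Hypotheses (n_gt0 : (0 < n)%N) (hU : local_min Omega U).
Implicit Types (x y z v h e : 'rV[R]_n) (a A : 'M[R]_n) (s r c C M S kappa rho epsilon delta : R).
Let fb := boundary [set x | 0 < U x].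

Definition msum A : R := \sum_i \sum_j `|A i j|.

Lemma msum_ge0 A : 0 <= msum A.
Proof. by apply: sumr_ge0 => i _; apply: sumr_ge0. Qed.

Lemma msum_le A m : (forall i j, `|A i j| <= m) -> msum A <= n%:R ^+ 2 * m.
Proof.
move=> h; apply: (@le_trans _ _ (\sum_(i < n) \sum_(j < n) m)).
  by apply: ler_sum => i _; apply: ler_sum.
by rewrite !sumr_const !card_ord -[m *+ n]mulr_natl -[_ *+ n]mulr_natl mulrA expr2.
Qed.

Lemma msumD A a : msum (A + a) <= msum A + msum a.
Proof.
rewrite /msum -big_split; apply: ler_sum => i _; rewrite -big_split; apply: ler_sum => j _.
by rewrite mxE ler_normD.
Qed.

Lemma quadratic_msum A h : `|quadratic A h| <= msum A * sqn h.
Proof.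
rewrite /quadratic mulr_suml; apply: le_trans (ler_norm_sum _ _ _) _; apply: ler_sum => i _.
rewrite mulr_suml; apply: le_trans (ler_norm_sum _ _ _) _; apply: ler_sum => j _.
rewrite !normrM -mulrA -sqr_enorm expr2; apply: ler_wpM2l => //.
by apply: ler_pM => //; exact: coord_le_enorm.
Qed.

Lemma quadraticDm A a h : quadratic (A + a) h = quadratic A h + quadratic a h.
Proof.
rewrite /quadratic -big_split; apply: eq_bigr => i _; rewrite -big_split; apply: eq_bigr => j _.
by rewrite mxE !mulrDl.
Qed.

Lemma trace_msum A : `|\tr A| <= msum A.
Proof.
apply: le_trans (ler_norm_sum _ _ _) _; apply: ler_sum => i _.
by rewrite (bigD1 i)//= lerDl sumr_ge0.
Qed.

(** The contraction of A with I - e e^T, elliptic for |e| < 1; [mhess_mono] bounds it from below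
    along the Hessians. *)
Definition lop A e := \tr A - quadratic A e.

Lemma lop_msum A e : sqn e <= 2 -> `|lop A e| <= 3 * msum A.
Proof.
move=> e2; apply: le_trans (ler_normB _ _) _.
have h1 := trace_msum A; have h2 := quadratic_msum A e.
have : msum A * sqn e <= msum A * 2 by rewrite ler_wpM2l// msum_ge0.
lra.
Qed.

Lemma lopD A a e : lop (A + a) e = lop A e + lop a e.
Proof. by rewrite /lop mxtraceD quadraticDm; ring. Qed.

(** With rho fixed, the radii obtained below depend on the set and not on the point. The singular
    set will be a countable union of such sets, up to points of large density. *)
Definition good rho epsilon c delta x :=
 [/\ fb x, small_density Omega U x rho epsilon,
   (forall r, 0 < r < rho -> exists2 y, enorm (y - x) < r & c * r ^+ 2 < `|U y|) &
   (forall r, 0 < r < rho -> ((delta * r)%:E <= rank2_distance fb r x)%E)].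

Lemma in_Omega rho epsilon x h : small_density Omega U x rho epsilon -> enorm h <= rho -> Omega (x + h).
Proof.
by move=> [r0 rO _ _] hr; apply: rO; apply/cballP; [exact: ltW|rewrite [x + _]addrC addrK].
Qed.

Lemma continuous_near rho epsilon x h : small_density Omega U x rho epsilon -> enorm h <= rho ->
  {for x + h, continuous U}.
Proof. by move=> sd hr; have [_ _ cU _ _] := hU; apply: cU; exact: in_Omega sd hr. Qed.

Lemma small_zero rho epsilon x : fb x -> small_density Omega U x rho epsilon -> U x = 0.
Proof.
move=> fx sd; apply: (fb_zero hU fx); have [r0 _ _ _] := sd.
by have := in_Omega (h := 0) sd; rewrite addr0 enorm0; apply; exact: ltW.
Qed.

(** A gradient large compared with epsilon r would persist at all smaller scales, as its total
    variation is O(epsilon r). At a scale small enough it would dominate the quadratic part and make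
    the free boundary flat. *)
Lemma grad_small delta : 0 < delta < 1 -> exists2 K : R, 0 < K & forall kappa rho epsilon c x r,
  0 < kappa <= 1 -> good rho epsilon c delta x -> 0 < epsilon -> 0 < r -> 4 * r <= rho ->
  enorm (mgrad U x (kappa * r)) <= K * epsilon * r.
Proof.
move=> d01; have /andP[d0 d1] := d01.
have alg1 (q l m s : R) : 0 < q * s -> 0 < l -> l / 2 <= m -> q * l / 32 * s < q * s / 8 * m.
  move=> h1 l0 h2; rewrite (_ : q * l / 32 * s = q * s * (l / 32)); last by ring.
  by rewrite -[X in _ < X]mulrA ltr_pM2l//; lra.
have alg2 (p q e r l : R) : 0 <= p * e * r -> (p + q) * e * r < l -> q * e * r < l.
  by rewrite !mulrDl; lra.
have alg3 (m q e s r l : R) : m * (q * e * s) <= m * (q * e * r) -> 2 * m * q * e * r < l -> m * (q * e * s) <= l / 2.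
  by lra.
have [C1 C10 hC1] := mgrad_evol n_gt0 hU; have [C2 C20 hC2] := mhess_evol n_gt0 hU.
have [C0 C00 hC0] := quad_approx n_gt0 hU.
have n1 : 1 <= n%:R :> R by rewrite ler1n.
exists (2 * n%:R * C1 + 64 * n%:R ^+ 2 * C2 / delta) => [|kappa rho epsilon c x r k01 [fx sd _ hfl] e0 r0 r4].
  by rewrite addr_gt0 ?divr_gt0 ?mulr_gt0 ?exprn_gt0 ?(lt_le_trans ltr01 n1).
rewrite leNgt; apply/negP; set lam := enorm _; set K := _ + _ => hl.
have /andP[k0 k1] := k01.
have [B2 B20 hB2] := hC0 kappa k01; have [rho0 rO _ _] := sd; have [B1 B10 hB1] := hB2 rho rho0.
have K0 : 0 <= K * epsilon * r.
  apply: mulr_ge0; last exact: ltW.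
  by apply: mulr_ge0; [rewrite /K addr_ge0 ?divr_ge0 ?mulr_ge0 ?exprn_ge0 ?(ltW C10) ?(ltW C20) ?(ltW d0)|exact: ltW].
have lam0 : 0 < lam by exact: le_lt_trans hl.
pose s := kappa * r; have s0 : 0 < s by rewrite mulr_gt0.
have sr : s <= r by rewrite ler_piMl// ltW.
pose a := msum (mhess U x s); have a0 : 0 <= a by exact: msum_ge0.
pose E := C0 * kappa ^+ 2 + B2 * epsilon + B1 * rho.
have E0 : 0 <= E by rewrite !addr_ge0// mulr_ge0 ?sqr_ge0 ?ltW.
pose G := a + E + 1; have G0 : 0 < G by rewrite ltr_wpDl// addr_ge0.
(* At this scale (a + E) r'^2 is at most delta lam r' / 64. The Hessian may have grown by a multiple
   of epsilon r / r', which contributes a multiple of epsilon r r'; this is just as small since lam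
   exceeds K epsilon r. *)
pose r' := Num.min r (delta * lam / (64 * G)).
have r'0 : 0 < r' by rewrite lt_min r0/= divr_gt0 ?mulr_gt0.
have r'r : r' <= r by rewrite ge_min lexx.
have r'G : G * r' <= delta * lam / 64.
  have : r' <= delta * lam / (64 * G) by rewrite ge_min lexx orbT.
  by rewrite ler_pdivlMr ?mulr_gt0//; lra.
pose s' := kappa * r'; have s'0 : 0 < s' by rewrite mulr_gt0.
have ss' : 0 < s' <= s by rewrite s'0 ler_pM2l.
have s4 : 4 * s <= rho by lra.
pose l := mgrad U x s'.
have nrm z m : (forall i, `|z ord0 i| <= m) -> 0 <= m -> enorm z <= n%:R * m.
  by move=> hz m0; apply: le_trans (enorm_le_norm z) _; apply: ler_wpM2l => //; exact: norm_le_coord.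
have ll : enorm (mgrad U x s - l) <= n%:R * (C1 * epsilon * s).
  apply: nrm => [i|]; last by rewrite !mulr_ge0// ltW.
  by rewrite !mxE; have := hC1 x rho epsilon s s' i sd ss' s4; rewrite !mxE.
have P1 : n%:R * (C1 * epsilon * s) <= lam / 2.
  have : n%:R * (C1 * epsilon * s) <= n%:R * (C1 * epsilon * r).
    by apply: ler_wpM2l => //; apply: ler_wpM2l => //; rewrite mulr_ge0 ?ltW.
  have : 0 <= 64 * n%:R ^+ 2 * C2 / delta * epsilon * r.
    by rewrite !mulr_ge0 ?invr_ge0 ?exprn_ge0 ?(ltW C20) ?(ltW d0) ?(ltW e0) ?(ltW r0).
  by move: hl; rewrite /K [X in X * epsilon * r]addrC => hl /alg2 => /(_ _ _ hl) hl2 hl3; exact: (alg3 _ _ _ _ _ _ hl3 hl2).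
have P2 : n%:R ^+ 2 * (C2 * epsilon * r) <= delta * lam / 64.
  have : 0 <= 2 * n%:R * C1 * epsilon * r.
    by rewrite !mulr_ge0 ?(ltW C10) ?(ltW e0) ?(ltW r0).
  have -> : n%:R ^+ 2 * (C2 * epsilon * r) = delta * (64 * n%:R ^+ 2 * C2 / delta * epsilon * r) / 64 by field; rewrite gt_eqF.
  by move/alg2 => /(_ _ _ hl)/ltW h; rewrite ler_pM2r ?invr_gt0// ler_pM2l.
have l2 : lam / 2 <= enorm l.
  have : lam <= enorm (mgrad U x s - l) + enorm l by rewrite /lam -{1}[mgrad _ _ _](subrK l) enormD.
  lra.
have lp : 0 < enorm l by apply: lt_le_trans l2; rewrite divr_gt0.
have A' : msum (mhess U x s') <= a + n%:R ^+ 2 * (C2 * epsilon * (s / s')).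
  rewrite -[mhess U x s'](subrK (mhess U x s)) addrC; apply: le_trans (msumD _ _) _.
  rewrite lerD2l; apply: msum_le => i j; rewrite mxE [X in _ + X]mxE -normrN opprB.
  exact: hC2 sd ss' s4.
have ssr : s / s' = r / r' by rewrite /s /s'; field; rewrite !gt_eqF.
have app h : enorm h <= r' -> `|U (x + h) - dot l h| <= delta * lam / 32 * r'.
  move=> hr; have := hB1 x r' h epsilon sd (small_zero fx sd) r'0 _ hr => H.
  have {}H : `|U (x + h) - (dot l h + quadratic (mhess U x s') h)| <= (C0 * kappa ^+ 2 + B2 * epsilon + B1 * r') * r' ^+ 2.
    by apply: H; lra.
  have Q := quadratic_msum (mhess U x s') h.
  have sh : sqn h <= r' ^+ 2 by rewrite -enorm_le// ltW.
  have Q2 : msum (mhess U x s') * sqn h <= (a + n%:R ^+ 2 * (C2 * epsilon * (r / r'))) * r' ^+ 2.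
    apply: ler_pM; [exact: msum_ge0|exact: sqn_ge0|by rewrite -ssr|exact: sh].
  have Q3 : (C0 * kappa ^+ 2 + B2 * epsilon + B1 * r') * r' ^+ 2 <= E * r' ^+ 2.
    apply: ler_wpM2r; first exact: sqr_ge0.
    rewrite /E lerD2l; apply: ler_wpM2l; first exact: ltW.
    by apply: le_trans r'r _; lra.
  have -> : U (x + h) - dot l h = (U (x + h) - (dot l h + quadratic (mhess U x s') h)) + quadratic (mhess U x s') h by rewrite opprD addrA subrK.
  apply: le_trans (ler_normD _ _) _; apply: le_trans (lerD (le_trans H Q3) (le_trans Q Q2)) _.
  have -> : E * r' ^+ 2 + (a + n%:R ^+ 2 * (C2 * epsilon * (r / r'))) * r' ^+ 2 =
     ((a + E) * r' + n%:R ^+ 2 * (C2 * epsilon * r)) * r' by field; rewrite gt_eqF.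
  apply: ler_wpM2r; first exact: ltW.
  have : (a + E) * r' <= G * r' by apply: ler_wpM2r; [exact: ltW|rewrite lerDl].
  lra.
have Q : (rank2_distance fb r' x < (delta * r')%:E)%E.
  (* The hyperplane orthogonal to l is the zero set of the quadratic polynomial (l . h)^2. *)
  pose b : 'M[R]_n := \matrix_(i, j) (l ord0 i * l ord0 j).
  have bE z : quadratic b z = dot l z ^+ 2.
    rewrite expr2 /dot mulr_suml; apply: eq_bigr => i _; rewrite mulr_sumr; apply: eq_bigr => j _.
    by rewrite mxE; ring.
  have dl : dot l l = enorm l ^+ 2 by rewrite dot_sqn sqr_enorm.
  apply: (@flat_model R n U (dot l) b x r' delta (delta * r' / 8 * enorm l) l r'0 d01).
  - by apply/matrixP => i j; rewrite !mxE mulrC.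
  - by rewrite bE dl -exprM expf_neq0// gt_eqF.
  - by move=> z; rewrite bE; split => [/eqP|->]; [rewrite sqrf_eq0 => /eqP|rewrite expr0n].
  - pose t : tm R n := tsum (fun i => Mul (Cst n (l ord0 i)) (Var R i)).
    rewrite (_ : dot l = eval t); first exact: continuous_eval.
    by apply/funext => z; rewrite eval_tsum.
  - by move=> h hr; apply: (continuous_near sd); apply: le_trans hr _; lra.
  - move=> h hr; apply: le_lt_trans (app h hr) _.
    by apply: alg1 => //; exact: mulr_gt0.
  move=> h; pose u := (enorm l)^-1 *: l.
  have nu : enorm u = 1 by rewrite enormZ gtr0_norm ?invr_gt0// mulVf// gt_eqF.
  have lu : dot l u = enorm l by rewrite dotZr dl expr2 mulKf// gt_eqF.
  have dr : 0 <= delta * r' / 8 by rewrite divr_ge0// mulr_ge0// ltW.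
  exists (h + (delta * r' / 8) *: u), (h - (delta * r' / 8) *: u); split.
  - by rewrite [h + _]addrC addrK enormZ nu mulr1 ger0_norm.
  - by rewrite [h - _]addrC addrK enormN enormZ nu mulr1 ger0_norm.
  - by rewrite dotDr dotZr lu.
  - by rewrite dotDr dotNr dotZr lu.
have := hfl r'; rewrite r'0 => /(_ _); rewrite leNgt Q => H.
by have : 0 < r' < rho -> false; [move=> h; apply: H; move: h => /andP[]|rewrite r'0 /= => h; suff: false by []; apply: h; lra].
Qed.

(** The constants are fixed in the order e, kappa, epsilon, rho, r. The errors C1 kappa^2, B2
    epsilon, B1 r and the gradient term K epsilon take a quarter of e each. *)
Lemma blowup delta (e : R) : 0 < delta < 1 -> 0 < e -> exists kappa : R, 0 < kappa <= 1 /\ exists2 epsilon0 : R, 0 < epsilon0 &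
  forall rho, 0 < rho -> exists2 r0 : R, 0 < r0 & forall epsilon c x r h, good rho epsilon c delta x ->
   0 < epsilon <= epsilon0 -> 0 < r <= r0 -> enorm h <= r ->
   `|U (x + h) - quadratic (mhess U x (kappa * r)) h| <= e * r ^+ 2.
Proof.
move=> d01 e0; have [K K0 hK] := grad_small d01; have [C1 C10 hC1] := quad_approx n_gt0 hU.
pose kappa := Num.min 1 (e / (4 * C1)).
have k0 : 0 < kappa by rewrite lt_min ltr01/= divr_gt0 ?mulr_gt0.
have k1 : kappa <= 1 by rewrite ge_min lexx.
have k01 : 0 < kappa <= 1 by rewrite k0.
have kC : C1 * kappa ^+ 2 <= e / 4.
  have : kappa <= e / (4 * C1) by rewrite ge_min lexx orbT.
  rewrite ler_pdivlMr ?mulr_gt0// => h.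
  have : C1 * kappa ^+ 2 <= C1 * kappa by rewrite ler_pM2l// expr2 ler_piMl// ltW.
  lra.
have [B2 B20 hB2] := hC1 kappa k01.
exists kappa; split => //; exists (Num.min (e / (4 * B2)) (e / (4 * K))).
  by rewrite lt_min !divr_gt0 ?mulr_gt0.
move=> rho rho0; have [B1 B10 hB1] := hB2 rho rho0.
exists (Num.min (rho / 4) (e / (4 * B1))); first by rewrite lt_min !divr_gt0 ?mulr_gt0.
move=> epsilon c x r h gx /andP[ep0]; rewrite le_min => /andP[ep1 ep2] /andP[r0]; rewrite le_min => /andP[r1 r2] hr.
have [fx sd _ _] := gx.
have r4 : 4 * r <= rho by lra.
have H1 := hB1 x r h epsilon sd (small_zero fx sd) r0 r4 hr.
have H2 := hK kappa rho epsilon c x r k01 gx ep0 r0 r4.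
have H3 := dot_le (mgrad U x (kappa * r)) h.
have b2 : B2 * epsilon <= e / 4 by move: ep1; rewrite ler_pdivlMr ?mulr_gt0//; lra.
have b1 : B1 * r <= e / 4 by move: r2; rewrite ler_pdivlMr ?mulr_gt0//; lra.
have b3 : K * epsilon <= e / 4 by move: ep2; rewrite ler_pdivlMr ?mulr_gt0//; lra.
have H4 : `|dot (mgrad U x (kappa * r)) h| <= e / 4 * r ^+ 2.
  apply: le_trans H3 _; apply: (@le_trans _ _ (K * epsilon * r * r)).
    by apply: ler_pM => //; exact: enorm_ge0.
  by rewrite -mulrA -expr2; apply: ler_wpM2r => //; exact: sqr_ge0.
have H5 : (C1 * kappa ^+ 2 + B2 * epsilon + B1 * r) * r ^+ 2 <= (e / 4 + e / 4 + e / 4) * r ^+ 2.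
  by apply: ler_wpM2r; [exact: sqr_ge0|apply: lerD => //; exact: lerD].
have -> : U (x + h) - quadratic (mhess U x (kappa * r)) h =
  (U (x + h) - (dot (mgrad U x (kappa * r)) h + quadratic (mhess U x (kappa * r)) h)) + dot (mgrad U x (kappa * r)) h.
  by rewrite opprD addrA addrAC subrK.
apply: le_trans (ler_normD _ _) _; apply: le_trans (lerD (le_trans H1 H5) H4) _.
by rewrite -mulrDl le_eqVlt; apply/orP; left; apply/eqP; field.
Qed.

(** At the fixed scale s0 the entries are bounded by the L^1 norm of U, uniformly in x; [mhess_mono]
    carries the one-sided bound to all smaller scales. *)
Lemma hess_lower s0 : 0 < s0 -> exists2 C : R, 0 < C & forall x s e, cball x (2 * s0) `<=` Omega ->
  0 < s <= s0 -> sqn e <= 2 -> - C <= lop (mhess U x s) e.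
Proof.
move=> s00; have [C C0 hC] := mhess_mono n_gt0 hU; have [C1 C10 hC1] := dens_le hU.
have cl := @closed_cball R n 0 1; have c0p := @c0_gt0 R n n_gt0.
have H1 (p : 'I_n * 'I_n) : exists B : R, 0 < B /\ forall x, `|mhess U x s0 p.1 p.2| <= B.
  have v2 : vanish (cball 0 1) (der p.1 (der p.2 (eta R n))).
    by apply: vanish_der => //; apply: vanish_der => //; exact: vanish_eta.
  have [A A0 hA] := bounded_vanish (@compact_cball _ _ _ _) v2.
  have p2 : 0 < (2 * c0 R n)^-1 by rewrite invr_gt0 mulr_gt0.
  have IU : 0 <= Int (fun z => `|U z|) by exact: Int_ge0.
  have sp : 0 <= s0 ^- (2 + n) by rewrite invr_ge0 exprn_ge0// ltW.
  exists (s0 ^- (2 + n) * (A * Int (fun z => `|U z|)) / (2 * c0 R n) + 1); split.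
    apply: ltr_wpDl => //; apply: mulr_ge0; last exact: ltW.
    by apply: mulr_ge0 => //; apply: mulr_ge0 => //; exact: ltW.
  move=> x; rewrite mxE mulNr normrN normrM (gtr0_norm p2) ler_wpDr//.
  apply: ler_wpM2r; first exact: ltW.
  rewrite /nconvol normrM (ger0_norm sp); apply: ler_wpM2l => //.
  exact: (convol_crude hU x s0 v2 hA).
have [B hB] := choice H1.
pose b := \sum_p B p.
have hb x : msum (mhess U x s0) <= n%:R ^+ 2 * b.
  apply: msum_le => i j; have [_ h] := hB (i, j); apply: le_trans (h x) _.
  by rewrite /b (bigD1 (i, j))//= lerDl sumr_ge0// => q _; have [/ltW] := hB q.
pose D := s0 ^+ 2 / s0 ^+ n * (C1 * (2 * s0) ^+ n / (2 * s0) ^+ 2).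
have D0 : 0 < D by rewrite /D; pos.
have b0 : 0 <= b by apply: sumr_ge0 => q _; have [/ltW] := hB q.
exists (3 * (n%:R ^+ 2 * b) + C * D).
  by apply: ltr_wpDl; [rewrite !mulr_ge0 ?sqr_ge0|rewrite mulr_gt0].
move=> x s e xO s01 e2; have := hC e x s0 s e2 s01 xO.
have s2 : 0 < 2 * s0 by rewrite mulr_gt0.
have := hC1 x (2 * s0) s2 xO.
have := lop_msum (mhess U x s0) e2; rewrite -/(lop _ e) -/(lop _ e) ler_norml => /andP[L1 _].
have := hb x => L2 L3 L4.
have L5 : C * (s0 ^+ 2 / s0 ^+ n * dens U x (2 * s0)) <= C * D.
  apply: ler_wpM2l; first exact: ltW.
  by apply: ler_wpM2l => //; rewrite divr_ge0// exprn_ge0// ltW.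
apply: le_trans L4; apply: (@le_trans _ _ (- (3 * (n%:R ^+ 2 * b)) - C * D)); first by rewrite opprD.
apply: lerD; last by rewrite lerN2.
by apply: le_trans L1; rewrite lerN2 ler_wpM2l.
Qed.

(** First from x to y at the scale kappa r, then down in the scale at y. The mean value inequality
    on ellipsoids needs the bound at all points of a ball and at all small scales. *)
Lemma hess_lower_near kappa : 0 < kappa <= 1 -> exists2 B2 : R, 0 < B2 & forall rho, 0 < rho -> exists2 B1 : R, 0 < B1 &
  forall x y r s e epsilon, small_density Omega U x rho epsilon -> 0 < r -> 8 * r <= rho -> enorm (y - x) <= r ->
  0 < s <= kappa * r -> sqn e <= 2 ->
  lop (mhess U x (kappa * r)) e - (B2 * epsilon + B1 * r) <= lop (mhess U y s) e.
Proof.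
move=> k01; have /andP[k0 k1] := k01.
have alg1 (r rho : R) : 8 * r <= rho -> 4 * (2 * (kappa * r)) <= kappa * rho.
  by rewrite (_ : 4 * (2 * (kappa * r)) = kappa * (8 * r)) ?ler_pM2l//; ring.
have alg2 (a b d m p b2 e b1 r C q : R) : - (3 * m) <= b -> 3 * m <= 3 * (p * (b2 * e + b1 * r)) ->
   d <= C * (q * e) -> 0 <= r -> a - ((3 * p * b2 + C * q) * e + (3 * p * b1 + 1) * r) <= a + b - d by lra.
have [C C0 hC] := mhess_mono n_gt0 hU.
have [B2 B20 hB2] := mhess_near n_gt0 hU k01.
pose P := 1 / psi0 R * (4 / kappa) ^+ n.
have P0 : 0 < P by rewrite /P; pos.
pose Q := 2 ^+ n / 2 ^+ 2 : R.
have Q0 : 0 < Q by rewrite /Q; pos.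
exists (3 * n%:R ^+ 2 * B2 + C * (P * Q)).
  apply: ltr_wpDl; last by do 2 apply: mulr_gt0 => //.
  by apply: mulr_ge0; [apply: mulr_ge0 => //; exact: sqr_ge0|exact: ltW].
move=> rho rho0; have [B1 B10 hB1] := hB2 rho rho0.
exists (3 * n%:R ^+ 2 * B1 + 1); first by
  apply: ltr_wpDl => //; apply: mulr_ge0; [apply: mulr_ge0 => //; exact: sqr_ge0|exact: ltW].
move=> x y r s e epsilon sd r0 r8 yx ss e2.
have [_ rO ep0 hd] := sd.
set s1 := kappa * r; have s10 : 0 < s1 by rewrite mulr_gt0.
have s1r : s1 <= r by rewrite ler_piMl// ltW.
have r4 : 4 * r <= rho by lra.
have s2 : 0 < 2 * s1 by rewrite mulr_gt0.
have yO : cball y (2 * s1) `<=` Omega.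
  by apply: subset_trans rO; apply: cball_sub; [exact: ltW|exact: ltW|lra].
have H1 := hC e y s1 s e2 ss yO.
have N := fun i j => hB1 x y r i j epsilon sd r0 r4 yx.
have H2 : msum (mhess U y s1 - mhess U x s1) <= n%:R ^+ 2 * (B2 * epsilon + B1 * r).
  by apply: msum_le => i j; rewrite mxE [X in _ + X]mxE.
have H3 := lop_msum (mhess U y s1 - mhess U x s1) e2.
have H4 : lop (mhess U y s1) e = lop (mhess U x s1) e + lop (mhess U y s1 - mhess U x s1) e.
  by rewrite -lopD addrC subrK.
have D : `|bilap U (rescale y (2 * s1) (psi R n))| <= 1 / psi0 R * epsilon * (4 / kappa) ^+ n * (2 * s1) ^+ n / (2 * s1) ^+ 2.
  apply: (dens_near hU ltr01 (@vanish_psi R n) _ k01 s2 _ rO _ ep0 hd).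
  - by move=> z; rewrite ger0_norm ?psi_ge0 ?psi_le1.
  - exact: alg1.
  - have -> : 2 * s1 / kappa = 2 * r by rewrite /s1; field; rewrite gt_eqF.
    by apply: le_trans yx _; rewrite ler_peMl ?ler1n// ltW.
have D' : s1 ^+ 2 / s1 ^+ n * dens U y (2 * s1) <= P * Q * epsilon.
  apply: (@le_trans _ _ (s1 ^+ 2 / s1 ^+ n * (1 / psi0 R * epsilon * (4 / kappa) ^+ n * (2 * s1) ^+ n / (2 * s1) ^+ 2))).
    apply: ler_wpM2l; first by rewrite divr_ge0// exprn_ge0// ltW.
    by apply: le_trans D; rewrite /dens -normrN ler_norm.
  rewrite le_eqVlt; apply/orP; left; apply/eqP; rewrite /P /Q !exprMn; field.
  by rewrite !gt_eqF ?exprn_gt0 ?psi0_gt0.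
have D'' := ler_wpM2l (ltW C0) D'.
apply: le_trans H1; rewrite -[X in _ <= X - _]/(lop _ _) H4.
move: H3; rewrite ler_norml => /andP[H3 _].
exact: alg2 H3 (ler_wpM2l (ler0n R 3) H2) D'' (ltW r0).
Qed.
End blowup.

(** * Positive semidefinite forms: rank one or a large minor *)

Section psd_forms.
Variables (R : realType) (n : nat).
Implicit Types (x y h g : 'rV[R]_n) (A B : 'M[R]_n) (i j k : 'I_n) (tau b : R).

Definition psd B := B^T = B /\ forall h, 0 <= quadratic B h.

Lemma bil_delta B i j : bil B (delta_mx ord0 i) (delta_mx ord0 j) = B i j.
Proof.
rewrite /bil (bigD1 i)//= [X in _ + X]big1 ?addr0 => [|k ki].
  rewrite (bigD1 j)//= [X in _ + X]big1 ?addr0 => [|k kj]; first by rewrite !mxE !eqxx !mulr1.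
  by rewrite !mxE !eqxx (negbTE kj) mulr0.
by apply: big1 => l _; rewrite !mxE (negbTE ki) andbF mulr0 mul0r.
Qed.

Lemma bil_deltal B i h : bil B (delta_mx ord0 i) h = dot (row i B) h.
Proof.
rewrite /bil (bigD1 i)//= [X in _ + X]big1 ?addr0 => [|k ki].
  by apply: eq_bigr => j _; rewrite !mxE !eqxx mulr1.
by apply: big1 => l _; rewrite !mxE (negbTE ki) andbF mulr0 mul0r.
Qed.

Lemma psd_diag B i : psd B -> 0 <= B i i.
Proof. by move=> [_ /(_ (delta_mx ord0 i))]; rewrite -bil_quadratic bil_delta. Qed.

Lemma psd_entry B i j : psd B -> `|B i j| <= (B i i + B j j) / 2.
Proof.
move=> [sB pB]; have h1 := pB (delta_mx ord0 i + delta_mx ord0 j).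
have h2 := pB (delta_mx ord0 i + (-1) *: delta_mx ord0 j).
move: h1 h2; rewrite !quadraticD// quadraticZ bilZr -!bil_quadratic !bil_delta ler_norml; lra.
Qed.

Lemma psd_cs B x y : psd B -> 0 < quadratic B y -> bil B x y ^+ 2 <= quadratic B x * quadratic B y.
Proof.
move=> [sB pB] qy; have := pB (x + (- (bil B x y / quadratic B y)) *: y).
rewrite quadraticD// quadraticZ bilZr => h.
rewrite -subr_ge0 (_ : _ - _ = quadratic B y * (quadratic B x + 2 * (- (bil B x y / quadratic B y) * bil B x y) +
  (- (bil B x y / quadratic B y)) ^+ 2 * quadratic B y)); last by field; rewrite gt_eqF.
by apply: mulr_ge0 => //; exact: ltW.
Qed.

Lemma psd_msum B : psd B -> msum B <= n%:R * \tr B.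
Proof.
move=> pB; apply: (@le_trans _ _ (\sum_i \sum_j (B i i + B j j) / 2)).
  by apply: ler_sum => i _; apply: ler_sum => j _; exact: psd_entry.
under eq_bigr do rewrite -mulr_suml big_split /= sumr_const card_ord.
by rewrite -mulr_suml big_split /= sumr_const card_ord sumrMnl /mxtrace -mulr_natl le_eqVlt; apply/orP; left; apply/eqP; field.
Qed.

Lemma psd_le_diag B i : psd B -> (forall k, B k k <= B i i) -> \tr B <= n%:R * B i i.
Proof.
move=> pB hi; apply: (@le_trans _ _ (\sum_(k < n) B i i)); first exact: ler_sum.
by rewrite sumr_const card_ord mulr_natl.
Qed.

Lemma exists_max_diag B : (0 < n)%N -> exists i, forall k, B k k <= B i i.
Proof.
move=> n0; have := @Order.TotalTheory.arg_maxP _ _ _ (Ordinal n0) predT (fun k => B k k) isT.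
by case=> i _ hi; exists i => k; exact: hi.
Qed.

(* Schur complement of the largest diagonal entry. *)
Lemma psd_dichotomy B tau : (0 < n)%N -> psd B -> 0 < \tr B -> 0 < tau ->
  (exists i j, [/\ (forall k, B k k <= B i i), 0 < B i i & tau * B i i ^+ 2 <= B i i * B j j - B i j ^+ 2]) \/
  (exists g b, [/\ enorm g = 1, 0 < b, b <= \tr B <= (1 + n%:R * tau) * b &
     forall h, 0 <= quadratic B h - b * dot g h ^+ 2 <= n%:R ^+ 2 * tau * b * sqn h]).
Proof.
move=> n0 pB trB t0; have [i hi] := exists_max_diag B n0; have [sB qB] := pB.
have bi : 0 < B i i.
  have := psd_le_diag pB hi => h; have := lt_le_trans trB h.
  by rewrite pmulr_rgt0// ltr0n.
have [[j hj]|hno] := pselect (exists j, tau * B i i ^+ 2 <= B i i * B j j - B i j ^+ 2); first by left; exists i, j.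
right; set be := B i i in bi hi hno *.
(* [S] is B without the rank one form (v . h)^2 / B i i. It is semidefinite by Cauchy-Schwarz, and S
   k k * B i i is the minor of B on the indices i and k, which is small for every k in the present
   case. *)
pose v := row i B; pose S := B - be^-1 *: (v^T *m v).
have vE k : v ord0 k = B i k by rewrite mxE.
have SE k l : S k l = B k l - B i k * B i l / be.
  by rewrite !mxE big_ord1 !mxE mulrC.
have vv h : quadratic (be^-1 *: (v^T *m v)) h = dot v h ^+ 2 / be.
  rewrite quadratic_scale mulrC; congr (_ / _); rewrite expr2 /dot mulr_suml; apply: eq_bigr => k _; rewrite mulr_sumr; apply: eq_bigr => l _.
  by rewrite mxE big_ord1 !mxE; ring.
have Sq h : quadratic S h = quadratic B h - dot v h ^+ 2 / be.
  by rewrite -vv; apply/eqP; rewrite eq_sym subr_eq -quadraticDm subrK.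
have pS : psd S.
  split=> [|h]; first by apply/matrixP => k l; rewrite mxE !SE [B i l * _]mulrC (_ : B l k = B k l)// -{1}sB mxE.
  have : 0 < quadratic B (delta_mx ord0 i) by rewrite -bil_quadratic bil_delta.
  move=> /(psd_cs h pB); rewrite -!bil_quadratic bil_delta bilC// bil_deltal -/v -/be => H.
  by rewrite bil_quadratic Sq subr_ge0 ler_pdivrMr.
have trS : \tr S <= n%:R * tau * be.
  apply: (@le_trans _ _ (\sum_(k < n) (tau * be))); last by rewrite sumr_const card_ord -[(tau * be) *+ n]mulr_natl mulrA.
  apply: ler_sum => k _; rewrite SE -(ler_pM2r bi) mulrBl divfK ?gt_eqF//.
  rewrite leNgt; apply/negP => H; apply: hno; exists k; rewrite expr2 mulrA; apply: ltW.
  by apply: lt_le_trans H _; rewrite [be * _]mulrC expr2.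
have trS0 : 0 <= \tr S by apply: sumr_ge0 => k _; exact: psd_diag.
have nv : be <= enorm v.
  by apply: le_trans (coord_le_enorm v i); rewrite vE ler_norm.
have nv0 : 0 < enorm v by exact: lt_le_trans nv.
pose b := enorm v ^+ 2 / be.
have beb : be <= b.
  by rewrite /b ler_pdivlMr// -expr2 ler_pXn2r ?nnegrE// ltW.
have b0 : 0 < b by exact: lt_le_trans beb.
have tb : n%:R * tau * be <= n%:R * tau * b by rewrite ler_wpM2l// mulr_ge0// ltW.
have trE : \tr B = \tr S + b.
  rewrite /mxtrace /b sqr_enorm /sqn mulr_suml -big_split; apply: eq_bigr => k _ /=.
  by rewrite SE vE expr2 subrK.
exists ((enorm v)^-1 *: v), b; split => //.
- by rewrite enormZ gtr0_norm ?invr_gt0// mulVf// gt_eqF.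
- by rewrite trE mulrDl mul1r lerDr trS0/= addrC lerD2l; apply: le_trans tb.
move=> h; rewrite dotZl exprMn.
have -> : b * ((enorm v)^-1 ^+ 2 * dot v h ^+ 2) = dot v h ^+ 2 / be.
  by rewrite /b; field; rewrite !gt_eqF.
rewrite -Sq; have [_ ->] /= := pS.
apply: le_trans (ler_norm _) _; apply: le_trans (quadratic_msum _ _) _.
apply: ler_wpM2r; first exact: sqn_ge0.
apply: le_trans (psd_msum pS) _; apply: le_trans (ler_wpM2l _ (le_trans trS tb)) _ => //.
by rewrite !mulrA -expr2.
Qed.
End psd_forms.

(** * Volume of strips in a ball *)

Section strips.
Variables (R : realType) (n : nat).
Notation leb := (@lebesgue_rV R n).
Implicit Types (y z g : 'rV[R]_n) (a l r : R).

Definition strip y r g a l := cball y r `&` [set z | a <= dot g (z - y) <= a + l].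

Lemma closed_strip y r g a l : closed (strip y r g a l).
Proof.
have cf : continuous (fun z => dot g (z - y)).
  pose t : tm R n := tsum (fun i => Mul (Cst n (g ord0 i)) (Add (Var R i) (Cst n (- y ord0 i)))).
  rewrite (_ : (fun _ => _) = eval t); first exact: continuous_eval.
  by apply/funext => z; rewrite eval_tsum; apply: eq_bigr => i _; rewrite !mxE.
apply: closedI; first exact: closed_cball.
rewrite (_ : [set _ | _] = (fun z => dot g (z - y)) @^-1` [set` `[a, a + l]]).
  by apply: closed_comp => //; exact: interval_closed.
by apply/seteqP; split => z /=; rewrite in_itv.
Qed.

Lemma leb_cball_ge y r : 0 < r -> (2 * r / n.+1%:R) ^+ n <= fine (leb (cball y r)).
Proof.
move=> r0; have rn : 0 < r / n.+1%:R by rewrite divr_gt0// ltr0n.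
rewrite -lee_fin fineK; last first.
  by rewrite ge0_fin_numE//; apply: leb_compact; exact: compact_cball.
rewrite -mulrA -(leb_normball y rn); apply: le_measure; rewrite ?inE.
- by apply: measurable_openrV; exact: open_normball.
- by apply: compact_measurable; exact: compact_cball.
move=> z /= zy; apply/cballP; [exact: ltW|].
apply: le_trans (enorm_le_norm _) _; apply: le_trans (ler_wpM2l _ (ltW zy)) _; first exact: ler0n.
by rewrite mulrCA ler_piMr ?(ltW r0)// ler_pdivrMr ?ltr0n// mul1r ler_nat.
Qed.

(* A ball is covered by about r / l translates of the strip. *)
Lemma leb_strip_ge : exists2 c : R, 0 < c & forall y r g a l, enorm g = 1 -> 0 <= a -> 0 < l ->
  a + l <= r / 2 -> c * l * r ^+ n / r <= fine (leb (strip y r g a l)).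
Proof.
exists ((2 * 4^-1 / n.+1%:R) ^+ n / 2) => [|y r g a l g1 a0 l0 alr].
  by rewrite divr_gt0// exprn_gt0// divr_gt0// ltr0n.
have r0 : 0 < r by lra.
have r4 : 0 < r / 4 by rewrite divr_gt0.
pose m := (Num.truncn (r / l)).+1.
(* The k-th translation carries the slab with g . (z - y) between - r / 4 + k l and - r / 4 + (k +
   1) l to the position of the strip; about r / l such slabs exhaust the ball of radius r / 4. *)
pose v k := (a + r / 4 - k%:R * l) *: g.
pose B k := (fun z => z + v k) @^-1` strip y r g a l.
have mS : measurable (strip y r g a l) by apply: measurable_closedrV; exact: closed_strip.
have mB k : measurable (B k).
  by rewrite -[B k]setTI; apply: measurable_shift.
have fS : (leb (strip y r g a l) < +oo)%E.
  apply: (@le_lt_trans _ _ (leb (cball y r))); last by apply: leb_compact; exact: compact_cball.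
  apply: le_measure; rewrite ?inE//.
    by apply: compact_measurable; exact: compact_cball.
  by move=> z [].
have cov : cball y (r / 4) `<=` \big[setU/set0]_(k < m) B k.
  rewrite -bigcup_mkord => z /cballP zy; have {}zy := zy (ltW r4).
  have dg : `|dot g (z - y)| <= r / 4 by apply: le_trans (dot_le _ _) _; rewrite g1 mul1r.
  pose d := dot g (z - y) + r / 4.
  have d0 : 0 <= d by move: dg; rewrite ler_norml /d; lra.
  have dr : d <= r by move: dg; rewrite ler_norml /d; lra.
  have dl : 0 <= d / l by rewrite divr_ge0// ltW.
  pose k := Num.truncn (d / l); have /andP[k1 k2] := truncn_itv dl.
  rewrite -/k ler_pdivlMr// in k1; rewrite -/k ltr_pdivrMr// -natr1 in k2.
  exists k => /=.
    by rewrite /m ltnS; apply: le_truncn; rewrite ler_pM2r ?invr_gt0.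
  have gg : dot g g = 1 by rewrite dot_sqn -sqr_enorm g1 expr1n.
  have zv : z + v k - y = (z - y) + v k by rewrite addrAC.
  rewrite /B /preimage /= /strip; split => /=.
    apply/cballP; first exact: ltW.
    rewrite zv; apply: le_trans (enormD _ _) _.
    rewrite enormZ g1 mulr1.
    have : `|a + r / 4 - k%:R * l| <= r / 2 + r / 4.
      have kl : 0 <= k%:R * l by rewrite mulr_ge0// ltW.
      move: dg; rewrite /d in k1 k2; rewrite ler_norml => dg; rewrite ler_norml; lra.
    lra.
  by rewrite zv dotDr dotZr gg mulr1; rewrite /d in k1 k2; lra.
have := content_subadditive leb (fun k _ => mB k) (compact_measurable (@compact_cball _ _ y (r / 4))) cov.
rewrite (eq_bigr (fun=> leb (strip y r g a l))); last first.
  by move=> k _; exact: leb_shift.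
rewrite sumr_const card_ord => H.
have H2 : fine (leb (cball y (r / 4))) <= fine (leb (strip y r g a l)) * m%:R.
  have finS : leb (strip y r g a l) \is a fin_num by rewrite ge0_fin_numE.
  rewrite -lee_fin fineK; last by rewrite ge0_fin_numE//; apply: leb_compact; exact: compact_cball.
  by apply: le_trans H _; rewrite EFinM fineK// muleC mule_natl.
have mr : m%:R <= 2 * (r / l).
  have rl : 1 <= r / l by rewrite ler_pdivlMr// mul1r; lra.
  have rl0 : 0 <= r / l by lra.
  have /andP[t1 _] := truncn_itv rl0.
  by rewrite /m -natr1; lra.
have H3 := le_trans (leb_cball_ge y r4) H2.
have H4 : fine (leb (strip y r g a l)) * m%:R <= fine (leb (strip y r g a l)) * (2 * (r / l)).
  by apply: ler_wpM2l => //; exact: fine_ge0.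
have {H3 H4} := le_trans H3 H4.
have -> : 2 * (r / 4) / n.+1%:R = 2 * 4^-1 / n.+1%:R * r by ring.
rewrite exprMn; move: (_ ^+ n) (r ^+ n) (fine _) => p q f h.
rewrite -(ler_pM2r (_ : 0 < 2 * (r / l))); last by rewrite mulr_gt0// divr_gt0.
by apply: le_trans h; rewrite le_eqVlt; apply/orP; left; apply/eqP; field; rewrite !gt_eqF.
Qed.
End strips.

(** * U does not resemble b (g . h)^2 *)

Section ridge.
Variables (R : realType) (n : nat).
Notation leb := (@lebesgue_rV R n).
Variables (Omega : set 'rV[R]_n) (U : 'rV[R]_n -> R).
Hypotheses (n_gt0 : (0 < n)%N) (hU : local_min Omega U).
Implicit Types (x y z v h e g : 'rV[R]_n) (s r c m epsilon rho : R).

(** The competitor lowers U by m / psi0 times a bump, hence by at least m on the half ball, and G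
    leaves the positivity set. The cost consists of the pairing with - Delta^2 U and of the bending
    energy of the bump. *)
Lemma push_down : exists2 C : R, 0 < C & forall x s m (G : set 'rV[R]_n), 0 < s -> 0 <= m -> cball x s `<=` Omega ->
  measurable G -> G `<=` cball x (s / 2) -> (forall z, G z -> 0 < U z <= m) ->
  fine (leb G) <= C * (m * dens U x s + m ^+ 2 * s ^+ n / s ^+ 4).
Proof.
have [C C0 hC] := @Int_lap_rescale R n; have p0 := @psi0_gt0 R.
have alg (k1 k2 d i a b : R) : 0 <= k1 -> 0 <= k2 -> 0 <= d -> 0 <= b -> a = k1 * d -> i <= k2 * b ->
   a + i <= (k1 + k2) * (d + b).
  move=> h1 h2 h3 h4 -> h5.
  have : 0 <= k1 * b by rewrite mulr_ge0.
  have : 0 <= k2 * d by rewrite mulr_ge0.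
  rewrite mulrDl !mulrDr; lra.
exists (2 / psi0 R + C / psi0 R ^+ 2) => [|x s m G s0 m0 xO mG Gx hG].
  by apply: addr_gt0; pos.
have [_ _ _ hp _] := hU.
pose t := Mul (Cst n (- (m / psi0 R))) (rescale x s (psi R n)).
have vt0 : vanish (cball x s) (rescale x s (psi R n)) by apply: vanish_rescale => //; exact: vanish_psi.
have vt : vanish (cball x s) t by exact: vanish_mulr.
have cc := @compact_cball R n x s.
have mp : 0 <= m / psi0 R by rewrite divr_ge0// ltW.
have tE z : eval t z = - (m / psi0 R * eval (psi R n) (s^-1 *: (z - x))).
  by rewrite /t [LHS]/= eval_rescale mulNr.
have tle z : eval t z <= 0 by rewrite tE oppr_le0 mulr_ge0// psi_ge0.
have hG2 z : G z -> 0 < U z /\ U z + eval t z <= 0.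
  move=> Gz; have /andP[u0 um] := hG z Gz; split => //.
  have := psi_ge s0 (Gx z Gz); rewrite tE subr_le0 => h.
  apply: le_trans um _; apply: (@le_trans _ _ (m / psi0 R * psi0 R)); first by rewrite divfK// gt_eqF.
  exact: ler_wpM2l.
have := hp t _ G cc xO vt tle mG hG2; move/le_trans; apply.
have d0 := dens_ge0 hU s0 xO.
have Ts : bilap U t = m / psi0 R * dens U x s.
  by rewrite (bilap_scale hU _ cc vt0) /dens mulrN mulNr.
have I1 : Int (fun z => eval (lap t) z ^+ 2) = (m / psi0 R) ^+ 2 * Int (fun z => eval (lap (rescale x s (psi R n))) z ^+ 2).
  rewrite -IntZ; last first.
    have vl := vanish_lap (@closed_cball R n x s) vt0.
    apply: (@intg_off _ _ (cball x s)) => //.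
      by move=> z; apply: cts_mul; exact: continuous_eval.
    by move=> z nz; rewrite vl// expr0n.
  by congr Int; apply/funext => z; rewrite lapZ exprMn sqrrN.
rewrite Ts I1; apply: alg.
- by apply: ltW; pos.
- by apply: ltW; pos.
- by rewrite mulr_ge0.
- by rewrite divr_ge0 ?mulr_ge0 ?exprn_ge0 ?(ltW s0).
- by field; rewrite gt_eqF.
have := hC x s s0 => h; apply: le_trans (ler_wpM2l (sqr_ge0 _) h) _.
by rewrite le_eqVlt; apply/orP; left; apply/eqP; field; rewrite !gt_eqF// exprn_gt0.
Qed.

(* U cannot look like b (g . h)^2: pushing it down by d r^2 gains the measure
   of a strip of width sqrt d r at a cost of order d r^n. *)
Lemma no_ridge c1 M : 0 < c1 -> 0 < M -> exists2 e : R, 0 < e & forall x r rho epsilon g b,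
  small_density Omega U x rho epsilon -> epsilon <= 1 -> 0 < r <= rho -> enorm g = 1 -> c1 <= b <= M ->
  ~ (forall h, enorm h <= r -> `|U (x + h) - b * dot g h ^+ 2| <= e * r ^+ 2).
Proof.
move=> c10 M0; have alg (a1 a2 a3 : R) : 0 < a1 * a2 -> 2 * a1 * a2 <= a3 -> a1 * a2 < a3 by lra.
have [cS cS0 hS] := @leb_strip_ge R n; have [C C0 hC] := push_down.
pose Q := C * (2 * M + (2 * M) ^+ 2).
have Q0 : 0 < Q by rewrite /Q mulr_gt0// addr_gt0 ?exprn_gt0 ?mulr_gt0.
pose p := cS * 2^-1 / 2 ^+ n * 2.
have p0 : 0 < p by rewrite /p !mulr_gt0// invr_gt0 exprn_gt0.
(* The gain is p w r^n and the cost at most Q w^2 r^n, so a narrow strip wins. *)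
pose w := Num.min (1 / 4) (p / (2 * Q)).
have w0 : 0 < w by rewrite lt_min; apply/andP; split; apply: divr_gt0 => //; exact: mulr_gt0.
have w4 : w <= 1 / 4 by rewrite ge_min lexx.
have wQ : 2 * Q * w <= p.
  have : w <= p / (2 * Q) by rewrite ge_min lexx orbT.
  by move=> h; rewrite [_ * w]mulrC -ler_pdivlMr//; exact: mulr_gt0.
have final : Q * w ^+ 2 < p * w.
  by rewrite expr2 mulrA ltr_pM2r//; apply: alg => //; exact: mulr_gt0.
have w2 : w ^+ 2 <= 1 by rewrite expr2; nra.
exists (Num.min (c1 * w ^+ 2 / 8) (M * w ^+ 2)).
  by rewrite lt_min; apply/andP; split; [apply: divr_gt0 => //|]; apply: mulr_gt0 => //; exact: exprn_gt0.
set e4 := Num.min _ _; have e41 : e4 <= c1 * w ^+ 2 / 8 by rewrite ge_min lexx.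
have e42 : e4 <= M * w ^+ 2 by rewrite ge_min lexx orbT.
move=> x r rho epsilon g b [rho0 rO e0 hd] e1 /andP[r0 rr] g1 /andP[bc bM] hb.
have r2 : 0 < r / 2 by rewrite divr_gt0.
have wr : 0 < w * r / 2 by rewrite divr_gt0// mulr_gt0.
have wr4 : w * r <= r / 4 by have := ler_wpM2r (ltW r0) w4; lra.
(* The strip keeps away from g . h = 0: there b (g . h)^2 >= c1 w^2 r^2 / 4, while the approximation
   error is at most c1 w^2 r^2 / 8, so U > 0. *)
pose G := strip x (r / 2) g (w * r / 2) (w * r / 2).
have rO' : cball x r `<=` Omega by apply: subset_trans rO; apply: cball_mono => //; exact: ltW.
pose m := 2 * M * w ^+ 2 * r ^+ 2.
have m0 : 0 <= m by rewrite /m !mulr_ge0 ?sqr_ge0// ltW.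
have gain := hS x (r / 2) g (w * r / 2) (w * r / 2) g1 (ltW wr) wr _.
have {}gain : cS * (w * r / 2) * (r / 2) ^+ n / (r / 2) <= fine (leb G) by apply: gain; lra.
have UG z : G z -> 0 < U z <= m.
  move=> [/cballP zx] /=; have {}zx := zx (ltW r2) => /andP[d1 d2].
  have := hb (z - x); rewrite [x + _]addrC subrK => hz.
  have zr : enorm (z - x) <= r by lra.
  move: (hz zr); rewrite ler_norml => /andP[b1 b2].
  set d := dot g (z - x) in d1 d2 b1 b2.
  have D1 : (w * r / 2) ^+ 2 <= d ^+ 2 by rewrite ler_pXn2r// ?nnegrE; lra.
  have D2 : d ^+ 2 <= (w * r) ^+ 2 by rewrite ler_pXn2r// ?nnegrE; lra.
  have E1 : c1 * (w * r / 2) ^+ 2 <= b * d ^+ 2 by apply: ler_pM => //; [exact: ltW|exact: sqr_ge0].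
  have E2 : b * d ^+ 2 <= M * (w * r) ^+ 2.
    by apply: ler_pM => //; [apply: le_trans bc; exact: ltW|exact: sqr_ge0].
  have E3 := ler_wpM2r (sqr_ge0 r) e41; have E4 := ler_wpM2r (sqr_ge0 r) e42.
  have P : 0 < c1 * w ^+ 2 * r ^+ 2 by rewrite !mulr_gt0 ?exprn_gt0.
  move: E1 E2; rewrite /m !exprMn; move: b1 b2 E3 E4 P; clear.
  move: (w ^+ 2) (r ^+ 2) (b * d ^+ 2) (U z) (e4) => W rr B u e5 *; apply/andP; split; lra.
have := hC x r m G r0 m0 rO' _ _ UG.
move=> /(_ _ _) cost.
have {}cost : fine (leb G) <= C * (m * dens U x r + m ^+ 2 * r ^+ n / r ^+ 4).
  by apply: cost; [apply: measurable_closedrV; exact: closed_strip|move=> z []].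
have dn : dens U x r <= r ^+ n / r ^+ 2.
  apply: le_trans (hd r _) _; first by rewrite r0.
  by rewrite -mulrA ler_piMl// divr_ge0 ?exprn_ge0// ltW.
have rn : 0 < r ^+ n by rewrite exprn_gt0.
have cost2 : C * (m * dens U x r + m ^+ 2 * r ^+ n / r ^+ 4) <= Q * w ^+ 2 * r ^+ n.
  apply: (@le_trans _ _ (C * (m * (r ^+ n / r ^+ 2) + m ^+ 2 * r ^+ n / r ^+ 4))).
    apply: ler_wpM2l; first exact: ltW.
    by rewrite lerD2r; exact: ler_wpM2l.
  have -> : C * (m * (r ^+ n / r ^+ 2) + m ^+ 2 * r ^+ n / r ^+ 4) = C * (2 * M * w ^+ 2 + (2 * M) ^+ 2 * (w ^+ 2 * w ^+ 2)) * r ^+ n.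
    by rewrite /m; field; rewrite gt_eqF.
  rewrite ler_pM2r// /Q -[leRHS]mulrA ler_pM2l// [in leRHS]mulrDl lerD2l.
  apply: ler_wpM2l; first exact: sqr_ge0.
  by rewrite ler_piMl// sqr_ge0.
have : cS * (w * r / 2) * (r / 2) ^+ n / (r / 2) = p * w * r ^+ n.
  by rewrite /p exprMn exprVn; field; rewrite !gt_eqF.
move=> E; have := le_trans gain (le_trans cost cost2); rewrite E ler_pM2r// leNgt.
by rewrite final.
Qed.
End ridge.

Lemma lipschitz_cts (R : realType) n (f : 'rV[R]_n -> R) (C : R) : 0 < C ->
  (forall y y', `|f y' - f y| <= C * `|y' - y|) -> continuous f.
Proof.
move=> C0 hf y A /nbhs_ballP[d /= d0 hd]; change (nbhs y (f @^-1` A)).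
apply/nbhs_ballP; exists (d / C); first by rewrite /= divr_gt0.
move=> z; rewrite ball_rVE /= => zd; apply: hd; rewrite /ball /= distrC.
by apply: le_lt_trans (hf _ _) _; rewrite mulrC -ltr_pdivlMr.
Qed.

(** * Lower Hessian bounds in the sense of distributions *)

Section weak_hessian.
Variables (R : realType) (n : nat).
Notation leb := (@lebesgue_rV R n).
Variables (Omega : set 'rV[R]_n) (U : 'rV[R]_n -> R).
Hypotheses (n_gt0 : (0 < n)%N) (hU : local_min Omega U).
Implicit Types (x y z v h e g : 'rV[R]_n) (t k : tm R n) (s r c m epsilon rho : R).
Notation unitball := (cball (0 : 'rV[R]_n) 1).

Let iU : intg U. Proof. by case: hU. Qed.

Lemma convol_lip t s : 0 < s -> vanish unitball t ->
  exists2 C : R, 0 < C & forall y y', `|convol U t y' s - convol U t y s| <= C * enorm (y' - y).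
Proof.
move=> s0 vt; have [A A0 hA] := iter_ddir_bound 1 vt.
have IU : 0 <= Int (fun z => `|U z|) by exact: Int_ge0.
pose D := s^-1 * (A * Int (fun z => `|U z|)).
have D0 : 0 <= D by rewrite mulr_ge0 ?invr_ge0 ?mulr_ge0// ltW.
exists (D + 1) => [|y y']; first by rewrite ltr_pwDr.
pose v := y' - y.
have F (q : R) := is_derive_convol_dir y v q s0 iU vt.
have := @mvt_abs R _ _ 0 1 (D * enorm v) ler01 (fun q _ => F q).
rewrite scale0r addr0 scale1r /v [y + _]addrC subrK subr0 mulr1 -/v => H.
apply: le_trans (H _) _ => [q _|]; last by rewrite ler_wpM2r ?enorm_ge0// lerDl.
rewrite mulNr normrN normrM gtr0_norm ?invr_gt0// /D -!mulrA ler_pM2l ?invr_gt0//.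
have vd : vanish unitball (ddir v t) by apply: vanish_ddir => //; exact: closed_cball.
apply: le_trans (convol_crude hU _ _ vd (hA v)) _.
by rewrite expr1 mulrAC -mulrA.
Qed.

Lemma C1dir_convol t s i : 0 < s -> vanish unitball t ->
  C1dir i (fun y => convol U t y s) /\
  'D_(delta_mx ord0 i) (fun y => convol U t y s) = fun y => - s^-1 * convol U (der i t) y s.
Proof.
move=> s0 vt; have cJ t' : vanish unitball t' -> continuous (fun y => convol U t' y s).
  move=> vt'; have [C C0 hC] := convol_lip s0 vt'.
  apply: (@lipschitz_cts _ _ _ (C * n%:R)) => [|y y']; first by rewrite mulr_gt0// ltr0n.
  by apply: le_trans (hC _ _) _; rewrite -mulrA ler_pM2l// enorm_le_norm.
have D y : is_derive y (delta_mx ord0 i) (fun y => convol U t y s) (- s^-1 * convol U (der i t) y s).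
  have := is_derive_convol_dir y (delta_mx ord0 i) 0 s0 iU vt.
  rewrite scale0r addr0 (@convol_eq _ _ U (ddir (delta_mx ord0 i) t) (der i t)); last first.
    apply/funext => x; rewrite eval_ddir (bigD1 i)//= big1 ?addr0 ?mxE ?eqxx ?mul1r// => j ji.
    by rewrite mxE (negbTE ji) andbF mul0r.
  move=> [].
  have E : (fun h : R => h^-1 *: (convol U t (y + (h *: (1 : R) + 0) *: delta_mx ord0 i) s - convol U t (y + 0 *: delta_mx ord0 i) s)) =
     (fun h : R => h^-1 *: (convol U t (h *: delta_mx ord0 i + y) s - convol U t y s)).
    by apply/funext => k; rewrite scaler1 addr0 scale0r addr0 [y + _]addrC.
  rewrite /derivable /derive /= E => h1 h2; apply: DeriveDef; [exact: h1|exact: h2].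
have DE : 'D_(delta_mx ord0 i) (fun y => convol U t y s) = fun y => - s^-1 * convol U (der i t) y s.
  by apply/funext => y; have [_ ->] := D y.
split => //; split; first exact: cJ.
  by move=> y; have [] := D y.
rewrite DE; apply: cts_mul; first exact: (@continuous_eval R n (Cst n _)).
by apply: cJ; apply: vanish_der => //; exact: closed_cball.
Qed.

(** Each integration by parts produces a sign that cancels the one from differentiating the kernel
    in its centre. *)
Lemma Int_convol_parts t s i j K k : 0 < s -> vanish unitball t -> compact K -> vanish K k ->
  Int (fun z => convol U t z s * eval (der i (der j k)) z) =
  s ^- 2 * Int (fun z => convol U (der i (der j t)) z s * eval k z).
Proof.
move=> s0 vt cK vk; have clK := closed_compact cK; have cl := @closed_cball R n 0 1.
have vti := vanish_der i cl vt; have vij := vanish_der j cl vti.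
have [c1 d1] := C1dir_convol i s0 vt; have [c2 d2] := C1dir_convol j s0 vti.
have [c3 _] := C1dir_convol i s0 vij.
have parts i' t' k' : C1dir i' (fun y => convol U t' y s) -> 'D_(delta_mx ord0 i') (fun y => convol U t' y s) = (fun y => - s^-1 * convol U (der i' t') y s) ->
    vanish K k' -> vanish unitball (der i' t') ->
    Int (fun z => convol U t' z s * eval (der i' k') z) = s^-1 * Int (fun z => convol U (der i' t') z s * eval k' z).
  move=> c d vk' vd; rewrite -derive_eval (Int_by_parts cK c (C1dir_eval _ _)); last by right.
  have [cd _] := C1dir_convol i' s0 vd; rewrite -[RHS]opprK -mulNr -IntZ.
    by congr (- Int _); apply/funext => z; rewrite mulrA; congr (_ * _); exact: (congr1 (fun f => f z) d).
  apply: (intg_off cK); last by move=> z Kz; rewrite vk' ?mulr0.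
  by move=> z; apply: cts_mul; [case: cd|exact: continuous_eval].
rewrite (parts i t (der j k) c1 d1 (vanish_der j clK vk) vti) (parts j (der i t) k c2 d2 vk vij) mulrA.
have -> : s^-1 * s^-1 = s ^- 2 by rewrite -exprVn expr2.
congr (_ * Int _); apply/funext => z; congr (_ * _); exact: convol_eq (derC j i t).
Qed.

Definition hess_op e k : tm R n :=
  tsum (fun i => tsum (fun j => Mul (Cst n ((i == j)%:R - e ord0 i * e ord0 j)) (der i (der j k)))).

Lemma eval_hess_op e k z : eval (hess_op e k) z =
  \sum_i \sum_j ((i == j)%:R - e ord0 i * e ord0 j) * eval (der i (der j k)) z.
Proof. by rewrite eval_tsum; apply: eq_bigr => i _; rewrite eval_tsum. Qed.

Lemma vanish_hess_op e K k : closed K -> vanish K k -> vanish K (hess_op e k).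
Proof.
move=> cK vk; apply: vanish_tsum => i; apply: vanish_tsum => j; apply: vanish_mulr.
by apply: vanish_der => //; exact: vanish_der.
Qed.

Lemma lopE (A : 'M[R]_n) e : lop A e = \sum_i \sum_j ((i == j)%:R - e ord0 i * e ord0 j) * A i j.
Proof.
rewrite /lop /mxtrace /quadratic -sumrB; apply: eq_bigr => i _.
rewrite (_ : A i i = \sum_j (i == j)%:R * A i j); last first.
  by rewrite (bigD1 i)//= eqxx mul1r big1 ?addr0// => j /negbTE; rewrite eq_sym => ->; rewrite mul0r.
by rewrite -sumrB; apply: eq_bigr => j _; ring.
Qed.

(* The mollifications converge uniformly, so the lower bound on their Hessians
   passes to the limit in the sense of distributions. *)
Lemma weak_lower e y s1 rho (B : R) k : 0 < s1 -> vanish (cball y rho) k -> (forall z, 0 <= eval k z) ->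
  (forall z, cball y rho z -> cball z s1 `<=` Omega) ->
  (forall z s, cball y rho z -> 0 < s <= s1 -> - B <= lop (mhess U z s) e) ->
  - (2 * B) * Int (eval k) <= Int (fun z => U z * eval (hess_op e k) z).
Proof.
move=> s10 vk k0 hO hB; have cK := @compact_cball R n y rho; have clK := @closed_cball R n y rho.
have vh := vanish_hess_op e clK vk; have ve := @vanish_eta R n; have cl := @closed_cball R n 0 1.
have c0p := @c0_gt0 R n n_gt0; have [C C0 hC] := mollify_close hU n_gt0.
have [A A0 hA] := bounded_vanish cK vh.
have ik := intg_vanish cK vk.
have lK : 0 <= fine (leb (cball y rho)) by exact: fine_ge0.
pose D := C * A * fine (leb (cball y rho)).
have D0 : 0 <= D by rewrite !mulr_ge0// ltW.
(* The bound at scale s is integrated against k, with the factor 2 because [mhess] is half the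
   Hessian. Replacing the mollification by U costs D s^2, which disappears as s tends to 0. *)
have main s : 0 < s <= s1 -> - (2 * B) * Int (eval k) - D * s ^+ 2 <= Int (fun z => U z * eval (hess_op e k) z).
  move=> /andP[s0 ss]; pose u z := - (s ^- n / c0 R n) * convol U (eta R n) z s.
  have iJ t k' : vanish unitball t -> vanish (cball y rho) k' -> intg (fun z => convol U t z s * eval k' z).
    move=> vt vk'; apply: (intg_off cK); last by move=> z Kz; rewrite vk' ?mulr0.
    have [[cJ _ _] _] := C1dir_convol (Ordinal n_gt0) s0 vt.
    by move=> z; apply: cts_mul; [exact: cJ|exact: continuous_eval].
  have veij i j : vanish unitball (der i (der j (eta R n))) by apply: vanish_der => //; exact: vanish_der.
  have vkij i j : vanish (cball y rho) (der i (der j k)) by apply: vanish_der => //; exact: vanish_der.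
  pose a (i j : 'I_n) : R := (i == j)%:R - e ord0 i * e ord0 j.
  pose c := - (s ^- n / c0 R n).
  have lopk : (fun z => lop (mhess U z s) e * eval k z) =
     (fun z => \sum_i \sum_j (c * a i j * s ^- 2 / 2) * (convol U (der i (der j (eta R n))) z s * eval k z)).
    apply/funext => z; rewrite lopE mulr_suml; apply: eq_bigr => i _; rewrite mulr_suml; apply: eq_bigr => j _.
    rewrite mxE -/(a i j) /nconvol /c exprD invfM.
    move: (convol _ _ _ _) (eval _ _) (a i j) (s ^- n) (s ^- 2) => *; field; by rewrite gt_eqF.
  have I1 : Int (fun z => u z * eval (hess_op e k) z) = 2 * Int (fun z => lop (mhess U z s) e * eval k z).
    have -> : (fun z => u z * eval (hess_op e k) z) =
       (fun z => \sum_i \sum_j (c * a i j) * (convol U (eta R n) z s * eval (der i (der j k)) z)).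
      apply/funext => z; rewrite eval_hess_op mulr_sumr; apply: eq_bigr => i _; rewrite mulr_sumr; apply: eq_bigr => j _.
      by rewrite /u -/c -/(a i j); move: (convol _ _ _ _) (eval _ _) (a i j) => *; ring.
    rewrite lopk.
    rewrite !Int_sum => [|i|i]; last 2 first.
    - by apply: intg_sum => j; apply: intgZ; exact: iJ.
    - by apply: intg_sum => j; apply: intgZ; exact: iJ.
    rewrite mulr_sumr; apply: eq_bigr => i _.
    rewrite !Int_sum => [|j|j]; last 2 first.
    - by apply: intgZ; exact: iJ.
    - by apply: intgZ; exact: iJ.
    rewrite mulr_sumr; apply: eq_bigr => j _; rewrite !IntZ; last 2 first.
    - exact: iJ.
    - exact: iJ.
    rewrite (Int_convol_parts i j s0 ve cK vk).
    by move: (Int _) (a i j) (s ^- 2) => *; field.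
  have I2 : - B * Int (eval k) <= Int (fun z => lop (mhess U z s) e * eval k z).
    rewrite -IntZ//; apply: Int_le; first exact: intgZ.
      by rewrite lopk; apply: intg_sum => i; apply: intg_sum => j; apply: intgZ; exact: iJ.
    move=> z; have [Kz|Kz] := pselect (cball y rho z); last by rewrite vk ?mulr0.
    by apply: ler_wpM2r => //; apply: hB => //; rewrite s0.
  have iuh : intg (fun z => u z * eval (hess_op e k) z).
    rewrite (_ : (fun z => _) = (fun z => - (s ^- n / c0 R n) * (convol U (eta R n) z s * eval (hess_op e k) z))).
      by apply: intgZ; exact: iJ.
    by apply/funext => z; rewrite /u mulrA.
  have iUh : intg (fun z => U z * eval (hess_op e k) z).
    by apply: intgM iU _ hA; exact: measurable_eval.
  have I3 : `|Int (fun z => U z * eval (hess_op e k) z - u z * eval (hess_op e k) z)| <= (C * s ^+ 2 * A) * fine (leb (cball y rho)).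
    suff hb z : `|U z * eval (hess_op e k) z - u z * eval (hess_op e k) z| <= (C * s ^+ 2 * A) * \1_(cball y rho) z.
      have mf := intg_measurable (intgB iUh iuh).
      by have [] := Int_bound (compact_measurable cK) (leb_compact cK) mf hb.
    rewrite -mulrBl normrM; have [Kz|Kz] := pselect (cball y rho z); last first.
      by rewrite vh// normr0 mulr0 indicE memNset// mulr0.
    rewrite indicE mem_set// mulr1; apply: ler_pM => //.
    have := hC z s s0; rewrite /u mulNr opprK mulrAC /nconvol; apply.
    by apply: subset_trans (hO z Kz); apply: cball_mono; [exact: ltW|].
  move: I3; rewrite IntB// ler_norml I1 => /andP[I3 _].
  have -> : D * s ^+ 2 = C * s ^+ 2 * A * fine (leb (cball y rho)) by rewrite /D; ring.
  move: I2 I3; move: (Int _) (Int _) (Int _) (fine _) => *; lra.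
apply/ler_addgt0Pr => d d0.
pose s := Num.min s1 (Num.min 1 (d / (D + 1))).
have s0 : 0 < s by rewrite !lt_min s10 ltr01 divr_gt0// ltr_wpDl.
have ss : s <= s1 by rewrite ge_min lexx.
have sl1 : s <= 1 by rewrite !ge_min lexx orbT.
have sd : s <= d / (D + 1) by rewrite !ge_min lexx !orbT.
have := main s; rewrite s0 ss => /(_ isT) H.
have H1 : D * s ^+ 2 <= d.
  apply: (@le_trans _ _ ((D + 1) * s)); last by rewrite mulrC -ler_pdivlMr// ltr_wpDl.
  by apply: ler_pM => //; [exact: sqr_ge0|rewrite lerDl|rewrite expr2 ler_piMl// ltW].
by move: H H1; move: (Int _) (Int _) => *; lra.
Qed.
End weak_hessian.

(** * Kernels on flattened ellipsoids *)

Section valley_kernel.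
Variables (R : realType) (n : nat).
Notation leb := (@lebesgue_rV R n).
Implicit Types (x y z g : 'rV[R]_n) (N s r : R).
Notation unitball := (cball (0 : 'rV[R]_n) 1).

Definition tdot g : tm R n := tsum (fun i => Mul (Cst n (g ord0 i)) (Var R i)).

Lemma eval_tdot g z : eval (tdot g) z = dot g z.
Proof. by rewrite eval_tsum. Qed.

Lemma der_tdot g i z : eval (der i (tdot g)) z = g ord0 i.
Proof.
rewrite der_tsum (bigD1 i)//= eqxx big1 ?addr0 => [|j ji]; first by rewrite mul0r add0r mulr1.
by rewrite mul0r add0r eq_sym (negbTE ji) mulr0.
Qed.

(* Level sets of [vw g N] are ellipsoids flattened by the factor N in the direction g. *)
Definition vw g N : tm R n :=
  Add (tball R n) (Mul (Cst n (1 - N ^+ 2)) (Mul (tdot g) (tdot g))).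
Definition vK g N : tm R n := Cut 0 (vw g N).
Definition vk g N : tm R n := Mul (Cst n 4) (Cut 2 (vw g N)).

Lemma eval_vw g N z : eval (vw g N) z = 1 - sqn z - (N ^+ 2 - 1) * dot g z ^+ 2.
Proof.
rewrite -[LHS]/(eval (tball R n) z + (1 - N ^+ 2) * (eval (tdot g) z * eval (tdot g) z)) eval_tball eval_tdot.
by ring.
Qed.

Lemma der_vw g N i z : eval (der i (vw g N)) z = - 2 * (z ord0 i + (N ^+ 2 - 1) * dot g z * g ord0 i).
Proof.
rewrite -[LHS]/(eval (der i (tball R n)) z + (0 * (eval (tdot g) z * eval (tdot g) z) +
  (1 - N ^+ 2) * (eval (der i (tdot g)) z * eval (tdot g) z + eval (tdot g) z * eval (der i (tdot g)) z))).
by rewrite der_tball eval_tdot der_tdot; ring.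
Qed.

Lemma der2_vw g N i j z : eval (der i (der j (vw g N))) z =
  - 2 * ((i == j)%:R + (N ^+ 2 - 1) * g ord0 i * g ord0 j).
Proof.
pose t : tm R n := Mul (Cst n (-2)) (Add (Var R j) (Mul (Cst n ((N ^+ 2 - 1) * g ord0 j)) (tdot g))).
have /(der_eq i) -> : eval (der j (vw g N)) = eval t.
  by apply/funext => x; rewrite der_vw /t /= -/(eval (tdot g) x) eval_tdot; ring.
by rewrite /t [LHS]/= -/(eval (tdot g) z) eval_tdot -/(eval (der i (tdot g)) z) der_tdot; ring.
Qed.

(** For this e, the matrix I - e e^T is the inverse of the matrix I + (N^2 - 1) g g^T of the
    ellipsoids, see [vdir_row]. *)
Definition vdir g N := Num.sqrt (1 - N ^- 2) *: g.

Lemma vdir_row g N z i : enorm g = 1 -> 1 <= N ->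
  \sum_j ((i == j)%:R - vdir g N ord0 i * vdir g N ord0 j) * (z ord0 j + (N ^+ 2 - 1) * dot g z * g ord0 j) = z ord0 i.
Proof.
move=> g1 N1; have N0 : N != 0 by rewrite gt_eqF// (lt_le_trans ltr01).
have b0 : 0 <= 1 - N ^- 2.
  rewrite subr_ge0 invf_le1 ?exprn_gt0 ?(lt_le_trans ltr01)//; exact: exprn_ege1.
have be : Num.sqrt (1 - N ^- 2) * Num.sqrt (1 - N ^- 2) = 1 - N ^- 2 by rewrite -expr2 sqr_sqrtr.
have gg : dot g g = 1 by rewrite dot_sqn -sqr_enorm g1 expr1n.
pose P := (N ^+ 2 - 1) * dot g z.
have E : \sum_j g ord0 j * (z ord0 j + P * g ord0 j) = dot g z + P.
  rewrite -[P in RHS]mulr1 -gg /dot [X in _ = _ + X]mulr_sumr -big_split; apply: eq_bigr => j _ /=; ring.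
transitivity (z ord0 i + P * g ord0 i - (1 - N ^- 2) * g ord0 i * (dot g z + P)); last first.
  by rewrite /P; field.
rewrite -E [X in _ = _ - X]mulr_sumr.
have -> : z ord0 i + P * g ord0 i = \sum_j (i == j)%:R * (z ord0 j + P * g ord0 j).
  by rewrite (bigD1 i)//= eqxx mul1r big1 ?addr0// => j /negbTE; rewrite eq_sym => ->; rewrite mul0r.
rewrite -sumrB; apply: eq_bigr => j _; rewrite /vdir !mxE -/P.
move: be; move: (Num.sqrt _) => q <-; ring.
Qed.

(** I - e e^T maps the gradient of [vw] to - 2 z. With f = [cutoff 0], contracting it with the
    Hessian of f(vw) gives the divergence of - 2 f'(vw) z, that is of - z vk. For ellipsoids this
    plays the role of [kernel_pair_eta]. *)
Lemma hess_op_vK g N z : enorm g = 1 -> 1 <= N ->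
  eval (hess_op (vdir g N) (vK g N)) z = - (n%:R * eval (vk g N) z + eval (eul (vk g N)) z).
Proof.
move=> g1 N1; rewrite eval_hess_op.
pose W := vw g N; pose A (i j : 'I_n) : R := (i == j)%:R - vdir g N ord0 i * vdir g N ord0 j.
have dK i j : eval (der i (der j (vK g N))) z =
    1 / 2 * eval (der i (vk g N)) z * eval (der j W) z + 1 / 2 * eval (vk g N) z * eval (der i (der j W)) z.
  have /(der_eq i) -> : eval (der j (vK g N)) = eval (Mul (Mul (Cst n 2) (Cut 2 W)) (der j W)).
    by apply/funext => x /=; ring.
  by rewrite /=; lra.
transitivity (\sum_i (- (z ord0 i * eval (der i (vk g N)) z) - eval (vk g N) z)); last first.
  by rewrite big_split /= !sumrN eval_eul sumr_const card_ord -[_ *+ n]mulr_natl; ring.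
apply: eq_bigr => i _.
transitivity (- eval (der i (vk g N)) z * (\sum_j A i j * (z ord0 j + (N ^+ 2 - 1) * dot g z * g ord0 j)) -
   eval (vk g N) z * (\sum_j A i j * ((delta_mx ord0 i : 'rV[R]_n) ord0 j + (N ^+ 2 - 1) * dot g (delta_mx ord0 i) * g ord0 j))).
  have -> : dot g (delta_mx ord0 i) = g ord0 i.
    rewrite /dot (bigD1 i)//= mxE !eqxx mulr1 big1 ?addr0// => l li.
    by rewrite mxE (negbTE li) andbF mulr0.
  have {}dK j : eval (der i (der j (vK g N))) z =
    1 / 2 * eval (der i (vk g N)) z * (- 2 * (z ord0 j + (N ^+ 2 - 1) * dot g z * g ord0 j)) +
    1 / 2 * eval (vk g N) z * (- 2 * ((i == j)%:R + (N ^+ 2 - 1) * g ord0 i * g ord0 j)).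
    by rewrite dK /W der_vw der2_vw.
  move: (dot g z) dK => d dK.
  rewrite !mulr_sumr -sumrB; apply: eq_bigr => j _; rewrite dK -/(A i j).
  by rewrite mxE eqxx [X in A i j * (X%:R + _)]/= eq_sym; move: (A i j) (eval _ _) (eval _ _) => *; lra.
by rewrite /A (vdir_row z i g1 N1) (vdir_row (delta_mx ord0 i) i g1 N1) mxE !eqxx mulr1n; ring.
Qed.

Lemma cutoff2_le s : cutoff 2 s <= 4.
Proof.
rewrite /cutoff; case: ifPn => // s0.
have := @exprn_le_expR R 1 (s^-1); rewrite invr_ge0 ltW// => /(_ isT) h.
have -> : - (2 / s) = - s^-1 - s^-1 by rewrite mulrDl !mul1r opprD.
have e0 := expR_gt0 (- s^-1 - s^-1).
apply: (@le_trans _ _ (2 ^+ 2 * expR s^-1 * expR (- s^-1 - s^-1))).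
  by apply: ler_wpM2r; [exact: ltW|].
rewrite -mulrA -expRD (_ : 2 ^+ 2 = 4 * 1 :> R); last by ring.
rewrite (_ : s^-1 + _ = - s^-1); last by ring.
rewrite mulr1 ler_piMr//.
by rewrite expR_le1 oppr_le0 invr_ge0 ltW.
Qed.

Lemma vk_ge0 g N z : 0 <= eval (vk g N) z.
Proof. by rewrite /= mulr_ge0// cutoff_ge0. Qed.

Lemma vk_le g N z : eval (vk g N) z <= 16.
Proof.
by rewrite /= -/(eval (vw g N) z) (_ : 16 = 4 * 4)//; [rewrite ler_pM2l// cutoff2_le|ring].
Qed.

(** [vw] is at most 1 everywhere, and cutoff 0 w = w^2 cutoff 2 w. *)
Lemma vK_le g N z : 1 <= N -> 0 <= eval (vK g N) z <= 1 / 4 * eval (vk g N) z.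
Proof.
move=> N1; have -> : eval (vK g N) z = cutoff 0 (eval (vw g N) z) by [].
have -> : eval (vk g N) z = 4 * cutoff 2 (eval (vw g N) z) by [].
rewrite cutoff_ge0 /= (_ : 1 / 4 * (4 * cutoff 2 (eval (vw g N) z)) = cutoff 2 (eval (vw g N) z)); last by field.
have [w0|w0] := lerP (eval (vw g N) z) 0; first by rewrite !cutoff_le0.
have w1 : eval (vw g N) z <= 1.
  rewrite eval_vw -addrA gerDl -opprD oppr_le0 addr_ge0 ?sqn_ge0// mulr_ge0 ?sqr_ge0// subr_ge0.
  exact: exprn_ege1.
by rewrite cutoffS (cutoffS 1) mulrA ler_piMl ?cutoff_ge0//; apply: mulr_ile1 => //; exact: ltW.
Qed.

Lemma vanish_Cut_vw g N m : 1 <= N -> vanish unitball (Cut m (vw g N)).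
Proof.
move=> N1 z nz; rewrite -[LHS]/(cutoff m (eval (vw g N) z)) cutoff_le0// eval_vw.
move: nz; rewrite /cball /= subr0 expr1n => /negP; rewrite -ltNge => z1.
have : 0 <= (N ^+ 2 - 1) * dot g z ^+ 2 by rewrite mulr_ge0 ?sqr_ge0// subr_ge0 exprn_ege1.
lra.
Qed.

(** The order 1 / N is that of the volume of the ellipsoid: in the ball of radius 1 / 2, [vw] is at
    least 1 / 2 on the strip 0 <= g . z <= 1 / (4 N). *)
Lemma Int_vk_ge : exists2 c : R, 0 < c & forall g N, enorm g = 1 -> 1 <= N -> c / N <= Int (eval (vk g N)).
Proof.
have [c c0 hc] := @leb_strip_ge R n.
pose p2 := expR (- 4) : R; have p0 : 0 < p2 by exact: expR_gt0.
exists (4 * p2 * (c * 4^-1 * 2^-1 ^+ n / 2^-1)) => [|g N g1 N1].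
  by rewrite !mulr_gt0// ?invr_gt0 ?exprn_gt0 ?invr_gt0.
have N0 : 0 < N by exact: lt_le_trans N1.
pose l := (4 * N)^-1; have l0 : 0 < l by rewrite invr_gt0 mulr_gt0.
have l4 : l <= 1 / 4 by rewrite /l invfM mulrC ler_pM2r ?invr_gt0// invf_le1.
have := hc 0 (2^-1) g 0 l g1 (lexx 0) l0.
rewrite add0r => /(_ _) H.
have {}H : c * l * 2^-1 ^+ n / 2^-1 <= fine (leb (strip 0 2^-1 g 0 l)) by apply: H; lra.
set S := strip _ _ _ _ _ in H.
have mS : measurable S by apply: measurable_closedrV; exact: closed_strip.
have fS : (leb S < +oo)%E.
  apply: (@le_lt_trans _ _ (leb (cball 0 2^-1))); last by apply: leb_compact; exact: compact_cball.
  by apply: le_measure; rewrite ?inE//; [apply: compact_measurable; exact: compact_cball|move=> z []].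
apply: (@le_trans _ _ (4 * p2 * fine (leb S))).
  rewrite -mulrA ler_pM2l ?mulr_gt0//; apply: le_trans H.
  by rewrite le_eqVlt; apply/orP; left; apply/eqP; rewrite /l; field; rewrite !gt_eqF.
rewrite -(Int_indic mS) -IntZ; last exact: intg_indic.
apply: Int_le; first by apply: intgZ; exact: intg_indic.
  by apply: (intg_vanish (@compact_cball _ _ 0 1)); apply: vanish_mulr; exact: vanish_Cut_vw.
move=> z; rewrite indicE; have [Sz|Sz] := pselect (S z); last by rewrite memNset// mulr0 vk_ge0.
rewrite mem_set// mulr1 -[leRHS]/(4 * cutoff 2 (eval (vw g N) z)) ler_pM2l//.
have w2 : 1 / 2 <= eval (vw g N) z.
  rewrite eval_vw; move: Sz => [/= S1 S2]; move: S1; rewrite /cball /= subr0 => S1.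
  have : (N ^+ 2 - 1) * dot g z ^+ 2 <= 1 / 16.
    rewrite subr0 add0r in S2; have /andP[s1 s2] := S2.
    apply: (@le_trans _ _ (N ^+ 2 * l ^+ 2)); last first.
      by rewrite /l le_eqVlt; apply/orP; left; apply/eqP; field; rewrite gt_eqF.
    apply: ler_pM; rewrite ?sqr_ge0 ?subr_ge0 ?exprn_ege1//; first by rewrite lerBlDr lerDl.
    by rewrite ler_pXn2r ?nnegrE// ltW.
  have : sqn z <= 1 / 4 by apply: le_trans S1 _; rewrite le_eqVlt; apply/orP; left; apply/eqP; field.
  lra.
have w1 : eval (vw g N) z <= 1.
  rewrite eval_vw -addrA gerDl -opprD oppr_le0 addr_ge0 ?sqn_ge0// mulr_ge0 ?sqr_ge0// subr_ge0.
  exact: exprn_ege1.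
move: (eval (vw g N) z) w1 w2 => w w1 w2; have w0 : 0 < w by lra.
rewrite /cutoff w0 -[p2]mul1r; apply: ler_pM => //; first exact: ltW.
  by rewrite exprn_ege1// invf_ge1.
rewrite ler_expR lerN2 ler_pdivrMr//; lra.
Qed.
End valley_kernel.

(** * The mean value inequality on ellipsoids *)

Section valley.
Variables (R : realType) (n : nat).
Variables (Omega : set 'rV[R]_n) (U : 'rV[R]_n -> R).
Hypotheses (n_gt0 : (0 < n)%N) (hU : local_min Omega U).
Implicit Types (x y z v h e g : 'rV[R]_n) (s r c m N epsilon rho : R).
Notation unitball := (cball (0 : 'rV[R]_n) 1).
Let fb := boundary [set x | 0 < U x].

Let iU : intg U. Proof. by case: hU. Qed.

(* Mean value inequality over ellipsoids for subsolutions of the Laplacian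
   minus (1 - N^-2) times the second derivative along g. *)
Lemma valley_mean g N y S s1 (B : R) : enorm g = 1 -> 1 <= N -> 0 < S -> 0 < s1 -> 0 <= B -> {for y, continuous U} ->
  (forall z, cball y S z -> cball z s1 `<=` Omega) ->
  (forall z s, cball y S z -> 0 < s <= s1 -> - B <= lop (mhess U z s) (vdir g N)) ->
  U y * Int (eval (vk g N)) <= S ^- n * convol U (vk g N) y S + B * (1 / 4 * Int (eval (vk g N))) * S ^+ 2.
Proof.
move=> g1 N1 S0 s10 B0 cy hO hB; have cl := @closed_cball R n 0 1.
have vK0 : vanish unitball (vK g N) by exact: vanish_Cut_vw.
have vk0 : vanish unitball (vk g N) by apply: vanish_mulr; exact: vanish_Cut_vw.
have ve : vanish unitball (eul (vk g N)) by exact: vanish_eul.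
have cc := @compact_cball R n 0 1.
have iK := intg_vanish cc vK0; have ik := intg_vanish cc vk0.
have IKk : Int (eval (vK g N)) <= 1 / 4 * Int (eval (vk g N)).
  by rewrite -IntZ//; apply: Int_le => //; [exact: intgZ|move=> z; have /andP[] := vK_le g z N1].
set Ik := Int (eval (vk g N)) in IKk *; set IK := Int (eval (vK g N)) in IKk.
pose H s := convol U (hess_op (vdir g N) (vK g N)) y s.
have low s : 0 < s <= S -> - (2 * B) * IK * s ^+ 2 <= s ^- n * H s.
  move=> /andP[s0 sS].
  have sub : cball y s `<=` cball y S by apply: cball_mono => //; exact: ltW.
  have := @weak_lower _ _ _ _ n_gt0 hU (vdir g N) y s1 s B (rescale y s (vK g N)) s10 (vanish_rescale s0 vK0) _ _ _.
  rewrite (_ : Int (eval (rescale y s (vK g N))) = s ^+ n * IK); last first.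
    rewrite /IK -(Int_kernel y s0 vK0); congr Int; apply/funext => z; exact: eval_rescale.
  rewrite (_ : Int (fun z => U z * eval (hess_op (vdir g N) (rescale y s (vK g N))) z) = s ^- 2 * H s); last first.
    rewrite /H /convol -IntZ; last first.
      by apply: intg_convol => //; exact: vanish_hess_op.
    congr Int; apply/funext => z; rewrite mulrCA; congr (_ * _).
    rewrite !eval_hess_op mulr_sumr; apply: eq_bigr => i _; rewrite mulr_sumr; apply: eq_bigr => j _.
    rewrite mulrCA; congr (_ * _).
    have /(der_eq i) -> : eval (der j (rescale y s (vK g N))) = eval (Mul (Cst n s^-1) (rescale y s (der j (vK g N)))).
      apply/funext => x; rewrite der_rescale.
      by rewrite -[RHS]/(s^-1 * eval (rescale y s (der j (vK g N))) x) eval_rescale.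
    rewrite -[LHS]/(0 * _ + s^-1 * eval (der i (rescale y s (der j (vK g N)))) z) mul0r add0r der_rescale mulrA.
    by rewrite -invfM expr2.
  move=> h; have {}h : - (2 * B) * (s ^+ n * IK) <= s ^- 2 * H s.
    apply: h.
    - by move=> z; rewrite eval_rescale; have /andP[] := vK_le g (s^-1 *: (z - y)) N1.
    - by move=> z /sub; exact: hO.
    - by move=> z s' /sub; exact: hB.
  have sn : 0 < s ^+ n by rewrite exprn_gt0.
  have s2 : 0 < s ^+ 2 by rewrite exprn_gt0.
  move: h; rewrite ler_pdivlMl// => h; rewrite ler_pdivlMl//; apply: le_trans h.
  by rewrite le_eqVlt; apply/orP; left; apply/eqP; ring.
have IK0 : 0 <= IK by apply: Int_ge0 => z; have /andP[] := vK_le g z N1.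
(* By [low] the average over the ellipsoid of size s decreases at a speed of at most 2 B IK s.
   Adding B IK s^2 makes it nondecreasing, and as s tends to 0 it tends to U y times the integral of
   the kernel. *)
pose F s := s ^- n * convol U (vk g N) y s + B * IK * s ^+ 2.
have dF s : 0 < s -> is_derive s 1 F (s^-1 * (s ^- n * H s) + B * IK * (2 * s)).
  move=> s0; have sN : s ^+ n != 0 by rewrite gt_eqF// exprn_gt0.
  have D1 := @is_derive1_inv _ (fun r => r ^+ n) s _ sN (is_derive1_exp n (is_derive1_id s)).
  have D2 := is_derive1_mul D1 (is_derive_convol_scale y s0 iU vk0).
  have D3 := is_derive1_scale (B * IK) (is_derive1_exp 2 (is_derive1_id s)).
  apply: is_derive1_eq (is_derive1_add D2 D3) _.
  have -> : H s = - (n%:R * convol U (vk g N) y s + convol U (eul (vk g N)) y s).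
    rewrite -(convol_scale _ _ _ iU vk0) -(convol_add _ _ iU) //; last exact: vanish_mulr.
    rewrite -mulN1r -convol_scale//; last by apply: vanish_add => //; exact: vanish_mulr.
    by apply: convol_eq; apply/funext => x; rewrite hess_op_vK//= -/(eval (eul (vk g N)) x); ring.
  have -> : n%:R * s ^+ n.-1 * 1 = n%:R * s ^+ n / s.
    by rewrite -[in s ^+ n](prednK n_gt0) exprS; field; rewrite gt_eqF.
  move: (convol _ _ _ _) (convol _ _ _ _) (s ^+ n) sN => a b p p0; rewrite expr1; field; by rewrite p0 gt_eqF.
have mono s : 0 < s <= S -> F s <= F S.
  move=> /andP[s0 sS]; have := @mvt_ge _ F (fun s => s^-1 * (s ^- n * H s) + B * IK * (2 * s)) s S 0 sS.
  rewrite mul0r subr_ge0; apply => q /andP[q1 q2].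
    by apply: dF; exact: lt_le_trans q1.
  have q0 : 0 < q by exact: lt_le_trans q1.
  have := low q; rewrite q0 q2 => /(_ isT) h.
  have : q^-1 * (- (2 * B) * IK * q ^+ 2) <= q^-1 * (q ^- n * H q) by rewrite ler_pM2l ?invr_gt0.
  rewrite (_ : q^-1 * (- (2 * B) * IK * q ^+ 2) = - (B * IK * (2 * q))); last by field; rewrite gt_eqF.
  by move: (q^-1 * _) => a; lra.
have [A A0 hA] := @convol_near R n U _ vk0.
suff : U y * Ik <= F S.
  move=> h; apply: le_trans h _; rewrite /F lerD2l ler_wpM2r ?sqr_ge0// ler_wpM2l//.
apply/ler_addgt0Pr => d d0; have dA : 0 < d / A by rewrite divr_gt0.
have /cvgrPdist_le/(_ _ dA)/nbhs_ballP[q /= q0 hq] := cy.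
pose s := Num.min S (q / 2); have s0 : 0 < s by rewrite lt_min S0 divr_gt0.
have sS : s <= S by rewrite ge_min lexx.
have sq : s <= q / 2 by rewrite ge_min lexx orbT.
have := hA y s (d / A) (U y) s0 iU (ltW dA) _.
rewrite -/Ik mulrCA mulfV ?mulr1 ?gt_eqF// => /(_ _) h.
have {}h : `|s ^- n * convol U (vk g N) y s - U y * Ik| <= d.
  apply: h => z /(cball_norm (ltW s0)) zs; rewrite distrC; apply: hq.
  by rewrite ball_rVE /=; lra.
have := mono s; rewrite s0 sS => /(_ isT) {}mono.
have : 0 <= B * IK * s ^+ 2 by apply: mulr_ge0; [exact: mulr_ge0|exact: sqr_ge0].
move: h mono; rewrite ler_norml {1}/F; move: (F S) (s ^- n * _) (U y * Ik) (B * IK * s ^+ 2) => *; lra.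
Qed.
End valley.

(** * U does not resemble - b (g . h)^2 *)

Section no_valley.
Variables (R : realType) (n : nat).
Notation leb := (@lebesgue_rV R n).
Variables (Omega : set 'rV[R]_n) (U : 'rV[R]_n -> R).
Hypotheses (n_gt0 : (0 < n)%N) (hU : local_min Omega U).
Implicit Types (x y z v h e g : 'rV[R]_n) (s r c m N epsilon rho : R).
Let fb := boundary [set x | 0 < U x].

Lemma continuous_enorm_sub x : continuous (fun z => enorm (z - x)).
Proof.
apply: (@lipschitz_cts _ _ _ n.+1%:R) => [|y y']; first by rewrite ltr0n.
apply: (@le_trans _ _ (enorm (y' - y))).
  rewrite ler_norml lerBlDr lerBrDr [- _ + _]addrC; apply/andP; split.
    by rewrite lerBlDr; apply: le_trans (enorm_tri y y' x) _; rewrite enormB addrC.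
  exact: enorm_tri.
by apply: le_trans (enorm_le_norm _) _; rewrite ler_wpM2r// ler_nat.
Qed.

(* A point y at which sqrt U - b |. - y0| is maximal: there U <= 4 U(y) on the
   ball of radius sqrt(U y) / b. *)
Lemma sqrt_max x r b : fb x -> 0 < r -> 0 < b -> (forall h, enorm h <= r -> {for x + h, continuous U}) ->
  (forall h, enorm h <= r -> U (x + h) <= b ^+ 2 / 16 * r ^+ 2) ->
  exists y, [/\ 0 < U y, enorm (y - x) + Num.sqrt (U y) / b <= r &
     forall z, enorm (z - y) <= Num.sqrt (U y) / b -> U z <= 4 * U y].
Proof.
move=> fx r0 b0 cU hU0.
have [y0 y0x Uy0] := fb_pos fx (divr_gt0 r0 (ltr0n _ 4)).
(* At a maximum y of F the square root of U grows away from y with slope at most b, so it at most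
   doubles within sqrt (U y) / b. Comparison with y0 keeps y within that same distance of y0. *)
pose F z := Num.sqrt (U z) - b * enorm (z - y0).
have r2 : 0 < r / 2 by rewrite divr_gt0.
have inr z : cball y0 (r / 2) z -> enorm (z - x) <= r.
  move=> /cballP zy; have {}zy := zy (ltW r2).
  by apply: le_trans (enorm_tri z y0 x) _; lra.
have Ux z : enorm (z - x) <= r -> U z <= b ^+ 2 / 16 * r ^+ 2.
  by move=> zr; have := hU0 _ zr; rewrite [x + _]addrC subrK.
have cF : {in cball y0 (r / 2), continuous F}.
  move=> z /set_mem /inr zr; have := cU _ zr; rewrite [x + _]addrC subrK => cz.
  apply: (@continuousB _ _ _ (fun z => Num.sqrt (U z)) (fun z => b * enorm (z - y0))).
    by apply: (@continuous_comp _ _ _ U (@Num.sqrt R)); [exact: cz|exact: sqrt_continuous].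
  by apply: (@cts_mul R n (fun=> b)); [exact: (@continuous_eval R n (Cst n b))|exact: continuous_enorm_sub].
have c1 : {within cball y0 (r / 2), continuous F} by exact: continuous_in_subspaceT.
have ne : cball y0 (r / 2) !=set0 by exists y0; exact: cball_self.
have [y /set_mem yK hy] := compact_EVT_max ne (@compact_cball R n y0 (r / 2)) c1.
have Fy0 : F y0 <= F y by apply: hy; apply/mem_set; exact: cball_self.
rewrite /F subrr enorm0 mulr0 subr0 in Fy0.
have sy0 : 0 < Num.sqrt (U y0) by rewrite sqrtr_gt0.
have by0 : b * enorm (y - y0) < Num.sqrt (U y) by lra.
have bn : 0 <= b * enorm (y - y0) by rewrite mulr_ge0 ?enorm_ge0// ltW.
have sy : 0 < Num.sqrt (U y) by lra.
have Uy : 0 < U y by rewrite sqrtr_gt0 in sy.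
have sr : Num.sqrt (U y) / b <= r / 4.
  rewrite ler_pdivrMr// -[X in _ <= X]ger0_norm ?mulr_ge0 ?divr_ge0 ?(ltW r0) ?(ltW b0)// -sqrtr_sqr ler_sqrt ?sqr_ge0//.
  by apply: le_trans (Ux y (inr y yK)) _; rewrite le_eqVlt; apply/orP; left; apply/eqP; field.
have yy0 : enorm (y - y0) <= Num.sqrt (U y) / b by rewrite ler_pdivlMr// mulrC ltW.
exists y; split => //.
  by have := enorm_tri y y0 x; lra.
move=> z zy; have zK : cball y0 (r / 2) z.
  by apply/cballP; [exact: ltW|apply: le_trans (enorm_tri z y y0) _; lra].
have := hy z (mem_set zK); rewrite /F => H.
have H2 : Num.sqrt (U z) <= 2 * Num.sqrt (U y).
  have t := enorm_tri z y y0.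
  have H3 : b * enorm (z - y0) <= b * enorm (z - y) + b * enorm (y - y0) by rewrite -mulrDr ler_pM2l//; exact: enorm_tri.
  move: zy; rewrite ler_pdivlMr// mulrC => zy; move: H t zy H3.
  move: (Num.sqrt (U z)) (Num.sqrt (U y)) => a1 a2; lra.
have [Uz|Uz] := lerP (U z) 0; first by apply: le_trans Uz _; rewrite mulr_ge0// ltW.
have : Num.sqrt (U z) ^+ 2 <= (2 * Num.sqrt (U y)) ^+ 2.
  by rewrite ler_pXn2r ?nnegrE ?sqrtr_ge0// mulr_ge0// sqrtr_ge0.
by rewrite exprMn !sqr_sqrtr ?(ltW Uz) ?(ltW Uy)//; lra.
Qed.

(* If U looks like - b (g . h)^2 then its positive set near a point y as above
   fills a fixed proportion of an ellipsoid, too much for it to pay off. *)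
Lemma no_valley C1 : 0 < C1 -> exists2 N : R, 1 <= N & exists2 e : R, 0 < e & forall x r g s1, fb x -> enorm g = 1 ->
  0 < r -> 0 < s1 -> (forall z, enorm (z - x) <= r -> cball z s1 `<=` Omega) -> cball x r `<=` Omega ->
  (forall z s, enorm (z - x) <= r -> 0 < s <= s1 -> - (C1 / N ^+ 2) <= lop (mhess U z s) (vdir g N)) ->
  ~ (forall h, enorm h <= r -> U (x + h) <= e * r ^+ 2).
Proof.
move=> C10; have [_ iU cU _ _] := hU.
have [D D0 hD] := dens_le hU; have [C C0 hC] := push_down hU; have [c3 c30 hc3] := @Int_vk_ge R n.
pose Q := D * C1 / 2 + C1 ^+ 2 / 4.
have Q0 : 0 < Q by rewrite /Q addr_gt0 ?divr_gt0 ?mulr_gt0 ?exprn_gt0.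
(* The positive part [G] will have measure at least c3 S^n / (128 N) by the mean value inequality
   and at most C 2^n Q S^n / N^2 by minimality, so that N <= P. *)
pose P := 128 * C * 2 ^+ n * Q / c3.
have P0 : 0 < P by rewrite /P divr_gt0// !mulr_gt0// exprn_gt0.
pose N := P + 1; have N1 : 1 <= N by rewrite lerDr ltW.
have N0 : 0 < N by exact: lt_le_trans N1.
(* With this b the radius S satisfies U y = C1 S^2 / (2 N^2), so the error term of the mean value
   inequality is exactly half of U y times the integral of the kernel and can be absorbed. *)
have [b b0 b2] : exists2 b : R, 0 < b & b ^+ 2 = C1 / 8 / N ^+ 2.
  exists (Num.sqrt (C1 / 8) / N); first by rewrite divr_gt0// sqrtr_gt0 divr_gt0.
  by rewrite exprMn sqr_sqrtr ?divr_ge0 ?(ltW C10)// exprVn.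
exists N => //; exists (b ^+ 2 / 16) => [|x r g s1 fx g1 r0 s10 hO xO hB hu]; first by rewrite divr_gt0// exprn_gt0.
have cUx h : enorm h <= r -> {for x + h, continuous U}.
  by move=> hr; apply: cU; apply: xO; apply/cballP; [exact: ltW|rewrite [x + _]addrC addrK].
have [y [m0 yr hy]] := sqrt_max fx r0 b0 cUx hu.
set m := U y in m0 yr hy.
have sm : 0 < Num.sqrt m by rewrite sqrtr_gt0.
have [S [S0 S2 mS]] : exists S : R, [/\ 0 < S, 2 * S = Num.sqrt m / b & m = C1 * S ^+ 2 / (2 * N ^+ 2)].
  exists (Num.sqrt m / b / 2); split; first by rewrite !divr_gt0.
    by field; rewrite gt_eqF.
  have mm : Num.sqrt m ^+ 2 = m by rewrite sqr_sqrtr// ltW.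
  have -> : (Num.sqrt m / b / 2) ^+ 2 = m / (4 * b ^+ 2).
    by rewrite !exprMn mm !exprVn; field; rewrite gt_eqF.
  by rewrite b2; field; rewrite !gt_eqF.
have inr z : enorm (z - y) <= 2 * S -> enorm (z - x) <= r.
  by rewrite S2 => zy; apply: le_trans (enorm_tri z y x) _; lra.
have yS z : cball y S z -> enorm (z - y) <= 2 * S.
  by move=> /cballP zy; apply: le_trans (zy (ltW S0)) _; lra.
have cy : {for y, continuous U}.
  by have := cUx (y - x); rewrite [x + _]addrC subrK; apply; apply: inr; rewrite subrr enorm0; lra.
have B0 : 0 <= C1 / N ^+ 2 by rewrite divr_ge0 ?exprn_ge0// ltW.
have := @valley_mean _ _ _ _ n_gt0 hU g N y S s1 (C1 / N ^+ 2) g1 N1 S0 s10 B0 cy _ _.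
have IkN := hc3 g N g1 N1.
rewrite -/m; set Ik := Int _ in IkN * => vm.
have {}vm : m * Ik <= S ^- n * convol U (vk g N) y S + C1 / N ^+ 2 * (1 / 4 * Ik) * S ^+ 2.
  by apply: vm => [z /yS/inr|z s /yS/inr]; [exact: hO|exact: hB].
pose G := cball y S `&` [set z | 0 < U z].
have mG : measurable G.
  apply: measurableI; first by apply: compact_measurable; exact: compact_cball.
  rewrite (_ : [set _ | _] = setT `&` U @^-1` [set` `]0, +oo[]); last first.
    by rewrite setTI; apply/seteqP; split => z /=; rewrite in_itv/= andbT.
  by apply: (intg_measurable iU) => //; exact: measurable_itv.
have fG : (leb G < +oo)%E.
  apply: (@le_lt_trans _ _ (leb (cball y S))); last by apply: leb_compact; exact: compact_cball.
  by apply: le_measure; rewrite ?inE//; [apply: compact_measurable; exact: compact_cball|move=> z []].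
have vk0 : vanish (cball 0 1) (vk g N) by apply: vanish_mulr; exact: vanish_Cut_vw.
(* On the ball U <= 4 m, the kernel is at most 16, and the part with U <= 0 is dropped. *)
have Jle : convol U (vk g N) y S <= 64 * m * fine (leb G).
  rewrite -(Int_indic mG) -IntZ; last exact: intg_indic.
  apply: Int_le; [exact: intg_convol|by apply: intgZ; exact: intg_indic|].
  move=> z; set kz := eval _ _; have kz0 : 0 <= kz := vk_ge0 _ _ _.
  have kz1 : kz <= 16 := vk_le _ _ _.
  have [Gz|Gz] := pselect (G z).
    rewrite indicE mem_set// mulr1 (_ : 64 * m = 4 * m * 16); last by ring.
    have [zS Uz] := Gz; apply: ler_pM => //; first exact: ltW.
    by apply: hy; rewrite -S2; exact: yS.
  rewrite indicE memNset// mulr0; have [zS|zS] := pselect (cball y S z).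
    rewrite mulrC; apply: mulr_ge0_le0 => //; rewrite leNgt; apply/negP => Uz; exact: Gz.
  by rewrite /kz vk0 ?mulr0//; move=> /(in_unitball y z S0).
have Sn : 0 < S ^+ n by rewrite exprn_gt0.
have Gge : S ^+ n * Ik <= 128 * fine (leb G).
  have e1 : C1 / N ^+ 2 * (1 / 4 * Ik) * S ^+ 2 = m * Ik / 2.
    by rewrite mS; field; rewrite gt_eqF.
  have e2 : S ^- n * convol U (vk g N) y S <= S ^- n * (64 * m * fine (leb G)).
    by rewrite ler_pM2l ?invr_gt0.
  have : m * (S ^+ n * Ik) <= m * (128 * fine (leb G)).
    have e3 : m * Ik / 2 <= S ^- n * (64 * m * fine (leb G)) by move: vm e2; rewrite e1; move: (S ^- n * _) (S ^- n * _) => *; lra.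
    have e4 := ler_wpM2l (ltW Sn) e3; move: e4; rewrite mulVKf ?gt_eqF//.
    by move: (S ^+ n) (fine _) => *; lra.
  by rewrite ler_pM2l.
have S20 : 0 < 2 * S by rewrite mulr_gt0.
have yO : cball y (2 * S) `<=` Omega.
  move=> z /cballP zy; apply: xO; apply/cballP; first exact: ltW.
  by apply: inr; apply: zy; exact: ltW.
have m4 : 0 <= 4 * m by rewrite mulr_ge0// ltW.
have := hC y (2 * S) (4 * m) G S20 m4 yO mG _ _ => Gle.
have {}Gle : fine (leb G) <= C * (4 * m * dens U y (2 * S) + (4 * m) ^+ 2 * (2 * S) ^+ n / (2 * S) ^+ 4).
  apply: Gle => [z [zS _]|z [zS Uz]].
    by rewrite (_ : 2 * S / 2 = S)//; field.
  by rewrite Uz; apply: hy; rewrite -S2; exact: yS.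
have dle := hD y (2 * S) S20 yO.
have {}Gle : fine (leb G) <= C * 2 ^+ n * Q / N ^+ 2 * S ^+ n.
  apply: le_trans Gle _.
  rewrite (_ : C * 2 ^+ n * Q / N ^+ 2 * S ^+ n = C * (2 ^+ n * S ^+ n * (Q / N ^+ 2))); last by ring.
  rewrite ler_pM2l//.
  apply: (@le_trans _ _ (4 * m * (D * (2 * S) ^+ n / (2 * S) ^+ 2) + (4 * m) ^+ 2 * (2 * S) ^+ n / (2 * S) ^+ 4)).
    by rewrite lerD2r; apply: ler_wpM2l.
  have -> : 4 * m * (D * (2 * S) ^+ n / (2 * S) ^+ 2) + (4 * m) ^+ 2 * (2 * S) ^+ n / (2 * S) ^+ 4 =
     2 ^+ n * S ^+ n * (D * C1 / 2 / N ^+ 2 + C1 ^+ 2 / 4 / N ^+ 2 / N ^+ 2).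
    by rewrite mS exprMn; field; rewrite !gt_eqF.
  rewrite ler_pM2l ?mulr_gt0 ?exprn_gt0// /Q mulrDl lerD2l ler_piMr//.
    by apply: divr_ge0; [apply: divr_ge0 => //|]; exact: sqr_ge0.
  by rewrite invf_le1 ?exprn_gt0// exprn_ege1.
have : c3 / N * S ^+ n <= c3 * P / N ^+ 2 * S ^+ n.
  apply: (@le_trans _ _ (128 * (C * 2 ^+ n * Q / N ^+ 2 * S ^+ n))).
    apply: le_trans (ler_wpM2r (ltW Sn) IkN) _; rewrite mulrC; apply: le_trans Gge _.
    by rewrite ler_pM2l.
  by rewrite le_eqVlt; apply/orP; left; apply/eqP; rewrite /P; field; rewrite !gt_eqF.
rewrite ler_pM2r// => h.
have : N <= P.
  have := ler_wpM2r (ltW (exprn_gt0 2 N0)) h.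
  rewrite (_ : c3 / N * N ^+ 2 = c3 * N); last by field; rewrite gt_eqF.
  by rewrite divfK ?gt_eqF ?exprn_gt0// ler_pM2l.
by rewrite /N gerDl ler10.
Qed.
End no_valley.

(** * The blow-up is semidefinite of rank at least two *)

Section rank_two.
Variables (R : realType) (n : nat).
Variables (Omega : set 'rV[R]_n) (U : 'rV[R]_n -> R).
Hypotheses (n_gt0 : (0 < n)%N) (hU : local_min Omega U).
Implicit Types (x y z v h e g : 'rV[R]_n) (A B : 'M[R]_n) (s r c m N epsilon rho sigma tau delta kappa : R).
Let fb := boundary [set x | 0 < U x].

Lemma quadratic_scalar tau h : quadratic (tau%:M) h = tau * sqn h.
Proof.
rewrite /quadratic /sqn mulr_sumr; apply: eq_bigr => i _.
rewrite (bigD1 i)//= big1 ?addr0 => [|j ji]; first by rewrite mxE eqxx mulr1n expr2 mulrA.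
by rewrite mxE eq_sym (negbTE ji) mulr0n !mul0r.
Qed.

Lemma msum_scalar tau : 0 <= tau -> msum (tau%:M : 'M[R]_n) = n%:R * tau.
Proof.
move=> t0; rewrite /msum (eq_bigr (fun=> tau)).
  by rewrite sumr_const card_ord -[tau *+ n]mulr_natl.
move=> i _; rewrite (bigD1 i)//= big1 ?addr0 => [|j ji]; first by rewrite mxE eqxx mulr1n ger0_norm.
by rewrite mxE eq_sym (negbTE ji) mulr0n normr0.
Qed.

Lemma psd_shift A tau : A^T = A -> 0 <= tau -> (forall v, enorm v <= 1 -> - tau <= quadratic A v) -> psd (A + tau%:M).
Proof.
move=> sA t0 hA; split=> [|h]; first by rewrite linearD /= tr_scalar_mx sA.
rewrite quadraticDm quadratic_scalar; have [h0|h0] := eqVneq (enorm h) 0.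
  by rewrite (enorm_eq0 h0) quadratic0 add0r mulr_ge0// sqn_ge0.
have hp : 0 < enorm h by rewrite lt_neqAle eq_sym h0 enorm_ge0.
have := hA ((enorm h)^-1 *: h); rewrite enormZ gtr0_norm ?invr_gt0// mulVf// => /(_ (lexx _)).
rewrite quadraticZ -sqr_enorm => H.
rewrite -(pmulr_rge0 _ (_ : 0 < (enorm h)^-1 ^+ 2)) ?exprn_gt0 ?invr_gt0//.
rewrite mulrDr mulrCA -exprMn mulVf// expr1n mulr1; lra.
Qed.

(** If the form takes both a value >= tau and a value <= - tau on the unit ball, then from any point
    a step s along one of these two directions raises it by tau s^2 and a step along the other
    lowers it, the sign of the step being chosen to favour the cross term; [flat_model] applies.
    Otherwise A or - A is bounded below by - tau. *)
Lemma indefinite_flat A x r (e : R) tau delta : 0 < r -> 0 < delta < 1 -> A^T = A -> 0 < tau ->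
  e * r ^+ 2 < tau * (delta * r / 8) ^+ 2 ->
  (forall h, enorm h <= r -> {for x + h, continuous U}) ->
  (forall h, enorm h <= r -> `|U (x + h) - quadratic A h| <= e * r ^+ 2) ->
  ((delta * r)%:E <= rank2_distance fb r x)%E ->
  exists2 sigma, sigma ^+ 2 = 1 & psd (sigma *: A + tau%:M).
Proof.
move=> r0 d01 sA t0 et cU hA hfl; have /andP[d0 d1] := d01.
have dr : 0 < delta * r / 8 by rewrite divr_gt0// mulr_gt0.
have [[ep [ep1 epA]]|hp] := pselect (exists v, enorm v <= 1 /\ tau <= quadratic A v); last first.
  exists (- 1); first by rewrite sqrrN expr1n.
  apply: psd_shift; [by rewrite linearZ /= sA|exact: ltW|].
  move=> v v1; rewrite quadratic_scale mulN1r lerN2 leNgt; apply/negP => H.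
  by apply: hp; exists v; split => //; exact: ltW.
have [[em [em1 emA]]|hm] := pselect (exists v, enorm v <= 1 /\ quadratic A v <= - tau); last first.
  exists 1; first by rewrite expr1n.
  rewrite scale1r; apply: psd_shift => //; first exact: ltW.
  move=> v v1; rewrite leNgt; apply/negP => H.
  by apply: hm; exists v; split => //; exact: ltW.
exfalso; move: hfl; rewrite leNgt => /negP; apply.
pose s := delta * r / 8.
have epz : quadratic A ep != 0 by rewrite gt_eqF// (lt_le_trans t0).
have sgn v h : exists2 sg : R, sg ^+ 2 = 1 & 0 <= sg * bil A h v.
  have [H|H] := lerP 0 (bil A h v); first by exists 1; rewrite ?expr1n ?mul1r.
  by exists (-1); rewrite ?sqrrN ?expr1n// mulN1r oppr_ge0 ltW.
have expd v h t : quadratic A (h + t *: v) = quadratic A h + 2 * (t * bil A h v) + t ^+ 2 * quadratic A v.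
  by rewrite quadraticD// bilZr quadraticZ.
have s2 : 0 <= s ^+ 2 by exact: sqr_ge0.
have nle (sg : R) v : sg ^+ 2 = 1 -> enorm v <= 1 -> enorm ((sg * s) *: v) <= s.
  move=> sg1 v1; rewrite enormZ normrM (ger0_norm (ltW dr)).
  have -> : `|sg| = 1 by move/eqP: sg1; rewrite sqrf_eq1 => /orP[]/eqP->; rewrite ?normrN normr1.
  by rewrite mul1r ler_piMr// ltW.
apply: (@flat_model R n U (quadratic A) A x r delta (tau * s ^+ 2) ep r0 d01 sA epz) => //.
- exact: continuous_quadratic.
- by move=> h hr; apply: le_lt_trans (hA h hr) et.
move=> h; have [sp sp1 spA] := sgn ep h; have [sm sm1 smA] := sgn em h.
exists (h + (sp * s) *: ep), (h + (- sm * s) *: em); split.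
- by rewrite [h + _]addrC addrK; exact: nle.
- by rewrite [h + _]addrC addrK; apply: nle => //; rewrite sqrrN.
- rewrite expd (_ : (sp * s) ^+ 2 = s ^+ 2); last by rewrite exprMn sp1 mul1r.
  rewrite -addrA lerD2l.
  have : s ^+ 2 * tau <= s ^+ 2 * quadratic A ep by exact: ler_wpM2l.
  have : 0 <= s * (sp * bil A h ep) by rewrite mulr_ge0// ltW.
  move: (bil _ _ _) (quadratic _ _) => p q; lra.
rewrite expd (_ : (- sm * s) ^+ 2 = s ^+ 2); last by rewrite exprMn sqrrN sm1 mul1r.
have : s ^+ 2 * quadratic A em <= s ^+ 2 * - tau by exact: ler_wpM2l.
have : 0 <= s * (sm * bil A h em) by rewrite mulr_ge0// ltW.
move: (bil _ _ _) (quadratic _ _) (quadratic _ _) => p q q'; lra.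
Qed.

(** The minor allows the coordinates i and j of h to be recovered from the others and from p . h and
    q . h, see [solve2]: the free boundary is close to a plane of dimension n - 2 that is a graph
    over the other coordinates. *)
Definition codim2 tau2 eta x r := exists (i j : 'I_n) (p q : 'rV[R]_n),
  [/\ forall k, `|p ord0 k| <= 1 /\ `|q ord0 k| <= 1,
      tau2 <= p ord0 i * q ord0 j - p ord0 j * q ord0 i &
      forall h, enorm h < r -> fb (x + h) -> `|dot p h| <= eta * r /\ `|dot q h| <= eta * r].

(** tau2 is fixed before eta, since [slab_drop] derives eta from tau2. Then come the thresholds tau
    and e, the scale ratio kappa, the density epsilon and finally the radius r1. *)
Lemma rank_two c delta s0 : 0 < c -> 0 < delta < 1 -> 0 < s0 -> exists2 tau2 : R, 0 < tau2 &
  forall eta, 0 < eta -> exists2 epsilon, 0 < epsilon & forall rho, 0 < rho -> exists2 r1 : R, 0 < r1 &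
  forall x r, good Omega U rho epsilon c delta x -> cball x (2 * s0) `<=` Omega -> 0 < r <= r1 ->
    codim2 tau2 eta x r.
Proof.
have algR (q p : R) : 0 < q -> q <= p / 8 -> [/\ q < p, q <= p, 2 * q <= p & 8 * q <= p] by move=> *; split; lra.
have algB (q : R) : 0 < q -> q / 2 < q by lra.
have algC (c' r2 e2 u q P Q : R) : `|u - q| <= e2 -> `|q| <= P -> P <= Q -> c' * r2 < `|u| -> e2 <= c' / 2 * r2 ->
  `|u| <= `|u - q| + `|q| -> c' / 2 * r2 <= Q by lra.
have algD (m1 s nt cc T : R) : cc / 2 <= m1 -> m1 <= s + nt -> s <= T -> nt <= cc / 4 -> cc / 4 <= T by lra.
have algE (p q X : R) : p <= X / 2 -> q <= X / 2 -> p + q <= X by lra.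
have algG (q t s e r2 : R) : q - t * s <= e * r2 -> t * s <= t * r2 -> q <= (e + t) * r2 by lra.
have algH (p q v : R) : p <= v -> q <= v -> p + q <= v * 2 by lra.
have algI (m1 b : R) : m1 * b <= 1 / 2 * b -> m1 * b <= b / 2 by lra.
have algJ (T X b v : R) : 0 < b -> v <= T -> T <= b + X -> X <= b / 2 -> v / 2 <= b by lra.
have algK (C T nt q t b X m1 : R) : - C <= T - nt - 2 * (q - t * 1) -> T <= b + X -> X <= b / 2 -> b <= q -> 0 <= nt -> t <= 1 ->
  0 <= m1 -> b <= 2 * C + 4 + m1 by lra.
have algL (C A1 T nt b m1 : R) : 0 < C -> - C <= A1 -> - A1 = T - nt -> nt <= m1 -> b <= T -> b <= 2 * C + 4 + m1 by lra.
have algM (w q bd ts X er tr e4 r2 : R) : `|w - (q - ts)| <= er -> 0 <= q - bd -> q - bd <= X -> 0 <= ts -> ts <= tr ->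
  X <= e4 / 4 * r2 -> tr <= e4 / 4 * r2 -> er <= e4 / 4 * r2 -> 0 <= e4 * r2 -> `|w - bd| <= e4 * r2.
  by rewrite !ler_norml => *; apply/andP; split; lra.
have algN (q v w : R) : - q = v - w -> q = w - v by lra.
have algO (p q r2 v : R) : p <= r2 -> q <= r2 -> 2 * r2 <= v -> p + q <= v by lra.
have algP (T b X v QB ts t be br nt M Z : R) : T <= b + X -> X <= Z * M -> (1 - Z) * b <= QB -> b * Z <= M * Z ->
  ts <= t -> t <= Z -> be <= Z / 2 -> br <= Z / 2 -> 0 <= nt ->
  - ((2 * M + 2) * Z) <= nt - T - (ts - QB) - (be + br) by lra.
have algQ (u bd e4 em : R) : - e4 <= - u - bd -> 0 <= bd -> e4 <= em -> u <= em by lra.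
move=> c_0 d01 s00; have /andP[d0 d1] := d01.
have n0 : 0 < n%:R :> R by rewrite ltr0n.
have [C C0 hC] := hess_lower n_gt0 hU s00.
have [M M0 ME] : exists2 M : R, 0 < M & M = 2 * C + 4 + n%:R.
  by exists (2 * C + 4 + n%:R) => //; rewrite !addr_gt0// mulr_gt0.
have [c2 c20 c2E] : exists2 c2 : R, 0 < c2 & c2 = c / (4 * n%:R).
  by exists (c / (4 * n%:R)) => //; rewrite divr_gt0// mulr_gt0.
have [ep ep0 hep] := no_ridge hU (divr_gt0 c20 (ltr0n R 2)) M0.
(* In units of 1 / N^2 the defect in the lower bound for the valley is M for the part of B outside
   g, M for b / N^2, 1 for the shift tau and 1 for the errors in epsilon and r. *)
have C10 : 0 < 2 * M + 2 by rewrite addr_gt0// mulr_gt0.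
have [N N1 [em em0 hem]] := no_valley n_gt0 hU C10.
have N0 : 0 < N by exact: lt_le_trans N1.
have N20 : 0 < N ^+ 2 by rewrite exprn_gt0.
have [e4 e40 [e4p e4m]] : exists2 e4 : R, 0 < e4 & e4 <= ep /\ e4 <= em.
  by exists (Num.min ep em); [rewrite lt_min ep0|rewrite !ge_min !lexx orbT].
have [tau2 t20 [t2N t2n t2e]] : exists2 t : R, 0 < t & [/\ n%:R * t <= 1 / N ^+ 2, n%:R * t <= 1 / 2 & n%:R ^+ 2 * t * M <= e4 / 4].
  exists (Num.min (1 / N ^+ 2 / n%:R) (Num.min (1 / 2 / n%:R) (e4 / 4 / (n%:R ^+ 2 * M)))).
    by rewrite !lt_min !divr_gt0 ?mulr_gt0 ?exprn_gt0.
  split.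
  - by rewrite mulrC -ler_pdivlMr// ge_min lexx.
  - by rewrite mulrC -ler_pdivlMr// !ge_min lexx orbT.
  by rewrite mulrAC mulrC -ler_pdivlMr ?mulr_gt0 ?exprn_gt0// !ge_min lexx !orbT.
exists tau2 => // eta eta0.
have [tau t0 [t1 tc tN te teta]] : exists2 t : R, 0 < t & [/\ t <= 1, n%:R * t <= c / 4, t <= 1 / N ^+ 2, t <= e4 / 4 & t <= eta ^+ 2 * c2 / n%:R / 2].
  exists (Num.min 1 (Num.min (c / 4 / n%:R) (Num.min (1 / N ^+ 2) (Num.min (e4 / 4) (eta ^+ 2 * c2 / n%:R / 2))))).
    by rewrite !lt_min ltr01 !divr_gt0 ?mulr_gt0 ?exprn_gt0.
  split; rewrite ?ge_min ?lexx ?orbT//.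
  by rewrite mulrC -ler_pdivlMr// !ge_min lexx !orbT.
have [e e0 [ec ee eeta ed]] : exists2 e : R, 0 < e & [/\ e <= c / 2, e <= e4 / 4, e <= eta ^+ 2 * c2 / n%:R / 2 & e <= tau * (delta / 8) ^+ 2 / 2].
  exists (Num.min (c / 2) (Num.min (e4 / 4) (Num.min (eta ^+ 2 * c2 / n%:R / 2) (tau * (delta / 8) ^+ 2 / 2)))).
    by rewrite !lt_min !divr_gt0 ?mulr_gt0 ?exprn_gt0 ?divr_gt0.
  by split; rewrite !ge_min ?lexx ?orbT.
have [kappa [k01 [ep1 ep10 hblow]]] := blowup n_gt0 hU d01 e0.
have /andP[k0 k1] := k01.
have [B2 B20 hB2] := hess_lower_near n_gt0 hU k01.
exists (Num.min ep1 (Num.min 1 (1 / (2 * N ^+ 2 * B2)))).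
  by rewrite !lt_min ep10 ltr01 divr_gt0// !mulr_gt0.
set epsilon := Num.min _ _ => rho rho0.
have epsilon1 : epsilon <= ep1 by rewrite ge_min lexx.
have epsilon2 : epsilon <= 1 by rewrite !ge_min lexx orbT.
have epsilon0 : 0 < epsilon by rewrite !lt_min ep10 ltr01 divr_gt0// !mulr_gt0.
have epsilon3 : B2 * epsilon <= 1 / N ^+ 2 / 2.
  have : epsilon <= 1 / (2 * N ^+ 2 * B2) by rewrite !ge_min lexx !orbT.
  rewrite ler_pdivlMr ?mulr_gt0// => h; rewrite -mulrA -invfM ler_pdivlMr ?mulr_gt0//; lra.
clearbody epsilon.
have [r0 r00 hr0] := hblow rho rho0; have [B1 B10 hB1] := hB2 rho rho0.
exists (Num.min r0 (Num.min (rho / 8) (Num.min s0 (1 / N ^+ 2 / 2 / B1)))).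
  by rewrite !lt_min r00 s00 !divr_gt0.
move=> x r gx xO /andP[rp]; rewrite !le_min => /and4P[rr0 rrho rs0 rB1].
have {}rB1 : B1 * r <= 1 / N ^+ 2 / 2 by move: rB1; rewrite ler_pdivlMr// mulrC.
have [fx sd hnd hfl] := gx.
have r2 : 0 < r ^+ 2 by rewrite exprn_gt0.
have [rlt rle r2le r8] := algR _ _ rp rrho.
have rrho' : 0 < r < rho by rewrite rp.
pose A := mhess U x (kappa * r); have sA : A^T = A by exact: mhess_sym.
have hA h : enorm h <= r -> `|U (x + h) - quadratic A h| <= e * r ^+ 2.
  by move=> hr; apply: (hr0 epsilon c) => //; rewrite ?epsilon0 ?rp.
have [sigma sg1 pB] : exists2 sigma, sigma ^+ 2 = 1 & psd (sigma *: A + tau%:M).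
  apply: (@indefinite_flat A x r e tau delta) => //.
  - rewrite (_ : delta * r / 8 = delta / 8 * r); last by ring.
    rewrite exprMn [tau * (_ * _)]mulrA ltr_pM2r//; apply: le_lt_trans ed _.
    have : 0 < tau * (delta / 8) ^+ 2 by rewrite mulr_gt0// exprn_gt0// divr_gt0.
    exact: algB.
  - by move=> h hr; apply: (continuous_near hU sd); exact: le_trans hr rle.
  - exact: hfl.
set B := _ + _ in pB; have [sB qB] := pB.
have sg : `|sigma| = 1 by move/eqP: sg1; rewrite sqrf_eq1 => /orP[]/eqP->; rewrite ?normrN normr1.
have qBE h : quadratic B h = sigma * quadratic A h + tau * sqn h.
  by rewrite quadraticDm quadratic_scale quadratic_scalar.
have sgA h : sigma * quadratic A h = quadratic B h - tau * sqn h by rewrite qBE addrK.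
have sgU h : enorm h <= r -> `|sigma * U (x + h) - sigma * quadratic A h| <= e * r ^+ 2.
  by move=> hr; rewrite -mulrBr normrM sg mul1r; exact: hA.
have sqr h : enorm h <= r -> sqn h <= r ^+ 2 by move=> hr; rewrite -enorm_le// ltW.
(* |U| exceeds c r^2 somewhere in the ball, and the approximation error is at most half of that. *)
have mA : c / 2 <= msum A.
  have [y yr hy] := hnd r rrho'; have := hA (y - x) (ltW yr); rewrite [x + _]addrC subrK => H.
  have Q := quadratic_msum A (y - x); have := sqr _ (ltW yr) => S1.
  have S2 : msum A * sqn (y - x) <= msum A * r ^+ 2 by rewrite ler_wpM2l// msum_ge0.
  rewrite -(ler_pM2r r2); have ec' := ler_wpM2r (ltW r2) ec.
  have := ler_normD (U y - quadratic A (y - x)) (quadratic A (y - x)); rewrite subrK.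
  exact: algC H Q S2 hy ec'.
have trB : c2 <= \tr B.
  have h1 : msum A <= msum B + n%:R * tau.
    have -> : msum A = msum (sigma *: A).
      by apply: eq_bigr => i _; apply: eq_bigr => j _; rewrite [in RHS]mxE normrM sg mul1r.
    rewrite -(msum_scalar (ltW t0)) (_ : sigma *: A = B + (- 1) *: tau%:M); last by rewrite scaleN1r addrK.
    apply: le_trans (msumD _ _) _; rewrite lerD2l le_eqVlt; apply/orP; left; apply/eqP.
    by apply: eq_bigr => i _; apply: eq_bigr => j _; rewrite [in LHS]mxE mulN1r normrN.
  have h2 := psd_msum pB.
  rewrite c2E invfM mulrA ler_pdivrMr// [\tr B * _]mulrC.
  exact: algD mA h1 h2 tc.
have trB0 : 0 < \tr B by exact: lt_le_trans trB.
have trA : sigma * \tr A = \tr B - n%:R * tau.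
  by rewrite /B mxtraceD mxtraceZ mxtrace_scalar -[tau *+ n]mulr_natl addrK.
have AE : mhess U x (kappa * r) = A by [].
clearbody B A.
have [[i [j [bi bi0 hij]]]|[g [b [g1 b0 /andP[b1 b2] hb]]]] := psd_dichotomy n_gt0 pB trB0 t20.
  set be := B i i in bi bi0 hij.
  have be2 : 0 < be ^+ 2 by rewrite exprn_gt0.
  have bj0 : 0 < B j j.
    rewrite -(pmulr_rgt0 _ bi0); apply: lt_le_trans (_ : 0 < tau2 * be ^+ 2) _; first by rewrite mulr_gt0.
    by apply: le_trans hij _; rewrite gerBl sqr_ge0.
  have bec : c2 / n%:R <= be.
    by rewrite ler_pdivrMr// mulrC; apply: le_trans trB _; exact: psd_le_diag.
  have eta2 : (e + tau) / be <= eta ^+ 2.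
    rewrite ler_pdivrMr//; apply: (@le_trans _ _ (eta ^+ 2 * (c2 / n%:R))); last by rewrite ler_wpM2l// sqr_ge0.
    by rewrite mulrA; exact: algE.
  (* Cauchy-Schwarz for B bounds the square of (row k B) . h by B(h) B k k, and B(h) <= (e + tau)
     r^2 wherever U vanishes. *)
  have row_le k h : B k k <= be -> 0 < B k k -> enorm h < r -> fb (x + h) -> `|dot (be^-1 *: row k B) h| <= eta * r.
    move=> kb k0' hr fh; have Uh : U (x + h) = 0.
      by apply: (fb_zero hU fh); apply: (in_Omega sd); exact: le_trans (ltW hr) rle.
    have hr' := ltW hr.
    have Bh : quadratic B h <= (e + tau) * r ^+ 2.
      have := sgU h hr'; rewrite Uh mulr0 sub0r normrN sgA ler_norml => /andP[_ h1].
      exact: algG h1 (ler_wpM2l (ltW t0) (sqr h hr')).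
    have cs : bil B h (delta_mx ord0 k) ^+ 2 <= quadratic B h * quadratic B (delta_mx ord0 k).
      by apply: psd_cs => //; rewrite -bil_quadratic bil_delta.
    rewrite bilC// bil_deltal -[X in _ * X]bil_quadratic bil_delta in cs.
    have er : 0 <= eta * r by rewrite mulr_ge0 ?ltW.
    rewrite -(@ler_pXn2r _ 2)// ?nnegrE// real_normK ?num_real// dotZl !exprMn.
    apply: (@le_trans _ _ (be^-1 ^+ 2 * ((e + tau) * r ^+ 2 * be))).
      apply: ler_wpM2l; first exact: sqr_ge0.
      apply: le_trans cs _; apply: ler_pM => //; exact: ltW.
    rewrite (_ : be^-1 ^+ 2 * ((e + tau) * r ^+ 2 * be) = (e + tau) / be * r ^+ 2); last by field; rewrite gt_eqF.
    by rewrite ler_pM2r.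
  exists i, j, (be^-1 *: row i B), (be^-1 *: row j B); split.
  - have ent k l : `|(be^-1 *: row k B) ord0 l| <= 1.
      rewrite !mxE normrM gtr0_norm ?invr_gt0// mulrC ler_pdivrMr// mul1r.
      by apply: le_trans (psd_entry k l pB) _; rewrite ler_pdivrMr//; exact: algH.
    by move=> k; split.
  - rewrite !mxE -/be [B j i](_ : _ = B i j); last by rewrite -[in LHS]sB mxE.
    by rewrite -(ler_pM2r be2); apply: le_trans hij _; rewrite le_eqVlt; apply/orP; left; apply/eqP; field; rewrite gt_eqF.
  by move=> h hr fh; split; apply: row_le => //; exact: bi.
exfalso.
have kr : 0 < kappa * r by rewrite mulr_gt0.
have krr : kappa * r <= r by rewrite ler_piMl// ltW.
have n2t : n%:R * tau2 * b <= b / 2 by apply: algI; rewrite ler_pM2r.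
rewrite mulrDl mul1r in b2.
have c2b : c2 / 2 <= b by exact: algJ b0 trB b2 n2t.
have sqg : sqn g = 1 by rewrite -sqr_enorm g1 expr1n.
have gg : dot g g = 1 by rewrite dot_sqn.
have Bg : b <= quadratic B g.
  by have /andP[h _] := hb g; move: h; rewrite gg expr1n mulr1 subr_ge0.
(* Near b (g . h)^2 the vector e = sqrt 2 g, near - b (g . h)^2 the vector e = 0, makes [lop] of
   order - b; its lower bound from [hess_lower] is then an upper bound for b. *)
have bM : b <= M.
  move: sg1 => /eqP; rewrite sqrf_eq1 => /orP[/eqP sgE|/eqP sgE].
    have := hC x (kappa * r) (Num.sqrt 2 *: g) xO; rewrite kr /= => /(_ _ _) H.
    have {}H : - C <= lop A (Num.sqrt 2 *: g).
      by rewrite -AE; apply: H; [exact: le_trans krr rs0|rewrite sqnZ sqr_sqrtr// sqg mulr1].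
    move: H; rewrite /lop quadraticZ sqr_sqrtr//.
    have := sgA g; rewrite sgE mul1r => ->; have := trA; rewrite sgE mul1r => ->; rewrite sqg.
    rewrite ME => H; apply: algK H b2 n2t Bg _ t1 _; last exact: ltW.
    by rewrite mulr_ge0// ltW.
  have := hC x (kappa * r) 0 xO; rewrite kr /= => /(_ _ _) H.
  have {}H : - C <= lop A 0.
    rewrite -AE; apply: H; first exact: le_trans krr rs0.
    by rewrite /sqn big1// => k _; rewrite mxE expr0n.
  move: H; rewrite /lop quadratic0 subr0; move: trA; rewrite sgE mulN1r => tA.
  have nt : n%:R * tau <= n%:R by rewrite ler_piMr// ltW.
  by rewrite ME => H; exact: algL C0 H tA nt b1.
have close h : enorm h <= r -> `|sigma * U (x + h) - b * dot g h ^+ 2| <= e4 * r ^+ 2.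
  move=> hr; have H1 := sgU h hr; rewrite sgA in H1; have /andP[H2 H3] := hb h.
  have H4 := ler_wpM2l (ltW t0) (sqr h hr).
  have H4' : 0 <= tau * sqn h by rewrite mulr_ge0 ?sqn_ge0// ltW.
  have H5 : n%:R ^+ 2 * tau2 * b * sqn h <= e4 / 4 * r ^+ 2.
    apply: ler_pM; rewrite ?sqn_ge0 ?sqr//.
      by rewrite !mulr_ge0 ?sqr_ge0// ltW.
    by apply: le_trans t2e; rewrite ler_pM2l// mulr_gt0// exprn_gt0.
  have H6 := ler_wpM2r (ltW r2) te; have H7 := ler_wpM2r (ltW r2) ee.
  have H8 : 0 <= e4 * r ^+ 2 by rewrite mulr_ge0// ltW.
  exact: algM H1 H2 H3 H4' H4 H5 H6 H7 H8.
move: sg1 => /eqP; rewrite sqrf_eq1 => /orP[/eqP sgE|/eqP sgE].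
  apply: (hep x r rho epsilon g b sd epsilon2 _ g1); rewrite ?rp ?c2b//=.
  move=> h hr; have := close h hr; rewrite sgE mul1r => /le_trans; apply.
  by rewrite ler_pM2r.
apply: (hem x r g (kappa * r) fx g1 rp kr).
- move=> z zr; have [_ rO _ _] := sd; apply: subset_trans rO; apply: cball_sub; [exact: ltW|exact: ltW|exact: algO zr krr r2le].
- have [_ rO _ _] := sd; apply: subset_trans rO; apply: cball_mono; [exact: ltW|exact: rle].
- move=> z s zr ss.
  have b01 : 0 <= 1 - N ^- 2 <= 1.
    by rewrite subr_ge0 gerBl invf_le1// exprn_ege1//= invr_ge0 ltW.
  have sv : sqn (vdir g N) = 1 - N ^- 2.
    by rewrite sqnZ sqg mulr1 sqr_sqrtr//; case/andP: b01.
  have sd2 : sqn (vdir g N) <= 2 by rewrite sv; have /andP[_ /le_trans] := b01; apply; rewrite ler1n.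
  have := hB1 x z r s (vdir g N) epsilon sd rp r8 zr ss sd2; apply: le_trans.
  rewrite AE /lop; have := sgA (vdir g N); rewrite sgE mulN1r sv => qA.
  have {}qA : quadratic A (vdir g N) = tau * (1 - N ^- 2) - quadratic B (vdir g N) by exact: algN.
  have tA : \tr A = n%:R * tau - \tr B by have := trA; rewrite sgE mulN1r; exact: algN.
  have qv : (1 - N ^- 2) * b <= quadratic B (vdir g N).
    by rewrite quadraticZ sqr_sqrtr; [rewrite ler_wpM2l//; case/andP: b01|case/andP: b01].
  rewrite qA tA.
  have i1 : n%:R * tau2 * b <= 1 / N ^+ 2 * M by apply: ler_pM => //; [rewrite mulr_ge0// ltW|exact: ltW].
  have i2 : b * N ^- 2 <= M * N ^- 2 by rewrite ler_pM2r// invr_gt0.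
  have i3 : tau * (1 - N ^- 2) <= tau by rewrite ler_piMr//; [exact: ltW|case/andP: b01].
  have i4 : 0 <= n%:R * tau by rewrite mulr_ge0// ltW.
  rewrite !mul1r in i1 tN epsilon3 rB1; exact: algP b2 i1 qv i2 i3 tN epsilon3 rB1 i4.
move=> h hr; have := close h hr; rewrite sgE mulN1r ler_norml => /andP[h1 _].
apply: algQ h1 _ _; first by rewrite mulr_ge0 ?sqr_ge0// ltW.
by rewrite ler_pM2r.
Qed.
End rank_two.

(** * Covers and Hausdorff premeasures *)

Section hausdorff_measure.
Variables (R : realType) (n : nat).
Implicit Types (A : set 'rV[R]_n) (x y z : 'rV[R]_n) (r e : R) (d : nat).

Lemma diam_le A y r : (forall z, A z -> enorm (z - y) <= r) -> (diam A <= (2 * r)%:E)%E.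
Proof.
move=> hA; apply: ge_ereal_sup => _ [a Aa [b Ab <-]]; rewrite lee_fin.
apply: le_trans (enorm_tri a y b) _; have := hA b Ab; rewrite enormB; have := hA a Aa; lra.
Qed.

Lemma diam_ge0 A : A !=set0 -> (0 <= diam A)%E.
Proof.
by move=> [a Aa]; apply: ereal_sup_ubound; exists a => //; exists a => //; rewrite subrr enorm0.
Qed.

Lemma diam_set0 : (diam (set0 : set 'rV[R]_n) = -oo)%E.
Proof. by rewrite /diam (_ : [set _ | _ in _ & _ in _] = set0) ?ereal_sup0//; apply/seteqP; split => // t [? []]. Qed.

Lemma hausdorff_weight_ge0 d A : (0 <= hausdorff_weight d A)%E.
Proof.
rewrite /hausdorff_weight; case: ifPn => // /set0P A0; apply: expe_ge0; exact: diam_ge0.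
Qed.

Lemma hausdorff_weight_le d A r : 0 <= r -> (diam A <= r%:E)%E -> (hausdorff_weight d A <= (r ^+ d)%:E)%E.
Proof.
move=> r0 Ar; rewrite /hausdorff_weight; case: ifPn => [_|/set0P A0]; first by rewrite lee_fin exprn_ge0.
have := diam_ge0 A0; case: (diam A) Ar => [q| |]//; rewrite !lee_fin -EFin_expe => qr q0.
by rewrite lee_fin lerXn2r ?nnegrE.
Qed.

Lemma hausdorff_weight_set0 d : (hausdorff_weight d (set0 : set 'rV[R]_n) = 0)%E.
Proof. by rewrite /hausdorff_weight eqxx. Qed.

(** The numbering f makes the family a sequence; indices outside its image receive the empty set, of
    diameter -oo and weight 0. *)
Lemma hausdorff_pre_cover d e A (T : choiceType) (D : set T) (f : T -> nat) (V : T -> set 'rV[R]_n) :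
  {in D &, injective f} -> (forall x, A x -> exists2 v, D v & V v x) -> (forall v, D v -> (diam (V v) <= e%:E)%E) ->
  (hausdorff_pre d e A <= \esum_(v in D) hausdorff_weight d (V v))%E.
Proof.
move=> fI AV Ve.
pose U k := \bigcup_(v in [set v | D v /\ f v = k]) V v.
have UE v : D v -> U (f v) = V v.
  move=> Dv; apply/seteqP; split => x; last by exists v.
  by move=> [w [Dw fw] Vx]; rewrite -(fI w v) ?inE.
have U0 k : ~ (exists2 v, D v & f v = k) -> U k = set0.
  by move=> h; rewrite -subset0 => x [v [Dv fv] _]; apply: h; exists v.
apply: (@le_trans _ _ (\sum_(0 <= k <oo) hausdorff_weight d (U k))%E).
  apply: ereal_inf_lbound; exists U => //; split => [x /AV[v Dv Vx]|k].
    by exists (f v) => //; rewrite UE.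
  have [[v Dv <-]|/U0 ->] := pselect (exists2 v, D v & f v = k); first by rewrite UE//; exact: Ve.
  by rewrite diam_set0 leNye.
rewrite nneseries_esumT => [|k]; last exact: hausdorff_weight_ge0.
rewrite (eq_esum (b := fun v => hausdorff_weight d (U (f v)))); last by move=> v Dv; rewrite UE.
rewrite -(@esum_image R _ _ D f (fun k => hausdorff_weight d (U k)))//.
rewrite [leRHS]esum_mkcond; apply: le_esum => k _; case: ifPn => // /negP; rewrite inE => h.
by rewrite U0 ?hausdorff_weight_set0// => -[v Dv fv]; apply: h; exists v.
Qed.

Lemma hausdorff_pre_seq d e w A (s : seq (set 'rV[R]_n)) : (forall x, A x -> exists2 B, List.In B s & B x) ->
  (forall B, List.In B s -> (diam B <= e%:E)%E /\ (hausdorff_weight d B <= w%:E)%E) ->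
  exists V : nat -> set 'rV[R]_n, [/\ A `<=` \bigcup_k V k, (forall k, (diam (V k) <= e%:E)%E) &
    (\sum_(0 <= k <oo) hausdorff_weight d (V k) <= ((size s)%:R * w)%:E)%E].
Proof.
move=> As hs; exists (fun k => nth set0 s k).
have nthP B : List.In B s -> exists2 k, (k < size s)%N & nth set0 s k = B.
  elim: {As hs} s => //= C s IH [->|/IH[k ks <-]]; first by exists 0%N.
  by exists k.+1.
have nthI k : (k < size s)%N -> List.In (nth set0 s k) s.
  elim: {As hs nthP} s k => //= C s IH [|k] ks; first by left.
  by right; exact: IH.
split => [x /As[B Bs Bx]|k|].
- by have [k _ kB] := nthP B Bs; exists k => //; rewrite kB.
- have [ks|ks] := ltnP k (size s); first by have [] := hs _ (nthI k ks).
  by rewrite nth_default// diam_set0 leNye.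
rewrite (nneseries_split 0 (size s)) => [|k _]; last exact: hausdorff_weight_ge0.
rewrite [X in (_ + X)%E]eseries0 => [|k ks _]; last by rewrite nth_default ?hausdorff_weight_set0.
rewrite adde0 add0n big_mkord; apply: (@le_trans _ _ (\sum_(k < size s) w%:E)%E).
  by apply: lee_sum => k _; have [] := hs _ (nthI k (ltn_ord k)).
by rewrite sumEFin sumr_const card_ord -[w *+ _]mulr_natl.
Qed.

(** The k-th set is given the share e / 2 ^ k.+1 of the total weight; the same share bounds the
    diameters, so they stay below e. *)
Lemma hausdorff_null d (G : nat -> set 'rV[R]_n) :
  (forall k (e : R), 0 < e -> exists s : seq (set 'rV[R]_n), [/\ (forall x, G k x -> exists2 B, List.In B s & B x) &
    exists2 w : R, (size s)%:R * w <= e & forall B, List.In B s -> (diam B <= e%:E)%E /\ (hausdorff_weight d B <= w%:E)%E]) ->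
  forall e : R, 0 < e -> exists V : nat * nat -> set 'rV[R]_n, [/\ \bigcup_k G k `<=` \bigcup_v V v, (forall v, (diam (V v) <= e%:E)%E) &
    (\esum_(v in setT) hausdorff_weight d (V v) <= e%:E)%E].
Proof.
move=> hG e e0.
have H k : exists V : nat -> set 'rV[R]_n, [/\ G k `<=` \bigcup_i V i, (forall i, (diam (V i) <= e%:E)%E) &
    (\sum_(0 <= i <oo) hausdorff_weight d (V i) <= (e / (2 ^ k.+1)%:R)%:E)%E].
  have ek0 : 0 < e / (2 ^ k.+1)%:R by rewrite divr_gt0// ltr0n expn_gt0.
  have eke : e / (2 ^ k.+1)%:R <= e.
    by rewrite ler_pdivrMr ?ltr0n ?expn_gt0// ler_peMr ?(ltW e0)// ler1n expn_gt0.
  have [s [Gs [w sw hw]]] := hG k _ ek0.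
  have [V [GV Ve Vw]] := hausdorff_pre_seq Gs hw.
  exists V; split => // [i|]; first by apply: le_trans (Ve i) _; rewrite lee_fin.
  by apply: le_trans Vw _; rewrite lee_fin.
have [V hV] := choice H.
exists (fun v => V v.1 v.2); split => [x [k _ Gx]|v|].
- by have [/(_ x Gx)[i _ Vx] _ _] := hV k; exists (k, i).
- by have [_ h _] := hV v.1.
have w0 k i : (0 <= hausdorff_weight d (V k i))%E by exact: hausdorff_weight_ge0.
rewrite (_ : setT = [set: nat] `*`` (fun=> [set: nat])); last by apply/seteqP; split.
rewrite -(esum_esum (a := fun k i => hausdorff_weight d (V k i)))//.
rewrite -nneseries_esumT => [|k]; last by apply: esum_ge0 => i _.
apply: le_trans (epsilon_trick0 xpredT (ltW e0)).
apply: lee_nneseries => [k _ _|k _]; first by apply: esum_ge0.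
by rewrite -nneseries_esumT//; have [] := hV k.
Qed.
End hausdorff_measure.

(** * Repeated subdivision of cubes *)

Section cubes.
Variables (R : realType) (n M : nat).
Implicit Types (x y z p : 'rV[R]_n) (l L rho : R) (D : {set 'I_n}) (Y : set 'rV[R]_n).
Notation m := M.+1.

(* Only the coordinates in D are constrained. *)
Definition cube D p L := [set y : 'rV[R]_n | forall k, k \in D -> p ord0 k <= y ord0 k < p ord0 k + L].

Definition subcube p l (f : {ffun 'I_n -> 'I_m}) : 'rV[R]_n := \row_k (p ord0 k + (f k)%:R * l).

(** Labels are set to [ord0] off D, so that [pffun_on] has exactly m ^ #|D| elements, one for each
    subcube. *)
Lemma cube_split D p l y : 0 < l -> cube D p (m%:R * l) y ->
  exists2 f : {ffun 'I_n -> 'I_m}, f \in pffun_on ord0 D predT & cube D (subcube p l f) l y.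
Proof.
move=> l0 hy; pose t k := Num.truncn ((y ord0 k - p ord0 k) / l).
have tP k : k \in D -> (t k < m)%N /\ (t k)%:R * l <= y ord0 k - p ord0 k < (t k).+1%:R * l.
  move=> kD; have /andP[h1 h2] := hy k kD.
  have q0 : 0 <= (y ord0 k - p ord0 k) / l by rewrite divr_ge0 ?subr_ge0// ltW.
  have /andP[] := truncn_itv q0; rewrite -/(t k) ler_pdivlMr// ltr_pdivrMr// => t1 t2; split; last by rewrite t1.
  by rewrite /t truncn_lt_nat// ltr_pdivrMr// ltrBlDl.
exists [ffun k => if k \in D then inord (t k) else ord0].
  apply/pffun_onP; split => [|g _]//.
  by apply/fintype.subsetP => k; rewrite inE ffunE; case: ifP => // _; rewrite eqxx.
move=> k kD; have [tm /andP[h1 h2]] := tP k kD.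
rewrite !mxE ffunE kD inordK//; move: h1 h2; rewrite -natr1 mulrDl mul1r; lra.
Qed.

Lemma size_flatten_le (T S : Type) (g : T -> seq S) (s : seq T) (B : nat) :
  (forall t, (size (g t) <= B)%N) -> (size (flatten (map g s)) <= size s * B)%N.
Proof.
move=> hB; elim: s => //= t s IH; rewrite size_cat mulSn; exact: leq_add.
Qed.

(** Omitting the subcube without points of Y at each subdivision leaves (m^d - 1)^j cells in place
    of m^(d j), where d = #|D|. *)
Lemma cubes_drop D Y rho J : 0 < rho ->
  (forall j p, (j < J)%N -> exists2 f : {ffun 'I_n -> 'I_m}, f \in pffun_on ord0 D predT &
     forall y, Y y -> ~ cube D (subcube p (m%:R ^+ j * rho) f) (m%:R ^+ j * rho) y) ->
  forall j, (j <= J)%N -> forall p, exists2 s : seq 'rV[R]_n, (size s <= (m ^ #|D| - 1) ^ j)%N &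
    forall y, Y y -> cube D p (m%:R ^+ j * rho) y -> exists2 p', p' \in s & cube D p' rho y.
Proof.
move=> rho0 hole; elim=> [_ p|j IH jJ p].
  by exists [:: p] => // y _; rewrite expr0 mul1r => hy; exists p => //; rewrite inE.
have [f fD hf] := hole j p jJ.
have IHp q : exists s : seq 'rV[R]_n, (size s <= (m ^ #|D| - 1) ^ j)%N /\
    forall y, Y y -> cube D q (m%:R ^+ j * rho) y -> exists2 p', p' \in s & cube D p' rho y.
  by have [s s1 s2] := IH (ltnW jJ) q; exists s.
have [g hg] := choice IHp.
pose F := rem f (enum (pffun_on (ord0 : 'I_m) D predT)).
have sF : size F = (m ^ #|D| - 1)%N.
  by rewrite size_rem ?mem_enum// -cardE card_pffun_on subn1 cardT size_enum_ord.
exists (flatten [seq g (subcube p (m%:R ^+ j * rho) f') | f' <- F]).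
  apply: leq_trans (size_flatten_le _ (B := ((m ^ #|D| - 1) ^ j)%N) _) _ => [f'|].
    by have [] := hg (subcube p (m%:R ^+ j * rho) f').
  by rewrite sF expnS.
move=> y Yy; rewrite exprS -mulrA => hy.
have l0 : 0 < m%:R ^+ j * rho by rewrite mulr_gt0// exprn_gt0// ltr0n.
have [f' f'D hf'] := cube_split l0 hy.
have ff : f' != f by apply/eqP => E; apply: (hf y Yy); rewrite -E.
have [_ /(_ y Yy hf')[p' p's hp']] := hg (subcube p (m%:R ^+ j * rho) f').
exists p' => //; apply/flattenP; exists (g (subcube p (m%:R ^+ j * rho) f')) => //.
by apply/mapP; exists f' => //; rewrite mem_rem_uniq ?enum_uniq// inE ff mem_enum.
Qed.
End cubes.

(** * Slabs around planes of codimension two *)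

Section codimension_two.
Variables (R : realType) (n : nat).
Implicit Types (x y z h w p q : 'rV[R]_n) (i j k : 'I_n) (tau l : R).

Definition det2 p q i j : R := p ord0 i * q ord0 j - p ord0 j * q ord0 i.

Lemma dot_supp2 p w i j : i != j -> (forall k, k != i -> k != j -> w ord0 k = 0) ->
  dot p w = p ord0 i * w ord0 i + p ord0 j * w ord0 j.
Proof.
move=> ij hw; rewrite /dot (bigD1 i)//= (bigD1 j) 1?eq_sym//= big1 ?addr0// => k /andP[ki kj].
by rewrite hw ?mulr0.
Qed.

Lemma det2_neq p q i j tau2 : 0 < tau2 -> tau2 <= det2 p q i j -> i != j.
Proof. by move=> t0 td; apply/eqP => ij; move: td; rewrite ij /det2 subrr leNgt t0. Qed.

(** Cramer's rule in the coordinates i and j. *)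
Lemma supp2_le p q i j tau2 w : 0 < tau2 -> tau2 <= det2 p q i j ->
  (forall k, `|p ord0 k| <= 1 /\ `|q ord0 k| <= 1) -> (forall k, k != i -> k != j -> w ord0 k = 0) ->
  enorm w <= n%:R * ((`|dot p w| + `|dot q w|) / tau2).
Proof.
move=> t0 td hpq hw; have ij := det2_neq t0 td.
set P := dot p w; set Q := dot q w.
have PE : P = _ := dot_supp2 p ij hw; have QE : Q = _ := dot_supp2 q ij hw.
have m0 : 0 <= (`|P| + `|Q|) / tau2 by rewrite divr_ge0 ?addr_ge0// ltW.
apply: le_trans (enorm_le_norm w) _; apply: ler_wpM2l => //; apply: norm_le_coord => // k.
have key c (a b : R) : `|a| <= 1 -> `|b| <= 1 -> c * det2 p q i j = a * P - b * Q -> `|c| <= (`|P| + `|Q|) / tau2.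
  move=> a1 b1 E; rewrite ler_pdivlMr//; apply: (@le_trans _ _ (`|c| * det2 p q i j)); first exact: ler_wpM2l.
  have d0 : 0 <= det2 p q i j by apply: le_trans td; exact: ltW.
  rewrite -{1}(ger0_norm d0) -normrM E; apply: le_trans (ler_normB _ _) _.
  by rewrite !normrM; apply: lerD; rewrite ler_piMl.
have [p_i q_i] := hpq i; have [p_j q_j] := hpq j.
have [->|ki] := eqVneq k i; first by apply: (key _ (q ord0 j) (p ord0 j)) => //; rewrite PE QE /det2; ring.
have [->|kj] := eqVneq k j; last by rewrite hw ?normr0.
by apply: (key _ (- q ord0 i) (- p ord0 i)); rewrite ?normrN// PE QE /det2; ring.
Qed.

Lemma supp2_exists p q i j tau2 (P Q : R) : 0 < tau2 -> tau2 <= det2 p q i j ->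
  exists w, [/\ forall k, k != i -> k != j -> w ord0 k = 0, dot p w = P & dot q w = Q].
Proof.
move=> t0 td; have ij := det2_neq t0 td; have d0 : det2 p q i j != 0 by rewrite gt_eqF// (lt_le_trans t0).
pose w : 'rV[R]_n := \row_k (if k == i then (q ord0 j * P - p ord0 j * Q) / det2 p q i j else
  if k == j then (p ord0 i * Q - q ord0 i * P) / det2 p q i j else 0).
have hw k : k != i -> k != j -> w ord0 k = 0 by move=> /negbTE ki /negbTE kj; rewrite mxE ki kj.
have wi : w ord0 i = (q ord0 j * P - p ord0 j * Q) / det2 p q i j by rewrite mxE eqxx.
have wj : w ord0 j = (p ord0 i * Q - q ord0 i * P) / det2 p q i j by rewrite mxE eq_sym (negbTE ij) eqxx.
by exists w; split => //; rewrite (dot_supp2 _ ij hw) wi wj /det2; field; exact: d0.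
Qed.

Definition solve_cst tau2 : R := n%:R + 2 * n%:R * (2 + n%:R) / tau2.

(** h splits into its coordinates off i and j, small by assumption, and a vector supported on i and
    j, to which [supp2_le] applies. *)
Lemma solve2 p q i j tau2 l h : 0 < tau2 -> tau2 <= det2 p q i j ->
  (forall k, `|p ord0 k| <= 1 /\ `|q ord0 k| <= 1) -> 0 <= l -> (forall k, k != i -> k != j -> `|h ord0 k| <= l) ->
  `|dot p h| <= 2 * l -> `|dot q h| <= 2 * l -> enorm h <= solve_cst tau2 * l.
Proof.
move=> t0 td hpq l0 hl hp hq.
pose h' : 'rV[R]_n := \row_k (if (k != i) && (k != j) then h ord0 k else 0).
have h'l k : `|h' ord0 k| <= l by rewrite mxE; case: ifP => [/andP[]|_]; [exact: hl|rewrite normr0].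
have h'n : enorm h' <= n%:R * l.
  by apply: le_trans (enorm_le_norm _) _; apply: ler_wpM2l => //; exact: norm_le_coord.
have dl (v : 'rV[R]_n) : (forall k, `|v ord0 k| <= 1) -> `|dot v h'| <= n%:R * l.
  move=> hv; apply: le_trans (ler_norm_sum _ _ _) _.
  apply: (@le_trans _ _ (\sum_(k < n) l)); last by rewrite sumr_const card_ord -[l *+ n]mulr_natl.
  by apply: ler_sum => k _; rewrite normrM -[l]mul1r; apply: ler_pM.
have ws k : k != i -> k != j -> (h - h') ord0 k = 0 by move=> ki kj; rewrite !mxE ki kj subrr.
have := supp2_le t0 td hpq ws; rewrite !dotDr !dotNr => H.
have dp : `|dot p h - dot p h'| <= 2 * l + n%:R * l.
  by apply: le_trans (ler_normB _ _) _; apply: lerD => //; apply: dl => k; have [] := hpq k.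
have dq : `|dot q h - dot q h'| <= 2 * l + n%:R * l.
  by apply: le_trans (ler_normB _ _) _; apply: lerD => //; apply: dl => k; have [] := hpq k.
rewrite -[h](subrK h') addrC; apply: le_trans (enormD _ _) _.
apply: le_trans (lerD h'n (le_trans H (ler_wpM2l (ler0n _ n) (ler_wpM2r _ (lerD dp dq))))) _.
  by rewrite invr_ge0 ltW.
by rewrite le_eqVlt; apply/orP; left; apply/eqP; rewrite /solve_cst; field; rewrite gt_eqF.
Qed.

(* Some subcube contains no point of G: otherwise G, hence the free boundary,
   would follow the plane p = q = 0 at scale s = m l / 4, contradicting the
   failure of flatness with the polynomial p^2 + q^2. *)
Lemma slab_hole M delta tau2 (fb G : set 'rV[R]_n) x r eta l pt i j p q :
  0 < delta < 1 -> 0 < tau2 -> (8 <= M.+1)%N -> 64 * solve_cst tau2 <= delta * M.+1%:R ->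
  0 < r -> 0 < l -> M.+1%:R * l <= r -> eta * r <= l -> tau2 <= det2 p q i j ->
  (forall k, `|p ord0 k| <= 1 /\ `|q ord0 k| <= 1) ->
  (forall h, enorm h < r -> fb (x + h) -> `|dot p h| <= eta * r /\ `|dot q h| <= eta * r) ->
  (forall y, G y -> fb y /\ forall s : R, 0 < s < r -> ((delta * s)%:E <= rank2_distance fb s y)%E) ->
  exists2 f : {ffun 'I_n -> 'I_M.+1}, f \in pffun_on ord0 [set k | (k != i) && (k != j)]%SET predT &
    forall y, G y /\ enorm (y - x) < r / 2 -> ~ cube [set k | (k != i) && (k != j)]%SET (subcube pt l f) l y.
Proof.
move=> d01 t0 M8 hM r0 l0 lr etal td hpq slab hG; have /andP[d0 d1] := d01.
set D := [set k | _]%SET; set m := M.+1 in hM lr M8 *.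
have inD k : (k \in D) = (k != i) && (k != j) by rewrite inE.
apply: contrapT => hno.
have meets f : f \in pffun_on (ord0 : 'I_m) D predT -> exists y, [/\ G y, enorm (y - x) < r / 2 & cube D (subcube pt l f) l y].
  move=> fD; apply: contrapT => h; apply: hno; exists f => // y [Gy yx] yc.
  by apply: h; exists y.
have same (f : {ffun 'I_n -> 'I_m}) z z' k : cube D (subcube pt l f) l z -> cube D (subcube pt l f) l z' -> k \in D -> `|z ord0 k - z' ord0 k| <= l.
  move=> /(_ k)zc /(_ k)zc' kD; have /andP[a1 a2] := zc kD; have /andP[b1 b2] := zc' kD.
  by rewrite ler_norml; apply/andP; split; lra.
have m8 : 8 <= m%:R :> R by rewrite ler_nat.
(* At this scale the spacing l of the points of G is fine: by the choice of m, [solve_cst] times l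
   is at most delta s / 16. *)
pose s := m%:R * l / 4; have s0 : 0 < s by rewrite divr_gt0// mulr_gt0// (lt_le_trans _ m8).
have s4 : 4 * s = m%:R * l by rewrite /s; field.
have ls : 2 * l <= s.
  by rewrite /s ler_pdivlMr// (_ : 2 * l * 4 = 8 * l); [rewrite ler_pM2r|ring].
have sr : s <= r / 4 by rewrite ler_pdivlMr// mulrC s4.
have Cl : solve_cst tau2 * l <= delta * s / 16.
  rewrite ler_pdivlMr// (_ : delta * s = delta * m%:R * l / 4); last by rewrite /s; ring.
  rewrite ler_pdivlMr// (_ : _ * 16 * 4 = 64 * solve_cst tau2 * l); last by ring.
  by rewrite ler_pM2r.
(* The base point y comes from the subcube of the centre, so that the ball of radius s about it
   stays in the large cube as far as the coordinates in [D] are concerned. *)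
pose c : 'rV[R]_n := \row_k (pt ord0 k + m%:R * l / 2).
have cc : cube D pt (m%:R * l) c.
  by move=> k _; rewrite mxE; have := mulr_gt0 (lt_le_trans (ltr0n _ 8) m8) l0; lra.
have [f fD cf] := cube_split l0 cc.
have [y [Gy yx yf]] := meets f fD; have [fy hy] := hG y Gy.
have hs : 0 < s < r by rewrite s0; lra.
have := hy s hs; apply/negP; rewrite -ltNge.
have ds : 0 < delta * s by rewrite mulr_gt0.
apply: (@le_lt_trans _ _ (delta * s / 2)%:E); last by rewrite lte_fin; lra.
pose a : 'M[R]_n := \matrix_(k, k') (p ord0 k * p ord0 k' + q ord0 k * q ord0 k').
have aE h : quadratic a h = dot p h ^+ 2 + dot q h ^+ 2.
  rewrite !expr2 /dot !mulr_suml -big_split; apply: eq_bigr => k _ /=.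
  by rewrite !mulr_sumr -big_split; apply: eq_bigr => k' _ /=; rewrite mxE; ring.
have a0 h : quadratic a h = 0 -> dot p h = 0 /\ dot q h = 0.
  by rewrite aE => /eqP; rewrite paddr_eq0 ?sqr_ge0// !sqrf_eq0 => /andP[/eqP -> /eqP ->].
have dd v : dot v (delta_mx ord0 i) = v ord0 i.
  rewrite /dot (bigD1 i)//= mxE !eqxx mulr1 big1 ?addr0// => k ki.
  by rewrite mxE (negbTE ki) andbF mulr0.
have az : quadratic a (delta_mx ord0 i) != 0.
  apply/eqP => /a0; rewrite !dd => -[pi qi]; move: td; rewrite /det2 pi qi mul0r mulr0 subrr.
  by rewrite leNgt t0.
have yl : `|dot p (y - x)| <= l /\ `|dot q (y - x)| <= l.
  have [h1 h2] : `|dot p (y - x)| <= eta * r /\ `|dot q (y - x)| <= eta * r.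
    by apply: slab; [lra|rewrite [x + _]addrC subrK].
  by split; exact: le_trans etal.
have two z : fb z -> enorm (z - x) < r -> `|dot p (z - y)| <= 2 * l /\ `|dot q (z - y)| <= 2 * l.
  move=> fz zx; have [h1 h2] : `|dot p (z - x)| <= eta * r /\ `|dot q (z - x)| <= eta * r.
    by apply: slab => //; rewrite [x + _]addrC subrK.
  have [y1 y2] := yl; rewrite (_ : z - y = (z - x) - (y - x)); last by rewrite opprB addrA subrK.
  have dB v : dot v ((z - x) - (y - x)) = dot v (z - x) - dot v (y - x) by rewrite dotDr dotNr.
  have ll : l + l = 2 * l by ring.
  rewrite !dB -ll; split; apply: le_trans (ler_normB _ _) _; apply: lerD => //; exact: le_trans etal.
(* Points are first contracted towards y by delta s / 8; the corrections of size delta s / 16 that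
   follow then cannot leave the open ball. *)
pose th := 1 - delta / 8.
have th0 : 0 < th by rewrite /th; lra.
have th1 : th <= 1 by rewrite /th; lra.
have thn h : enorm h < s -> enorm (th *: h) <= th * s.
  by move=> hh; rewrite enormZ gtr0_norm// ler_pM2l// ltW.
have ths : th * s = s - delta * s / 8 by rewrite /th; ring.
have hth h : enorm h < s -> enorm (h - th *: h) <= delta * s / 8.
  move=> hh; rewrite -{1}[h]scale1r -scalerBl (_ : 1 - th = delta / 8); last by rewrite /th; ring.
  rewrite enormZ gtr0_norm ?divr_gt0// [leRHS]mulrAC ler_pM2l ?divr_gt0//; exact: ltW.
have sym : a^T = a by apply/matrixP => k k'; rewrite !mxE; ring.
apply: (rank2_distance_le sym az); apply: HD_le.
  move=> z [fz]; rewrite /eball /= => zy.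
  have zx : enorm (z - x) < r by apply: le_lt_trans (enorm_tri z y x) _; lra.
  have [zp zq] := two z fz zx.
  have [w [ws wp wq]] := supp2_exists (dot p (th *: (z - y))) (dot q (th *: (z - y))) t0 td.
  have wn : enorm w <= delta * s / 16.
    apply: le_trans Cl; apply: (solve2 t0 td hpq (ltW l0)).
    - by move=> k ki kj; rewrite ws// normr0 ltW.
    - by rewrite wp dotZr normrM gtr0_norm//; apply: le_trans zp; rewrite ler_piMl.
    - by rewrite wq dotZr normrM gtr0_norm//; apply: le_trans zq; rewrite ler_piMl.
  exists (y + (th *: (z - y) - w)).
    rewrite /eball /= [y + _]addrC addrK; split.
      by rewrite aE !dotDr !dotNr wp wq !subrr expr0n addr0.
    apply: le_lt_trans (enormD _ _) _; rewrite enormN.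
    by have := thn _ zy; rewrite ths; lra.
  rewrite opprD addrA opprB addrA addrAC -addrA [- _ + w]addrC addrA -addrA [w - _]addrC addrA.
  rewrite (_ : z - y - _ + w = (z - y - th *: (z - y)) + w)//.
  apply: le_trans (enormD _ _) _; have := hth _ zy; lra.
move=> z []; rewrite /eball /= => /a0[vp vq] zy.
pose v := y + th *: (z - y).
have vc : cube D pt (m%:R * l) v.
  move=> k kD; have := same f y c k yf cf kD; rewrite [c ord0 k]mxE ler_norml => /andP[c1 c2].
  have := le_trans (coord_le_enorm (th *: (z - y)) k) (thn _ zy); rewrite ler_norml => /andP[v1 v2].
  rewrite [v ord0 k]mxE; have : th * s <= s by rewrite ler_piMl// ltW.
  move: s4 ls c1 c2 v1 v2; move: (th * s) (_ ord0 k) (_ ord0 k) (pt ord0 k) (m%:R * l) => *.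
  by apply/andP; split; lra.
(* The subcube of the plane point v contains some y' of G. Off i and j their coordinates differ by
   at most l, and p and q by at most 2 l, so [solve2] bounds their distance. *)
have [g gD vg] := cube_split l0 vc.
have [y' [Gy' yx' yg]] := meets g gD; have [fy' _] := hG y' Gy'.
have [yp yq] : `|dot p (y' - y)| <= 2 * l /\ `|dot q (y' - y)| <= 2 * l by apply: two => //; lra.
have y'v : enorm (y' - v) <= delta * s / 16.
  apply: le_trans Cl; apply: (solve2 t0 td hpq (ltW l0)).
  - by move=> k ki kj; have := same g y' v k yg vg; rewrite inD ki kj !mxE; apply.
  - by rewrite /v opprD addrA dotDr dotNr dotZr vp mulr0 subr0.
  - by rewrite /v opprD addrA dotDr dotNr dotZr vq mulr0 subr0.
exists y'.
  split => //; rewrite /eball /=; apply: le_lt_trans (enorm_tri y' v y) _.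
  have -> : v - y = th *: (z - y) by rewrite /v [y + _]addrC addrK.
  have := thn _ zy; rewrite ths; lra.
apply: le_trans (enorm_tri z v y') _; rewrite [enorm (v - y')]enormB.
have -> : z - v = (z - y) - th *: (z - y) by rewrite /v opprD addrA.
by have := hth _ zy; lra.
Qed.
End codimension_two.

(** * From holes at all scales to zero content *)

Section drop.
Variables (R : realType) (n : nat).
Implicit Types (x y z h w p q : 'rV[R]_n) (i j k : 'I_n) (tau l : R).

Lemma pow_small (A q e : R) : 0 <= q < 1 -> 0 < e -> exists N : nat, forall J, (N <= J)%N -> A * q ^+ J < e.
Proof.
move=> /andP[q0 q1] e0; have : `|q| < 1 by rewrite ger0_norm.
move=> /(cvg_geometric A)/cvgrPdist_lt/(_ _ e0)[N _ hN]; exists N => J NJ.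
have := hN J NJ; rewrite /= sub0r normrN; exact: le_lt_trans (ler_norm _).
Qed.

Lemma cast_pow (m d J : nat) : (0 < m)%N -> (((m ^ d - 1) ^ J)%N)%:R = (m%:R ^+ d - 1) ^+ J :> R.
Proof. by move=> m0; rewrite natrX natrB ?expn_gt0 ?m0// natrX. Qed.

Lemma card_minus2 i j : i != j -> #|[set k : 'I_n | (k != i) && (k != j)]%SET| = (n - 2)%N.
Proof.
move=> ij; rewrite (_ : [set k | _]%SET = (~: [set i; j])%SET); last first.
  by apply/setP => k; rewrite !inE negb_or.
by rewrite cardsCs finset.setCK cards2 ij card_ord.
Qed.

(** One point of Y is taken in each cell that meets Y, so that the centres of the next generation
    lie in Y again, as [drop_null] requires. *)
Lemma choose_points (T : eqType) (s : seq T) (C : T -> set 'rV[R]_n) (Y : set 'rV[R]_n) :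
  (forall y, Y y -> exists2 t, t \in s & C t y) ->
  exists s' : seq 'rV[R]_n, [/\ (size s' <= size s)%N, (forall y, y \in s' -> Y y) &
    forall y, Y y -> exists y', y' \in s' /\ exists t, C t y /\ C t y'].
Proof.
move=> Ys.
have H t : exists o : option 'rV[R]_n, (forall y, o = Some y -> Y y /\ C t y) /\ (o = None -> forall y, Y y -> ~ C t y).
  have [[y [Yy Cy]]|h] := pselect (exists y, Y y /\ C t y).
    by exists (Some y); split => // y' [<-].
  by exists None; split => // _ y Yy Cy; apply: h; exists y.
have [g hg] := choice H.
exists (pmap g s); split; first by rewrite size_pmap count_size.
  by move=> y; rewrite mem_pmap => /mapP[t _ /esym/(proj1 (hg t))[]].
move=> y Yy; have [t ts Cty] := Ys y Yy; case E: (g t) => [y'|].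
  exists y'; split; last by exists t; have [_] := (hg t).1 y' E.
  by rewrite mem_pmap; apply/mapP; exists t.
by have := (hg t).2 E y Yy.
Qed.

(** The thickness eta of the slab is tied to the number J of subdivisions, as it must not exceed the
    side of the last cells; J itself depends only on n, delta and tau2. *)
Lemma slab_drop delta tau2 : 0 < delta < 1 -> 0 < tau2 -> exists (theta : R) (K : nat) (eta : R),
  [/\ 0 < theta <= 1 / 2, K%:R * theta ^+ (n - 2) <= 1 / 2, 0 < eta &
  forall (U : 'rV[R]_n -> R) (G : set 'rV[R]_n) x r, 0 < r -> codim2 U tau2 eta x r ->
  (forall y, G y -> boundary [set x | 0 < U x] y /\
     forall s : R, 0 < s < r -> ((delta * s)%:E <= rank2_distance (boundary [set x | (0 < U x)%R]) s y)%E) ->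
  exists s : seq 'rV[R]_n, [/\ (size s <= K)%N, (forall y, y \in s -> G y) &
    forall y, G y -> enorm (y - x) < r / 2 -> exists2 y', y' \in s & enorm (y - y') < theta * (r / 2)]].
Proof.
move=> d01 t0; have /andP[d0 d1] := d01.
pose C := solve_cst n tau2; pose d := (n - 2)%N.
have C0 : 0 <= C.
  by rewrite /C /solve_cst addr_ge0// divr_ge0 ?(ltW t0)// !mulr_ge0// addr_ge0.
have C1 : 0 < 4 * (C + 1) by rewrite mulr_gt0// ltr_wpDl.
have [M [M8 hM]] : exists M : nat, (8 <= M.+1)%N /\ 64 * C <= delta * M.+1%:R.
  have q0 : 0 <= 64 * C / delta by rewrite divr_ge0 ?mulr_ge0// ltW.
  exists (Num.truncn (64 * C / delta) + 8)%N; split; first by rewrite leqW// leq_addl.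
  rewrite [delta * _]mulrC -ler_pdivrMr//; have /andP[_ /ltW h] := truncn_itv q0.
  by apply: le_trans h _; rewrite ler_nat ltnS leq_addr.
set m := M.+1 in M8 hM.
have m0 : 0 < m%:R :> R by rewrite ltr0n.
have m1 : 1 <= m%:R :> R by rewrite ler1n.
have md0 : 0 < m%:R ^+ d :> R by rewrite exprn_gt0.
(* The (m^d - 1)^J remaining cells of relative size m^-J have a d-dimensional content with the
   factor q0^J, which beats the constant (4 (C + 1))^d. *)
pose q0 := (m%:R ^+ d - 1) / m%:R ^+ d : R.
have q01 : 0 <= q0 < 1.
  by rewrite divr_ge0 ?subr_ge0 ?exprn_ege1 ?(ltW md0)//= ltr_pdivrMr// mul1r gtrBl.
have i01 : 0 <= (m%:R^-1 : R) < 1.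
  by rewrite invr_ge0 ltW//= invf_lt1// ltr1n (leq_trans _ M8).
have h2 : 0 < 1 / 2 :> R by rewrite divr_gt0.
have [N1 hN1] := pow_small ((4 * (C + 1)) ^+ d) q01 h2.
have [N2 hN2] := pow_small (4 * (C + 1)) i01 h2.
pose J := maxn N1 N2.
pose eta := m%:R^-1 ^+ J : R.
have eta0 : 0 < eta by rewrite exprn_gt0// invr_gt0.
(* Two points of G sharing a cell of side eta r are at distance at most C eta r, below theta (r / 2)
   = 2 (C + 1) eta r. *)
pose theta := 4 * (C + 1) * eta.
exists theta, ((m ^ d - 1) ^ J)%N, eta; split => //.
- by rewrite mulr_gt0//= ltW// hN2// leq_maxr.
- rewrite cast_pow// /theta /eta exprMn -exprM mulnC exprM mulrCA -exprMn exprVn -/q0.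
  by apply: ltW; apply: hN1; exact: leq_maxl.
move=> U G x r r0 [i [j [p [q [hpq td slab]]]]] hG.
have ij : i != j by apply: det2_neq t0 td.
pose rho := eta * r; have rho0 : 0 < rho by rewrite mulr_gt0.
have Jr : m%:R ^+ J * rho = r by rewrite /rho /eta mulrA exprVn mulfV ?mul1r// gt_eqF// exprn_gt0.
set D : {set 'I_n} := [set k | (k != i) && (k != j)]%SET.
have cD : #|D| = d by exact: card_minus2.
pose Y := [set y | G y /\ enorm (y - x) < r / 2].
have hole (j' : nat) pt : (j' < J)%N -> exists2 f : {ffun 'I_n -> 'I_m}, f \in pffun_on ord0 D predT &
     forall y, Y y -> ~ cube D (subcube pt (m%:R ^+ j' * rho) f) (m%:R ^+ j' * rho) y.
  move=> jJ; have l0 : 0 < m%:R ^+ j' * rho by rewrite mulr_gt0// exprn_gt0.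
  apply: (slab_hole pt d01 t0 M8 hM r0 l0 _ _ td hpq slab hG).
    by rewrite mulrA -exprS -[leRHS]Jr ler_pM2r// ler_weXn2l.
  by rewrite -/rho ler_peMl ?exprn_ege1// ltW.
pose pt : 'rV[R]_n := \row_k (x ord0 k - r / 2).
have [s ss hs] := cubes_drop rho0 hole (leqnn J) pt.
have [y Yy|s' [s's s'Y hs']] := @choose_points _ s (fun t => cube D t rho) Y.
  apply: hs => //; rewrite Jr => k _; rewrite mxE.
  have [_ yx] := Yy; have := le_lt_trans (coord_le_enorm (y - x) k) yx.
  rewrite !mxE ltr_norml => /andP[y1 y2]; apply/andP; split; lra.
exists s'; split => [|y /s'Y[]//|y Gy yx].
  by apply: leq_trans s's _; rewrite -cD.
have [y' [y's [t [ty ty']]]] := hs' y (conj Gy yx); exists y' => //.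
have [Gy' yx'] := s'Y y' y's.
have sl z : G z -> enorm (z - x) < r / 2 -> `|dot p (z - x)| <= rho /\ `|dot q (z - x)| <= rho.
  move=> Gz zx; apply: slab; first by apply: lt_trans zx _; rewrite ltr_pdivrMr//; lra.
  by rewrite [x + _]addrC subrK; have [] := hG z Gz.
have [p1 q1] := sl y Gy yx; have [p2 q2] := sl y' Gy' yx'.
have dB v : dot v (y - y') = dot v (y - x) - dot v (y' - x).
  by rewrite -dotNr -dotDr opprB addrA subrK.
have two : rho + rho = 2 * rho by ring.
apply: (@le_lt_trans _ _ (C * rho)).
  apply: (solve2 t0 td hpq (ltW rho0)).
  - move=> k ki kj; have kD : k \in D by rewrite inE ki kj.
    have /andP[a1 a2] := ty k kD; have /andP[b1 b2] := ty' k kD.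
    by rewrite !mxE ler_norml; apply/andP; split; lra.
  - by rewrite dB -two; apply: le_trans (ler_normB _ _) _; exact: lerD.
  - by rewrite dB -two; apply: le_trans (ler_normB _ _) _; exact: lerD.
rewrite (_ : theta * (r / 2) = (2 * (C + 1)) * rho); last by rewrite /theta /rho; field.
rewrite ltr_pM2r//; lra.
Qed.

Lemma finite_net (G : set 'rV[R]_n) (r1 B : R) : 0 < r1 -> (forall y, G y -> enorm y <= B) ->
  exists2 s : seq 'rV[R]_n, (forall y, y \in s -> G y) & forall y, G y -> exists2 y', y' \in s & enorm (y - y') < r1.
Proof.
move=> r10 GB.
pose B' := `|B| + 1; have B'0 : 0 < B' by rewrite ltr_wpDl.
pose M := Num.truncn (2 * B' * n.+1%:R / r1).
have q0 : 0 <= 2 * B' * n.+1%:R / r1 by rewrite divr_ge0 ?mulr_ge0// ltW.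
pose l := 2 * B' / M.+1%:R; have l0 : 0 < l by rewrite divr_gt0 ?mulr_gt0.
have nl : n%:R * l < r1.
  rewrite /l mulrA ltr_pdivrMr//; have /andP[_] := truncn_itv q0; rewrite -/M ltr_pdivrMr//.
  rewrite [r1 * _]mulrC; apply: le_lt_trans; rewrite [leRHS]mulrC ler_pM2r ?mulr_gt0// ler_nat.
  exact: leqnSn.
pose pt : 'rV[R]_n := const_mx (- B').
have [y Gy|s' [_ s'G hs']] := @choose_points _ (enum (pffun_on (ord0 : 'I_M.+1) [set: 'I_n]%SET predT))
   (fun f => cube [set: 'I_n]%SET (subcube pt l f) l) G.
  have [|f fD hf] := @cube_split R n M [set: 'I_n]%SET pt l y l0.
    move=> k _; rewrite mxE (_ : M.+1%:R * l = 2 * B'); last by rewrite /l mulrC divfK// gt_eqF.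
    have := le_trans (coord_le_enorm y k) (GB y Gy); rewrite ler_norml => /andP[y1 y2].
    have := ler_norm B; rewrite /B'; lra.
  by exists f => //; rewrite mem_enum.
exists s' => // y Gy.
have [y' [y's [f [fy fy']]]] := hs' y Gy; exists y' => //; apply: le_lt_trans nl.
apply: le_trans (enorm_le_norm _) _; apply: ler_wpM2l => //; apply: norm_le_coord; first exact: ltW.
move=> k; have /andP[a1 a2] := fy k (finset.in_setT k); have /andP[b1 b2] := fy' k (finset.in_setT k).
by rewrite !mxE ler_norml; rewrite !mxE in a1 a2 b1 b2; apply/andP; split; lra.
Qed.

(* Iterating the drop multiplies the d-dimensional content by at most 1/2. *)
Lemma drop_null d (G : set 'rV[R]_n) (theta r1 B : R) (K : nat) : 0 < theta <= 1 / 2 -> K%:R * theta ^+ d <= 1 / 2 ->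
  0 < r1 -> (forall y, G y -> enorm y <= B) ->
  (forall x r, G x -> 0 < r <= r1 -> exists s : seq 'rV[R]_n, [/\ (size s <= K)%N, (forall y, y \in s -> G y) &
    forall y, G y -> enorm (y - x) < r -> exists2 y', y' \in s & enorm (y - y') < theta * r]) ->
  forall e : R, 0 < e -> exists s : seq (set 'rV[R]_n), [/\ (forall x, G x -> exists2 A, List.In A s & A x) &
    exists2 w : R, (size s)%:R * w <= e & forall A, List.In A s -> (diam A <= e%:E)%E /\ (hausdorff_weight d A <= w%:E)%E].
Proof.
move=> /andP[th0 th2] hK r10 GB drop e e0.
have [s0 s0G hs0] := finite_net r10 GB; pose K0 := size s0.
have iter m : exists s : seq 'rV[R]_n, [/\ (size s <= K0 * K ^ m)%N, (forall y, y \in s -> G y) &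
    forall y, G y -> exists2 y', y' \in s & enorm (y - y') < theta ^+ m * r1].
  elim: m => [|m [s [sK sG hs]]].
    by exists s0; rewrite expn0 muln1 expr0 mul1r.
  have tr : 0 < theta ^+ m * r1 <= r1.
    rewrite mulr_gt0 ?exprn_gt0//= ler_piMl ?(ltW r10)// exprn_ile1 ?(ltW th0)//; lra.
  have H x : exists s' : seq 'rV[R]_n, (size s' <= K)%N /\ (forall y, y \in s' -> G y) /\ (G x ->
     forall y, G y -> enorm (y - x) < theta ^+ m * r1 -> exists2 y', y' \in s' & enorm (y - y') < theta * (theta ^+ m * r1)).
    have [Gx|nG] := pselect (G x); last by exists [::].
    by have [s' [? ? ?]] := drop x _ Gx tr; exists s'.
  have [g hg] := choice H.
  exists (flatten (map g s)); split.
  - apply: leq_trans (size_flatten_le s (B := K) _) _; first by move=> t; have [] := hg t.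
    by rewrite expnSr mulnA leq_mul2r sK orbT.
  - by move=> y /flattenP[t /mapP[x xs ->] yt]; have [_ [h _]] := hg x; exact: h.
  move=> y Gy; have [x xs yx] := hs y Gy; have [_ [_ h]] := hg x.
  have [y' y't yy'] := h (sG x xs) y Gy yx; exists y'; last by rewrite exprS -mulrA.
  by apply/flattenP; exists (g x) => //; apply/mapP; exists x.
have h01 : 0 <= (1 / 2 : R) < 1 by apply/andP; split; lra.
have [N1 hN1] := pow_small (2 * r1) h01 e0.
have [N2 hN2] := pow_small (K0%:R * (2 * r1) ^+ d) h01 e0.
pose m := maxn N1 N2; have [s [sK sG hs]] := iter m.
have tm0 : 0 <= theta ^+ m * r1 by rewrite mulr_ge0 ?exprn_ge0 ?ltW.
exists (map (fun y => eball y (theta ^+ m * r1)) s); split.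
  move=> x Gx; have [y ys xy] := hs x Gx; exists (eball y (theta ^+ m * r1)) => //.
  by elim: s ys {sK sG hs} => //= z s IH; rewrite inE => /orP[/eqP ->|/IH]; [left|right].
exists ((2 * (theta ^+ m * r1)) ^+ d).
  rewrite size_map; apply: (@le_trans _ _ ((K0 * K ^ m)%:R * (2 * (theta ^+ m * r1)) ^+ d)).
    by apply: ler_wpM2r; [rewrite exprn_ge0// mulr_ge0|rewrite ler_nat].
  apply: le_trans (_ : _ <= K0%:R * (2 * r1) ^+ d * (1 / 2) ^+ m) _; last first.
    by apply: ltW; apply: hN2; exact: leq_maxr.
  rewrite natrM natrX [2 * _]mulrCA [(theta ^+ m * _) ^+ d]exprMn -exprM mulnC exprM -!mulrA ler_wpM2l//.
  rewrite mulrA -exprMn mulrC ler_wpM2l ?exprn_ge0 ?mulr_ge0 ?(ltW r10)//.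
  by rewrite lerXn2r ?nnegrE// ?mulr_ge0 ?exprn_ge0 ?(ltW th0)//; lra.
have dm y : (diam (eball y (theta ^+ m * r1)) <= (2 * (theta ^+ m * r1))%:E)%E.
  by apply: (@diam_le _ _ _ y) => z; rewrite /eball /= => /ltW.
move=> A As; have [y ->] : exists y, A = eball y (theta ^+ m * r1).
  by elim: s As {sK sG hs} => //= z s IH [<-|/IH//]; exists z.
split; last by apply: hausdorff_weight_le => //; rewrite mulr_ge0.
apply: le_trans (dm y) _; rewrite lee_fin; apply: le_trans (_ : _ <= 2 * r1 * (1 / 2) ^+ m) _; last first.
  by apply: ltW; apply: hN1; exact: leq_maxl.
rewrite mulrCA mulrC ler_wpM2l ?mulr_ge0 ?(ltW r10)// lerXn2r ?nnegrE ?(ltW th0)//; lra.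
Qed.
End drop.

(** * The singular set: dense points and a null remainder *)

Section singular_set.
Variables (R : realType) (n : nat).
Variables (Omega : set 'rV[R]_n) (U : 'rV[R]_n -> R).
Hypotheses (n_gt0 : (0 < n)%N) (hU : local_min Omega U).
Implicit Types (x y z h : 'rV[R]_n) (E G K : set 'rV[R]_n) (r c m epsilon rho delta : R).
Let fb := boundary [set x | 0 < U x].

(** [rank_two] is used at scale 2 r because [slab_drop] covers only the ball of half the radius;
    [drop_null] then iterates the cover. *)
Lemma good_null c delta (s0 B : R) : 0 < c -> 0 < delta < 1 -> 0 < s0 -> exists2 epsilon, 0 < epsilon &
  forall rho, 0 < rho -> forall e : R, 0 < e -> exists s : seq (set 'rV[R]_n),
   [/\ (forall x, good Omega U rho epsilon c delta x /\ cball x (2 * s0) `<=` Omega /\ enorm x <= B -> exists2 A, List.In A s & A x) &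
    exists2 w : R, (size s)%:R * w <= e &
      forall A, List.In A s -> (diam A <= e%:E)%E /\ (hausdorff_weight (n - 2) A <= w%:E)%E].
Proof.
move=> c_0 d01 s00; have [tau2 t0 hr2] := rank_two n_gt0 hU c_0 d01 s00.
have [theta [K [eta [th hK eta0 hdrop]]]] := slab_drop n d01 t0.
have [epsilon ep0 hep] := hr2 eta eta0; exists epsilon => // rho rho0.
have [r1 r10 hr1] := hep rho rho0.
pose r' := Num.min r1 rho / 2.
have r'0 : 0 < r' by rewrite divr_gt0// lt_min r10.
have r'1 : r' <= r1 / 2 by rewrite ler_pM2r ?invr_gt0// ge_min lexx.
have r'2 : r' <= rho / 2 by rewrite ler_pM2r ?invr_gt0// ge_min lexx orbT.
apply: (@drop_null _ _ _ _ theta r' B K th hK r'0) => [y [_ []]//|x r [gx [xO _]] /andP[r0 rr]].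
have r20 : 0 < 2 * r by rewrite mulr_gt0.
have r2r : 2 * r / 2 = r by field.
have cd : codim2 U tau2 eta x (2 * r).
  by apply: hr1 => //; rewrite r20 /=; lra.
have [|s [sz1 sz2 s3]] := hdrop U [set y | good Omega U rho epsilon c delta y /\ cball y (2 * s0) `<=` Omega /\ enorm y <= B] x _ r20 cd.
  move=> y [[fy _ _ hfl] _]; split => // s /andP[sp sr]; apply: hfl; rewrite sp /=; lra.
by rewrite r2r in s3; exists s.
Qed.

Fixpoint bumps (s : seq ('rV[R]_n * R)) : tm R n :=
  if s is v :: s' then Add (rescale v.1 v.2 (psi R n)) (bumps s') else Cst n 0.

Lemma eval_bumps (s : seq ('rV[R]_n * R)) z : eval (bumps s) z = \sum_(v <- s) eval (psi R n) (v.2^-1 *: (z - v.1)).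
Proof. by elim: s => [|v s IH]; rewrite ?big_nil// big_cons -IH -eval_rescale. Qed.

Lemma vanish_bumps K (s : seq ('rV[R]_n * R)) : (forall v, v \in s -> 0 < v.2 /\ cball v.1 v.2 `<=` K) -> vanish K (bumps s).
Proof.
elim: s => [|v s IH] h; first by [].
apply: vanish_add; last by apply: IH => w ws; apply: h; rewrite inE ws orbT.
have [v0 vK] := h v (mem_head _ _); apply: (vanishS vK).
by apply: vanish_rescale => //; exact: vanish_psi.
Qed.

Lemma bilap_bumps K (s : seq ('rV[R]_n * R)) : compact K -> (forall v, v \in s -> 0 < v.2 /\ cball v.1 v.2 `<=` K) ->
  - bilap U (bumps s) = \sum_(v <- s) dens U v.1 v.2.
Proof.
move=> cK; elim: s => [|v s IH] h.
  rewrite big_nil (bilap_eq U (t' := Mul (Cst n 0) (Cst n 0))); last by apply/funext => z /=; rewrite mul0r.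
  by rewrite (bilap_scale hU _ cK)// mul0r oppr0.
have h' w : w \in s -> 0 < w.2 /\ cball w.1 w.2 `<=` K by move=> ws; apply: h; rewrite inE ws orbT.
have [v0 vK] := h v (mem_head _ _).
have v1 : vanish K (rescale v.1 v.2 (psi R n)).
  by apply: (vanishS vK); apply: vanish_rescale => //; exact: vanish_psi.
by rewrite big_cons -IH//= (bilap_add hU cK v1 (vanish_bumps h')) opprD.
Qed.

Lemma compact_cballs (s : seq 'rV[R]_n) r : compact [set z | exists2 y, y \in s & cball y r z].
Proof.
elim: s => [|y s IH].
  by rewrite (_ : [set _ | _] = set0); [exact: compact0|apply/seteqP; split => // z []].
rewrite (_ : [set _ | _] = cball y r `|` [set z | exists2 y, y \in s & cball y r z]).
  by apply: compactU => //; exact: compact_cball.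
apply/seteqP; split => [z [w]|z [zy|[w ws zw]]].
- by rewrite inE => /orP[/eqP -> zw|ws zw]; [left|right; exists w].
- by exists y => //; rewrite mem_head.
- by exists w => //; rewrite inE ws orbT.
Qed.

(* The bumps are dominated together by a fixed one, built on a finite net of E. *)
Lemma dens_packing E (s0 B : R) : 0 < s0 -> (forall x, E x -> cball x (2 * s0) `<=` Omega) -> (forall x, E x -> enorm x <= B) ->
  exists2 C : R, 0 < C & forall s : seq ('rV[R]_n * R), uniq s -> (forall v, v \in s -> E v.1 /\ 0 < v.2 < s0 / 4) ->
   (forall v w, v \in s -> w \in s -> v <> w -> v.2 + w.2 < `|v.1 - w.1|) -> \sum_(v <- s) dens U v.1 v.2 <= C.
Proof.
move=> s00 EO EB; have s04 : 0 < s0 / 4 by rewrite divr_gt0.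
have [net netE hnet] := finite_net s04 EB; have p0 := @psi0_gt0 R.
pose K := [set z | exists2 y, y \in net & cball y s0 z].
have cK : compact K by exact: compact_cballs.
have KO : K `<=` Omega.
  move=> z [y yn zy]; apply: (EO y (netE y yn)); apply: cball_mono zy; first exact: ltW.
  by rewrite ler_peMl ?ler1n// ltW.
pose net' := [seq (y, s0) | y <- net].
have net'P v : v \in net' -> 0 < v.2 /\ cball v.1 v.2 `<=` K.
  by move=> /mapP[y yn ->]; split => // z zy; exists y.
(* At least 1 on each ball of radius below s0 / 4 centred in E, as every point of E is within s0 / 4
   of the net. *)
pose Phi := Mul (Cst n (psi0 R)^-1) (bumps net').
have vPhi : vanish K Phi by apply: vanish_mulr; exact: vanish_bumps.
exists (`|bilap U Phi| + 1) => [|s us sE sd]; first by rewrite ltr_wpDl.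
have sK v : v \in s -> 0 < v.2 /\ cball v.1 v.2 `<=` K.
  move=> vs; have [Ev /andP[v0 v4]] := sE v vs; split => // z /cballP zv.
  have [y yn vy] := hnet v.1 Ev; exists y => //; apply/cballP; first exact: ltW.
  by apply: le_trans (enorm_tri z v.1 y) _; have := zv (ltW v0); lra.
rewrite -(bilap_bumps cK sK); apply: (@le_trans _ _ (- bilap U Phi)); last first.
  by rewrite -normrN; apply: le_trans (ler_norm _) _; rewrite lerDl.
rewrite lerN2; apply: (bilap_mono hU cK KO (vanish_bumps sK) vPhi) => z.
have Phi0 : 0 <= eval Phi z.
  rewrite /Phi /= mulr_ge0 ?invr_ge0 ?(ltW p0)// eval_bumps.
  by apply: sumr_ge0 => v _; exact: psi_ge0.
rewrite eval_bumps.
have [[v vs vz]|hno] := pselect (exists2 v, v \in s & cball v.1 v.2 z); last first.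
  rewrite big_seq big1// => v vs; apply: (@vanish_psi R n) => h; apply: hno; exists v => //.
  by apply/in_unitball => //; have [] := sK v vs.
have [Ev /andP[v0 v4]] := sE v vs.
(* The balls are separated, so only the bump of v can be nonzero at z. *)
rewrite (bigD1_seq v)//= big_seq_cond big1 ?addr0 => [|w /andP[ws wv]]; last first.
  apply: (@vanish_psi R n) => h; have [w0 _] := sK w ws.
  have zw : cball w.1 w.2 z by apply/in_unitball.
  have H : v.2 + w.2 < `|v.1 - w.1| by apply: sd => // /esym/eqP; rewrite (negbTE wv).
  have := ler_normD (v.1 - z) (z - w.1); rewrite addrA subrK -[`|v.1 - z|]normrN opprB => H2.
  have H3 := lerD (cball_norm (ltW v0) vz) (cball_norm (ltW w0) zw).
  by have := le_trans H2 H3; rewrite leNgt H.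
apply: le_trans (psi_le1 _) _; have [y yn vy] := hnet v.1 Ev.
rewrite /Phi [leRHS]/= -ler_pdivrMl ?invr_gt0// invrK mulr1 eval_bumps.
have y'n : (y, s0) \in net' by apply/mapP; exists y.
rewrite (big_rem _ y'n)/=; apply: (@le_trans _ _ (eval (psi R n) (s0^-1 *: (z - y)))).
  apply: psi_ge => //; apply/cballP; first by rewrite divr_ge0// ltW.
  move: vz => /cballP vz; apply: le_trans (enorm_tri z v.1 y) _; have := vz (ltW v0); lra.
by rewrite lerDl; apply: sumr_ge0 => w _; exact: psi_ge0.
Qed.

Lemma powB2 r : (2 <= n)%N -> 0 < r -> r ^+ n / r ^+ 2 = r ^+ (n - 2).
Proof. by move=> n2 r0; rewrite expfB_cond// ?gt_eqF// implybT. Qed.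

Definition dense_point epsilon x :=
  forall rho : R, 0 < rho -> exists2 s : R, 0 < s < rho & epsilon * s ^+ n / s ^+ 2 < dens U x s.

(** At the selected scales s^(n-2) is at most the density divided by epsilon. The balls being
    disjoint, [dens_packing] bounds the total weight by a constant independent of the mesh e. *)
Lemma dense_cover E (s0 B : R) epsilon : (2 <= n)%N -> 0 < s0 -> 0 < epsilon ->
  (forall x, E x -> cball x (2 * s0) `<=` Omega) -> (forall x, E x -> enorm x <= B) ->
  exists2 C : R, 0 < C & forall e : R, 0 < e -> exists (D : set ('rV[R]_n * R)) (f : 'rV[R]_n * R -> nat) (V : 'rV[R]_n * R -> set 'rV[R]_n),
   [/\ {in D &, injective f}, (forall x, E x /\ dense_point epsilon x -> exists2 v, D v & V v x),
     (forall v, D v -> (diam (V v) <= e%:E)%E) & (\esum_(v in D) hausdorff_weight (n - 2) (V v) <= C%:E)%E].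
Proof.
move=> n2 s00 ep0 EO EB; have [C0 C00 hC0] := dens_packing s00 EO EB.
have N0 : 0 < 6 * n%:R :> R by rewrite mulr_gt0// ltr0n.
pose Q := (6 * n%:R) ^+ (n - 2) / epsilon; have Q0 : 0 < Q by rewrite divr_gt0// exprn_gt0.
exists (Q * C0) => [|e e0]; first exact: mulr_gt0.
(* The Vitali factor 3, times the factor n between the Euclidean norm and the sup norm in which the
   balls were selected. *)
pose V (v : 'rV[R]_n * R) := [set z | enorm (z - v.1) <= 3 * n%:R * v.2].
pose r0 := Num.min (s0 / 4) (e / (6 * n%:R)).
have r00 : 0 < r0 by rewrite lt_min !divr_gt0.
pose W := [set v : 'rV[R]_n * R | [/\ E v.1, 0 < v.2 < r0 & epsilon * v.2 ^+ n / v.2 ^+ 2 < dens U v.1 v.2]].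
have [D [DW Dd Dc]] : exists D : set ('rV[R]_n * R), [/\ D `<=` W,
    (forall v w, D v -> D w -> v <> w -> v.2 + w.2 < `|v.1 - w.1|) &
    (forall v, W v -> exists w, [/\ D w, `|v.1 - w.1| <= v.2 + w.2 & v.2 <= 2 * w.2])].
  by apply: (@vitali_selection _ _ W r0) => v [_ /andP[h1 h2] _] //; exact: ltW.
have D0 v : D v -> 0 < v.2 by move=> /DW[_ /andP[]].
have [f fI] := disjoint_balls_countable D0 Dd.
have dV v : D v -> (diam (V v) <= (6 * n%:R * v.2)%:E)%E.
  move=> Dv; rewrite (_ : 6 * n%:R * v.2 = 2 * (3 * n%:R * v.2)); last by ring.
  by apply: (@diam_le _ _ _ v.1).
exists D, f, V; split.
- by move=> v w /set_mem Dv /set_mem Dw; exact: fI.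
- move=> x [Ex dx]; have [s /andP[sp sr] hs] := dx r0 r00.
  have [|w [Dw xw sw]] := Dc (x, s); first by split => //=; rewrite sp.
  exists w => //; rewrite /V /=; apply: le_trans (enorm_le_norm _) _.
  rewrite [3 * _]mulrC -mulrA ler_wpM2l//; apply: le_trans xw _; rewrite /= in sw *; lra.
- move=> v Dv; apply: le_trans (dV v Dv) _; rewrite lee_fin mulrC -ler_pdivlMr//.
  by have [_ /andP[_ /ltW h] _] := DW v Dv; apply: le_trans h _; rewrite ge_min lexx orbT.
apply: ge_ereal_sup => _ [F [finF FD] <-]; rewrite fsbig_finite//.
set sF := finmap.enum_fset _.
have inF v : v \in sF -> F v by move=> vs; apply/set_mem; rewrite -(in_fset_set finF).
apply: (@le_trans _ _ (\sum_(v <- sF) (Q * dens U v.1 v.2)%:E)%E).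
  rewrite big_seq [leRHS]big_seq; apply: lee_sum => v /inF/FD Dv.
  have [_ _ h] := DW v Dv; have v0 := D0 v Dv.
  apply: le_trans (hausdorff_weight_le (n - 2) _ (dV v Dv)) _.
    by rewrite mulr_ge0// ltW.
  have -> : Q * dens U v.1 v.2 = (6 * n%:R) ^+ (n - 2) * (epsilon^-1 * dens U v.1 v.2) by rewrite /Q mulrA.
  by rewrite lee_fin exprMn -(powB2 n2 v0) ler_pM2l ?exprn_gt0// ler_pdivlMl// mulrA; exact: ltW.
rewrite sumEFin lee_fin -mulr_sumr ler_pM2l//; apply: hC0; first exact: finmap.fset_uniq.
- by move=> v /inF/FD/DW[Ev /andP[h1 h2] _]; rewrite h1; split => //=; apply: lt_le_trans h2 _; rewrite ge_min lexx.
- by move=> v w /inF/FD Dv /inF/FD Dw; exact: Dd.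
Qed.

(** The two families are interleaved over the even and the odd indices. *)
Lemma hausdorff_pre_cover2 d (e : R) A (T1 T2 : choiceType) (D1 : set T1) (D2 : set T2) (f1 : T1 -> nat) (f2 : T2 -> nat)
    (V1 : T1 -> set 'rV[R]_n) (V2 : T2 -> set 'rV[R]_n) : {in D1 &, injective f1} -> {in D2 &, injective f2} ->
  (forall x, A x -> (exists2 v, D1 v & V1 v x) \/ (exists2 v, D2 v & V2 v x)) ->
  (forall v, D1 v -> (diam (V1 v) <= e%:E)%E) -> (forall v, D2 v -> (diam (V2 v) <= e%:E)%E) ->
  (hausdorff_pre d e A <= \esum_(v in D1) hausdorff_weight d (V1 v) + \esum_(v in D2) hausdorff_weight d (V2 v))%E.
Proof.
move=> f1I f2I AV e1 e2.
pose f (t : T1 + T2) := match t with inl v => (f1 v).*2 | inr v => (f2 v).*2.+1 end.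
pose V (t : T1 + T2) := match t with inl v => V1 v | inr v => V2 v end.
pose D := (inl @` D1) `|` (inr @` D2) : set (T1 + T2).
apply: (@le_trans _ _ (\esum_(t in D) hausdorff_weight d (V t))%E).
  apply: (@hausdorff_pre_cover _ _ _ _ _ _ D f V).
  - move=> _ _ /set_mem[[v Dv <-]|[v Dv <-]] /set_mem[[w Dw <-]|[w Dw <-]] /=.
    + by move=> /double_inj/f1I ->; rewrite ?inE.
    + by move=> /(congr1 odd); rewrite /= !odd_double.
    + by move=> /(congr1 odd); rewrite /= !odd_double.
    + by move=> [] /double_inj/f2I ->; rewrite ?inE.
  - by move=> x /AV[[v Dv Vx]|[v Dv Vx]]; [exists (inl v) => //; left; exists v|exists (inr v) => //; right; exists v].
  - by move=> _ [[v Dv <-]|[v Dv <-]]; [exact: e1|exact: e2].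
rewrite (esumID (inl @` D1)) => [|t _]; last exact: hausdorff_weight_ge0.
rewrite (_ : D `&` _ = inl @` D1); last by apply/seteqP; split => [t []//|t h]; split => //; left.
rewrite (_ : D `&` _ = inr @` D2); last first.
  apply/seteqP; split => [t [[h /(_ h)//|//]]|t h]; split; first by right.
  by move: h => [v _ <-] [w _].
rewrite !esum_image//; last 2 first.
- by move=> v w _ _ [].
- by move=> v w _ _ [].
Qed.

(** A point of the set is either dense, and these points are covered with weight at most C at every
    mesh, or lies in some [G k], and these sets together are covered with weight at most 1. *)
Lemma singular_finite E (s0 B : R) c delta : (2 <= n)%N -> 0 < s0 -> 0 < c -> 0 < delta ->
  (forall x, E x -> cball x (2 * s0) `<=` Omega) -> (forall x, E x -> enorm x <= B) ->
  (hausdorff (n - 2) [set x | [/\ E x, fb x, nondegenerate U c x &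
     exists2 rx : R, (0 < rx)%R & forall r, (0 < r < rx)%R -> ((delta * r)%:E <= rank2_distance fb r x)%E]] < +oo)%E.
Proof.
move=> n2 s00 c_0 dl0 EO EB; set S := [set x | _].
(* Lowering delta only weakens the failure of flatness, and the flatness arguments take delta below
   1. *)
pose de := Num.min delta (1 / 2); have de01 : 0 < de < 1.
  rewrite lt_min dl0 divr_gt0//=; apply: (@le_lt_trans _ _ (1 / 2)); first by rewrite ge_min lexx orbT.
  by rewrite ltr_pdivrMr// mul1r ltr1n.
have ded : de <= delta by rewrite ge_min lexx.
have [epsilon ep0 hgood] := good_null B c_0 de01 s00.
have [C C0 hC] := dense_cover n2 s00 ep0 EO EB.
(* A point that is not dense has its own scale below which all conditions of [good] hold; it belongs
   to [G k] as soon as 1 / k.+1 is smaller. *)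
pose G k := [set x | good Omega U k.+1%:R^-1 epsilon c de x /\ cball x (2 * s0) `<=` Omega /\ enorm x <= B].
have k0 (k : nat) : 0 < k.+1%:R^-1 :> R by rewrite invr_gt0 ltr0n.
have Gnull := @hausdorff_null _ _ (n - 2) G (fun k => hgood _ (k0 k)).
apply: (@le_lt_trans _ _ (C + 1)%:E); last exact: ltry.
apply: ge_ereal_sup => _ [e e0 <-].
have m0 : 0 < Num.min e 1 by rewrite lt_min ltr01 andbT.
have [V2 [V2c V2d V2w]] := Gnull _ m0.
have [D [f [V1 [fI V1c V1d V1w]]]] := hC e e0.
have me : Num.min e 1 <= e by rewrite ge_min lexx.
apply: (@le_trans _ _ (\esum_(v in D) hausdorff_weight (n - 2) (V1 v) + \esum_(v in [set: nat * nat]) hausdorff_weight (n - 2) (V2 v))%E).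
  apply: (@hausdorff_pre_cover2 _ _ _ _ _ D setT f pickle V1 V2) => //.
  - move=> x [Ex fx [r1 r10 hr1] [rx rx0 hrx]].
    have [dx|/existsNP[r2 /not_implyP[r20 hr2]]] := pselect (dense_point epsilon x); [left|right].
      exact: V1c.
    have hr2' s : 0 < s < r2 -> dens U x s <= epsilon * s ^+ n / s ^+ 2.
      by move=> sr; rewrite leNgt; apply/negP => h; apply: hr2; exists s.
    pose r3 := Num.min (Num.min r1 r2) (Num.min rx (2 * s0)).
    have r30 : 0 < r3 by rewrite !lt_min r10 r20 rx0 mulr_gt0.
    have [k _ /(_ k (leqnn k)) kr] := near_infty_natSinv_lt (PosNum r30).
    have {}kr : k.+1%:R^-1 < r3 by [].
    move: kr; rewrite !lt_min => /andP[/andP[kr1 kr2] /andP[krx krs]].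
    have [|v _ Vx] := V2c x; last by exists v.
    exists k => //; split; last by split; [exact: EO|exact: EB].
    split => //.
    + split; [exact: k0| |exact: ltW|].
        by apply: subset_trans (EO x Ex); apply: cball_mono; [exact: ltW|exact: ltW].
      by move=> s /andP[sp sk]; apply: hr2'; rewrite sp /=; exact: le_lt_trans sk kr2.
    + by move=> r /andP[rp rk]; apply: hr1; rewrite rp /=; exact: lt_trans rk kr1.
    + move=> r /andP[rp rk]; apply: le_trans (hrx r _); first by rewrite lee_fin ler_wpM2r// ltW.
      by rewrite rp /=; exact: lt_trans rk krx.
  - by move=> v _; apply: le_trans (V2d v) _; rewrite lee_fin.
rewrite EFinD; apply: leeD => //; apply: le_trans V2w _; rewrite lee_fin ge_min lexx orbT//.
Qed.
End singular_set.

(** * Compact containment and conclusion *)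

Section conclusion.
Variables (R : realType) (n : nat).
Implicit Types (x y z : 'rV[R]_n) (K Omega : set 'rV[R]_n) (u : 'rV[R]_n -> R).

Lemma compact_margin K Omega : compact K -> open Omega -> K `<=` Omega ->
  exists2 s : R, 0 < s & forall x, K x -> cball x (2 * s) `<=` Omega.
Proof.
move=> /compact_near_coveringP cK oO KO.
have : \forall s \near (0 : R)^'+, K `<=` [set x | cball x (2 * s) `<=` Omega].
  apply: (cK R (0 : R)^'+ (fun s x => cball x (2 * s) `<=` Omega)) => x Kx.
  have /nbhs_ballP[e /= e0 xeO] : nbhs x Omega by apply: open_nbhs_nbhs; split => //; exact: KO.
  exists (ball x (e / 2), [set s : R | 0 < s < e / 4]) => /=; first split.
  - by apply: nbhsx_ballx; rewrite divr_gt0.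
  - have h : \forall s \near (0 : R)^'+, s < e / 4 by apply: nbhs_right_lt; rewrite divr_gt0.
    by near=> s; apply/andP; split; near: s => //; exact: nbhs_right_gt.
  - move=> [y s] [/= xy /andP[s0 se]] z zy; apply: xeO; move: xy; rewrite !ball_rVE /= => xy.
    have yz := cball_norm (ltW (mulr_gt0 (ltr0n _ 2) s0)) zy.
    rewrite -[z - x](subrKA y); apply: le_lt_trans (ler_normD _ _) _; lra.
move=> h; have [s [s0 hs]] : exists s : R, 0 < s /\ K `<=` [set x | cball x (2 * s) `<=` Omega].
  by apply: (@filter_ex _ (0 : R)^'+); apply: filterI => //; exact: nbhs_right_gt.
by exists s.
Unshelve. all: by end_near. Qed.

Lemma compact_enorm K : compact K -> exists B : R, forall x, K x -> enorm x <= B.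
Proof.
move=> /compact_bounded[M [_ hM]]; exists (n%:R * (M + 1)) => x Kx.
apply: le_trans (enorm_le_norm _) _; rewrite ler_wpM2l//.
by apply: hM => //; rewrite ltrDl.
Qed.

(** Halving c makes the inequality strict: it then holds on a right neighbourhood of 0, and at an
    actual point of each ball instead of a supremum. *)
Lemma liminf_nondegenerate Omega u c x : open Omega -> Omega x -> 0 < c ->
  (c%:E <= limf_einf (fun r : R => ereal_sup [set `|u y|%:E | y in eball x r] * (r ^- 2)%:E) (0 : R)^'+)%E ->
  nondegenerate (u \_ Omega) (c / 2) x.
Proof.
move=> oO Ox c0; rewrite limf_einfE => h.
have c2 : ((c / 2)%:E < c%:E)%E by rewrite lte_fin; lra.
have [_ [V FV <-] hV] := ereal_sup_gt (lt_le_trans c2 h).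
have [s s0 hs] : exists2 s : R, 0 < s & cball x s `<=` Omega.
  have [|s s0 hs] := @compact_margin [set x] Omega (@compact_set1 _ x) oO; first by move=> _ ->.
  by exists (2 * s); [rewrite mulr_gt0|exact: hs].
have [e /= e0 eV] := FV; exists (Num.min e s) => [|r /andP[r0]]; first by rewrite lt_min e0.
rewrite lt_min => /andP[re rs].
have Vr : V r by apply: eV => //=; rewrite sub0r normrN gtr0_norm.
have {hV} : ((c / 2)%:E < ereal_sup [set `|u y|%:E | y in eball x r] * (r ^- 2)%:E)%E.
  by apply: lt_le_trans hV _; apply: ereal_inf_lbound; exists r.
have r20 : 0 < r ^- 2 by rewrite invr_gt0 exprn_gt0.
rewrite -lte_pdivrMr// => hV.
have {hV} /ereal_sup_gt[_ [y xy <-]] : ((c / 2 * r ^+ 2)%:E < ereal_sup [set `|u y|%:E | y in eball x r])%E.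
  by apply: le_lt_trans hV; rewrite lee_fin invrK.
rewrite lte_fin => cy; exists y => //; rewrite restrE indicE mem_set ?mulr1//.
by apply: hs; apply/cballP; [exact: ltW|apply: ltW; exact: lt_trans rs].
Qed.

Lemma hausdorff_subset s (A B : set 'rV[R]_n) : A `<=` B -> (hausdorff s A <= hausdorff s B)%E.
Proof.
move=> AB; apply: ge_ereal_sup => _ [e e0 <-]; apply: (@le_trans _ _ (hausdorff_pre s e B)).
  by apply: ereal_inf_le_tmp => _ [U [BU dU] <-]; exists U => //; split => //; exact: subset_trans BU.
by apply: ereal_sup_ubound; exists e.
Qed.
End conclusion.

Theorem theorem1p10 (R : realType) (n : nat) (n_gt0 : (0 < n)%N)
    (Omega : set 'rV[R]_n) (hOmega : smooth_bounded_domain Omega)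
    (u0 : 'rV[R]_n -> R) (hu0 : sobolev Omega 2 u0)
    (u : 'rV[R]_n -> R) (hu : minimizer Omega u0 u)
    (* u is the continuous representative of its class *)
    (cu : {in Omega, continuous u}) :
  (@lebesgue_rV R n).-negligible
    ([set x | free_boundary Omega u x /\
              vanishing_rank2_flat (free_boundary Omega u) x] `&` Omega) /\
  (forall D : set 'rV[R]_n, compactly_contained D Omega ->
    (exists2 c : R, 0 < c &
      forall x, (free_boundary Omega u `&` closure D) x ->
        (c%:E <= limf_einf (fun r : R =>
           ereal_sup [set `|u y|%:E | y in eball x r] * (r ^- 2)%:E)
           (0 : R)^'+)%E) ->
    (@lebesgue_rV R n).-negligible (free_boundary Omega u `&` closure D) /\
    (forall delta : R, 0 < delta -> (2 <= n)%N ->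
      (hausdorff (n - 2)
        (not_rank2_flat (free_boundary Omega u) delta `&` closure D)
        < +oo)%E)).
Proof.
have [_ oO _ bO _] := hOmega; have hU := minimizer_local_min oO bO hu cu.
have fbE : free_boundary Omega u = boundary [set x | 0 < (u \_ Omega) x] by rewrite /free_boundary positive_setE.
split; first by apply: (vanishing_flat_negligible (F := free_boundary Omega u)) => x [].
move=> D [cD DO] [c c0 hc].
have nd x : (free_boundary Omega u `&` closure D) x -> nondegenerate (u \_ Omega) (c / 2) x.
  by move=> fx; apply: liminf_nondegenerate => //; [exact: DO fx.2|exact: hc].
have c20 : 0 < c / 2 by rewrite divr_gt0.
split => [|delta d0 n2].
  apply: (nondegenerate_negligible n_gt0 hU c20) => x fx; split; [by rewrite -fbE; exact: fx.1|exact: DO fx.2|exact: nd].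
have [s s0 hs] := compact_margin cD oO DO; have [B hB] := compact_enorm cD.
apply: le_lt_trans (singular_finite n_gt0 hU n2 s0 c20 d0 hs hB).
by apply: hausdorff_subset => x [[fx hx] Dx]; split => //; rewrite -?fbE//; exact: nd.
Qed.
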